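(* Let $(A,\Delta_A)$ be a $C^*$-quantum group with universal quantum group $(A^{u},\Delta_{A^{u}})$ and reducing map $\Lambda\colon A^{u}\to A$, and let $R\in\mathcal U(A\otimes A)$ be an $R$-matrix. There is a unique $R^{u}\in\mathcal U(A^{u}\otimes A^{u})$ with $$(\Lambda\otimes\Lambda)R^{u}=R \quad\text{in }\mathcal U(A\otimes A),$$ $$(\Delta_{A^{u}}\otimes\mathrm{id}_{A^{u}})R^{u}=R^{u}_{23}R^{u}_{13}\quad\text{in }\mathcal U(A^{u}\otimes A^{u}\otimes A^{u}),$$ $$(\mathrm{id}_{A^{u}}\otimes\Delta_{A^{u}})R^{u}=R^{u}_{12}R^{u}_{13}\quad\text{in }\mathcal U(A^{u}\otimes A^{u}\otimes A^{u}).$$ This unitary also satisfies $$R^{u}\,\bigl(\sigma\circ\Delta_{A^{u}}(a)\bigr)\,(R^{u})^{*}=\Delta_{A^{u}}(a)\qquad\text{for all }a\in A^{u}.$$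
   Context: Conventions: $\otimes$ is the minimal $C^*$-tensor product, $\mathcal M(A)$ the multiplier algebra, $\mathcal U(A)$ the unitary group of $\mathcal M(A)$, $\sigma$ the flip $x\otimes y\mapsto y\otimes x$; a morphism $A\to B$ is a nondegenerate $*$-homomorphism $A\to\mathcal M(B)$ (extended to multipliers); leg numbering notation is used. A $C^*$-quantum group is a pair $(A,\Delta_A)$ obtained from a manageable multiplicative unitary $\mathbb W\in\mathcal U(\mathcal H\otimes\mathcal H)$ on a separable Hilbert space ($\mathbb W_{23}\mathbb W_{12}=\mathbb W_{12}\mathbb W_{13}\mathbb W_{23}$; manageable in Woronowicz's sense: there are an injective positive self-adjoint operator $Q$ on $\mathcal H$ and a unitary $\widetilde{\mathbb W}$ on $\overline{\mathcal H}\otimes\mathcal H$ with $\mathbb W^*(Q\otimes Q)\mathbb W=Q\otimes Q$ and $(x\otimes v\mid\mathbb W\mid z\otimes y)=(\bar z\otimes Qv\mid\widetilde{\mathbb W}\mid\bar x\otimes Q^{-1}y)$ for $x,z\in\mathcal H$, $v\in\mathrm{dom}(Q)$, $y\in\mathrm{dom}(Q^{-1})$). Here $A$ is the closed linear span of $\{(\omega\otimes\mathrm{id})\mathbb W:\omega\in\mathbb B(\mathcal H)_*\}$, $\hat A$ the closed linear span of $\{(\mathrm{id}\otimes\omega)\mathbb W\}$; $\mathbb W$ viewed as $W\in\mathcal U(\hat A\otimes A)$ is the reduced bicharacter; $\Delta_A\colon A\to A\otimes A$ and $\hat\Delta_A\colon\hat A\to\hat A\otimes\hat A$ are the unique morphisms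 with $(\mathrm{id}\otimes\Delta_A)W=W_{12}W_{13}$ and $(\hat\Delta_A\otimes\mathrm{id})W=W_{23}W_{13}$. Universal quantum group (Sołtan–Woronowicz): $A^{u}$ comes with $\mathcal V\in\mathcal U(\hat A\otimes A^{u})$ such that every unitary $U\in\mathcal U(\hat A\otimes\mathbb K(\mathcal L))$ with $(\hat\Delta_A\otimes\mathrm{id})U=U_{23}U_{13}$ is $(\mathrm{id}\otimes\varphi)\mathcal V$ for a unique representation $\varphi$ of $A^{u}$ on $\mathcal L$; $A^{u}$ is the closed linear span of $\{(\omega\otimes\mathrm{id})\mathcal V:\omega\in\hat A'\}$; the comultiplication satisfies $(\mathrm{id}\otimes\Delta_{A^{u}})\mathcal V=\mathcal V_{12}\mathcal V_{13}$ and the reducing map $\Lambda\colon A^{u}\to A$ satisfies $(\mathrm{id}\otimes\Lambda)\mathcal V=W$. A bicharacter in $\mathcal U(A\otimes A)$ is a unitary $R$ with $(\Delta_A\otimes\mathrm{id})R=R_{23}R_{13}$ and $(\mathrm{id}\otimes\Delta_A)R=R_{12}R_{13}$. It is an $R$-matrix if in addition $R\,(\sigma\circ\Delta_A(a))\,R^*=\Delta_A(a)$ for all $a\in A$. *)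

(* Defs.v *)
From HB Require Import structures.
From mathcomp Require Import all_boot all_order all_algebra.
From mathcomp Require Import complex.
From mathcomp Require Import all_classical all_reals all_analysis.
From mathcomp Require Import ring lra.
Set Implicit Arguments.
Unset Strict Implicit.
Unset Printing Implicit Defensive.
Import Order.TTheory GRing.Theory Num.Theory.
Import numFieldNormedType.Exports.
Local Open Scope classical_set_scope.
Local Open Scope ring_scope.

(* R[i] as an abstract numClosedFieldType, so that the topology of a
   numFieldType is inferred on it. *)
Definition Cplx (R : realType) : numClosedFieldType := R[i].

Section ComplexFacts.
Variable R : realType.
Implicit Types (A B z w : Cplx R).

Lemma quad_CS A B z : 0 <= A -> 0 <= B ->
  (forall a b : Cplx R,
     0 <= a * a^* * A + (a^* * b * z + (a^* * b * z)^*) + b * b^* * B) ->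
  `|z| ^+ 2 <= A * B.
Proof.
move=> A0 B0 H.
have [z0|z0] := eqVneq z 0; first by rewrite z0 normr0 expr0n/= mulr_ge0.
have N0 : 0 < `|z| ^+ 2 by rewrite exprn_gt0// normr_gt0.
have [E|An0] := eqVneq A 0.
- have := H (- ((B + 1) / `|z| ^+ 2) * z) 1.
  have rB : (B + 1)^* = B + 1 by rewrite conj_Creal// realD ?ger0_real.
  have rz : (`|z| ^+ 2)^* = `|z| ^+ 2 by rewrite conj_Creal// ger0_real// ltW.
  have zz : z^* * z = `|z| ^+ 2 by rewrite mulrC normCK.
  have -> : (- ((B + 1) / `|z| ^+ 2) * z)^* * 1 * z = - (B + 1).
    rewrite rmorphM rmorphN rmorphM fmorphV/= rB rz mulr1 -mulrA zz.
    by rewrite mulNr -mulrA mulVf ?mulr1// gt_eqF.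
  have rNB : (- (B + 1))^* = - (B + 1) by rewrite conj_Creal// rpredN realD ?ger0_real.
  rewrite rNB E mulr0 add0r rmorph1 !(mulr1, mul1r).
  rewrite (_ : - (B + 1) + - (B + 1) + B = - (B + 2)); last by ring.
  by rewrite lt_geF// oppr_lt0 ltr_wpDl.
have {An0}A0' : 0 < A by rewrite lt_def An0.
have := H (- z) A.
have rA : A^* = A by rewrite conj_Creal// ger0_real.
rewrite rA normCK !(rmorphM, rmorphN)/= rA conjCK.
rewrite (_ : _ + _ = A * (A * B - z * z^*)); last by ring.
by rewrite pmulr_rge0// subr_ge0.
Qed.

Definition rate (n : nat) : Cplx R := n.+1%:R^-1.

Lemma rate_gt0 n : 0 < rate n. Proof. by rewrite invr_gt0 ltr0n. Qed.
Lemma rate_ge0 n : 0 <= rate n. Proof. exact/ltW/rate_gt0. Qed.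

Lemma ge0_cplx w : 0 <= w -> exists2 r : R, 0 <= r & w = (r%:C)%C.
Proof.
move=> w0; have : w \is Num.real by rewrite ger0_real.
by move=> /complex_realP[r wr]; exists r => //; rewrite -ler0c -wr.
Qed.

Lemma rate_small (e : Cplx R) : 0 < e -> exists n, rate n <= e.
Proof.
move=> e0; have [r _ er] := ge0_cplx (ltW e0).
have r0 : 0 < r by move: e0; rewrite er ltcR.
have := archi_boundP (ltW (divr_gt0 ltr01 r0)); set n := Num.bound _ => nr.
exists n; rewrite er /rate.
rewrite (_ : (n.+1%:R : Cplx R) = ((n.+1%:R : R)%:C)%C); last by rewrite rmorph_nat.
rewrite -fmorphV/= lecR -[leRHS]invrK lef_pV2 ?posrE ?invr_gt0 ?ltr0n//.
by rewrite -div1r ltW// (lt_trans nr)// ltr_nat.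
Qed.

Lemma real_limit (u : nat -> R) (d : nat -> R) :
  (forall n m, `|u n - u m| <= d n + d m) ->
  exists l, forall n, `|l - u n| <= d n.
Proof.
move=> H; pose E : set R := [set u n - d n | n in setT].
have ub m : ubound E (u m + d m).
  move=> _ [n _ <-]; have := H n m; rewrite ler_norml => /andP[_]; lra.
have hs : has_sup E by split; [exists (u 0%N - d 0%N), 0%N | exists (u 0%N + d 0%N)].
exists (sup E) => n; rewrite ler_norml; apply/andP; split.
  suff : u n - d n <= sup E by lra.
  by apply: ub_le_sup; [case: hs | exists n].
suff : sup E <= u n + d n by lra.
by apply: ge_sup => //; case: hs.
Qed.

Lemma cplx_limit (u : nat -> Cplx R) (G : Cplx R) : 0 <= G ->
  (forall n m, `|u n - u m| <= G * (rate n + rate m)) ->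
  exists z, forall n, `|z - u n| <= 2 * G * rate n.
Proof.
move=> /ge0_cplx[g g0 ->] H.
have rE n : rate n = ((n.+1%:R^-1 : R)%:C)%C by rewrite fmorphV/= rmorph_nat.
have HR n m : (ComplexField.Normc.normc (u n - u m) <= g * n.+1%:R^-1 + g * m.+1%:R^-1)%R.
  by have := H n m; rewrite !rE -rmorphD -rmorphM/= -mulrDr lecR.
have cR (w : R[i]) : `|complex.Re w| <= ComplexField.Normc.normc w /\ `|complex.Im w| <= ComplexField.Normc.normc w.
  case: w => a b /=; split; rewrite -sqrtr_sqr ler_sqrt ?addr_ge0 ?sqr_ge0//.
    by rewrite lerDl sqr_ge0.
  by rewrite lerDr sqr_ge0.
have [|a Ha] := @real_limit (fun n => complex.Re (u n)) (fun n => g * n.+1%:R^-1).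
  by move=> n m; rewrite -raddfB/=; apply: le_trans (HR n m); case: (cR (u n - u m)).
have [|b Hb] := @real_limit (fun n => complex.Im (u n)) (fun n => g * n.+1%:R^-1).
  by move=> n m; rewrite -raddfB/=; apply: le_trans (HR n m); case: (cR (u n - u m)).
exists (Complex a b) => n.
rewrite (_ : 2 * _ * _ = ((g * n.+1%:R^-1 + g * n.+1%:R^-1 : R)%:C)%C); last first.
  by rewrite rE -mulrA -rmorphM/= mulr2n mulrDl !mul1r -rmorphD.
have : ComplexField.Normc.normc (Complex a b - u n) <= g * n.+1%:R^-1 + g * n.+1%:R^-1.
  move: (Ha n) (Hb n); case: (u n) => x y /= H1 H2.
  set p := a - x in H1 *; set q := b - y in H2 *.
  set r := g * _ in H1 H2 *.
  have r0 : 0 <= r by rewrite mulr_ge0.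
  rewrite -[leRHS]ger0_norm ?addr_ge0// -sqrtr_sqr ler_sqrt ?sqr_ge0//.
  have Hp : p ^+ 2 <= r ^+ 2 by rewrite -[p ^+ 2]real_normK ?num_real// ler_sqr.
  have Hq : q ^+ 2 <= r ^+ 2 by rewrite -[q ^+ 2]real_normK ?num_real// ler_sqr.
  by have := sqr_ge0 r; nra.
by rewrite -lecR.
Qed.
End ComplexFacts.

Section Limits.
Variable R : realType.
Implicit Types (x y c z w : Cplx R).

Lemma le_rate x y c : x \is Num.real -> y \is Num.real -> 0 <= c ->
  (forall n, x <= y + c * rate R n) -> x <= y.
Proof.
move=> xr yr c0 H; rewrite real_leNgt//; apply/negP => yx.
have d0 : 0 < (x - y) / (c + 1) by rewrite divr_gt0 ?subr_gt0 ?ltr_wpDl.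
have [n Hn] := rate_small (R := R) (e := (x - y) / (c + 1) / 2) (divr_gt0 d0 (ltr0Sn _ _)).
have := H n; rewrite -lerBlDl => /le_trans/(_ (ler_wpM2l c0 Hn)).
have c1 : 0 < c + 1 by rewrite ltr_wpDl.
rewrite lt_geF// !mulrA ltr_pdivrMr// ltr_pdivrMr//.
rewrite mulrC -subr_gt0.
rewrite (_ : _ - _ = (x - y) * (c + 2)); last by ring.
by rewrite mulr_gt0 ?subr_gt0 ?ltr_wpDl.
Qed.

Lemma eq_rate z w c : 0 <= c ->
  (forall n, `|z - w| <= c * rate R n) -> z = w.
Proof.
move=> c0 H; apply/eqP; rewrite -subr_eq0 -normr_le0.
apply: (@le_rate _ _ c) => //.
  by move=> n; rewrite add0r.
Qed.

End Limits.

(* Reproducing kernel Hilbert spaces: [rkhs k] below is the Hilbert space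
   completion of the span of the functions [k^~ x], realized by functions. *)
Record kernel (R : realType) (X : Type) := Kernel {
  kfun :> X -> X -> Cplx R ;
  kherm : forall x y, kfun y x = (kfun x y)^* ;
  kpsd : forall s : seq (Cplx R * X),
    0 <= \sum_(p <- s) \sum_(q <- s) p.1^* * q.1 * kfun p.2 q.2 }.

Section RKHS.
Variables (R : realType) (X : Type).
Notation C := (Cplx R).
Notation fsum := (seq (C * X)).
Notation rt := (rate R).
Implicit Types (f g : X -> C) (s t : fsum).

Definition ev f s : C := \sum_(p <- s) p.1^* * f p.2.
Definition scl (a : C) s : fsum := [seq (a * p.1, p.2) | p <- s].

Lemma ev_cat f s t : ev f (s ++ t) = ev f s + ev f t.
Proof. by rewrite /ev big_cat. Qed.
Lemma ev_scl f a s : ev f (scl a s) = a^* * ev f s.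
Proof.
rewrite /ev big_map big_distrr/=; apply: eq_bigr => p _ /=.
by rewrite rmorphM mulrA.
Qed.
Lemma evD f g s : ev (f + g) s = ev f s + ev g s.
Proof. by rewrite /ev -big_split/=; apply: eq_bigr => p _; rewrite -mulrDr. Qed.
Lemma evZ a f s : ev (a *: f) s = a * ev f s.
Proof. by rewrite /ev big_distrr/=; apply: eq_bigr => p _; exact: mulrCA. Qed.
Lemma ev0 s : ev 0 s = 0.
Proof. by rewrite /ev big1// => p _; rewrite mulr0. Qed.
Lemma evN f s : ev (- f) s = - ev f s.
Proof. by rewrite -scaleN1r evZ mulN1r. Qed.
Lemma evB f g s : ev (f - g) s = ev f s - ev g s.
Proof. by rewrite evD evN. Qed.
Lemma ev1 f x : ev f [:: (1, x)] = f x.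
Proof. by rewrite /ev big_seq1 rmorph1 mul1r. Qed.

Variable k : kernel R X.

Definition kf s : X -> C := fun x => \sum_(p <- s) p.1 * k x p.2.
Lemma kf_cat s t : kf (s ++ t) = kf s + kf t.
Proof. by apply/funext => x; rewrite /kf big_cat. Qed.
Lemma kf_scl a s : kf (scl a s) = a *: kf s.
Proof.
apply/funext => x; rewrite /kf big_map [RHS]big_distrr/=.
by apply: eq_bigr => p _; rewrite mulrA.
Qed.

Definition gram t s := ev (kf s) t.
Lemma gramE t s : gram t s = \sum_(p <- t) \sum_(q <- s) p.1^* * q.1 * k p.2 q.2.
Proof.
by apply: eq_bigr => p _; rewrite big_distrr/=; apply: eq_bigr => q _; rewrite mulrA.
Qed.
Lemma gramC s t : gram s t = (gram t s)^*.
Proof.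
rewrite !gramE exchange_big rmorph_sum/=; apply: eq_bigr => p _.
rewrite rmorph_sum/=; apply: eq_bigr => q _.
by rewrite !rmorphM/= conjCK -kherm; ring.
Qed.
Lemma gram_ge0 s : 0 <= gram s s.
Proof. by rewrite gramE; exact: kpsd. Qed.

Definition N s := sqrtC (gram s s).
Lemma N_ge0 s : 0 <= N s. Proof. by rewrite sqrtC_ge0 gram_ge0. Qed.
Lemma NE s : N s ^+ 2 = gram s s. Proof. by rewrite sqrtCK. Qed.

Lemma gram_CS t s : `|gram t s| <= N t * N s.
Proof.
rewrite -(@ler_pXn2r _ 2)// ?nnegrE ?mulr_ge0 ?N_ge0//.
rewrite exprMn !NE; apply: quad_CS; rewrite ?gram_ge0// => a b.
have := gram_ge0 (scl a t ++ scl b s).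
rewrite /gram ev_cat !ev_scl kf_cat !kf_scl !evD !evZ.
rewrite -/(gram t t) -/(gram t s) -/(gram s t) -/(gram s s) (gramC s t).
set z := gram t s; rewrite !rmorphM/= conjCK.
by congr (0 <= _); ring.
Qed.

Definition dom f (M : C) := forall t, `|ev f t| <= M * N t.
Definition sub s t := s ++ scl (-1) t.
Lemma kf_sub s t : kf (sub s t) = kf s - kf t.
Proof. by rewrite kf_cat kf_scl scaleN1r. Qed.
Lemma dom_kf s : dom (kf s) (N s).
Proof. by move=> t; rewrite mulrC gram_CS. Qed.
Lemma N_le s M : 0 <= M -> dom (kf s) M -> N s <= M.
Proof.
move=> M0 /(_ s); rewrite -/(gram s s) -NE ger0_norm ?exprn_ge0 ?N_ge0//.
have [->//|n0] := eqVneq (N s) 0.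
by rewrite expr2 ler_pM2r// lt_def n0 N_ge0.
Qed.
Lemma domD f g M1 M2 : dom f M1 -> dom g M2 -> dom (f + g) (M1 + M2).
Proof.
move=> H1 H2 t; rewrite evD mulrDl; apply: le_trans (ler_normD _ _) _.
exact: lerD.
Qed.
Lemma domZ a f M : dom f M -> dom (a *: f) (`|a| * M).
Proof. by move=> H t; rewrite evZ normrM -mulrA ler_wpM2l. Qed.
Lemma domN f M : dom f M -> dom (- f) M.
Proof. by move=> H t; rewrite evN normrN. Qed.
Lemma domB f g M1 M2 : dom f M1 -> dom g M2 -> dom (f - g) (M1 + M2).
Proof. by move=> H1 /domN; exact: domD. Qed.
Lemma dom_le f M1 M2 : M1 <= M2 -> dom f M1 -> dom f M2.
Proof. by move=> H1 H2 t; apply: le_trans (H2 t) _; rewrite ler_wpM2r ?N_ge0. Qed.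
Lemma dom0 M : 0 <= M -> dom 0 M.
Proof. by move=> M0 t; rewrite ev0 normr0 mulr_ge0 ?N_ge0. Qed.

Definition rkhs_set : set (X -> C) :=
  [set f | forall e : C, 0 < e -> exists s, dom (f - kf s) e].
Definition mem_rkhs : {pred X -> C} := mem rkhs_set.
Lemma rkhsP f : (f \in mem_rkhs) <-> rkhs_set f.
Proof. by split; rewrite /mem_rkhs -topredE/= in_setE. Qed.

Lemma kf_rkhs s : rkhs_set (kf s).
Proof. by move=> e e0; exists s; rewrite subrr; apply/dom0/ltW. Qed.

Lemma rkhs_submod : subsemimod_closed mem_rkhs.
Proof.
split; first split.
- by apply/rkhsP => e e0; exists [::]; rewrite /kf;
    (rewrite (_ : (fun _ => _) = 0) ?subrr; [exact/dom0/ltW|by apply/funext => x; rewrite big_nil]).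
- move=> f g /rkhsP Hf /rkhsP Hg; apply/rkhsP => e e0.
  have e20 : 0 < e / 2 by rewrite divr_gt0.
  have [[s Hs] [t Ht]] := (Hf _ e20, Hg _ e20).
  exists (s ++ t); rewrite kf_cat opprD addrACA [e]splitr; exact: domD.
- move=> a f /rkhsP Hf; apply/rkhsP => e e0.
  have a1 : 0 < `|a| + 1 by rewrite ltr_wpDl.
  have [s Hs] := Hf _ (divr_gt0 e0 a1).
  exists (scl a s); rewrite kf_scl -scalerBr; apply: dom_le (domZ _ Hs).
  rewrite mulrA ler_pdivrMr// mulrC ler_wpM2l ?ltW//.
  by rewrite ltrDl.
Qed.

Lemma rkhs_bnd f : rkhs_set f -> exists2 M, 0 <= M & dom f M.
Proof.
move=> /(_ 1 ltr01)[s Hs]; exists (1 + N s); first by rewrite addr_ge0 ?N_ge0.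
by rewrite -(subrK (kf s) f); apply: domD => //; exact: dom_kf.
Qed.

Lemma dom_sub f s t e1 e2 : 0 <= e1 -> 0 <= e2 ->
  dom (f - kf s) e1 -> dom (f - kf t) e2 -> N (sub s t) <= e1 + e2.
Proof.
move=> e10 e20 H1 H2; apply: N_le; first by rewrite addr_ge0.
rewrite kf_sub (_ : _ - _ = (f - kf t) - (f - kf s)); first by rewrite [e1 + e2]addrC; exact: domB.
by rewrite opprB [RHS]addrC addrA subrK.
Qed.

Lemma ev_sub f s t : ev f (sub s t) = ev f s - ev f t.
Proof. by rewrite ev_cat ev_scl rmorphN rmorph1 mulN1r. Qed.

Definition ip_spec f g (z : C) := forall s (e M : C), 0 < e -> 0 <= M ->
  dom (f - kf s) e -> dom g M -> `|z - ev g s| <= M * e.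

Lemma ip_ex f g : rkhs_set f -> rkhs_set g -> exists z, ip_spec f g z.
Proof.
move=> Hf Hg; have [M0 M00 HM0] := rkhs_bnd Hg.
have /choice[u Hu] : forall n, exists s, dom (f - kf s) (rt n).
  by move=> n; apply: Hf; exact: rate_gt0.
have key s t (e1 e2 M : C) : 0 <= e1 -> 0 <= e2 -> 0 <= M -> dom g M ->
    dom (f - kf s) e1 -> dom (f - kf t) e2 -> `|ev g s - ev g t| <= M * (e1 + e2).
  move=> e10 e20 M1 Hg' H1 H2; rewrite -ev_sub; apply: le_trans (Hg' _) _.
  by rewrite ler_wpM2l// (dom_sub _ _ H1 H2).
have [z Hz] : exists z, forall n, `|z - ev g (u n)| <= 2 * M0 * rt n.
  apply: cplx_limit => // n m; apply: key => //; exact: rate_ge0.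
exists z => s e M e0 M1 Hs Hg'.
apply: (@le_rate _ _ _ (2 * M0 + M)).
- exact: ger0_real.
- by rewrite ger0_real// mulr_ge0// ltW.
- by rewrite addr_ge0// mulr_ge0.
- move=> n; apply: le_trans (ler_distD (ev g (u n)) _ _) _.
  have := key _ _ _ _ _ (rate_ge0 R n) (ltW e0) M1 Hg' (Hu n) Hs.
  by move=> /(lerD (Hz n))/le_trans; apply; rewrite le_eqVlt; apply/orP; left; apply/eqP; ring.
Qed.

Lemma ip_spec_uniq f g z w K : rkhs_set f -> 0 <= K -> ip_spec f g w ->
  rkhs_set g ->
  (forall s (e : C), 0 < e -> e <= 1 -> dom (f - kf s) e -> `|z - ev g s| <= K * e) ->
  z = w.
Proof.
move=> Hf K0 Hw Hg Hz; have [M M0 HM] := rkhs_bnd Hg.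
apply: (@eq_rate _ _ _ (K + M)); first exact: addr_ge0.
move=> n; have [s Hs] := Hf _ (rate_gt0 R n).
apply: le_trans (ler_distD (ev g s) _ _) _; rewrite mulrDl lerD//.
  apply: Hz => //; first exact: rate_gt0.
  by rewrite invf_le1 ?ltr0n// ler1n.
by rewrite distrC; apply: Hw => //; exact: rate_gt0.
Qed.

Definition ip f g : C := xget 0 (ip_spec f g).
Lemma ipP f g : rkhs_set f -> rkhs_set g -> ip_spec f g (ip f g).
Proof. by move=> Hf Hg; have [z Hz] := ip_ex Hf Hg; exact: (xgetI 0 Hz). Qed.

Lemma ip_uniq f g z K : rkhs_set f -> rkhs_set g -> 0 <= K ->
  (forall s (e : C), 0 < e -> e <= 1 -> dom (f - kf s) e -> `|z - ev g s| <= K * e) ->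
  z = ip f g.
Proof. by move=> Hf Hg K0; apply: ip_spec_uniq => //; exact: ipP. Qed.

Lemma rkhsDZ a f g : rkhs_set f -> rkhs_set g -> rkhs_set (a *: f + g).
Proof.
case: rkhs_submod => -[_ HD] HZ /rkhsP Hf /rkhsP Hg.
by apply/rkhsP/HD => //; exact: HZ.
Qed.

Lemma ipDZ f a g1 g2 : rkhs_set f -> rkhs_set g1 -> rkhs_set g2 ->
  ip f (a *: g1 + g2) = a * ip f g1 + ip f g2.
Proof.
move=> Hf H1 H2; have [M1 M10 HM1] := rkhs_bnd H1.
have [M2 M20 HM2] := rkhs_bnd H2.
apply/esym/(@ip_uniq _ _ _ (`|a| * M1 + M2)) => //.
- exact: rkhsDZ.
- by rewrite addr_ge0// mulr_ge0.
move=> s e e0 _ Hs; rewrite evD evZ opprD addrACA -mulrBr.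
apply: le_trans (ler_normD _ _) _; rewrite mulrDl lerD//; last exact: ipP.
by rewrite normrM -mulrA ler_wpM2l//; exact: ipP.
Qed.

Lemma N_le_dom f s M e : 0 <= M -> 0 <= e -> dom f M -> dom (f - kf s) e -> N s <= M + e.
Proof.
move=> M0 e0 H1 H2; apply: N_le; first exact: addr_ge0.
rewrite (_ : kf s = f - (f - kf s)); last by rewrite opprB addrC subrK.
exact: domB.
Qed.

Lemma ipC f g : rkhs_set f -> rkhs_set g -> ip g f = (ip f g)^*.
Proof.
move=> Hf Hg; have [M1 M10 HM1] := rkhs_bnd Hf.
have [M2 M20 HM2] := rkhs_bnd Hg.
apply/esym/(@ip_uniq _ _ _ (M2 + (M1 + 1) + (M2 + 1))) => //.
  by rewrite !addr_ge0.
move=> t e e0 e1 Ht; have [s Hs] := Hf _ e0.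
have -> : (ip f g)^* - ev f t = (ip f g - ev g s)^* + (ev (g - kf t) s)^* - ev (f - kf s) t.
  rewrite !evB !rmorphB/= -/(gram s t) -/(gram t s) gramC conjCK.
  by ring.
rewrite !mulrDl; apply: le_trans (ler_normB _ _) _.
apply: lerD; first apply: le_trans (ler_normD _ _) _; first apply: lerD.
- by rewrite norm_conjC; exact: ipP.
- rewrite norm_conjC; apply: le_trans (Ht _) _; rewrite mulrC -mulrDl ler_wpM2r ?(ltW e0)//.
  by apply: le_trans (N_le_dom _ _ HM1 Hs) _ => //; [exact: ltW|rewrite lerD2l].
- apply: le_trans (Hs _) _; rewrite mulrC -mulrDl ler_wpM2r ?(ltW e0)//.
  by apply: le_trans (N_le_dom _ _ HM2 Ht) _ => //; [exact: ltW|rewrite lerD2l].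
Qed.

Lemma ip_kf s f : rkhs_set f -> ip (kf s) f = ev f s.
Proof.
move=> Hf; have Hs := kf_rkhs s; have [M M0 HM] := rkhs_bnd Hf.
apply: (@eq_rate _ _ _ M) => // n; apply: ipP => //; first exact: rate_gt0.
by rewrite subrr; apply/dom0/rate_ge0.
Qed.

Lemma ip_ge0 f : rkhs_set f -> 0 <= ip f f.
Proof.
move=> Hf; have [M M0 HM] := rkhs_bnd Hf.
have rI : ip f f \is Num.real by apply/CrealP; rewrite -ipC.
rewrite -oppr_le0; apply: (@le_rate _ _ _ (M + (M + 1))) => //.
- by rewrite rpredN.
- by rewrite !addr_ge0.
move=> n; have [s Hs] := Hf _ (rate_gt0 R n).
have r0 := rate_ge0 R n.
have r1 : rt n <= 1 by rewrite invf_le1 ?ltr0n// ler1n.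
rewrite add0r.
have H1 : `|ip f f - gram s s| <= (M + (M + 1)) * rt n.
  rewrite (_ : _ - _ = (ip f f - ev f s) + ev (f - kf s) s); last first.
    by rewrite evB -/(gram s s); ring.
  apply: le_trans (ler_normD _ _) _; rewrite mulrDl; apply: lerD.
    by apply: ipP => //; exact: rate_gt0.
  apply: le_trans (Hs _) _; rewrite mulrC ler_wpM2r//.
  by apply: le_trans (N_le_dom _ _ HM Hs) _ => //; rewrite lerD2l.
have rr : gram s s - ip f f \is Num.real by rewrite realB// ger0_real// gram_ge0.
apply: le_trans H1; rewrite distrC; apply: le_trans (real_ler_norm rr).
by rewrite lerDr gram_ge0.
Qed.

Lemma ipDZl f a g1 g2 : rkhs_set f -> rkhs_set g1 -> rkhs_set g2 ->
  ip (a *: g1 + g2) f = a^* * ip g1 f + ip g2 f.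
Proof.
move=> Hf H1 H2; have H12 := rkhsDZ a H1 H2.
by rewrite ipC// ipDZ// rmorphD rmorphM/= -!ipC.
Qed.

Definition nrm f := sqrtC (ip f f).
Lemma nrm_ge0 f : rkhs_set f -> 0 <= nrm f.
Proof. by move=> Hf; rewrite sqrtC_ge0 ip_ge0. Qed.
Lemma nrmE f : nrm f ^+ 2 = ip f f. Proof. exact: sqrtCK. Qed.

Lemma rkhs0 : rkhs_set 0. Proof. by case: rkhs_submod => -[/rkhsP]. Qed.

Lemma ipZ a f g : rkhs_set f -> rkhs_set g -> ip f (a *: g) = a * ip f g.
Proof.
move=> Hf Hg; have H0 := rkhs0.
have ip0 : ip f 0 = 0.
  have := ipDZ 1 Hf H0 H0; rewrite scaler0 addr0 mul1r => /eqP.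
  by rewrite -subr_eq0 opprD addrA subrr sub0r oppr_eq0 => /eqP.
by have := ipDZ a Hf Hg H0; rewrite addr0 ip0 addr0.
Qed.

Lemma ip_CS f g : rkhs_set f -> rkhs_set g -> `|ip f g| <= nrm f * nrm g.
Proof.
move=> Hf Hg; rewrite -(@ler_pXn2r _ 2)// ?nnegrE ?mulr_ge0 ?nrm_ge0//.
rewrite exprMn !nrmE; apply: quad_CS; rewrite ?ip_ge0// => a b.
have H0 := rkhs0; have Hbg : rkhs_set (b *: g) by have := rkhsDZ b Hg H0; rewrite addr0.
have H := rkhsDZ a Hf Hbg; have := ip_ge0 H.
rewrite ipDZ// ipDZl// ipDZl// !ipZ// [ip (b *: g) f]ipC// [ip (b *: g) g]ipC// !ipZ//.
rewrite !rmorphM/= conjCK -[(ip g g)^*]ipC//.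
by congr (0 <= _); ring.
Qed.

Lemma nrmD f g : rkhs_set f -> rkhs_set g -> nrm (f + g) <= nrm f + nrm g.
Proof.
move=> Hf Hg; have H : rkhs_set (f + g) by have := rkhsDZ 1 Hf Hg; rewrite scale1r.
rewrite -(@ler_pXn2r _ 2)// ?nnegrE ?addr_ge0 ?nrm_ge0//.
rewrite nrmE sqrrD !nrmE.
have -> : ip (f + g) (f + g) = ip f f + (ip f g + (ip f g)^*) + ip g g.
  have := ipDZ 1 H Hf Hg; rewrite scale1r mul1r => ->.
  have := ipDZl 1 Hf Hf Hg; rewrite scale1r rmorph1 mul1r => ->.
  have := ipDZl 1 Hg Hf Hg; rewrite scale1r rmorph1 mul1r => ->.
  by rewrite [ip g f]ipC//; ring.
rewrite lerD2r lerD2l.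
have rz : ip f g + (ip f g)^* \is Num.real by apply/CrealP; rewrite rmorphD/= conjCK addrC.
apply: le_trans (real_ler_norm rz) _; apply: le_trans (ler_normD _ _) _.
by rewrite norm_conjC mulr2n lerD// ip_CS.
Qed.

Lemma nrmZ a f : rkhs_set f -> nrm (a *: f) = `|a| * nrm f.
Proof.
move=> Hf; have Haf : rkhs_set (a *: f) by have := rkhsDZ a Hf rkhs0; rewrite addr0.
apply/eqP; rewrite -(@eqrXn2 _ 2)// ?mulr_ge0 ?nrm_ge0//.
rewrite exprMn !nrmE ipZ// ipC// ipZ// rmorphM/= -ipC// normCK.
by apply/eqP; ring.
Qed.

Lemma dom_nrm f : rkhs_set f -> dom f (nrm f).
Proof.
move=> Hf t; rewrite -ip_kf//; apply: le_trans (ip_CS (kf_rkhs t) Hf) _.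
by rewrite mulrC /nrm ip_kf//; exact: kf_rkhs.
Qed.

Lemma nrm0 f : rkhs_set f -> nrm f = 0 -> f = 0.
Proof.
move=> Hf f0; apply/funext => x; apply/eqP; rewrite -normr_le0.
by have := dom_nrm Hf [:: (1, x)]; rewrite f0 mul0r ev1.
Qed.

Lemma nrm_le f (E : C) : rkhs_set f -> 0 < E -> dom f E -> nrm f <= 3 * E.
Proof.
move=> Hf E0 HE; have E0' := ltW E0.
have [s Hs] := Hf _ E0.
rewrite -(@ler_pXn2r _ 2)// ?nnegrE ?mulr_ge0 ?nrm_ge0// nrmE.
rewrite -[ip f f]ger0_norm ?ip_ge0//.
rewrite (_ : ip f f = (ip f f - ev f s) + ev f s); last by rewrite subrK.
apply: le_trans (ler_normD _ _) _.
have H1 := ipP Hf Hf E0 E0' Hs HE.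
have H2 : `|ev f s| <= E * (E + E).
  by apply: le_trans (HE _) _; rewrite ler_wpM2l// (N_le_dom _ _ HE Hs).
apply: le_trans (lerD H1 H2) _; rewrite -subr_ge0.
rewrite (_ : _ - _ = 6 * (E * E)); last by ring.
by rewrite mulr_ge0// mulr_ge0.
Qed.

Lemma rkhs_lim (u : nat -> fsum) :
  (forall n m, N (sub (u n) (u m)) <= 2 * (rt n + rt m)) ->
  exists2 f, rkhs_set f & forall n, dom (f - kf (u n)) (2 * rt n).
Proof.
move=> H.
have Hx x : exists z, forall n, `|z - kf (u n) x| <= 2 * (2 * N [:: (1, x)]) * rt n.
  apply: cplx_limit => [|n m]; first by rewrite mulr_ge0 ?N_ge0.
  rewrite -(ev1 (kf (u n)) x) -(ev1 (kf (u m)) x) -evB -kf_sub.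
  apply: le_trans (dom_kf _ _) _; rewrite -[leRHS]mulrA [N [:: _] * _]mulrC [leRHS]mulrA.
  by rewrite ler_wpM2r ?N_ge0.
have [f Hf] := choice Hx.
have Hd n : dom (f - kf (u n)) (2 * rt n).
  move=> t; pose c := \sum_(p <- t) `|p.1| * (2 * (2 * N [:: (1, p.2)])).
  have c0 : 0 <= c by apply: sumr_ge0 => p _; rewrite !mulr_ge0 ?N_ge0.
  apply: (@le_rate _ _ _ (c + 2 * N t)).
  - exact: ger0_real.
  - by rewrite ger0_real// !mulr_ge0 ?N_ge0 ?rate_ge0.
  - by rewrite addr_ge0// mulr_ge0 ?N_ge0.
  move=> m; rewrite (_ : f - kf (u n) = (f - kf (u m)) + (kf (u m) - kf (u n))); last first.
    by rewrite addrA subrK.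
  rewrite evD -kf_sub; apply: le_trans (ler_normD _ _) _.
  have -> : 2 * rt n * N t + (c + 2 * N t) * rt m = c * rt m + 2 * (rt m + rt n) * N t by ring.
  apply: lerD; last first.
    by apply: le_trans (dom_kf _ _) _; rewrite ler_wpM2r ?N_ge0.
  rewrite /ev /c mulr_suml; apply: le_trans (ler_norm_sum _ _ _) _.
  apply: ler_sum => p _; rewrite normrM norm_conjC -mulrA ler_wpM2l//.
  exact: Hf.
exists f => // e e0.
have [n Hn] := rate_small (divr_gt0 e0 (ltr0Sn _ 1)).
exists (u n); apply: dom_le (Hd n).
by rewrite mulrC -ler_pdivlMr.
Qed.
End RKHS.

(* Inner products are antilinear in the first variable and linear in the
   second one. *)
HB.mixin Record hasInner (R : realType) H & CompleteNormedModule (Cplx R) H := {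
  inner : H -> H -> Cplx R ;
  innerD : forall x y z, inner x (y + z) = inner x y + inner x z ;
  innerZ : forall x a y, inner x (a *: y) = a * inner x y ;
  innerC : forall x y, inner y x = (inner x y)^* ;
  inner_norm : forall x, inner x x = `|x| ^+ 2 }.

#[short(type="hilbertType")]
HB.structure Definition Hilbert (R : realType) :=
  {H of CompleteNormedModule (Cplx R) H & hasInner R H}.

Section RkhsType.
Variables (R : realType) (X : Type) (k : kernel R X).

HB.instance Definition _ :=
  GRing.isSubmodClosed.Build (Cplx R) (X -> Cplx R) (mem_rkhs k) (rkhs_submod k).

Record rkhs := Rkhs { rkhs_val : X -> Cplx R ; _ : rkhs_val \in mem_rkhs k }.
HB.instance Definition _ := [isSub for rkhs_val].
HB.instance Definition _ := [Choice of rkhs by <:].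
HB.instance Definition _ := [SubChoice_isSubLmodule of rkhs by <:].

Lemma rkhs_valP (f : rkhs) : rkhs_set k (rkhs_val f).
Proof. by apply/rkhsP; exact: valP. Qed.

Lemma rkhs_valD (f g : rkhs) : rkhs_val (f + g) = rkhs_val f + rkhs_val g.
Proof. by []. Qed.
Lemma rkhs_valB (f g : rkhs) : rkhs_val (f - g) = rkhs_val f - rkhs_val g.
Proof. by []. Qed.
Lemma rkhs_valZ a (f : rkhs) : rkhs_val (a *: f) = a *: rkhs_val f.
Proof. by []. Qed.

Let nm (f : rkhs) := nrm k (rkhs_val f).
Let nmD f g : nm (f + g) <= nm f + nm g.
Proof. by rewrite /nm rkhs_valD; apply: nrmD; exact: rkhs_valP. Qed.
Let nmZ a f : nm (a *: f) = `|a| * nm f.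
Proof. by rewrite /nm rkhs_valZ nrmZ//; exact: rkhs_valP. Qed.
Let nm0 f : nm f = 0 -> f = 0.
Proof. by move=> /(nrm0 (rkhs_valP f)) f0; apply: val_inj. Qed.
HB.instance Definition _ := Lmodule_isNormed.Build (Cplx R) rkhs nmD nmZ nm0.

Let rkhs_complete (F : set_system rkhs) : ProperFilter F -> cauchy F -> cvg F.
Proof.
move=> FF /cauchyP Fc.
have /choice[u Hu] : forall n, exists p : rkhs * seq (Cplx R * X),
    F (ball p.1 (rate R n)) /\ dom k (rkhs_val p.1 - kf k p.2) (rate R n).
  move=> n; have [f Ff] := Fc _ (rate_gt0 R n).
  have [s Hs] := rkhs_valP f (rate_gt0 R n).
  by exists (f, s).
have near n (g : rkhs) : ball (u n).1 (rate R n) g ->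
    dom k (rkhs_val g - rkhs_val (u n).1) (rate R n).
  rewrite -ball_normE/= distrC => /ltW H; apply: dom_le H _.
  by have := dom_nrm (rkhs_valP (g - (u n).1)); rewrite rkhs_valB.
have near2 n (g : rkhs) : ball (u n).1 (rate R n) g ->
    dom k (rkhs_val g - kf k (u n).2) (2 * rate R n).
  move=> /near H; rewrite mulr2n mulrDl !mul1r.
  rewrite -(subrK (rkhs_val (u n).1) (rkhs_val g)) -addrA.
  by apply: domD => //; case: (Hu n).
have [|f Hf Hd] := @rkhs_lim R X k (fun n => (u n).2).
  move=> n m; have /filter_ex[g [gn gm]] :
      F (ball (u n).1 (rate R n) `&` ball (u m).1 (rate R m)).
    by apply: filterI; [case: (Hu n)|case: (Hu m)].
  rewrite mulrDr; apply: (dom_sub _ _ (near2 _ _ gn) (near2 _ _ gm));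
    by rewrite mulr_ge0// rate_ge0.
have fm : f \in mem_rkhs k by apply/rkhsP.
apply/cvg_ex; exists (Rkhs fm); apply/fcvg_ballP => e e0.
have [n Hn] := rate_small (divr_gt0 e0 (ltr0Sn _ 12)).
have [Fn _] := Hu n; apply: filterS Fn => g /near2 Hg.
rewrite -ball_normE/=; apply: le_lt_trans (_ : 12 * rate R n < e).
  rewrite -[`|_|]/(nrm k (rkhs_val (_ - _))) rkhs_valB.
  rewrite (_ : 12 * rate R n = 3 * (2 * rate R n + 2 * rate R n)); last by ring.
  apply: nrm_le.
  - by have := rkhs_valP (Rkhs fm - g); rewrite rkhs_valB.
  - by rewrite addr_gt0// mulr_gt0// rate_gt0.
  - rewrite -[rkhs_val (Rkhs fm)]/f -(subrK (kf k (u n).2) f) -addrA -[_ - rkhs_val g]opprB.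
    exact: domB.
apply: (@lt_le_trans _ _ (13 * rate R n)); last by rewrite mulrC -ler_pdivlMr.
by rewrite ltr_pM2r ?rate_gt0// ltr_nat.
Qed.
HB.instance Definition _ := Uniform_isComplete.Build rkhs rkhs_complete.

Let inn (f g : rkhs) := ip k (rkhs_val f) (rkhs_val g).
Let innD f g h : inn f (g + h) = inn f g + inn f h.
Proof.
rewrite /inn rkhs_valD.
by have := ipDZ 1 (rkhs_valP f) (rkhs_valP g) (rkhs_valP h); rewrite scale1r mul1r.
Qed.
Let innZ f a g : inn f (a *: g) = a * inn f g.
Proof. by rewrite /inn rkhs_valZ ipZ//; exact: rkhs_valP. Qed.
Let innC f g : inn g f = (inn f g)^*.
Proof. by rewrite /inn ipC//; exact: rkhs_valP. Qed.
Let inn_norm f : inn f f = `|f| ^+ 2.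
Proof. by rewrite -[`|f|]/(nrm k (rkhs_val f)) nrmE. Qed.
HB.instance Definition _ := hasInner.Build R rkhs innD innZ innC inn_norm.

End RkhsType.

Section Spans.
Variable R : realType.

Definition lspan (V : lmodType (Cplx R)) (S : set V) : set V :=
  [set v | exists n (a : 'I_n -> Cplx R) (u : 'I_n -> V),
    (forall i, S (u i)) /\ v = \sum_(i < n) a i *: u i].

End Spans.

Section InnerTheory.
Variables (R : realType) (H : hilbertType R).
Implicit Types (x y z : H) (a : Cplx R).

Lemma innerDl x y z : inner (x + y) z = inner x z + inner y z.
Proof. by rewrite innerC innerD rmorphD/= -!innerC. Qed.
Lemma innerZl a x y : inner (a *: x) y = a^* * inner x y.
Proof. by rewrite innerC innerZ rmorphM/= -innerC. Qed.
Lemma inner0 x : inner x 0 = 0.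
Proof. by rewrite -[0 in LHS](scale0r x) innerZ mul0r. Qed.
Lemma innerN x y : inner x (- y) = - inner x y.
Proof. by rewrite -scaleN1r innerZ mulN1r. Qed.
Lemma innerNl x y : inner (- x) y = - inner x y.
Proof. by rewrite -scaleN1r innerZl rmorphN rmorph1 mulN1r. Qed.
Lemma inner_sumr I (r : seq I) (F : I -> H) x :
  inner x (\sum_(i <- r) F i) = \sum_(i <- r) inner x (F i).
Proof. exact: (big_morph _ (innerD x) (inner0 x)). Qed.
Lemma inner_suml I (r : seq I) (F : I -> H) x :
  inner (\sum_(i <- r) F i) x = \sum_(i <- r) inner (F i) x.
Proof.
rewrite innerC inner_sumr rmorph_sum/=; apply: eq_bigr => i _.
by rewrite -innerC.
Qed.
Lemma inner_ge0 x : 0 <= inner x x.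
Proof. by rewrite inner_norm exprn_ge0. Qed.
Lemma inner_eq0 x : (inner x x == 0) = (x == 0).
Proof. by rewrite inner_norm sqrf_eq0 normr_eq0. Qed.

End InnerTheory.

Section TensorKernel.
Variables (R : realType) (H K : hilbertType R).
Notation C := (Cplx R).

Let S (s : seq (H * K)) : C :=
  \sum_(p <- s) \sum_(q <- s) inner p.1 q.1 * inner p.2 q.2.

Let S_ge0 s : 0 <= S s.
Proof.
have [n] := ubnP (count (fun p => p.2 != 0) s); elim: n s => // n IH s.
rewrite ltnS => sn.
have [/hasP[p0 p0s y0]|/hasPn s0] := boolP (has (fun p => p.2 != 0) s); last first.
  rewrite /S big1_seq// => p /= ps; rewrite big1_seq// => q /= qs.
  by have /negPn/eqP-> := s0 _ qs; rewrite inner0 mulr0.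
set e := p0.2 in y0.
pose N := inner e e.
have N0 : N != 0 by rewrite inner_eq0.
pose pr (y : K) := y - (inner e y / N) *: e.
pose s' := [seq (p.1, pr p.2) | p <- s].
have pr0 : pr 0 = 0 by rewrite /pr inner0 mul0r scale0r subr0.
have pre : pr e = 0 by rewrite /pr mulfV// scale1r subrr.
have cs' : (count (fun p => p.2 != 0%R) s' < n)%N.
  apply: leq_trans sn; rewrite count_map.
  have [s1 [s2 ->]] : exists s1 s2, s = s1 ++ p0 :: s2.
    by case/splitPr: p0s => s1 s2; exists s1, s2.
  have sub : subpred (preim (fun p : H * K => (p.1, pr p.2)) (fun p => p.2 != 0))
                     (fun p => p.2 != 0).
    by move=> p /=; apply: contraNN => /eqP ->; rewrite pr0.
  rewrite !count_cat/= -/e pre eqxx y0/= add0n add1n addnS ltnS.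
  by rewrite leq_add// sub_count.
have -> : S s = N^-1 * inner (\sum_(p <- s) inner e p.2 *: p.1) (\sum_(p <- s) inner e p.2 *: p.1) + S s'.
  rewrite inner_suml big_distrr/= /S big_map -big_split/=; apply: eq_bigr => p _.
  rewrite inner_sumr big_distrr/= big_map -big_split/=; apply: eq_bigr => q _.
  rewrite innerZ innerZl /pr innerD !innerN !innerDl !innerNl !innerZ !innerZl -/N.
  rewrite rmorphM fmorphV/= -[N^*]innerC -/N -[(inner e p.2)^*]innerC.
  by field.
rewrite addr_ge0 ?IH// mulr_ge0 ?inner_ge0// invr_ge0 inner_ge0//.
Qed.

Definition tensor_kfun (p q : H * K) : C := inner p.1 q.1 * inner p.2 q.2.

Let tensor_kherm p q : tensor_kfun q p = (tensor_kfun p q)^*.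
Proof. by rewrite /tensor_kfun rmorphM/= -!innerC. Qed.

Let tensor_kpsd (s : seq (C * (H * K))) :
  0 <= \sum_(p <- s) \sum_(q <- s) p.1^* * q.1 * tensor_kfun p.2 q.2.
Proof.
have := S_ge0 [seq (p.1 *: p.2.1, p.2.2) | p <- s].
rewrite /S big_map; congr (0 <= _); apply: eq_bigr => p _.
rewrite big_map; apply: eq_bigr => q _.
by rewrite innerZ innerZl /tensor_kfun; ring.
Qed.

Definition tensor_kernel := Kernel tensor_kherm tensor_kpsd.
End TensorKernel.

Section TensorProduct.
Variables (R : realType) (H K : hilbertType R).

(* H (x) K is the Hilbert space of the kernel (x, x') (y, y') on H * K; it is
   characterized by inner_tens and tens_dense. *)
Definition htens : hilbertType R := rkhs (tensor_kernel H K).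

Let tens_mem (x : H) (y : K) : kf (tensor_kernel H K) [:: (1, (x, y))] \in mem_rkhs (tensor_kernel H K).
Proof. by apply/rkhsP/kf_rkhs. Qed.

Definition tens (x : H) (y : K) : htens := Rkhs (tens_mem x y).

Lemma rkhs_val_tens x y p : rkhs_val (tens x y) p = inner p.1 x * inner p.2 y.
Proof. by rewrite /= /kf big_seq1 mul1r. Qed.

Lemma inner_tens x1 y1 x2 y2 :
  inner (tens x1 y1) (tens x2 y2) = inner x1 x2 * inner y1 y2.
Proof.
rewrite -[LHS]/(ip _ (kf _ _) _) ip_kf; last exact: rkhs_valP.
by rewrite ev1 rkhs_val_tens.
Qed.

Lemma tensDl x1 x2 y : tens (x1 + x2) y = tens x1 y + tens x2 y.
Proof.
apply/val_inj/funext => p.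
rewrite -[LHS]/(rkhs_val _ p) -[RHS]/(rkhs_val (tens x1 y) p + rkhs_val (tens x2 y) p).
by rewrite !rkhs_val_tens innerD mulrDl.
Qed.

Lemma tensDr x y1 y2 : tens x (y1 + y2) = tens x y1 + tens x y2.
Proof.
apply/val_inj/funext => p.
rewrite -[LHS]/(rkhs_val _ p) -[RHS]/(rkhs_val (tens x y1) p + rkhs_val (tens x y2) p).
by rewrite !rkhs_val_tens innerD mulrDr.
Qed.

Lemma tensZl a x y : tens (a *: x) y = a *: tens x y.
Proof.
apply/val_inj/funext => p.
rewrite -[LHS]/(rkhs_val _ p) -[RHS]/(a * rkhs_val (tens x y) p).
by rewrite !rkhs_val_tens innerZ mulrA.
Qed.

Lemma tensZr a x y : tens x (a *: y) = a *: tens x y.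
Proof.
apply/val_inj/funext => p.
rewrite -[LHS]/(rkhs_val _ p) -[RHS]/(a * rkhs_val (tens x y) p).
by rewrite !rkhs_val_tens innerZ mulrCA.
Qed.

Lemma tens_dense :
  closure (lspan (R := R) [set tens x y | x in [set: H] & y in [set: K]]) = setT.
Proof.
apply/seteqP; split=> // f _ B /nbhs_ballP[e e0 eB].
have e40 : 0 < e / 4 by rewrite divr_gt0.
have [s Hs] := rkhs_valP f e40.
pose g : htens := \sum_(i < size s) (tnth (in_tuple s) i).1 *:
  tens (tnth (in_tuple s) i).2.1 (tnth (in_tuple s) i).2.2.
have gE : rkhs_val g = kf (tensor_kernel H K) s.
  have -> : g = \sum_(p <- s) p.1 *: tens p.2.1 p.2.2 by rewrite [RHS]big_tnth.
  rewrite (big_morph (@rkhs_val _ _ _) (@rkhs_valD _ _ _) (erefl _ : rkhs_val 0 = 0)).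
  apply/funext => p; rewrite fct_sumE; apply: eq_bigr => q _.
  by rewrite -[LHS]/(q.1 * rkhs_val (tens q.2.1 q.2.2) p) rkhs_val_tens.
exists g; split.
  exists (size s), (fun i => (tnth (in_tuple s) i).1),
    (fun i => tens (tnth (in_tuple s) i).2.1 (tnth (in_tuple s) i).2.2).
  split; last by [].
  move=> i; exists (tnth (in_tuple s) i).2.1 => //; by exists (tnth (in_tuple s) i).2.2.
apply: eB; rewrite -ball_normE/=.
apply: (@le_lt_trans _ _ (3 * (e / 4))).
  by apply: nrm_le => //; [exact: rkhs_valP|rewrite rkhs_valB gE].
by rewrite mulrA ltr_pdivrMr// mulrC ltr_pM2l// ltr_nat.
Qed.

End TensorProduct.

(* The conjugate Hilbert space: same vectors, conjugate scalar action. *)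
Definition conjg (T : Type) : Type := T.

Section Conjugate.
Variables (R : realType) (H : hilbertType R).

HB.instance Definition _ := PseudoMetricNormedZmod.copy (conjg H) H.
HB.instance Definition _ := Complete.copy (conjg H) H.

Let cscale (a : Cplx R) (x : conjg H) : conjg H := (a^* *: (x : H) : H).
Let cscaleA a b x : cscale a (cscale b x) = cscale (a * b) x.
Proof. by rewrite /cscale scalerA rmorphM. Qed.
Let cscale1 x : cscale 1 x = x.
Proof. by rewrite /cscale rmorph1 scale1r. Qed.
Let cscaleDr : right_distributive cscale +%R.
Proof. by move=> a x y; exact: (scalerDr a^* (x : H) (y : H)). Qed.
Let cscaleDl x : {morph cscale^~ x : a b / a + b >-> a + b}.
Proof. by move=> a b; rewrite /cscale rmorphD; exact: (scalerDl (x : H)). Qed.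
HB.instance Definition _ := GRing.Zmodule_isLmodule.Build (Cplx R) (conjg H)
  cscaleA cscale1 cscaleDr cscaleDl.

Let cnormZ (a : Cplx R) (x : conjg H) : `|a *: x| = `|a| * `|x|.
Proof. by rewrite -[LHS]/(`|a^* *: (x : H)|) normrZ norm_conjC. Qed.
HB.instance Definition _ :=
  PseudoMetricNormedZmod_Lmodule_isNormedModule.Build (Cplx R) (conjg H) cnormZ.

Let cinner (x y : conjg H) : Cplx R := inner (y : H) (x : H).
Let cinnerD x y z : cinner x (y + z) = cinner x y + cinner x z.
Proof. exact: innerDl. Qed.
Let cinnerZ x a y : cinner x (a *: y) = a * cinner x y.
Proof. by rewrite -[LHS]/(inner (a^* *: (y : H)) (x : H)) innerZl conjCK. Qed.
Let cinnerC x y : cinner y x = (cinner x y)^*.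
Proof. exact: innerC. Qed.
Let cinner_norm x : cinner x x = `|x| ^+ 2.
Proof. exact: inner_norm. Qed.
HB.instance Definition _ := hasInner.Build R (conjg H) cinnerD cinnerZ cinnerC cinner_norm.

Definition bar (x : H) : conjg H := x.
End Conjugate.

Section Operators.
Variable R : realType.
Notation C := (Cplx R).
Implicit Types H K L : hilbertType R.

Definition op_bound H K (T : H -> K) (b : C) : Prop :=
  forall x, `|T x| <= b * `|x|.

Definition bounded_op H K (T : H -> K) : Prop :=
  linear T /\ exists b, op_bound T b.

Definition adj H K (T : H -> K) : K -> H :=
  xget (fun=> 0) [set S | forall x y, inner (S x) y = inner x (T y)].

Definition unitary_op H K (U : H -> K) : Prop :=
  [/\ bounded_op U, adj U \o U = id & U \o adj U = id].

(* closed linear span for the operator norm *)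
Definition op_cspan H K (S : set (H -> K)) : set (H -> K) :=
  [set T | bounded_op T /\ forall e : C, 0 < e ->
     exists2 T', lspan S T' & op_bound (T - T') e].

Definition separable H : Prop := exists u : nat -> H, closure (range u) = setT.

(* The bounded operator F on the Hilbert tensor product that is determined by
   F (tens x y) = f x y. *)
Definition tens_lift H K L (f : H -> K -> L) : htens H K -> L :=
  xget (fun=> 0) [set F | bounded_op F /\ forall x y, F (tens x y) = f x y].

Definition otens H H' K K' (a : H -> H') (b : K -> K') : htens H K -> htens H' K' :=
  tens_lift (fun x y => tens (a x) (b y)).

Definition swap H K : htens H K -> htens K H := tens_lift (fun x y => tens y x).

Definition assoc H K L : htens (htens H K) L -> htens H (htens K L) :=
  tens_lift (fun u z => tens_lift (fun x y => tens x (tens y z)) u).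
Definition unassoc H K L : htens H (htens K L) -> htens (htens H K) L :=
  tens_lift (fun x v => tens_lift (fun y z => tens (tens x y) z) v).

(* An operator on H (x) (K (x) L), seen on (H (x) K) (x) L. *)
Definition reassoc H K L (T : htens H (htens K L) -> htens H (htens K L)) :
    htens (htens H K) L -> htens (htens H K) L :=
  @unassoc H K L \o T \o @assoc H K L.

(* Leg numbering; threefold tensor products are (H (x) K) (x) L. *)
Definition leg12 H K L (T : htens H K -> htens H K) :
    htens (htens H K) L -> htens (htens H K) L := otens T id.
Definition leg23 H K L (T : htens K L -> htens K L) :
    htens (htens H K) L -> htens (htens H K) L := reassoc (otens id T).
Definition leg13 H K L (T : htens H L -> htens H L) :
    htens (htens H K) L -> htens (htens H K) L :=
  @unassoc H K L \o otens id (@swap L K) \o @assoc H L K \o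
  otens T id \o
  @unassoc H L K \o otens id (@swap K L) \o @assoc H K L.

Definition flip H (T : htens H H -> htens H H) : htens H H -> htens H H :=
  @swap H H \o T \o @swap H H.

End Operators.
Arguments leg12 {R H K} L T.
Arguments leg23 {R} H {K L} T.
Arguments leg13 {R H} K {L} T.

Section CstarAlgebras.
Variable R : realType.
Notation C := (Cplx R).
Implicit Types H K : hilbertType R.

(* C*-algebras are represented faithfully and nondegenerately on a Hilbert
   space, so that M(A) is the idealizer of A in B(H). *)
Record cstar_algebra H (A : set (H -> H)) : Prop := {
  cstar_bounded : forall a, A a -> bounded_op a ;
  cstar_closed : op_cspan A `<=` A ;
  cstar_mul : forall a b, A a -> A b -> A (a \o b) ;
  cstar_adj : forall a, A a -> A (adj a) ;
  cstar_nondegenerate : closure (lspan [set a x | a in A & x in [set: H]]) = setT }.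

Definition multiplier H (A : set (H -> H)) : set (H -> H) :=
  [set T | bounded_op T /\ forall a, A a -> A (T \o a) /\ A (a \o T)].

Definition UM H (A : set (H -> H)) : set (H -> H) :=
  [set U | unitary_op U /\ multiplier A U].

(* The minimal tensor product, realized spatially. *)
Definition atens H K (A : set (H -> H)) (B : set (K -> K)) :
    set (htens H K -> htens H K) :=
  op_cspan [set otens a b | a in A & b in B].

Definition compact_ops H : set (H -> H) :=
  [set T | bounded_op T /\ precompact (T @` [set x | `|x| <= 1])].

(* Only the values of phi on A matter. *)
Record morphism H K (A : set (H -> H)) (B : set (K -> K))
    (phi : (H -> H) -> (K -> K)) : Prop := {
  mor_mult : forall a, A a -> multiplier B (phi a) ;
  mor_lin : forall (c : C) a b, A a -> A b -> phi (c *: a + b) = c *: phi a + phi b ;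
  mor_mul : forall a b, A a -> A b -> phi (a \o b) = phi a \o phi b ;
  mor_adj : forall a, A a -> phi (adj a) = adj (phi a) ;
  mor_nondegenerate : op_cspan [set phi a \o b | a in A & b in B] = B }.

(* the extension to M(A) of a morphism defined on A *)
Definition mor_ext H K (A : set (H -> H)) (phi : (H -> H) -> (K -> K)) (m : H -> H) :
    K -> K :=
  xget (fun=> 0) [set T | bounded_op T /\ forall a, A a -> T \o phi a = phi (m \o a)].

Definition mor_tens H1 H2 K1 K2 (A1 : set (H1 -> H1)) (A2 : set (H2 -> H2))
    (B1 : set (K1 -> K1)) (B2 : set (K2 -> K2))
    (phi : (H1 -> H1) -> (K1 -> K1)) (psi : (H2 -> H2) -> (K2 -> K2)) :
    (htens H1 H2 -> htens H1 H2) -> (htens K1 K2 -> htens K1 K2) :=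
  xget (fun=> 0) [set Phi | morphism (atens A1 A2) (atens B1 B2) Phi /\
    forall a b, A1 a -> A2 b -> Phi (otens a b) = otens (phi a) (psi b)].

(* (phi (x) psi)(X) for X in M(A1 (x) A2) *)
Definition mor_app H1 H2 K1 K2 (A1 : set (H1 -> H1)) (A2 : set (H2 -> H2))
    (B1 : set (K1 -> K1)) (B2 : set (K2 -> K2))
    (phi : (H1 -> H1) -> (K1 -> K1)) (psi : (H2 -> H2) -> (K2 -> K2))
    (X : htens H1 H2 -> htens H1 H2) : htens K1 K2 -> htens K1 K2 :=
  mor_ext (atens A1 A2) (mor_tens A1 A2 B1 B2 phi psi) X.

(* the predual B(H)_* *)
Definition normal_functional H (w : (H -> H) -> C) : Prop :=
  exists x y : nat -> H,
    [/\ cvgn (series (fun n => `|x n| ^+ 2)), cvgn (series (fun n => `|y n| ^+ 2)) &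
        forall T, bounded_op T -> series (fun n => inner (x n) (T (y n))) @ \oo --> w T].

(* the dual Banach space of A *)
Definition bounded_functional H (A : set (H -> H)) (w : (H -> H) -> C) : Prop :=
  (forall (c : C) a b, A a -> A b -> w (c *: a + b) = c * w a + w b) /\
  exists M : C, forall a b, A a -> op_bound a b -> `|w a| <= M * b.

(* w' is the strictly continuous linear extension to M(A) of w in A' *)
Definition strict_extension H (A : set (H -> H)) (w w' : (H -> H) -> C) : Prop :=
  [/\ forall a, A a -> w' a = w a,
      forall (c : C) m n, multiplier A m -> multiplier A n ->
        w' (c *: m + n) = c * w' m + w' n &
      exists (M : C) (n : nat) (a : 'I_n -> H -> H), (forall i, A (a i)) /\
        forall m (b : C), multiplier A m ->
          (forall i, op_bound (m \o a i) b /\ op_bound (a i \o m) b) ->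
          `|w' m| <= M * b].

(* (id (x) w_{u,v})(T) and (w_{x,y} (x) id)(T) for the vector functionals
   w_{u,v} = (u | . | v) *)
Definition rcoef H K (T : htens H K -> htens H K) (u v : K) : H -> H :=
  xget (fun=> 0) [set S | bounded_op S /\
    forall x y, inner x (S y) = inner (tens x u) (T (tens y v))].
Definition lcoef H K (T : htens H K -> htens H K) (x y : H) : K -> K :=
  xget (fun=> 0) [set S | bounded_op S /\
    forall u v, inner u (S v) = inner (tens x u) (T (tens y v))].

(* (w (x) id)(T) and (id (x) w)(T) *)
Definition lslice H K (w : (H -> H) -> C) (T : htens H K -> htens H K) : K -> K :=
  xget (fun=> 0) [set S | bounded_op S /\
    forall u v, inner u (S v) = w (rcoef T u v)].
Definition rslice H K (w : (K -> K) -> C) (T : htens H K -> htens H K) : H -> H :=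
  xget (fun=> 0) [set S | bounded_op S /\
    forall x y, inner x (S y) = w (lcoef T x y)].

End CstarAlgebras.

Section QuantumGroups.
Variable R : realType.
Notation C := (Cplx R).
Implicit Types H K : hilbertType R.

(* Unbounded operators are given by their graphs. *)
Definition adj_graph H (Q : set (H * H)) : set (H * H) :=
  [set q | forall p, Q p -> inner p.2 q.1 = inner p.1 q.2].

Definition positive_selfadjoint H (Q : set (H * H)) : Prop :=
  [/\ closure [set p.1 | p in Q] = setT, adj_graph Q = Q &
      forall p, Q p -> 0 <= inner p.1 p.2].

(* the graph of Q (x) Q, the closure of the algebraic tensor product *)
Definition graph_tens H (Q : set (H * H)) : set (htens H H * htens H H) :=
  closure (lspan [set (tens p.1 q.1, tens p.2 q.2) | p in Q & q in Q]).

Definition pentagon H (W : htens H H -> htens H H) : Prop :=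
  leg23 H W \o leg12 H W = leg12 H W \o leg13 H W \o leg23 H W.

Definition manageable H (W : htens H H -> htens H H) : Prop :=
  exists (Q : set (H * H)) (W' : htens (conjg H) H -> htens (conjg H) H),
    [/\ positive_selfadjoint Q, forall x, Q (x, 0) -> x = 0, unitary_op W',
        forall u v, graph_tens Q (W u, W v) <-> graph_tens Q (u, v) &
        forall x z v v' y y', Q (v, v') -> Q (y', y) ->
          inner (tens x v) (W (tens z y)) =
          inner (tens (bar z) v') (W' (tens (bar x) y'))].

Definition right_leg H (W : htens H H -> htens H H) : set (H -> H) :=
  op_cspan [set lslice w W | w in @normal_functional R H].
Definition left_leg H (W : htens H H -> htens H H) : set (H -> H) :=
  op_cspan [set rslice w W | w in @normal_functional R H].

Record cqgroup := CQGroup {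
  cq_space : hilbertType R ;
  cq_W : htens cq_space cq_space -> htens cq_space cq_space ;
  cq_separable : separable cq_space ;
  cq_unitary : unitary_op cq_W ;
  cq_pentagon : pentagon cq_W ;
  cq_manageable : manageable cq_W ;
  cq_alg := right_leg cq_W ;
  cq_dual := left_leg cq_W ;
  cq_comult : (cq_space -> cq_space) ->
    (htens cq_space cq_space -> htens cq_space cq_space) ;
  cq_comult_mor : morphism cq_alg (atens cq_alg cq_alg) cq_comult ;
  cq_comultE :
    reassoc (mor_app cq_dual cq_alg cq_dual (atens cq_alg cq_alg) id cq_comult cq_W) =
    leg12 cq_space cq_W \o leg13 cq_space cq_W ;
  cq_dcomult : (cq_space -> cq_space) ->
    (htens cq_space cq_space -> htens cq_space cq_space) ;
  cq_dcomult_mor : morphism cq_dual (atens cq_dual cq_dual) cq_dcomult ;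
  cq_dcomultE :
    mor_app cq_dual cq_alg (atens cq_dual cq_dual) cq_alg cq_dcomult id cq_W =
    leg23 cq_space cq_W \o leg13 cq_space cq_W }.

Arguments cq_alg : clear implicits.
Arguments cq_dual : clear implicits.
Arguments cq_comult : clear implicits.
Arguments cq_dcomult : clear implicits.
Arguments cq_W : clear implicits.

(* unitaries U in M(^A (x) B) with (^Delta (x) id)U = U_23 U_13 *)
Definition dual_corep (G : cqgroup) K (B : set (K -> K))
    (U : htens (cq_space G) K -> htens (cq_space G) K) : Prop :=
  UM (atens (cq_dual G) B) U /\
  mor_app (cq_dual G) B (atens (cq_dual G) (cq_dual G)) B (cq_dcomult G) id U =
  leg23 (cq_space G) U \o leg13 (cq_space G) U.

Record universal_cqg (G : cqgroup) := UniversalCQG {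
  u_space : hilbertType R ;
  u_alg : set (u_space -> u_space) ;
  u_cstar : cstar_algebra u_alg ;
  u_V : htens (cq_space G) u_space -> htens (cq_space G) u_space ;
  u_corep : dual_corep u_alg u_V ;
  u_universal : forall (L : hilbertType R) (U : htens (cq_space G) L -> htens (cq_space G) L),
    dual_corep (@compact_ops R L) U ->
    let is_rep phi := morphism u_alg (@compact_ops R L) phi /\
      mor_app (cq_dual G) u_alg (cq_dual G) (@compact_ops R L) id phi u_V = U in
    exists2 phi, is_rep phi &
      forall phi', is_rep phi' -> forall a, u_alg a -> phi' a = phi a ;
  (* Only the inclusion is asked for: slices by arbitrary elements of the dual
     of ^A belong to M(A^u), but in general not to A^u (take ^A = C(G) with G
     compact and infinite, and a point evaluation). *)
  u_span : u_alg `<=` op_cspan [set S | exists w w',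
    [/\ bounded_functional (cq_dual G) w, strict_extension (cq_dual G) w w' &
        S = lslice w' u_V]] ;
  u_comult : (u_space -> u_space) -> (htens u_space u_space -> htens u_space u_space) ;
  u_comult_mor : morphism u_alg (atens u_alg u_alg) u_comult ;
  u_comultE :
    reassoc (mor_app (cq_dual G) u_alg (cq_dual G) (atens u_alg u_alg) id u_comult u_V) =
    leg12 u_space u_V \o leg13 u_space u_V ;
  u_red : (u_space -> u_space) -> (cq_space G -> cq_space G) ;
  u_red_mor : morphism u_alg (cq_alg G) u_red ;
  u_redE :
    mor_app (cq_dual G) u_alg (cq_dual G) (cq_alg G) id u_red u_V = cq_W G }.

Definition bicharacter H (A : set (H -> H)) (D : (H -> H) -> (htens H H -> htens H H))
    (X : htens H H -> htens H H) : Prop :=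
  [/\ UM (atens A A) X,
      mor_app A A (atens A A) A D id X = leg23 H X \o leg13 H X &
      reassoc (mor_app A A A (atens A A) id D X) = leg12 H X \o leg13 H X].

Definition Rmatrix H (A : set (H -> H)) (D : (H -> H) -> (htens H H -> htens H H))
    (X : htens H H -> htens H H) : Prop :=
  bicharacter A D X /\ forall a, A a -> X \o flip (D a) \o adj X = D a.

End QuantumGroups.
Arguments cq_alg {R} c _.
Arguments cq_dual {R} c _.
Arguments cq_comult {R} c _ _.
Arguments cq_dcomult {R} c _ _.
Arguments cq_W {R} c _.
Arguments u_alg {R G} u _.
Arguments u_V {R G} u _.
Arguments u_comult {R G} u _ _.
Arguments u_red {R G} u _ _.

(* Main.v *)
Require Import Defs.
From HB Require Import structures.
From mathcomp Require Import all_boot all_order all_algebra.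
From mathcomp Require Import complex.
From mathcomp Require Import all_classical all_reals all_analysis.
From mathcomp Require Import zify ring lra.
Set Implicit Arguments.
Unset Strict Implicit.
Unset Printing Implicit Defensive.
Import Order.TTheory GRing.Theory Num.Theory.
Import numFieldNormedType.Exports.
Local Open Scope classical_set_scope.
Local Open Scope ring_scope.

(* Let W be the multiplicative unitary on H (x) H and V the universal
   corepresentation on H (x) Hu. Manageability makes every operator d with
   W (d (x) 1) = (1 (x) d) W scalar: a Stein equation e - T e T = 2 K d K, with T
   and K functions of Q, gives such an operator e for which e^* maps many vectors
   of the domain of Q into it, and the identity relating W and its conjugate then
   forces e, hence d, to be scalar. Therefore a unitary whose leg embedding is
   invariant under W acts trivially on one leg, and the equations
     X_12 Y_13 V_23 = V_23 X_12,   Z_23 Y_13 V_12 = V_12 Y_13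
   have unitary solutions Y on H (x) Hu and Z on Hu (x) Hu. The unitary Z is the
   lift of X = R: applying the reducing map or the comultiplication to one leg of
   these equations turns them into equations of the same shape, whose solutions
   are unique.

   A lift R^u is determined by X. The morphisms a |-> (Lambda (x) id) Delta_u(a)
   and a |-> V (Lambda(a) (x) 1) V^* agree, since they agree on V. Hence the
   bicharacter identities become, with Q = (id (x) Lambda) R^u,
     Q_23 X_13 V_12 = V_12 X_13,   Q_12 R^u_13 V_23 = V_23 Q_12.
   That a morphism of A^u is determined by its value on V needs the slices of V
   by functionals of the dual: they multiply the vector slices of V into the
   closed span of the vector slices.

   The R-matrix property reads X_23 W_13 W_12 = W_12 W_13 X_23. Conjugating twice
   with V turns it into Z_23 V_13 V_12 = V_12 V_13 Z_23. *)

(** * Hilbert spaces, closed spans and bounded operators *)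

(** The Stein equation is a bounded form of the Sylvester equation [Q^2 e + e Q^2 = Q d Q].
    Tensoring it with [Q^2] gives the same equation for Q (x) Q, with which W commutes, so
    uniqueness of solutions carries the intertwining relation from d to e. Tensor products of
    morphisms, their extensions to multipliers and slices are chosen objects in the statement, so
    each has to be constructed before it can be computed. This needs the automatic contractivity of
    homomorphisms, also after tensoring with an identity, and approximate units; both are obtained
    from power iterations. Leg equations live on tensor products in which some legs carry no algebra
    at all. Hence the image of an operator under id (x) phi is expressed by the relation [rel]
    between operators on Hilbert modules, whose first leg is an arbitrary Hilbert space. Products,
    leg embeddings and ampliations preserve it, so a solution of a leg equation is transported along
    a morphism by transporting each factor. Legs are compressed away by a unit vector of H; the zero
    space is treated separately. *)

Section HilbertBasics.
Variables (R : realType) (H : hilbertType R).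
Notation C := (Cplx R).
Implicit Types (x y z : H) (a b c e : C).

Lemma innerB x y z : inner x (y - z) = inner x y - inner x z.
Proof. by rewrite innerD innerN. Qed.
Lemma innerBl x y z : inner (x - y) z = inner x z - inner y z.
Proof. by rewrite innerDl innerNl. Qed.
Lemma inner0l x : inner 0 x = 0.
Proof. by rewrite innerC inner0 conjC0. Qed.

Lemma inner_ext y z : (forall x, inner x y = inner x z) -> y = z.
Proof.
move=> h; apply/eqP; rewrite -subr_eq0 -inner_eq0 innerB h subrr //.
Qed.

Lemma CS x y : `|inner x y| <= `|x| * `|y|.
Proof.
rewrite -(@ler_pXn2r _ 2)// ?nnegrE ?mulr_ge0// exprMn -!inner_norm.
apply: quad_CS; rewrite ?inner_ge0// => a b.
have := inner_ge0 (a *: x + b *: y).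
rewrite innerD !innerDl !innerZ !innerZl (innerC x y) !rmorphM/= conjCK.
by congr (0 <= _); ring.
Qed.

Lemma norm_le_inner x c : 0 <= c -> (forall y, `|inner y x| <= c * `|y|) -> `|x| <= c.
Proof.
move=> c0 /(_ x); rewrite inner_norm normrX normr_id expr2.
have [->|x0] := eqVneq `|x| 0; first by rewrite mulr0.
by rewrite ler_pM2r// lt_def x0 normr_ge0.
Qed.

Lemma norm_eps0 x c : 0 <= c -> (forall e, 0 < e -> `|x| <= c * e) -> x = 0.
Proof.
move=> c0 h; apply/eqP; rewrite -normr_le0.
apply: (@le_rate R _ _ c) => //.
by move=> n; rewrite add0r; apply: h; exact: rate_gt0.
Qed.

Lemma le_eps (a b c : C) : 0 <= a -> 0 <= b -> 0 <= c ->
  (forall e, 0 < e -> a <= b + c * e) -> a <= b.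
Proof.
move=> a0 b0 c0 h; apply: (@le_rate R _ _ c) => //; rewrite ?ger0_real//.
by move=> n; apply: h; exact: rate_gt0.
Qed.

Lemma hcauchy (u : nat -> H) :
  (forall e, 0 < e -> exists N, forall n m, (N <= n)%N -> (N <= m)%N -> `|u n - u m| <= e) ->
  exists l, forall e, 0 < e -> exists N, forall n, (N <= n)%N -> `|l - u n| <= e.
Proof.
move=> h; have : cvg (u @ \oo).
  apply/cauchy_cvgP/cauchyP => e e0.
  have [|N hN] := h (e / 2); first by rewrite divr_gt0.
  exists (u N); exists N => // n /= Nn.
  rewrite -ball_normE/=; apply: le_lt_trans (hN _ _ (leqnn N) Nn) _.
  by rewrite ltr_pdivrMr// ltr_pMr// ltr1n.
move=> /cvgrPdist_le/= hl; exists (lim (u @ \oo)) => e e0.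
by have [N _ hN] := hl e e0; exists N => n Nn; exact: hN.
Qed.

Lemma hcauchy_rate (u : nat -> H) c : 0 <= c ->
  (forall n m, `|u n - u m| <= c * (rate R n + rate R m)) ->
  exists l, forall n, `|l - u n| <= c * rate R n.
Proof.
move=> c0 h.
have rmono n m : (n <= m)%N -> rate R m <= rate R n.
  by move=> nm; rewrite /rate lef_pV2 ?posrE ?ltr0n// ler_nat ltnS.
have c1 : 0 < c + 1 by rewrite ltr_wpDl.
have small e : 0 < e -> exists N, forall n, (N <= n)%N -> c * rate R n <= e / 2.
  move=> e0; have e1 : 0 < e / 2 / (c + 1) by rewrite !divr_gt0.
  have [N hN] := rate_small e1; exists N => n Nn.
  apply: le_trans (_ : (c + 1) * rate R n <= _).
    by rewrite ler_wpM2r ?rate_ge0// lerDl.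
  rewrite -ler_pdivlMl// mulrC; exact: le_trans (rmono _ _ Nn) hN.
have [e e0|l hl] := hcauchy (u := u).
  have [N hN] := small e e0; exists N => n m Nn Nm.
  apply: le_trans (h n m) _; rewrite mulrDr [leRHS]splitr.
  by rewrite lerD// hN.
exists l => n; apply: (@le_eps _ _ 1) => //; rewrite ?mulr_ge0 ?rate_ge0//.
move=> e e0; rewrite mul1r.
have e20 : 0 < e / 2 by rewrite divr_gt0.
have [N1 h1] := hl _ e20; have [N2 h2] := small _ e0.
set m := maxn N1 N2.
apply: le_trans (ler_distD (u m) _ _) _.
rewrite (_ : c * rate R n + e = e / 2 + (c * rate R n + e / 2)); last by field.
rewrite lerD//; first by apply: h1; rewrite leq_maxl.
apply: le_trans (h m n) _; rewrite mulrDr [leLHS]addrC lerD2l.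
by apply: h2; rewrite leq_maxr.
Qed.

(** Variational proof: a minimizing sequence of [J x = |x|^2 - 2 Re (f x)] is Cauchy by the
    parallelogram identity [par], and expanding J around [u n] bounds [inner (u n) x - f x] by the
    defect of minimality ([key]). *)
Lemma riesz (f : H -> C) (M : C) :
  (forall a x y, f (a *: x + y) = a * f x + f y) ->
  (forall x, `|f x| <= M * `|x|) -> exists u, forall x, f x = inner u x.
Proof.
move=> fL fM.
have f0 : f 0 = 0.
  have h := fL 1 0 0; rewrite scale1r addr0 mul1r in h.
  by apply: (addrI (f 0)); rewrite addr0 -h.
have fD x y : f (x + y) = f x + f y by have := fL 1 x y; rewrite scale1r mul1r.
have fZ a x : f (a *: x) = a * f x by have := fL a x 0; rewrite !addr0 f0 addr0.
pose J x : C := `|x| ^+ 2 - (f x + (f x)^*).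
have Jr x : J x \is Num.real.
  apply/CrealP; rewrite /J rmorphB rmorphD/= conjCK [X in _ - X]addrC.
  by congr (_ - _); rewrite conj_Creal// ger0_real// exprn_ge0.
(* M can fail to be nonnegative only when every norm vanishes; its modulus is a bound in all
   cases. *)
pose M' : C := `|M|.
have fM' x : `|f x| <= M' * `|x|.
  have [x0|x0] := eqVneq `|x| 0; first by have := fM x; rewrite x0 !mulr0.
  have M0 : 0 <= M.
    have := le_trans (normr_ge0 _) (fM x); rewrite pmulr_lge0// lt_def x0//=.
  by rewrite /M' (ger0_norm M0).
have Jlb x : - M' ^+ 2 <= J x.
  have r : f x + (f x)^* \is Num.real by apply/CrealP; rewrite rmorphD/= conjCK addrC.
  have h1 : f x + (f x)^* <= 2 * (M' * `|x|).
    apply: le_trans (real_ler_norm r) _; apply: le_trans (ler_normD _ _) _.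
    by rewrite norm_conjC mulr2n mulrDl !mul1r lerD.
  rewrite /J -subr_ge0 opprK.
  have sq : 0 <= (`|x| - M') ^+ 2.
    by apply: real_exprn_even_ge0 => //; rewrite realB ?ger0_real ?normr_ge0.
  apply: le_trans sq _; rewrite -subr_ge0.
  suff : 0 <= 2 * (M' * `|x|) - (f x + (f x)^*) by congr (0 <= _); ring.
  by rewrite subr_ge0.
pose j x : R := complex.Re (J x).
have jE x : J x = ((j x)%:C)%C by rewrite /j RRe_real.
pose E : set R := range j.
have [m hm] : exists m : R, - M' ^+ 2 = (m%:C)%C.
  exists (complex.Re (- M' ^+ 2)); apply/esym/RRe_real; rewrite rpredN.
  by apply/ger0_real/exprn_ge0/normr_ge0.
have hE : has_inf E.
  split; first by exists (j 0), 0.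
  by exists m => _ [x _ <-]; have := Jlb x; rewrite hm jE lecR.
have /choice[u hu] : forall n, exists x, J x <= ((inf E)%:C)%C + rate R n.
  move=> n; have [r _ er] := ge0_cplx (rate_ge0 R n).
  have r0 : 0 < r by have := rate_gt0 R n; rewrite er ltcR.
  have [_ [x _ <-] hx] := inf_adherent r0 hE.
  by exists x; rewrite jE er -rmorphD/= lecR ltW.
have Jinf x : ((inf E)%:C)%C <= J x.
  by rewrite jE lecR; apply: ge_inf; [case: hE | exists x].
set I : C := ((inf E)%:C)%C in hu Jinf.
have par x y : J x + J y = 2 * J (2^-1 *: (x + y)) + 2^-1 * `|x - y| ^+ 2.
  rewrite /J fZ fD -!inner_norm innerZ innerZl innerB !innerBl innerD !innerDl.
  by rewrite !rmorphM !rmorphD/= fmorphV/= rmorph_nat; field.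
have cau n k : `|u n - u k| ^+ 2 <= 2 * (rate R n + rate R k).
  rewrite -[leLHS](mulKf (x := 2^-1)) ?invr_eq0 ?pnatr_eq0// invrK.
  rewrite ler_pM2l// -(lerD2l (2 * J (2^-1 *: (u n + u k)))) -par.
  apply: le_trans (lerD (hu n) (hu k)) _.
  rewrite addrACA lerD2r (_ : I + I = 2 * I); last by ring.
  by rewrite ler_pM2l.
have key n x : `|inner (u n) x - f x| ^+ 2 <= rate R n * `|x| ^+ 2.
  set z := inner (u n) x - f x.
  have hb : I <= J (u n) by [].
  rewrite mulrC; apply: quad_CS; rewrite ?exprn_ge0 ?rate_ge0// => a b.
  have gen (t : C) : 0 <= rate R n + (t * z + (t * z)^*) + t * t^* * `|x| ^+ 2.
    have := le_trans (hu n) _; move=> _.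
    have := lerD (Jinf (u n + t *: x)) (hu n).
    rewrite [leRHS](_ : _ = J (u n) + (I + (rate R n + (t * z + (t * z)^*) + t * t^* * `|x| ^+ 2))).
      by rewrite addrC lerD2l lerDl.
    rewrite /J fD fZ -!inner_norm innerD !innerDl !innerZ !innerZl /z (innerC (u n) x).
    rewrite !(rmorphM, rmorphB, rmorphD)/= ?conjCK.
    by ring.
  have [->|b0] := eqVneq b 0.
    by rewrite !(mulr0, mul0r) rmorph0 !addr0 mulr_ge0 ?exprn_ge0// -normCK exprn_ge0.
  (* This t, after multiplication by [|b|^2], gives the quadratic form that [quad_CS] asks for. *)
  have := gen (a^* / b^*).
  move=> /(mulr_ge0 (exprn_ge0 2 (normr_ge0 b))).
  congr (0 <= _); rewrite normCK.
  have b0' : b^* != 0 by rewrite conjC_eq0.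
  rewrite !(rmorphM, fmorphV)/= !conjCK.
  by field; rewrite b0 b0'.
have [e e0|l hl] := hcauchy (u := u).
  have e1 : 0 < e ^+ 2 / 4 by rewrite divr_gt0// exprn_gt0.
  have [N hN] := rate_small e1; exists N => n k Nn Nk.
  rewrite -(@ler_pXn2r _ 2)// ?nnegrE ?(ltW e0)//.
  apply: le_trans (cau n k) _.
  have rmono n' : (N <= n')%N -> rate R n' <= e ^+ 2 / 4.
    move=> nm; apply: le_trans hN; rewrite /rate lef_pV2 ?posrE ?ltr0n// ler_nat ltnS//.
  rewrite (_ : e ^+ 2 = 2 * (e ^+ 2 / 4 + e ^+ 2 / 4)); last by field.
  by rewrite ler_pM2l// lerD// rmono.
exists l => x; apply/eqP; rewrite -subr_eq0 -normr_le0.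
apply: (@le_eps _ _ (2 * `|x|)) => //.
move=> e e0; rewrite add0r.
have [N1 h1] := hl _ e0.
have [N2 h2] := rate_small (exprn_gt0 2 e0).
pose k := maxn N1 N2.
rewrite distrC; apply: le_trans (ler_distD (inner (u k) x) _ _) _.
rewrite mulr2n !mulrDl mul1r lerD//.
  rewrite -innerBl; apply: le_trans (CS _ _) _; rewrite mulrC ler_wpM2l// h1// leq_maxl//.
rewrite -(@ler_pXn2r _ 2)// ?nnegrE ?mulr_ge0 ?(ltW e0)//.
apply: le_trans (key k x) _; rewrite exprMn mulrC ler_wpM2l ?exprn_ge0//.
apply: le_trans h2; rewrite /rate lef_pV2 ?posrE ?ltr0n// ler_nat ltnS leq_maxr//.
Qed.

End HilbertBasics.

(** * Closed linear spans for an abstract bound predicate *)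

Section ClosedSpan.
Variables (R : realType) (V : lmodType (Cplx R)) (bd : V -> Cplx R -> Prop).
Notation C := (Cplx R).

(* [bd v b] stands for |v| <= b; vectors, operators and pairs of operators are
   instances. [sp] and [cs] are the span and its closure, [csub] the closed subspaces. *)
Record bound_axioms : Prop := {
  bd0 : forall b, 0 <= b -> bd 0 b ;
  bdD : forall v w a b, bd v a -> bd w b -> bd (v + w) (a + b) ;
  bdZ : forall c v a, bd v a -> bd (c *: v) (`|c| * a) ;
  bd_le : forall v a b, a <= b -> bd v a -> bd v b ;
  bd_lim : forall v b, 0 <= b -> (forall e, 0 < e -> bd v (b + e)) -> bd v b ;
  bd_sep : forall v, (forall e, 0 < e -> bd v e) -> v = 0 }.

Definition bd_complete := forall u : nat -> V,
  (forall e, 0 < e -> exists N, forall n m, (N <= n)%N -> (N <= m)%N -> bd (u n - u m) e) ->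
  exists l, forall e, 0 < e -> exists N, forall n, (N <= n)%N -> bd (l - u n) e.

Inductive sp (S : V -> Prop) : V -> Prop :=
| sp0 : sp S 0
| spS c v w : S v -> sp S w -> sp S (c *: v + w).

Definition cs (S : V -> Prop) (v : V) : Prop :=
  forall e, 0 < e -> exists2 w, sp S w & bd (v - w) e.

Record csub (P : V -> Prop) : Prop := {
  csub0 : P 0 ;
  csubL : forall c v w, P v -> P w -> P (c *: v + w) ;
  csubC : forall v, (forall e, 0 < e -> exists2 w, P w & bd (v - w) e) -> P v }.

Lemma sp_in S v : S v -> sp S v.
Proof. by move=> Sv; rewrite -[v]addr0 -[v]scale1r; apply: spS => //; exact: sp0. Qed.

Lemma sp_lin S c v w : sp S v -> sp S w -> sp S (c *: v + w).
Proof.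
move=> Hv Hw; elim: Hv => [|d v' v'' Sv' _ IH]; first by rewrite scaler0 add0r.
by rewrite scalerDr scalerA -addrA; exact: spS.
Qed.

Lemma sp_min S (P : V -> Prop) : P 0 -> (forall c v w, P v -> P w -> P (c *: v + w)) ->
  (forall v, S v -> P v) -> forall v, sp S v -> P v.
Proof. by move=> P0 PL SP v; elim=> // c w u /SP Pw _ Pu; exact: PL. Qed.

Hypothesis B : bound_axioms.

Lemma bdB v w a b : bd v a -> bd w b -> bd (v - w) (a + b).
Proof.
move=> hv hw; apply: (bdD B) hv _; rewrite -scaleN1r -[b]mul1r -[X in X * b](normrN1 C).
exact: (bdZ B).
Qed.

Lemma bd_sub v w e : bd (v - w) e -> bd (w - v) e.
Proof.
by move=> h; rewrite -opprB -scaleN1r -[e]mul1r -[X in X * e](normrN1 C); exact: (bdZ B).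
Qed.

Lemma bd_dist u v w a b : bd (v - u) a -> bd (u - w) b -> bd (v - w) (a + b).
Proof. by move=> h1 h2; rewrite -(subrK u v) -addrA; exact: (bdD B). Qed.

Lemma csubZ P c v : csub P -> P v -> P (c *: v).
Proof. by move=> hP Pv; rewrite -[_ *: _]addr0; apply: (csubL hP) => //; exact: (csub0 hP). Qed.
Lemma csubD P v w : csub P -> P v -> P w -> P (v + w).
Proof. by move=> hP Pv Pw; rewrite -[v]scale1r; apply: (csubL hP). Qed.
Lemma csubN P v : csub P -> P v -> P (- v).
Proof. by move=> hP Pv; rewrite -scaleN1r; exact: csubZ. Qed.
Lemma csubB P v w : csub P -> P v -> P w -> P (v - w).
Proof. by move=> hP Pv Pw; apply: csubD => //; exact: csubN. Qed.
Lemma csub_sum P I (r : seq I) (F : I -> V) : csub P -> (forall i, P (F i)) ->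
  P (\sum_(i <- r) F i).
Proof.
move=> hP hF; elim: r => [|i r IH]; first by rewrite big_nil; exact: (csub0 hP).
by rewrite big_cons; exact: csubD.
Qed.

Lemma sp_cs S v : sp S v -> cs S v.
Proof. by move=> h e e0; exists v => //; rewrite subrr; apply: (bd0 B); exact: ltW. Qed.

Lemma cs_in (S : V -> Prop) v : S v -> cs S v.
Proof. by move=> /sp_in; exact: sp_cs. Qed.

Lemma cs_csub S : csub (cs S).
Proof.
split.
- by move=> e e0; exists 0; [exact: sp0|rewrite subrr; apply: (bd0 B); exact: ltW].
- move=> c v w hv hw e e0.
  have c1 : 0 < `|c| + 1 by rewrite ltr_wpDl.
  have e1 : 0 < e / 2 / (`|c| + 1) by rewrite !divr_gt0.
  have e2 : 0 < e / 2 by rewrite divr_gt0.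
  have [v' sv' bv'] := hv _ e1; have [w' sw' bw'] := hw _ e2.
  exists (c *: v' + w'); first exact: sp_lin.
  rewrite opprD addrACA -scalerBr [e]splitr; apply: (bdD B) => //.
  apply: (bd_le B) (bdZ B c bv'); rewrite mulrC -[leLHS]mulrA ler_piMr ?(ltW e2)//.
  by rewrite mulrC ler_pdivrMr// mul1r lerDl.
- move=> v h e e0; have e2 : 0 < e / 2 by rewrite divr_gt0.
  have [w /(_ _ e2)[w' sw' b1] b2] := h _ e2.
  by exists w' => //; rewrite [e]splitr; exact: bd_dist b2 b1.
Qed.

Lemma cs_min S P : csub P -> (forall v, S v -> P v) -> forall v, cs S v -> P v.
Proof.
move=> hP SP v hv; apply: (csubC hP) => e /hv[w sw bw]; exists w => //.
by move: sw; apply: sp_min => //; [exact: (csub0 hP)|exact: (csubL hP)].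
Qed.

End ClosedSpan.

Section ClosedSpanMap.
Variables (R : realType) (V W : lmodType (Cplx R)).
Variables (bv : V -> Cplx R -> Prop) (bw : W -> Cplx R -> Prop).
Hypotheses (BV : bound_axioms bv) (BW : bound_axioms bw).

Lemma csub_preim (f : V -> W) (M : Cplx R) (P : W -> Prop) :
  (forall c v w, f (c *: v + w) = c *: f v + f w) -> 0 <= M ->
  (forall v b, 0 <= b -> bv v b -> bw (f v) (M * b)) -> csub bw P -> csub bv (fun v => P (f v)).
Proof.
move=> fL M0 fb hP.
have f0 : f 0 = 0.
  have h := fL 1 0 0; rewrite !scale1r addr0 in h.
  by apply: (addrI (f 0)); rewrite addr0 -h.
split.
- by rewrite f0; exact: (csub0 hP).
- by move=> c v w Pv Pw; rewrite fL; exact: (csubL hP).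
- move=> v h; apply: (csubC hP) => e e0.
  have M1 : 0 < M + 1 by rewrite ltr_wpDl.
  have [w Pw b] := h _ (divr_gt0 e0 M1).
  exists (f w) => //.
  have -> : f v - f w = f (v - w).
    by rewrite addrC -scaleN1r -fL addrC scaleN1r.
  apply: (bd_le BW) (fb _ _ (ltW (divr_gt0 e0 M1)) b).
  by rewrite mulrCA ler_piMr ?(ltW e0)// ler_pdivrMr// mul1r lerDl.
Qed.

Lemma cs_map (f : V -> W) (M : Cplx R) (S : V -> Prop) (T : W -> Prop) :
  (forall c v w, f (c *: v + w) = c *: f v + f w) -> 0 <= M ->
  (forall v b, 0 <= b -> bv v b -> bw (f v) (M * b)) -> (forall v, S v -> cs bw T (f v)) ->
  forall v, cs bv S v -> cs bw T (f v).
Proof.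
move=> fL M0 fb ST v; apply: (@cs_min _ _ _ S (fun v => cs bw T (f v))) => //.
by apply: csub_preim fL M0 fb _; exact: cs_csub.
Qed.

(** The maximum norm on pairs. A bounded linear map given on generators is handled through the
    closed span of its graph, which is then another instance of [cs]. *)
Definition bpair (p : V * W) (b : Cplx R) := bv p.1 b /\ bw p.2 b.

Lemma bpair_axioms : bound_axioms bpair.
Proof.
split.
- by move=> b b0; split; [exact: (bd0 BV)|exact: (bd0 BW)].
- by move=> v w a b [v1 v2] [w1 w2]; split; [exact: (bdD BV)|exact: (bdD BW)].
- by move=> c v a [v1 v2]; split; [exact: (bdZ BV)|exact: (bdZ BW)].
- by move=> v a b ab [v1 v2]; split; [exact: (bd_le BV ab)|exact: (bd_le BW ab)].
- move=> v b b0 h; split; [apply: (bd_lim BV) => //|apply: (bd_lim BW) => //].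
    by move=> e /h[].
  by move=> e /h[].
- move=> [v w] h; congr (_, _); [apply: (bd_sep BV)|apply: (bd_sep BW)].
    by move=> e /h[].
  by move=> e /h[].
Qed.
End ClosedSpanMap.

(** * Extension by continuity of a relation between generators *)

Section Graph.
Variables (R : realType) (V W : lmodType (Cplx R)).
Variables (bv : V -> Cplx R -> Prop) (bw : W -> Cplx R -> Prop).
Hypotheses (BV : bound_axioms bv) (BW : bound_axioms bw) (cW : bd_complete bw).
Variables (G : V * W -> Prop) (c : Cplx R).
Hypothesis (c0 : 0 <= c).
Hypothesis contr : forall p, sp G p -> forall b, 0 <= b -> bv p.1 b -> bw p.2 (c * b).

Let c1 : 0 < c + 1. Proof. by rewrite ltr_wpDl. Qed.

Lemma graph_contr p b : cs (bpair bv bw) G p -> 0 <= b -> bv p.1 b -> bw p.2 (c * b).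
Proof.
move=> hp b0 hb; apply: (bd_lim BW); first exact: mulr_ge0.
move=> e e0; have [q sq [/= q1 q2]] := hp _ (divr_gt0 e0 c1).
have e1 : 0 < e / (c + 1) by rewrite divr_gt0.
have h1 : bv q.1 (b + e / (c + 1)).
  rewrite -[q.1](subrK p.1) addrC; apply: (bdD BV) => //; exact: (bd_sub BV).
have := contr sq (addr_ge0 b0 (ltW e1)) h1.
move=> /(bdD BW q2); rewrite subrK => h2; apply: (bd_le BW) h2.
rewrite le_eqVlt; apply/orP; left; apply/eqP; field.
by rewrite gt_eqF.
Qed.

Lemma graph_fun v w w' : cs (bpair bv bw) G (v, w) -> cs (bpair bv bw) G (v, w') -> w = w'.
Proof.
move=> h1 h2; apply/eqP; rewrite -subr_eq0; apply/eqP/(bd_sep BW) => e e0.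
have := csubB (cs_csub (bpair_axioms BV BW) G) h1 h2.
move=> /graph_contr/(_ (ltW (divr_gt0 e0 c1))) /=; rewrite subrr => /(_ (bd0 BV _)).
move=> h; apply: (bd_le BW) (h (ltW (divr_gt0 e0 c1))).
by rewrite mulrCA ler_piMr ?(ltW e0)// ler_pdivrMr// mul1r lerDl.
Qed.

(** The second components of approximants taken from the span form a Cauchy sequence by [contr], and
    completeness supplies the value. *)
Lemma graph_total v : cs bv (fun v => exists w, G (v, w)) v -> exists w, cs (bpair bv bw) G (v, w).
Proof.
move=> hv.
have spG v' : sp (fun v => exists w, G (v, w)) v' -> exists w, sp G (v', w).
  elim=> [|a x y [w Gw] _ [w' sw']]; first by exists 0; exact: sp0.
  by exists (a *: w + w'); exact: (spS a Gw sw').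
have /choice[p hp] : forall n, exists p, sp G p /\ bv (v - p.1) (rate R n).
  move=> n; have [v' /spG[w' sw'] bv'] := hv _ (rate_gt0 R n).
  by exists (v', w').
have rmono n m : (n <= m)%N -> rate R m <= rate R n.
  by move=> nm; rewrite /rate lef_pV2 ?posrE ?ltr0n// ler_nat ltnS.
have small e : 0 < e -> exists N, forall n, (N <= n)%N -> rate R n <= e.
  by move=> e0; have [N hN] := rate_small e0; exists N => n Nn; exact: le_trans (rmono _ _ Nn) hN.
have [e e0|w hw] := cW (u := fun n => (p n).2).
  have e1 : 0 < e / (c + 1) / 2 by rewrite !divr_gt0.
  have [N hN] := small _ e1; exists N => n m Nn Nm.
  have [sn bn] := hp n; have [sm bm] := hp m.
  have sB : sp G ((p n) - (p m)).
    by rewrite addrC -scaleN1r; apply: sp_lin.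
  have hb : bv (p n - p m).1 (e / (c + 1)).
    rewrite [e / (c + 1)]splitr; apply: (bd_dist BV (u := v)).
      by apply: (bd_sub BV); exact: (bd_le BV (hN _ Nn)).
    exact: (bd_le BV (hN _ Nm)).
  apply: (bd_le BW) (contr sB _ hb); last by rewrite divr_ge0// ltW.
  by rewrite mulrCA ler_piMr ?(ltW e0)// ler_pdivrMr// mul1r lerDl.
exists w => e e0; have [N1 h1] := hw _ e0; have [N2 h2] := small _ e0.
pose n := maxn N1 N2; have [sn bn] := hp n.
exists (p n) => //; split => /=; last by apply: h1; rewrite leq_maxl.
by apply: (bd_le BV) bn; apply: h2; rewrite leq_maxr.
Qed.
End Graph.

Section Operators.
Variable R : realType.
Notation C := (Cplx R).
Implicit Types H K L : hilbertType R.

(** Operators of the statement are bare functions. Packaging them with their boundedness gives a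
    module with extensional equality, on which closed spans and algebraic rewriting work. *)
Record Op H K := MkOp { opf :> H -> K ; opP : bounded_op opf }.

Lemma op_ext H K (S T : Op H K) : (forall x, S x = T x) -> S = T.
Proof.
case: S T => [s sP] [t tP] /= h; have st : s = t by apply/funext.
by subst t; congr MkOp; exact: Prop_irrelevance.
Qed.

Lemma opL H K (T : Op H K) a x y : T (a *: x + y) = a *: T x + T y.
Proof. by case: (opP T) => h _; exact: h. Qed.
Lemma op0 H K (T : Op H K) : T 0 = 0.
Proof.
have h := opL T 1 0 0; rewrite !scale1r addr0 in h.
by apply: (addrI (T 0)); rewrite addr0 -h.
Qed.
Lemma opD H K (T : Op H K) x y : T (x + y) = T x + T y.
Proof. by have := opL T 1 x y; rewrite !scale1r. Qed.
Lemma opZ H K (T : Op H K) a x : T (a *: x) = a *: T x.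
Proof. by have := opL T a x 0; rewrite op0 !addr0. Qed.
Lemma opN H K (T : Op H K) x : T (- x) = - T x.
Proof. by rewrite -scaleN1r opZ scaleN1r. Qed.
Lemma opB H K (T : Op H K) x y : T (x - y) = T x - T y.
Proof. by rewrite opD opN. Qed.
Lemma op_sum H K (T : Op H K) I (r : seq I) (F : I -> H) :
  T (\sum_(i <- r) F i) = \sum_(i <- r) T (F i).
Proof. exact: (big_morph T (opD T) (op0 T)). Qed.

Definition bnd H K (T : Op H K) (b : C) : Prop := op_bound T b.

Lemma op_bnd H K (T : Op H K) : exists2 b, 0 <= b & bnd T b.
Proof.
have [_ [b hb]] := opP T; exists `|b| => // x; apply: le_trans (hb x) _.
have [->|x0] := eqVneq `|x| 0; first by rewrite !mulr0.
have b0 : 0 <= b.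
  by have := le_trans (normr_ge0 _) (hb x); rewrite pmulr_lge0// lt_def x0/=.
by rewrite ger0_norm.
Qed.

Lemma mk_bounded H K (f : H -> K) b :
  (forall a x y, f (a *: x + y) = a *: f x + f y) ->
  (forall x, `|f x| <= b * `|x|) -> bounded_op f.
Proof. by move=> fL fb; split; [exact: fL | exists b]. Qed.

Lemma oid_subproof H : bounded_op (@id H).
Proof. by apply: (@mk_bounded _ _ _ 1) => // x; rewrite mul1r. Qed.
Definition oid H := MkOp (oid_subproof H).

Lemma ocomp_subproof H K L (S : Op K L) (T : Op H K) : bounded_op (S \o T).
Proof.
have [b b0 hb] := op_bnd S; have [c c0 hc] := op_bnd T.
apply: (@mk_bounded _ _ _ (b * c)) => [a x y|x] /=; first by rewrite !opL.
by apply: le_trans (hb _) _; rewrite -mulrA ler_wpM2l.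
Qed.
Definition ocomp H K L (S : Op K L) (T : Op H K) : Op H L := MkOp (ocomp_subproof S T).

Section OpLmod.
Variables H K : hilbertType R.
HB.instance Definition _ := gen_eqMixin (Op H K).
HB.instance Definition _ := gen_choiceMixin (Op H K).

Lemma oadd_subproof (S T : Op H K) : bounded_op (fun x => S x + T x).
Proof.
have [b b0 hb] := op_bnd S; have [c c0 hc] := op_bnd T.
apply: (@mk_bounded _ _ _ (b + c)) => [a x y|x].
  by rewrite !opL scalerDr addrACA.
by rewrite mulrDl; apply: le_trans (ler_normD _ _) _; exact: lerD.
Qed.
Definition oadd S T := MkOp (oadd_subproof S T).
Lemma oscale_subproof (a : C) (T : Op H K) : bounded_op (fun x => a *: T x).
Proof.
have [c c0 hc] := op_bnd T.
apply: (@mk_bounded _ _ _ (`|a| * c)) => [d x y|x].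
  by rewrite opL scalerDr !scalerA mulrC.
by rewrite normrZ -mulrA ler_wpM2l.
Qed.
Definition oscale a T := MkOp (oscale_subproof a T).
Lemma ozero_subproof : bounded_op (fun _ : H => 0 : K).
Proof.
by apply: (@mk_bounded _ _ _ 0) => [a x y|x]; rewrite ?scaler0 ?addr0// normr0 mul0r.
Qed.
Definition ozero := MkOp ozero_subproof.

Let addA : associative oadd. Proof. by move=> S T U; apply: op_ext => x; exact: addrA. Qed.
Let addC : commutative oadd. Proof. by move=> S T; apply: op_ext => x; exact: addrC. Qed.
Let add0 : left_id ozero oadd. Proof. by move=> S; apply: op_ext => x; exact: add0r. Qed.
Let addN : left_inverse ozero (oscale (-1)) oadd.
Proof. by move=> S; apply: op_ext => x /=; rewrite scaleN1r addNr. Qed.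
HB.instance Definition _ := GRing.isZmodule.Build (Op H K) addA addC add0 addN.

Let scA a b (T : Op H K) : oscale a (oscale b T) = oscale (a * b) T.
Proof. by apply: op_ext => x; exact: scalerA. Qed.
Let sc1 (T : Op H K) : oscale 1 T = T.
Proof. by apply: op_ext => x; exact: scale1r. Qed.
Let scDr : right_distributive oscale +%R.
Proof. by move=> a S T; apply: op_ext => x; exact: scalerDr. Qed.
Let scDl (T : Op H K) : {morph oscale^~ T : a b / a + b >-> a + b}.
Proof. by move=> a b; apply: op_ext => x; exact: scalerDl. Qed.
HB.instance Definition _ := GRing.Zmodule_isLmodule.Build C (Op H K) scA sc1 scDr scDl.

Lemma addoE (S T : Op H K) x : (S + T) x = S x + T x. Proof. by []. Qed.
Lemma scaleoE a (T : Op H K) x : (a *: T) x = a *: T x. Proof. by []. Qed.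
Lemma zerooE x : (0 : Op H K) x = 0. Proof. by []. Qed.
Lemma oppoE (T : Op H K) x : (- T) x = - T x.
Proof. by rewrite -scaleN1r scaleoE scaleN1r. Qed.
Lemma suboE (S T : Op H K) x : (S - T) x = S x - T x.
Proof. by rewrite addoE oppoE. Qed.
Lemma sumoE I (r : seq I) (F : I -> Op H K) x :
  (\sum_(i <- r) F i) x = \sum_(i <- r) F i x.
Proof. by elim: r => [|i r IH]; rewrite ?big_nil ?big_cons // -IH. Qed.

Lemma bnd_axioms : bound_axioms (@bnd H K).
Proof.
split.
- by move=> b b0 x; rewrite zerooE normr0 mulr_ge0.
- move=> v w a b hv hw x; rewrite addoE mulrDl.
  by apply: le_trans (ler_normD _ _) _; exact: lerD.
- by move=> c v a hv x; rewrite scaleoE normrZ -mulrA ler_wpM2l.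
- by move=> v a b ab hv x; apply: le_trans (hv x) _; rewrite ler_wpM2r.
- move=> v b b0 h x; apply: (@le_eps _ _ _ `|x|); rewrite ?mulr_ge0// => e e0.
  by rewrite [_ * e]mulrC -mulrDl; exact: h.
- move=> v h; apply: op_ext => x; apply: (@norm_eps0 _ _ _ `|x|) => // e e0.
  by rewrite mulrC; exact: h.
Qed.
End OpLmod.
End Operators.

Notation "S ** T" := (ocomp S T) (at level 40, left associativity).

Section OpTheory.
Variable R : realType.
Notation C := (Cplx R).
Implicit Types H K L M : hilbertType R.

Lemma ocompE H K L (S : Op K L) (T : Op H K) x : (S ** T) x = S (T x). Proof. by []. Qed.
Lemma oidE H x : oid H x = x. Proof. by []. Qed.
Lemma ocompA H K L M (S : Op L M) (T : Op K L) (U : Op H K) :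
  S ** (T ** U) = S ** T ** U.
Proof. by apply: op_ext. Qed.
Lemma ocomp1 H K (S : Op H K) : S ** oid H = S. Proof. by apply: op_ext. Qed.
Lemma o1comp H K (S : Op H K) : oid K ** S = S. Proof. by apply: op_ext. Qed.
Lemma ocompDl H K L (S S' : Op K L) (T : Op H K) : (S + S') ** T = S ** T + S' ** T.
Proof. by apply: op_ext. Qed.
Lemma ocompDr H K L (S : Op K L) (T T' : Op H K) : S ** (T + T') = S ** T + S ** T'.
Proof. by apply: op_ext => x; exact: opD. Qed.
Lemma ocompZl H K L a (S : Op K L) (T : Op H K) : (a *: S) ** T = a *: (S ** T).
Proof. by apply: op_ext. Qed.
Lemma ocompZr H K L a (S : Op K L) (T : Op H K) : S ** (a *: T) = a *: (S ** T).
Proof. by apply: op_ext => x; exact: opZ. Qed.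
Lemma ocompNl H K L (S : Op K L) (T : Op H K) : (- S) ** T = - (S ** T).
Proof. by rewrite -scaleN1r ocompZl scaleN1r. Qed.
Lemma ocompNr H K L (S : Op K L) (T : Op H K) : S ** (- T) = - (S ** T).
Proof. by rewrite -scaleN1r ocompZr scaleN1r. Qed.
Lemma ocompBl H K L (S S' : Op K L) (T : Op H K) : (S - S') ** T = S ** T - S' ** T.
Proof. by rewrite ocompDl ocompNl. Qed.
Lemma ocompBr H K L (S : Op K L) (T T' : Op H K) : S ** (T - T') = S ** T - S ** T'.
Proof. by rewrite ocompDr ocompNr. Qed.
Lemma ocomp0 H K L (S : Op K L) : S ** (0 : Op H K) = 0.
Proof. by apply: op_ext => x; exact: op0. Qed.
Lemma o0comp H K L (T : Op H K) : (0 : Op K L) ** T = 0. Proof. by apply: op_ext. Qed.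
Lemma ocomp_suml H K L I (r : seq I) (F : I -> Op K L) (T : Op H K) :
  (\sum_(i <- r) F i) ** T = \sum_(i <- r) F i ** T.
Proof. by apply: op_ext => x; rewrite /= !sumoE. Qed.
Lemma ocomp_sumr H K L I (r : seq I) (S : Op K L) (F : I -> Op H K) :
  S ** (\sum_(i <- r) F i) = \sum_(i <- r) S ** F i.
Proof. by apply: op_ext => x; rewrite /= !sumoE op_sum. Qed.

Lemma bnd_comp H K L (S : Op K L) (T : Op H K) a b :
  0 <= a -> bnd S a -> bnd T b -> bnd (S ** T) (a * b).
Proof.
by move=> a0 hS hT x; apply: le_trans (hS _) _; rewrite -mulrA ler_wpM2l.
Qed.
Lemma bnd_id H : bnd (oid H) 1. Proof. by move=> x; rewrite mul1r. Qed.

Lemma bnd_eps0 H K (T : Op H K) c : 0 <= c -> (forall e, 0 < e -> bnd T (c * e)) -> T = 0.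
Proof.
move=> c0 h; apply: op_ext => x; apply: (@norm_eps0 _ _ _ (c * `|x|)); first exact: mulr_ge0.
by move=> e e0; rewrite mulrAC; exact: h.
Qed.
Lemma bnd_eps_eq H K (S T : Op H K) : (forall e, 0 < e -> bnd (S - T) e) -> S = T.
Proof.
move=> h; apply/eqP; rewrite -subr_eq0; apply/eqP/(@bnd_eps0 _ _ _ 1) => // e e0.
by rewrite mul1r; exact: h.
Qed.

Lemma adj_ex H K (T : Op H K) : exists S : Op K H, forall x y, inner (S x) y = inner x (T y).
Proof.
have [b b0 hb] := op_bnd T.
have /choice[s hs] : forall x, exists u, forall y, inner x (T y) = inner u y.
  move=> x; apply: (@riesz _ _ _ (`|x| * b)) => [a y z|y].
    by rewrite opL innerD innerZ.
  by apply: le_trans (CS _ _) _; rewrite -mulrA ler_wpM2l.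
have sL a x y : s (a *: x + y) = a *: s x + s y.
  apply: inner_ext => z; rewrite innerC -hs innerDl innerZl [RHS]innerC innerDl innerZl.
  by rewrite -!hs.
have sb x : `|s x| <= b * `|x|.
  apply: norm_le_inner => [|y]; first exact: mulr_ge0.
  rewrite innerC norm_conjC -hs; apply: le_trans (CS _ _) _.
  by rewrite mulrC mulrAC ler_wpM2r.
by exists (MkOp (mk_bounded sL sb)) => x y /=; rewrite -hs.
Qed.

Definition ad H K (T : Op H K) : Op K H := projT1 (cid (adj_ex T)).
Lemma adE H K (T : Op H K) x y : inner (ad T x) y = inner x (T y).
Proof. by rewrite /ad; case: cid => S hS /=; exact: hS. Qed.
Lemma adEr H K (T : Op H K) x y : inner x (ad T y) = inner (T x) y.
Proof. by rewrite innerC adE -innerC. Qed.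
Lemma ad_uniq H K (T : Op H K) (S : Op K H) :
  (forall x y, inner (S x) y = inner x (T y)) -> S = ad T.
Proof.
move=> h; apply: op_ext => x; apply: inner_ext => y.
by rewrite innerC h [RHS]innerC adE.
Qed.
Lemma adK H K (T : Op H K) : ad (ad T) = T.
Proof. by apply/esym/ad_uniq => x y; rewrite adEr. Qed.
Lemma adM H K L (S : Op K L) (T : Op H K) : ad (S ** T) = ad T ** ad S.
Proof. by apply/esym/ad_uniq => x y; rewrite !ocompE !adE. Qed.
Lemma ad1 H : ad (oid H) = oid H.
Proof. by apply/esym/ad_uniq. Qed.
Lemma adD H K (S T : Op H K) : ad (S + T) = ad S + ad T.
Proof. by apply/esym/ad_uniq => x y; rewrite !addoE innerDl innerD !adE. Qed.
Lemma adZ H K a (T : Op H K) : ad (a *: T) = a^* *: ad T.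
Proof. by apply/esym/ad_uniq => x y; rewrite !scaleoE innerZl innerZ adE conjCK. Qed.
Lemma adN H K (T : Op H K) : ad (- T) = - ad T.
Proof. by rewrite -scaleN1r adZ rmorphN rmorph1 scaleN1r. Qed.
Lemma adB H K (S T : Op H K) : ad (S - T) = ad S - ad T.
Proof. by rewrite adD adN. Qed.
Lemma ad0 H K : ad (0 : Op H K) = 0.
Proof. by apply/esym/ad_uniq => x y; rewrite !zerooE inner0 inner0l. Qed.

Lemma ad_sum H K I (r : seq I) (F : I -> Op H K) :
  ad (\sum_(i <- r) F i) = \sum_(i <- r) ad (F i).
Proof. exact: (big_morph (@ad H K) (@adD H K) (ad0 H K)). Qed.

Lemma bnd_ad H K (T : Op H K) b : 0 <= b -> bnd T b -> bnd (ad T) b.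
Proof.
move=> b0 hb x; apply: norm_le_inner => [|y]; first exact: mulr_ge0.
rewrite innerC norm_conjC adE; apply: le_trans (CS _ _) _.
by rewrite mulrC mulrAC ler_wpM2r.
Qed.

Lemma bnd_inner H K (T : Op H K) b : 0 <= b ->
  (forall x y, `|inner x (T y)| <= b * `|x| * `|y|) -> bnd T b.
Proof.
move=> b0 h y; apply: norm_le_inner => [|x]; first exact: mulr_ge0.
by rewrite mulrAC; exact: h.
Qed.

Lemma ad_norm H K (T : Op H K) x : `|T x| ^+ 2 = inner x ((ad T ** T) x).
Proof. by rewrite -inner_norm ocompE adEr. Qed.

Lemma ad_norm' H K (T : Op H K) x : `|ad T x| ^+ 2 = inner x ((T ** ad T) x).
Proof. by rewrite ad_norm adK. Qed.
Lemma sa_inner H (T : Op H H) x y : ad T = T -> inner x (T y) = inner (T x) y.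
Proof. by move=> h; rewrite -adE h. Qed.

Definition unit_ H K (U : Op H K) := ad U ** U = oid H /\ U ** ad U = oid K.
Lemma unitK H K L (U : Op H K) (T : Op L H) : unit_ U -> ad U ** (U ** T) = T.
Proof. by move=> [h _]; rewrite ocompA h o1comp. Qed.
Lemma unitVK H K L (U : Op H K) (T : Op L K) : unit_ U -> U ** (ad U ** T) = T.
Proof. by move=> [_ h]; rewrite ocompA h o1comp. Qed.
Lemma unitrK H K L (U : Op H K) (T : Op K L) : unit_ U -> T ** U ** ad U = T.
Proof. by move=> [_ h]; rewrite -ocompA h ocomp1. Qed.
Lemma unitrVK H K L (U : Op H K) (T : Op H L) : unit_ U -> T ** ad U ** U = T.
Proof. by move=> [h _]; rewrite -ocompA h ocomp1. Qed.
Lemma unit_ad H K (U : Op H K) : unit_ U -> unit_ (ad U).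
Proof. by move=> [h1 h2]; split; rewrite adK. Qed.
Lemma unit_comp H K L (U : Op K L) (V : Op H K) : unit_ U -> unit_ V -> unit_ (U ** V).
Proof.
move=> hU hV; split; rewrite adM.
  by rewrite -ocompA unitK//; case: hV.
by rewrite -ocompA unitVK//; case: hU.
Qed.
Lemma unit_id H : unit_ (oid H).
Proof. by split; rewrite ad1 ocomp1. Qed.
Lemma unit_injl H K L (U : Op H K) (S T : Op L H) : unit_ U -> U ** S = U ** T -> S = T.
Proof. by move=> hU h; rewrite -(unitK S hU) h unitK. Qed.
Lemma unit_injr H K L (U : Op H K) (S T : Op K L) : unit_ U -> S ** U = T ** U -> S = T.
Proof. by move=> hU h; rewrite -(unitrK S hU) h unitrK. Qed.
Lemma unit_inner H K (U : Op H K) x y : unit_ U -> inner (U x) (U y) = inner x y.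
Proof. by move=> [h _]; rewrite -adE -ocompE h. Qed.
Lemma unit_bnd H K (U : Op H K) : unit_ U -> bnd U 1.
Proof.
move=> hU x; rewrite mul1r -(@ler_pXn2r _ 2)// ?nnegrE// -!inner_norm unit_inner//.
Qed.

Definition hb H (x : H) (b : C) : Prop := `|x| <= b.
Lemma hb_axioms H : bound_axioms (@hb H).
Proof.
split.
- by move=> b b0; rewrite /hb normr0.
- by move=> v w a b hv hw; apply: le_trans (ler_normD _ _) _; exact: lerD.
- by move=> c v a hv; rewrite /hb normrZ ler_wpM2l.
- by move=> v a b ab hv; apply: le_trans hv _.
- by move=> v b b0 h; apply: (@le_eps _ _ _ 1) => // e e0; rewrite mul1r; exact: h.
- by move=> v h; apply: (@norm_eps0 _ _ _ 1) => // e e0; rewrite mul1r; exact: h.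
Qed.
Lemma hb_complete H : bd_complete (@hb H).
Proof. exact: hcauchy. Qed.

Definition hdense H (S : H -> Prop) := forall x, cs (@hb H) S x.

Lemma op_extend H K (G : H * K -> Prop) (c : C) : 0 <= c ->
  (forall p, sp G p -> `|p.2| <= c * `|p.1|) -> hdense (fun x => exists y, G (x, y)) ->
  exists2 T : Op H K, bnd T c & forall x y, G (x, y) -> T x = y.
Proof.
move=> c0 hG dG; pose BP := bpair_axioms (hb_axioms H) (hb_axioms K).
have contr p : sp G p -> forall b, 0 <= b -> hb p.1 b -> hb p.2 (c * b).
  by move=> sp b b0 h; apply: le_trans (hG _ sp) _; rewrite ler_wpM2l.
have /choice[t ht] : forall x, exists y, cs (bpair (@hb H) (@hb K)) G (x, y).
  by move=> x; exact: (graph_total (hb_axioms H) (hb_axioms K) (@hb_complete K) c0 contr (dG x)).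
have tu x y : cs (bpair (@hb H) (@hb K)) G (x, y) -> t x = y.
  move=> h.  exact: (graph_fun (hb_axioms H) (hb_axioms K) c0 contr (ht x) h).
have tL a x y : t (a *: x + y) = a *: t x + t y.
  by apply: tu; exact: (csubL (cs_csub BP G) a (ht x) (ht y)).
have tb x : `|t x| <= c * `|x|.
  by have := graph_contr (hb_axioms H) (hb_axioms K) c0 contr (ht x) (normr_ge0 x) (lexx _).
exists (MkOp (mk_bounded tL tb)) => // x y Gxy; apply: tu.
exact: (cs_in BP).
Qed.

Definition htotal H (S : H -> Prop) := forall v, (forall s, S s -> inner s v = 0) -> v = 0.

Lemma dense_total H (S : H -> Prop) : hdense S -> htotal S.
Proof.
move=> dS v h; have [->//|v0] := eqVneq v 0.
have hv : forall s, cs (@hb H) S s -> inner s v = 0.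
  move=> s hs; apply/eqP; rewrite -normr_le0.
  apply: (@le_eps _ _ _ `|v|) => // e e0; rewrite add0r mulrC.
  have [w sw bw] := hs _ e0.
  have w0 : inner w v = 0.
    elim: sw => [|a x y Sx _ IH]; first exact: inner0l.
    by rewrite innerDl innerZl h// mulr0 add0r.
  rewrite -[inner s v]subr0 -w0 -innerBl; apply: le_trans (CS _ _) _.
  by rewrite ler_wpM2r.
by apply/eqP; rewrite -inner_eq0 hv.
Qed.

Lemma op_ext_total H K (S : H -> Prop) (T U : Op H K) : htotal S ->
  (forall s, S s -> T s = U s) -> T = U.
Proof.
move=> tS h; rewrite -(adK T) -(adK U); congr ad; apply: op_ext => x.
apply/eqP; rewrite -subr_eq0; apply/eqP/tS => s Ss.
by rewrite innerB !adEr h// subrr.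
Qed.

(** The limit is the pointwise one; it is bounded because it stays within distance 1 of some
    [u N]. *)
Lemma ocauchy H K (u : nat -> Op H K) :
  (forall e, 0 < e -> exists N, forall n m, (N <= n)%N -> (N <= m)%N -> bnd (u n - u m) e) ->
  exists l, forall e, 0 < e -> exists N, forall n, (N <= n)%N -> bnd (l - u n) e.
Proof.
move=> h.
have hx x : exists l, forall e, 0 < e -> exists N, forall n, (N <= n)%N -> `|l - u n x| <= e.
  apply: hcauchy => e e0; have x1 : 0 < `|x| + 1 by rewrite ltr_wpDl.
  have [N hN] := h _ (divr_gt0 e0 x1); exists N => n m Nn Nm.
  rewrite -suboE; apply: le_trans (hN _ _ Nn Nm x) _.
  by rewrite -mulrA ler_piMr ?(ltW e0)// mulrC ler_pdivrMr// mul1r lerDl.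
have [l hl] := choice hx.
have lL a x y : l (a *: x + y) = a *: l x + l y.
  apply/eqP; rewrite -subr_eq0; apply/eqP/(@norm_eps0 _ _ _ (1 + (`|a| + 1))).
    by rewrite !addr_ge0.
  move=> e e0; have [N1 h1] := hl (a *: x + y) _ e0; have [N2 h2] := hl x _ e0.
  have [N3 h3] := hl y _ e0; pose n := maxn N1 (maxn N2 N3).
  have -> : l (a *: x + y) - (a *: l x + l y) =
     (l (a *: x + y) - u n (a *: x + y)) - (a *: (l x - u n x) + (l y - u n y)).
    by rewrite opL scalerBr [X in _ = _ - X]addrACA -opprD opprB addrA subrK.
  rewrite !mulrDl !mul1r; apply: le_trans (ler_normB _ _) _; apply: lerD.
    by apply: h1; rewrite leq_maxl.
  apply: le_trans (ler_normD _ _) _; rewrite normrZ; apply: lerD.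
    by rewrite ler_wpM2l// h2// leq_max leq_max leqnn orbT.
  by apply: h3; rewrite !leq_max leqnn !orbT.
have [N hN] := h 1 ltr01; have [b b0 hb] := op_bnd (u N).
have lim_le e k0 : 0 <= e -> (forall n, (k0 <= n)%N -> bnd (u n - u k0) e) ->
    forall x, `|l x - u k0 x| <= e * `|x|.
  move=> e0 hM x; apply: (@le_eps _ _ _ 1); rewrite ?mulr_ge0// => d d0.
  have [M1 hM1] := hl x _ d0; pose n := maxn k0 M1.
  apply: le_trans (ler_distD (u n x) _ _) _; rewrite addrC mul1r lerD//.
    by rewrite -suboE; apply: hM; rewrite leq_maxl.
  by apply: hM1; rewrite leq_maxr.
have lb x : `|l x| <= (1 + b) * `|x|.
  rewrite -(subrK (u N x) (l x)) mulrDl; apply: le_trans (ler_normD _ _) _.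
  by apply: lerD => //; apply: lim_le => // n Nn; exact: hN.
exists (MkOp (mk_bounded lL lb)) => e e0.
have e20 : 0 < e / 2 by rewrite divr_gt0.
have [M hM] := h _ e20; exists M => n Mn x.
rewrite suboE /= -(subrK (u M x) (l x)) -addrA -suboE [e]splitr mulrDl.
apply: le_trans (ler_normD _ _) _; apply: lerD; last exact: hM.
by apply: lim_le => [|k Mk]; [exact: ltW | exact: hM].
Qed.

Lemma op_complete H K : bd_complete (@bnd R H K).
Proof. exact: ocauchy. Qed.

Lemma op_ext_dense H K (S : H -> Prop) (T U : Op H K) : hdense S ->
  (forall s, S s -> T s = U s) -> T = U.
Proof. by move=> /dense_total; exact: op_ext_total. Qed.

Lemma dense_sub H (S T : H -> Prop) : hdense S -> (forall x, S x -> T x) -> hdense T.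
Proof.
move=> dS ST x; apply: (@cs_min _ _ _ S) => //; first exact: (cs_csub (hb_axioms H)).
by move=> v /ST; exact: (cs_in (hb_axioms H)).
Qed.

Lemma dense_cs H (S T : H -> Prop) : hdense S -> (forall x, S x -> cs (@hb H) T x) -> hdense T.
Proof.
move=> dS ST x; apply: (@cs_min _ _ _ S) => //; exact: (cs_csub (hb_axioms H)).
Qed.

Lemma dense_map H K (T : Op H K) (S : H -> Prop) (S' : K -> Prop) : hdense S ->
  (forall s, S s -> S' (T s)) -> hdense (fun y => exists x, y = T x) -> hdense S'.
Proof.
move=> dS SS' dT; apply: dense_cs dT _ => _ [x ->].
have [b b0 hb_] := op_bnd T.
apply: (cs_map (bv := @hb H) (hb_axioms K) (f := T) (M := b) (S := S)) => //.
- by move=> c v w; exact: opL.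
- by move=> v a a0 ha; apply: le_trans (hb_ _) _; rewrite ler_wpM2l.
- by move=> v /SS' h; apply: (cs_in (hb_axioms K)).
Qed.

(** Preserved inner products pass to spans by sesquilinearity, so G extends to an isometry; dense
    second components make it onto. The flip, the associator and the conjugate flip are built this
    way. *)
Lemma unit_extend H K (G : H * K -> Prop) :
  (forall p q, G p -> G q -> inner p.2 q.2 = inner p.1 q.1) ->
  hdense (fun x => exists y, G (x, y)) -> hdense (fun y => exists x, G (x, y)) ->
  exists2 U : Op H K, unit_ U & forall x y, G (x, y) -> U x = y.
Proof.
move=> hG d1 d2.
have spG p q : sp G p -> sp G q -> inner p.2 q.2 = inner p.1 q.1.
  move=> sp1; elim: sp1 q => [|a x y Gx _ IH] q sq; first by rewrite /= !inner0l.
  rewrite /= !innerDl !innerZl IH//; congr (_ * _ + _).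
  elim: sq => [|b x' y' Gx' _ IH']; first by rewrite /= !inner0.
  by rewrite /= !innerD !innerZ IH' hG.
have [|//|U bU hU] := @op_extend _ _ G 1 ler01.
  move=> p sp; rewrite mul1r -(@ler_pXn2r _ 2)// ?nnegrE// -!inner_norm spG//.
have UU : ad U ** U = oid H.
  apply: (op_ext_dense d1) => s [y Gy]; apply/eqP; rewrite -subr_eq0; apply/eqP.
  apply: (dense_total d1) => s' [y' Gy'].
  by rewrite innerB ocompE adEr !(hU _ _ Gy) !(hU _ _ Gy') (hG _ _ Gy' Gy)/= subrr.
exists U => //; split => //; apply: (op_ext_dense d2) => y [x Gxy].
by rewrite -(hU _ _ Gxy) -ocompE -ocompA UU.
Qed.
End OpTheory.

(** Linear identities between vectors are tested against an arbitrary vector, which turns them into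
    ring identities between scalars. *)
Ltac vabel := apply: inner_ext => ?;
  rewrite ?(oppoE, suboE, addoE, scaleoE, zerooE, innerB, innerD, innerN, innerZ, inner0); ring.
Ltac abel := apply: op_ext => ?; vabel.

(** * Tensor products and leg numbering *)

Section GramSchmidt.
Variables (R : realType) (K : hilbertType R).

Definition orthonormal n (e : nat -> K) :=
  forall i j, (i < n)%N -> (j < n)%N -> inner (e i) (e j) = (i == j)%:R :> Cplx R.

Lemma gram_schmidt (s : seq K) : exists n e, orthonormal n e /\
  forall y, y \in s -> y = \sum_(i < n) inner (e i) y *: e i.
Proof.
elim: s => [|y s [n [e [on he]]]]; first by exists 0%N, (fun=> 0).
pose r := y - \sum_(i < n) inner (e i) y *: e i.
have [r0|r0] := eqVneq r 0.
  exists n, e; split=> // z; rewrite inE => /orP[/eqP ->|/he//].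
  by apply/eqP; rewrite -subr_eq0 -/r r0.
have orth i : (i < n)%N -> inner (e i) r = 0.
  move=> ni; rewrite /r innerB inner_sumr (bigD1 (Ordinal ni))//= big1 => [|j ji].
    by rewrite innerZ on// eqxx mulr1 addr0 subrr.
  rewrite innerZ on// (_ : (i == j) = false) ?mulr0//.
  by apply/negbTE; apply: contraNneq ji => ij; apply/eqP/val_inj; rewrite /= ij.
pose a := `|r|^-1.
have rn0 : `|r| != 0 by rewrite normr_eq0.
have aa : a^* = a by rewrite conj_Creal// ger0_real// invr_ge0.
pose e' i := if i == n then a *: r else e i.
have e'n : e' n = a *: r by rewrite /e' eqxx.
have e'l i : (i < n)%N -> e' i = e i by move=> ni; rewrite /e' ltn_eqF.
have on' : orthonormal n.+1 e'.
  move=> i j; rewrite !ltnS [(i <= n)%N]leq_eqVlt [(j <= n)%N]leq_eqVlt => /orP[/eqP ->|ni] /orP[/eqP ->|nj].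
  - rewrite e'n innerZ innerZl aa inner_norm eqxx expr2 [a * (`|r| * _)]mulrA.
    by rewrite mulVf// mul1r mulVf.
  - rewrite e'n e'l// innerZl innerC orth// conjC0 mulr0.
    by rewrite (gtn_eqF nj).
  - by rewrite e'n e'l// innerZ orth// mulr0 (ltn_eqF ni).
  - by rewrite !e'l// on.
exists n.+1, e'; split=> // z.
have sumE w : \sum_(i < n.+1) inner (e' i) w *: e' i =
    \sum_(i < n) inner (e i) w *: e i + inner (e' n) w *: e' n.
  by rewrite big_ord_recr/=; congr (_ + _); apply: eq_bigr => i _; rewrite !e'l.
rewrite inE => /orP[/eqP ->|zs]; rewrite sumE e'n.
  have -> : inner (a *: r) y = `|r|.
    rewrite innerZl aa -[y](subrK (\sum_(i < n) inner (e i) y *: e i)) -/r.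
    rewrite innerD inner_sumr big1 => [|i _].
      by rewrite addr0 inner_norm expr2 mulrA mulVf// mul1r.
    by rewrite innerZ [inner r _]innerC orth// conjC0 mulr0.
  by rewrite scalerA /a mulfV// scale1r /r addrC subrK.
suff -> : inner (a *: r) z = 0 by rewrite scale0r addr0; exact: he.
rewrite (he z zs) inner_sumr big1// => i _.
by rewrite innerZ innerZl [inner r _]innerC orth// conjC0 !mulr0.
Qed.
End GramSchmidt.

Section Tensor.
Variable R : realType.
Notation C := (Cplx R).
Implicit Types H K L : hilbertType R.

Lemma tens0l H K (y : K) : tens (0 : H) y = 0.
Proof. by rewrite -(scale0r (0 : H)) tensZl scale0r. Qed.
Lemma tens0r H K (x : H) : tens x (0 : K) = 0.
Proof. by rewrite -(scale0r (0 : K)) tensZr scale0r. Qed.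
Lemma tens_suml H K I (r : seq I) (F : I -> H) (y : K) :
  tens (\sum_(i <- r) F i) y = \sum_(i <- r) tens (F i) y.
Proof. exact: (big_morph (fun x => tens x y) (fun x x' => tensDl x x' y) (tens0l H y)). Qed.
Lemma tens_sumr H K I (r : seq I) (x : H) (F : I -> K) :
  tens x (\sum_(i <- r) F i) = \sum_(i <- r) tens x (F i).
Proof. exact: (big_morph (tens x) (tensDr x) (tens0r K x)). Qed.
Lemma norm_tens H K (x : H) (y : K) : `|tens x y| = `|x| * `|y|.
Proof.
apply/eqP; rewrite -(@eqrXn2 _ 2)// ?mulr_ge0// exprMn -!inner_norm inner_tens//.
Qed.

Lemma closure_approx (V : hilbertType R) (S : set V) x : closure S x ->
  forall e, 0 < e -> exists2 y, S y & `|x - y| <= e.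
Proof.
move=> h e e0; have [y [Sy]] := h _ (nbhsx_ballx x e e0).
by rewrite -ball_normE /= => /ltW; exists y.
Qed.

Lemma lspan_sp (V : lmodType C) (S : set V) v : lspan S v -> sp S v.
Proof.
move=> [n [a [u [Su ->]]]]; elim: n a u Su => [|n IH] a u Su.
  by rewrite big_ord0; exact: sp0.
by rewrite big_ord_recl; apply: spS => //; exact: IH.
Qed.

Lemma sp_lspan (V : lmodType C) (S : set V) v : sp S v -> lspan S v.
Proof.
elim=> [|c w u Sw _ [n [a [x [Sx ->]]]]].
  by exists 0%N, (fun=> 0), (fun=> 0); split => [[]//|]; rewrite big_ord0.
exists n.+1, (fun i => oapp a c (unlift ord0 i)), (fun i => oapp x w (unlift ord0 i)).
split=> [i|]; first by case: unliftP => [j _|_] /=; [exact: Sx|].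
rewrite big_ord_recl unlift_none/=; congr (_ + _); apply: eq_bigr => i _.
by rewrite liftK.
Qed.

Lemma closure_dense H (S : set H) : closure (lspan S) = setT -> hdense S.
Proof.
move=> h x e e0; have : closure (lspan S) x by rewrite h.
by move=> /closure_approx/(_ e e0)[y /lspan_sp Sy xy]; exists y.
Qed.

Lemma dense_tens H K : hdense (fun u : htens H K => exists x y, u = tens x y).
Proof.
apply: dense_sub (closure_dense (@tens_dense R H K)) _ => _ [x _ [y _ <-]].
by exists x, y.
Qed.

Lemma swap_ex H K : exists2 U : Op (htens H K) (htens K H), unit_ U &
  forall x y, U (tens x y) = tens y x.
Proof.
pose G (p : htens H K * htens K H) := exists x y, p = (tens x y, tens y x).
have [|||U uU hU] := @unit_extend _ _ _ G.
- by move=> _ _ [x [y ->]] [x' [y' ->]]; rewrite /= !inner_tens mulrC.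
- apply: dense_sub (@dense_tens H K) _ => _ [x [y ->]].
  by exists (tens y x), x, y.
- apply: dense_sub (@dense_tens K H) _ => _ [y [x ->]].
  by exists (tens x y), x, y.
by exists U => // x y; apply: hU; exists x, y.
Qed.
Definition sw H K := s2val (cid2 (swap_ex H K)).
Lemma sw_unit H K : unit_ (sw H K). Proof. exact: (s2valP (cid2 (swap_ex H K))). Qed.
Lemma swE H K x y : sw H K (tens x y) = tens y x.
Proof. exact: (s2valP' (cid2 (swap_ex H K))). Qed.

(** The second legs of a finite sum of tensors can be expanded in an orthonormal family
    ([gram_schmidt]). The squared norm is then a sum of squared norms in the first factor, so any
    bound of a is a bound of a (x) 1. *)
Lemma ol_ex H H' K (a : Op H H') : exists2 T : Op (htens H K) (htens H' K),
  (forall b, 0 <= b -> bnd a b -> bnd T b) & forall x y, T (tens x y) = tens (a x) y.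
Proof.
pose G (p : htens H K * htens H' K) := exists x y, p = (tens x y, tens (a x) y).
have dG : hdense (fun x => exists y, G (x, y)).
  apply: dense_sub (@dense_tens H K) _ => _ [x [y ->]].
  by exists (tens (a x) y), x, y.
have spG p : sp G p -> exists s : seq (H * K),
    p.1 = \sum_(q <- s) tens q.1 q.2 /\ p.2 = \sum_(q <- s) tens (a q.1) q.2.
  elim=> [|c _ q [x [y ->]] _ [s [h1 h2]]]; first by exists [::]; rewrite !big_nil.
  exists ((c *: x, y) :: s); rewrite !big_cons/= -h1 -h2 opZ !tensZl.
  by [].
have bG b : 0 <= b -> bnd a b -> forall p, sp G p -> `|p.2| <= b * `|p.1|.
  move=> b0 hb p /spG[s [-> ->]].
  have [n [e [on he]]] := gram_schmidt [seq q.2 | q <- s].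
  pose f (i : 'I_n) := \sum_(q <- s) inner (e i) q.2 *: q.1.
  have E (V : hilbertType R) (g : Op H V) :
      \sum_(q <- s) tens (g q.1) q.2 = \sum_(i < n) tens (g (f i)) (e i).
    transitivity (\sum_(q <- s) \sum_(i < n) tens (g (inner (e i) q.2 *: q.1)) (e i)).
      rewrite big_seq [RHS]big_seq; apply: eq_bigr => q qs.
      rewrite {1}(he q.2) ?map_f// tens_sumr; apply: eq_bigr => i _.
      by rewrite tensZr opZ tensZl.
    rewrite exchange_big; apply: eq_bigr => i _.
    by rewrite op_sum tens_suml.
  have NE (V : hilbertType R) (g : 'I_n -> V) :
      `|\sum_(i < n) tens (g i) (e i)| ^+ 2 = \sum_(i < n) `|g i| ^+ 2.
    rewrite -inner_norm inner_suml; apply: eq_bigr => i _.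
    rewrite inner_sumr (bigD1 i)//= big1 => [|j ji].
      by rewrite inner_tens on// eqxx mulr1 addr0 inner_norm.
    rewrite inner_tens on// (_ : (_ == _) = false) ?mulr0//.
    by apply/negbTE; apply: contraNneq ji => ij; apply/eqP/val_inj; rewrite /= ij.
  rewrite -(@ler_pXn2r _ 2)// ?nnegrE ?mulr_ge0// exprMn.
  rewrite (E _ a) (E _ (oid H)) !NE mulr_sumr; apply: ler_sum => i _.
  by rewrite -exprMn ler_pXn2r// ?nnegrE ?mulr_ge0// hb.
have [c c0 hc] := op_bnd a.
have [T bT hT] := op_extend c0 (bG c c0 hc) dG.
exists T; last by move=> x y; apply: hT; exists x, y.
move=> b b0 hb; have [T' bT' hT'] := op_extend b0 (bG b b0 hb) dG.
suff -> : T = T' by [].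
apply: (op_ext_dense dG) => s [y Gy].
by rewrite (hT _ _ Gy) (hT' _ _ Gy).
Qed.
Definition ol H H' K (a : Op H H') := s2val (cid2 (@ol_ex H H' K a)).
Lemma olb H H' K (a : Op H H') b : 0 <= b -> bnd a b -> bnd (ol K a) b.
Proof. exact: (s2valP (cid2 (@ol_ex H H' K a))). Qed.
Lemma olE H H' K (a : Op H H') x (y : K) : ol K a (tens x y) = tens (a x) y.
Proof. exact: (s2valP' (cid2 (@ol_ex H H' K a))). Qed.

(** Only the left ampliation is constructed; the right one is its conjugate by the flip. [locked]
    keeps unification from unfolding the product. *)
Definition ot H H' K K' (a : Op H H') (b : Op K K') : Op (htens H K) (htens H' K') :=
  locked (sw K' H' ** ol H' b ** sw H' K ** ol K a).
Lemma otE H H' K K' (a : Op H H') (b : Op K K') x y : ot a b (tens x y) = tens (a x) (b y).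
Proof. by rewrite /ot -lock !ocompE olE swE olE swE. Qed.
Lemma bnd_ot H H' K K' (a : Op H H') (b : Op K K') c d : 0 <= c -> 0 <= d ->
  bnd a c -> bnd b d -> bnd (ot a b) (c * d).
Proof.
move=> c0 d0 hc hd.
have h1 := bnd_comp d0 (olb (K := H') d0 hd) (unit_bnd (sw_unit H' K)).
have h2 := bnd_comp ler01 (unit_bnd (sw_unit K' H')) h1.
have := bnd_comp _ h2 (olb (K := K) c0 hc).
rewrite mul1r mulr1 /ot -lock !ocompA [c * d]mulrC; apply.
exact: d0.
Qed.

Lemma tens_ext H K L (S T : Op (htens H K) L) :
  (forall x y, S (tens x y) = T (tens x y)) -> S = T.
Proof. by move=> h; apply: (op_ext_dense (@dense_tens H K)) => _ [x [y ->]]. Qed.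

Lemma il_subproof H K (x : H) : bounded_op (fun y : K => tens x y).
Proof.
apply: (@mk_bounded _ _ _ _ `|x|) => [a y z|y]; last by rewrite norm_tens.
by rewrite tensDr tensZr.
Qed.
Definition il H K (x : H) : Op K (htens H K) := MkOp (@il_subproof H K x).
Lemma ir_subproof H K (y : K) : bounded_op (fun x : H => tens x y).
Proof.
apply: (@mk_bounded _ _ _ _ `|y|) => [a x z|x]; last by rewrite norm_tens mulrC.
by rewrite tensDl tensZl.
Qed.
Definition ir H K (y : K) : Op H (htens H K) := MkOp (@ir_subproof H K y).
Lemma ilE H K (x : H) (y : K) : il K x y = tens x y. Proof. by []. Qed.
Lemma irE H K (x : H) (y : K) : ir H y x = tens x y. Proof. by []. Qed.
Lemma bnd_il H K (x : H) : bnd (il K x) `|x|.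
Proof. by move=> y; rewrite ilE norm_tens. Qed.
Lemma bnd_ir H K (y : K) : bnd (ir H y) `|y|.
Proof. by move=> x; rewrite irE norm_tens mulrC. Qed.
Lemma ad_ilE H K (x z : H) (y : K) : ad (il K x) (tens z y) = inner x z *: y.
Proof. by apply: inner_ext => w; rewrite adEr ilE inner_tens innerZ. Qed.
Lemma ad_irE H K (y w : K) (z : H) : ad (ir H y) (tens z w) = inner y w *: z.
Proof. by apply: inner_ext => v; rewrite adEr irE inner_tens innerZ mulrC. Qed.
Lemma ilL H K a (x y : H) : il K (a *: x + y) = a *: il K x + il K y.
Proof. by apply: op_ext => z; rewrite ilE tensDl tensZl. Qed.
Lemma irL H K a (x y : K) : ir H (a *: x + y) = a *: ir H x + ir H y.
Proof. by apply: op_ext => z; rewrite irE tensDr tensZr. Qed.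

Lemma tens_ext2 H K L M (S T : Op (htens (htens H K) L) M) :
  (forall x y z, S (tens (tens x y) z) = T (tens (tens x y) z)) -> S = T.
Proof.
move=> h; apply: tens_ext => u z; rewrite -!irE -!ocompE; congr (opf _ u).
by apply: tens_ext => x y; exact: h.
Qed.
Lemma tens_ext3 H1 H2 H3 H4 M (S T : Op (htens (htens (htens H1 H2) H3) H4) M) :
  (forall x y z w, S (tens (tens (tens x y) z) w) = T (tens (tens (tens x y) z) w)) -> S = T.
Proof.
move=> h; apply: tens_ext => u z; rewrite -!irE -!ocompE; congr (opf _ u).
by apply: tens_ext2 => x y w; exact: h.
Qed.
Lemma tens_ext2' H K L M (S T : Op (htens H (htens K L)) M) :
  (forall x y z, S (tens x (tens y z)) = T (tens x (tens y z))) -> S = T.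
Proof.
move=> h; apply: tens_ext => x u; rewrite -!ilE -!ocompE; congr (opf _ u).
by apply: tens_ext => y z; exact: h.
Qed.

Lemma vec_ext H K (u v : htens H K) :
  (forall x y, inner (tens x y) u = inner (tens x y) v) -> u = v.
Proof.
move=> h; apply/eqP; rewrite -subr_eq0; apply/eqP/(dense_total (@dense_tens H K)).
by move=> _ [x [y ->]]; rewrite innerB h subrr.
Qed.
Lemma vec_ext2 H K L (u v : htens (htens H K) L) :
  (forall x y z, inner (tens (tens x y) z) u = inner (tens (tens x y) z) v) -> u = v.
Proof.
move=> h; apply: vec_ext => t z; rewrite -!irE -!adEr; apply: (congr1 (inner t)).
by apply: vec_ext => x y; rewrite !adEr; exact: h.
Qed.
Lemma vec_ext3 H1 H2 H3 H4 (u v : htens (htens (htens H1 H2) H3) H4) :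
  (forall x y z w, inner (tens (tens (tens x y) z) w) u =
                   inner (tens (tens (tens x y) z) w) v) -> u = v.
Proof.
move=> h; apply: vec_ext => t z; rewrite -!irE -!adEr; apply: (congr1 (inner t)).
by apply: vec_ext2 => x y w; rewrite !adEr; exact: h.
Qed.

Section OtTheory.
Variables H H' H'' K K' K'' : hilbertType R.
Lemma ot_comp (a : Op H' H'') (b : Op K' K'') (a' : Op H H') (b' : Op K K') :
  ot a b ** ot a' b' = ot (a ** a') (b ** b').
Proof. by apply: tens_ext => x y; rewrite !(ocompE, otE). Qed.
Lemma ot_id : ot (oid H) (oid K) = oid (htens H K).
Proof. by apply: tens_ext => x y; rewrite !otE. Qed.
Lemma ad_ot (a : Op H H') (b : Op K K') : ad (ot a b) = ot (ad a) (ad b).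
Proof.
apply: tens_ext => x y; apply: vec_ext => z w.
by rewrite adEr !otE !inner_tens !adEr.
Qed.
Lemma otLl c (a a' : Op H H') (b : Op K K') : ot (c *: a + a') b = c *: ot a b + ot a' b.
Proof. by apply: tens_ext => x y; rewrite addoE scaleoE !otE tensDl tensZl. Qed.
Lemma otLr c (a : Op H H') (b b' : Op K K') : ot a (c *: b + b') = c *: ot a b + ot a b'.
Proof. by apply: tens_ext => x y; rewrite addoE scaleoE !otE tensDr tensZr. Qed.
Lemma ot_il (a : Op H H') (b : Op K K') x : ot a b ** il K x = il K' (a x) ** b.
Proof. by apply: op_ext => y; rewrite !ocompE !ilE otE. Qed.
Lemma ot_ir (a : Op H H') (b : Op K K') y : ot a b ** ir H y = ir H' (b y) ** a.
Proof. by apply: op_ext => x; rewrite !ocompE !irE otE. Qed.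
End OtTheory.

Lemma ot_unit H H' K K' (a : Op H H') (b : Op K K') : unit_ a -> unit_ b -> unit_ (ot a b).
Proof. by move=> [a1 a2] [b1 b2]; split; rewrite ad_ot ot_comp ?a1 ?b1 ?a2 ?b2 ot_id. Qed.

Lemma ad_sw H K : ad (sw H K) = sw K H.
Proof.
apply: tens_ext => x y; rewrite swE -[tens x y]swE -ocompE.
by have [-> _] := sw_unit H K.
Qed.
Lemma sw_ot H H' K K' (a : Op H H') (b : Op K K') : sw H' K' ** ot a b = ot b a ** sw H K.
Proof. by apply: tens_ext => x y; rewrite !ocompE swE !otE swE. Qed.

Lemma assoc_ex H K L : exists2 U : Op (htens (htens H K) L) (htens H (htens K L)), unit_ U &
  forall x y z, U (tens (tens x y) z) = tens x (tens y z).
Proof.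
pose G (p : htens (htens H K) L * htens H (htens K L)) :=
  exists x y z, p = (tens (tens x y) z, tens x (tens y z)).
have [|||U uU hU] := @unit_extend _ _ _ G.
- move=> _ _ [x [y [z ->]]] [x' [y' [z' ->]]]; rewrite /= !inner_tens mulrA//.
- apply: dense_cs (@dense_tens _ L) _ => _ [u [z ->]].
  apply: (cs_map (bv := @hb R _) (hb_axioms _) (f := ir (htens H K) z) (M := `|z|)
     (S := fun u => exists x y, u = tens x y)).
  + by move=> *; exact: opL.
  + by [].
  + by move=> v b b0 hv; apply: le_trans (@bnd_ir _ _ z v) _; rewrite ler_wpM2l.
  + move=> _ [x [y ->]]; apply: (cs_in (hb_axioms _)).
    by exists (tens x (tens y z)), x, y, z.
  + exact: (@dense_tens).
- apply: dense_cs (@dense_tens H _) _ => _ [x [u ->]].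
  apply: (cs_map (bv := @hb R _) (hb_axioms _) (f := il (htens K L) x) (M := `|x|)
     (S := fun u => exists x y, u = tens x y)).
  + by move=> *; exact: opL.
  + by [].
  + by move=> v b b0 hv; apply: le_trans (@bnd_il _ _ x v) _; rewrite ler_wpM2l.
  + move=> _ [y [z ->]]; apply: (cs_in (hb_axioms _)).
    by exists (tens (tens x y) z), x, y, z.
  + exact: (@dense_tens).
by exists U => // x y z; apply: hU; exists x, y, z.
Qed.
Definition as_ H K L := s2val (cid2 (assoc_ex H K L)).
Lemma as_unit H K L : unit_ (as_ H K L). Proof. exact: (s2valP (cid2 (assoc_ex H K L))). Qed.
Lemma asE H K L x y z : as_ H K L (tens (tens x y) z) = tens x (tens y z).
Proof. exact: (s2valP' (cid2 (assoc_ex H K L))). Qed.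
Definition ua H K L := ad (as_ H K L).
Lemma uaE H K L x y z : ua H K L (tens x (tens y z)) = tens (tens x y) z.
Proof. by rewrite -asE -ocompE; have [-> _] := as_unit H K L. Qed.
Lemma ad_ua H K L : ad (ua H K L) = as_ H K L. Proof. exact: adK. Qed.
Lemma ua_unit H K L : unit_ (ua H K L). Proof. exact/unit_ad/as_unit. Qed.

Definition s23 H K L := locked (ua H L K ** ot (oid H) (sw K L) ** as_ H K L).
Lemma s23E H K L x y z : s23 H K L (tens (tens x y) z) = tens (tens x z) y.
Proof. by rewrite /s23 -lock !ocompE asE otE swE uaE. Qed.
Lemma s23_unit H K L : unit_ (s23 H K L).
Proof.
rewrite /s23 -lock; apply: unit_comp; last exact: as_unit.
by apply: unit_comp; [exact: ua_unit | apply: ot_unit; [exact: unit_id | exact: sw_unit]].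
Qed.
Lemma ad_s23 H K L : ad (s23 H K L) = s23 H L K.
Proof. by rewrite /s23 -!lock !adM ad_ot ad1 ad_sw ad_ua !ocompA. Qed.

Definition l12 H K L (T : Op (htens H K) (htens H K)) := locked (ot T (oid L)).
Definition l23 H K L (T : Op (htens K L) (htens K L)) :=
  locked (ua H K L ** ot (oid H) T ** as_ H K L).
Definition l13 H K L (T : Op (htens H L) (htens H L)) :=
  locked (s23 H L K ** ot T (oid K) ** s23 H K L).
End Tensor.
Arguments l12 {R H K} L T.
Arguments l23 {R} H {K L} T.
Arguments l13 {R H} K {L} T.

Section StarHom.
Variable R : realType.
Implicit Types H K L X Y : hilbertType R.

Record starhom X Y (E : Op X X -> Op Y Y) : Prop := {
  shM : forall S T, E (S ** T) = E S ** E T ;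
  shA : forall S, E (ad S) = ad (E S) ;
  sh1 : E (oid X) = oid Y }.

Lemma sh_unit X Y (E : Op X X -> Op Y Y) U : starhom E -> unit_ U -> unit_ (E U).
Proof.
by move=> hE [u1 u2]; split; rewrite -(shA hE) -(shM hE) ?u1 ?u2 (sh1 hE).
Qed.

Lemma sh_comp X Y Z (E : Op X X -> Op Y Y) (F : Op Y Y -> Op Z Z) :
  starhom E -> starhom F -> starhom (F \o E).
Proof.
move=> hE hF; split=> *; first by rewrite /= (shM hE) (shM hF).
- by rewrite /= (shA hE) (shA hF).
- by rewrite /= (sh1 hE) (sh1 hF).
Qed.

Lemma sh_otl H K : starhom (fun T : Op H H => ot T (oid K)).
Proof. by split=> [S T|S|]; rewrite ?ot_comp ?ad_ot ?ocomp1 ?ad1 ?ot_id. Qed.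
Lemma sh_otr H K : starhom (fun T : Op K K => ot (oid H) T).
Proof. by split=> [S T|S|]; rewrite ?ot_comp ?ad_ot ?ocomp1 ?ad1 ?ot_id. Qed.
Lemma sh_conj X Y (U : Op Y X) : unit_ U -> starhom (fun T => ad U ** T ** U).
Proof.
move=> hU; split=> [S T|S|].
- by rewrite !ocompA unitrK.
- by rewrite !adM adK !ocompA.
- by rewrite ocomp1; case: hU.
Qed.

Lemma sh_l12 H K L : starhom (@l12 R H K L).
Proof. by rewrite /l12; unlock; exact: sh_otl. Qed.
Lemma sh_l23 H K L : starhom (@l23 R H K L).
Proof.
have := sh_comp (sh_otr H (htens K L)) (sh_conj (as_unit H K L)).
by congr starhom; apply/funext => T; rewrite /l23 -lock.
Qed.
Lemma sh_l13 H K L : starhom (@l13 R H K L).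
Proof.
have := sh_comp (sh_otl (htens H L) K) (sh_conj (s23_unit H K L)).
by congr starhom; apply/funext => T; rewrite /l13 -lock /= ad_s23.
Qed.
End StarHom.

(** * Leg embeddings through their matrix coefficients *)

Section Coefficients.
Variable R : realType.

Section Three.
Variables H K L : hilbertType R.
Lemma l12c (T : Op (htens H K) (htens H K)) (x x' : H) (y y' : K) (z z' : L) :
  inner (tens (tens x y) z) (l12 L T (tens (tens x' y') z')) =
  inner (tens x y) (T (tens x' y')) * inner z z'.
Proof. by rewrite /l12 -lock otE inner_tens. Qed.
Lemma l23c (T : Op (htens K L) (htens K L)) (x x' : H) (y y' : K) (z z' : L) :
  inner (tens (tens x y) z) (l23 H T (tens (tens x' y') z')) =
  inner x x' * inner (tens y z) (T (tens y' z')).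
Proof.
by rewrite /l23 -lock !ocompE asE otE /ua adEr asE inner_tens.
Qed.
Lemma l13c (T : Op (htens H L) (htens H L)) (x x' : H) (y y' : K) (z z' : L) :
  inner (tens (tens x y) z) (l13 K T (tens (tens x' y') z')) =
  inner (tens x z) (T (tens x' z')) * inner y y'.
Proof.
by rewrite /l13 -lock !ocompE s23E otE -ad_s23 adEr s23E inner_tens.
Qed.
Lemma op3_ext (S T : Op (htens (htens H K) L) (htens (htens H K) L)) :
  (forall x x' y y' z z', inner (tens (tens x y) z) (S (tens (tens x' y') z')) =
    inner (tens (tens x y) z) (T (tens (tens x' y') z'))) -> S = T.
Proof. by move=> h; apply: tens_ext2 => x' y' z'; apply: vec_ext2 => x y z. Qed.
End Three.

(* Fourfold tensor products ((H1 (x) H2) (x) H3) (x) H4; an operator on three of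
   the legs, in increasing order, is amplified by e_ijk. *)
Section Four.
Variables H1 H2 H3 H4 : hilbertType R.
Notation H1234 := (htens (htens (htens H1 H2) H3) H4).
Notation B X := (Op X X).

Definition e123 (S : B (htens (htens H1 H2) H3)) : B H1234 := l12 H4 S.
Definition e124 (S : B (htens (htens H1 H2) H4)) : B H1234 := l13 H3 S.
Definition q134 := ot (s23 H1 H2 H3) (oid H4).
Definition e134 (S : B (htens (htens H1 H3) H4)) : B H1234 :=
  ad q134 ** l13 H2 S ** q134.
Definition q234 := as_ H1 (htens H2 H3) H4 ** ot (as_ H1 H2 H3) (oid H4).
Definition e234 (S : B (htens (htens H2 H3) H4)) : B H1234 :=
  ad q234 ** ot (oid H1) S ** q234.

Lemma sh_e123 : starhom e123. Proof. exact: sh_l12. Qed.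
Lemma sh_e124 : starhom e124. Proof. exact: sh_l13. Qed.
Lemma q134_unit : unit_ q134.
Proof. by apply: ot_unit; [exact: s23_unit|exact: unit_id]. Qed.
Lemma sh_e134 : starhom e134.
Proof. exact: (sh_comp (@sh_l13 R _ _ _) (sh_conj q134_unit)). Qed.
Lemma q234_unit : unit_ q234.
Proof. by apply: unit_comp (as_unit _ _ _) _; apply: ot_unit; [exact: as_unit|exact: unit_id]. Qed.
Lemma sh_e234 : starhom e234.
Proof. exact: (sh_comp (sh_otr _ _) (sh_conj q234_unit)). Qed.

Lemma e123c S x x' y y' z z' w w' :
  inner (tens (tens (tens x y) z) w) (e123 S (tens (tens (tens x' y') z') w')) =
  inner (tens (tens x y) z) (S (tens (tens x' y') z')) * inner w w'.
Proof. by rewrite /e123 /l12 -lock otE inner_tens. Qed.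
Lemma e124c S x x' y y' z z' w w' :
  inner (tens (tens (tens x y) z) w) (e124 S (tens (tens (tens x' y') z') w')) =
  inner (tens (tens x y) w) (S (tens (tens x' y') w')) * inner z z'.
Proof. exact: l13c. Qed.
Lemma e134c S x x' y y' z z' w w' :
  inner (tens (tens (tens x y) z) w) (e134 S (tens (tens (tens x' y') z') w')) =
  inner (tens (tens x z) w) (S (tens (tens x' z') w')) * inner y y'.
Proof.
rewrite /e134 !ocompE adEr (_ : forall t, q134 (tens t w) = tens (s23 _ _ _ t) w); last first.
  by move=> t; rewrite /q134 otE.
by rewrite /q134 otE !s23E; exact: l13c.
Qed.
Lemma e234c S x x' y y' z z' w w' :
  inner (tens (tens (tens x y) z) w) (e234 S (tens (tens (tens x' y') z') w')) =
  inner (tens (tens y z) w) (S (tens (tens y' z') w')) * inner x x'.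
Proof.
rewrite /e234 /q234 ocompE [in X in inner _ X]ocompE adEr !ocompE !otE !asE.
by rewrite otE inner_tens mulrC.
Qed.

Lemma op4_ext (S T : B H1234) :
  (forall x x' y y' z z' w w',
    inner (tens (tens (tens x y) z) w) (S (tens (tens (tens x' y') z') w')) =
    inner (tens (tens (tens x y) z) w) (T (tens (tens (tens x' y') z') w'))) -> S = T.
Proof. by move=> h; apply: tens_ext3 => x' y' z' w'; apply: vec_ext3 => x y z w. Qed.

Definition L12 T := e123 (l12 H3 T).
Definition L13 T := e123 (l13 H2 T).
Definition L23 T := e123 (l23 H1 T).
Definition L14 T := e124 (l13 H2 T).
Definition L24 T := e124 (l23 H1 T).
Definition L34 T := e134 (l23 H1 T).

Lemma e124_12 T : e124 (l12 H4 T) = L12 T.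
Proof. by apply: op4_ext => *; rewrite e124c e123c !l12c mulrAC. Qed.
Lemma e134_12 T : e134 (l12 H4 T) = L13 T.
Proof. by apply: op4_ext => *; rewrite e134c e123c l12c l13c mulrAC. Qed.
Lemma e134_13 T : e134 (l13 H3 T) = L14 T.
Proof. by apply: op4_ext => *; rewrite e134c e124c !l13c mulrAC. Qed.
Lemma e234_12 T : e234 (l12 H4 T) = L23 T.
Proof. by apply: op4_ext => *; rewrite e234c e123c l12c l23c; ring. Qed.
Lemma e234_13 T : e234 (l13 H3 T) = L24 T.
Proof. by apply: op4_ext => *; rewrite e234c e124c l13c l23c; ring. Qed.
Lemma e234_23 T : e234 (l23 H2 T) = L34 T.
Proof. by apply: op4_ext => *; rewrite e234c e134c !l23c; ring. Qed.

Lemma sh_L12 : starhom L12. Proof. exact: (sh_comp (@sh_l12 R _ _ _) sh_e123). Qed.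
Lemma sh_L13 : starhom L13. Proof. exact: (sh_comp (@sh_l13 R _ _ _) sh_e123). Qed.
Lemma sh_L23 : starhom L23. Proof. exact: (sh_comp (@sh_l23 R _ _ _) sh_e123). Qed.
Lemma sh_L14 : starhom L14. Proof. exact: (sh_comp (@sh_l13 R _ _ _) sh_e124). Qed.
Lemma sh_L24 : starhom L24. Proof. exact: (sh_comp (@sh_l23 R _ _ _) sh_e124). Qed.
Lemma sh_L34 : starhom L34. Proof. exact: (sh_comp (@sh_l23 R _ _ _) sh_e134). Qed.

(** Operators on disjoint legs commute: a unitary p regroups the four legs in pairs, and conjugation
    by p turns the two operators into S (x) 1 and 1 (x) T. *)
Lemma L12_34 S T : L12 S ** L34 T = L34 T ** L12 S.
Proof.
have [p p_unit pE] : exists2 p : Op H1234 (htens (htens _ _) (htens _ _)), unit_ p &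
    forall x y z w, p (tens (tens (tens x y) z) w) = tens (tens x y) (tens z w).
  exists (as_ (htens H1 H2) H3 H4); first by exact: as_unit.
  by move=> x y z w; rewrite asE.
have -> : L12 S = ad p ** ot S (oid _) ** p.
  by apply: op4_ext => *; rewrite e123c l12c !ocompE adEr !pE otE !inner_tens; ring.
have -> : L34 T = ad p ** ot (oid _) T ** p.
  by apply: op4_ext => *; rewrite e134c l23c !ocompE adEr !pE otE !inner_tens; ring.
by rewrite !ocompA !unitrK// -!(ocompA (ad p)) !ot_comp !ocomp1 !o1comp.
Qed.
Lemma L13_24 S T : L13 S ** L24 T = L24 T ** L13 S.
Proof.
have [p p_unit pE] : exists2 p : Op H1234 (htens (htens _ _) (htens _ _)), unit_ p &
    forall x y z w, p (tens (tens (tens x y) z) w) = tens (tens x z) (tens y w).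
  exists (as_ (htens H1 H3) H2 H4 ** q134); first by apply: unit_comp (as_unit _ _ _) q134_unit.
  by move=> x y z w; rewrite ocompE /q134 otE s23E asE.
have -> : L13 S = ad p ** ot S (oid _) ** p.
  by apply: op4_ext => *; rewrite e123c l13c !ocompE adEr !pE otE !inner_tens; ring.
have -> : L24 T = ad p ** ot (oid _) T ** p.
  by apply: op4_ext => *; rewrite e124c l23c !ocompE adEr !pE otE !inner_tens; ring.
by rewrite !ocompA !unitrK// -!(ocompA (ad p)) !ot_comp !ocomp1 !o1comp.
Qed.
Lemma L14_23 S T : L14 S ** L23 T = L23 T ** L14 S.
Proof.
have [p p_unit pE] : exists2 p : Op H1234 (htens (htens _ _) (htens _ _)), unit_ p &
    forall x y z w, p (tens (tens (tens x y) z) w) = tens (tens x w) (tens y z).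
  exists (ot (oid _) (oid _) ** as_ (htens H1 H4) H2 H3 ** ot (s23 H1 H2 H4) (oid H3) ** s23 (htens H1 H2) H3 H4); first by apply: unit_comp (s23_unit _ _ _); apply: unit_comp; [rewrite ot_id o1comp; exact: as_unit | apply: ot_unit (s23_unit _ _ _) (@unit_id _ _)].
  by move=> x y z w; rewrite ot_id o1comp !ocompE s23E otE s23E asE.
have -> : L14 S = ad p ** ot S (oid _) ** p.
  by apply: op4_ext => *; rewrite e124c l13c !ocompE adEr !pE otE !inner_tens; ring.
have -> : L23 T = ad p ** ot (oid _) T ** p.
  by apply: op4_ext => *; rewrite e123c l23c !ocompE adEr !pE otE !inner_tens; ring.
by rewrite !ocompA !unitrK// -!(ocompA (ad p)) !ot_comp !ocomp1 !o1comp.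
Qed.
End Four.
End Coefficients.

(** * Concrete C*-algebras *)

Section CAlgebra.
Variable R : realType.
Notation C := (Cplx R).
Implicit Types H K L : hilbertType R.

Record CA H (A : Op H H -> Prop) : Prop := {
  ca_csub : csub (@bnd R H H) A ;
  ca_mul : forall a b, A a -> A b -> A (a ** b) ;
  ca_adj : forall a, A a -> A (ad a) }.

(** Purely algebraic: only values on A are constrained, and boundedness is automatic by
    [hom_contr]. *)
Record hom H K (A : Op H H -> Prop) (phi : Op H H -> Op K K) : Prop := {
  hom_lin : forall (c : C) a b, A a -> A b -> phi (c *: a + b) = c *: phi a + phi b ;
  hom_mul : forall a b, A a -> A b -> phi (a ** b) = phi a ** phi b ;
  hom_adj : forall a, A a -> phi (ad a) = ad (phi a) }.

Definition nd H K (A : Op H H -> Prop) (phi : Op H H -> Op K K) : Prop :=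
  hdense (fun y : K => exists a x, A a /\ y = phi a x).

Section HomLin.
Variables (H K : hilbertType R) (A : Op H H -> Prop) (phi : Op H H -> Op K K).
Hypotheses (cA : CA A) (hphi : hom A phi).
Lemma CA0 : A 0. Proof. exact: csub0 (ca_csub cA). Qed.
Lemma CAD a b : A a -> A b -> A (a + b). Proof. exact: (csubD (ca_csub cA)). Qed.
Lemma CAB a b : A a -> A b -> A (a - b). Proof. exact: (csubB (ca_csub cA)). Qed.
Lemma CAZ (c : C) a : A a -> A (c *: a). Proof. exact: (csubZ c (ca_csub cA)). Qed.
Lemma hom0 : phi 0 = 0.
Proof.
have h := hom_lin hphi 1 CA0 CA0; rewrite !scale1r addr0 in h.
by apply: (addrI (phi 0)); rewrite addr0 -h.
Qed.
Lemma homD a b : A a -> A b -> phi (a + b) = phi a + phi b.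
Proof. by move=> Aa Ab; have := hom_lin hphi 1 Aa Ab; rewrite !scale1r. Qed.
Lemma homZ (c : C) a : A a -> phi (c *: a) = c *: phi a.
Proof. by move=> Aa; have := hom_lin hphi c Aa CA0; rewrite hom0 !addr0. Qed.
Lemma homB a b : A a -> A b -> phi (a - b) = phi a - phi b.
Proof.
by move=> Aa Ab; rewrite -scaleN1r homD ?homZ ?scaleN1r//; exact: CAZ.
Qed.
Lemma hom_sum I (r : seq I) (F : I -> Op H H) : (forall i, A (F i)) ->
  phi (\sum_(i <- r) F i) = \sum_(i <- r) phi (F i).
Proof.
move=> AF; elim: r => [|i r IH]; first by rewrite !big_nil hom0.
rewrite !big_cons homD ?IH//; exact: (csub_sum _ (ca_csub cA)).
Qed.
Lemma hom_sum_seq (I : eqType) (r : seq I) (F : I -> Op H H) :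
  (forall i, i \in r -> A (F i)) ->
  phi (\sum_(i <- r) F i) = \sum_(i <- r) phi (F i).
Proof.
elim: r => [|i r IH] AF; first by rewrite !big_nil hom0.
rewrite !big_cons homD ?IH//; first by move=> j jr; apply: AF; rewrite inE jr orbT.
  by apply: AF; rewrite inE eqxx.
rewrite big_seq; apply: big_ind => [|a b|j jr]; [exact: CA0|exact: CAD|].
by apply: AF; rewrite inE jr orbT.
Qed.
End HomLin.

(** The element s stands for [1 - sqrt (1 - h)], characterized without a unit so that it stays in A.
    It is the limit of the iteration of [s |-> (h + s^2) / 2], which preserves the ball of radius
    [c = 1 - d] because [(1 - d^2) + c^2 = 2 c], and contracts it by the factor c. *)
Lemma sqrt_step H (A : Op H H -> Prop) (h : Op H H) (d : C) : CA A -> A h -> ad h = h ->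
  0 < d -> d < 1 -> bnd h (1 - d ^+ 2) ->
  exists s, [/\ A s, ad s = s & s + s - s ** s = h].
Proof.
move=> cA Ah hh d0 d1 bh.
pose c : C := 1 - d.
have c0 : 0 <= c by rewrite subr_ge0 ltW.
have c1 : c < 1 by rewrite ltrBlDr ltrDl.
have d2 : 0 <= 1 - d ^+ 2.
  by rewrite subr_ge0 -(expr1n _ 2) ler_pXn2r// ?nnegrE ltW.
pose sn := fix f n := if n is m.+1 then 2^-1 *: (h + f m ** f m) else 0 : Op H H.
have snA n : A (sn n).
  elim: n => [|n IH]; first exact: CA0.
  by apply: CAZ => //; apply: CAD => //; exact: ca_mul.
have snad n : ad (sn n) = sn n.
  elim: n => [|n IH]; first exact: ad0.
  by rewrite /= adZ adD hh adM IH fmorphV/= rmorph_nat.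
have snb n : bnd (sn n) c.
  elim: n => [|n IH]; first exact: (bd0 (bnd_axioms _ _)).
  have h1 := bdD (bnd_axioms _ _) bh (bnd_comp c0 IH IH).
  have := bdZ (bnd_axioms _ _) 2^-1 h1; apply: (bd_le (bnd_axioms _ _)).
  rewrite ger0_norm ?invr_ge0// /c le_eqVlt; apply/orP; left; apply/eqP; by field.
have snd n : bnd (sn n.+1 - sn n) (c ^+ n).
  elim: n => [|n IH].
    rewrite /= subr0 ocomp0 addr0 expr0.
    have := bdZ (bnd_axioms _ _) 2^-1 bh; apply: (bd_le (bnd_axioms _ _)).
    rewrite ger0_norm ?invr_ge0// mulrC ler_pdivrMr// mul1r.
    rewrite lerBlDr; apply: (@le_trans _ _ 2); first by rewrite ler1n.
    by rewrite lerDl exprn_ge0// ltW.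
  have -> : sn n.+2 - sn n.+1 =
      2^-1 *: (sn n.+1 ** (sn n.+1 - sn n) + (sn n.+1 - sn n) ** sn n).
    rewrite -[sn n.+2]/(2^-1 *: (h + sn n.+1 ** sn n.+1)).
    rewrite -{2}[sn n.+1]/(2^-1 *: (h + sn n ** sn n)) -scalerBr; congr (_ *: _).
    by rewrite ocompBr ocompBl opprD addrACA subrr add0r addrA subrK.
  have h1 := bdD (bnd_axioms _ _) (bnd_comp c0 (snb n.+1) IH)
    (bnd_comp (exprn_ge0 n c0) IH (snb n)).
  have := bdZ (bnd_axioms _ _) 2^-1 h1; apply: (bd_le (bnd_axioms _ _)).
  rewrite ger0_norm ?invr_ge0// exprS le_eqVlt; apply/orP; left; apply/eqP; by field.
have snk n k : bnd (sn (n + k)%N - sn n) (c ^+ n * (1 - c ^+ k) / d).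
  elim: k => [|k IH].
    by rewrite addn0 subrr expr0 subrr mulr0 mul0r; apply: (bd0 (bnd_axioms _ _)).
  rewrite addnS.
  have := bd_dist (bnd_axioms _ _) (snd (n + k)%N) IH; apply: (bd_le (bnd_axioms _ _)).
  rewrite exprD exprS /c le_eqVlt; apply/orP; left; apply/eqP; field.
  by rewrite gt_eqF.
(* Bernoulli's inequality [c^n (1 + n d) <= 1] compares the geometric decay with [rate]. *)
have cn n : c ^+ n <= d^-1 * rate R n.
  have : c ^+ n * (1 + n%:R * d) <= 1.
    elim: n => [|n IH]; first by rewrite mul0r addr0 mulr1 expr0.
    apply: le_trans IH; rewrite exprSr -mulrA ler_wpM2l ?exprn_ge0// /c.
    rewrite -subr_ge0 -natr1 (_ : _ - _ = (n%:R + 1) * d ^+ 2); last by ring.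
    by rewrite mulr_ge0 ?exprn_ge0 ?(ltW d0)// addr_ge0.
  rewrite /rate -invfM -[_^-1]mul1r ler_pdivlMr ?mulr_gt0//; apply: le_trans.
  rewrite ler_wpM2l ?exprn_ge0// -natr1 mulrDr mulr1 mulrC addrC lerD2r ltW//.
have [e e0|s hs] := ocauchy (u := sn).
  have [N hN] := rate_small (mulr_gt0 (mulr_gt0 d0 d0) e0).
  have key n k : (N <= n)%N -> bnd (sn (n + k)%N - sn n) e.
    move=> Nn; apply: (bd_le (bnd_axioms _ _)) (snk n k).
    rewrite ler_pdivrMr//; apply: le_trans (_ : c ^+ n <= _).
      by rewrite ler_piMr ?exprn_ge0// lerBlDr lerDl exprn_ge0.
    apply: le_trans (cn n) _; rewrite mulrC ler_pdivrMr//.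
    rewrite (_ : e * d * d = d * d * e); last by ring.
    by apply: le_trans hN; rewrite /rate lef_pV2 ?posrE ?ltr0n// ler_nat ltnS.
  exists N => n m Nn Nm; have [nm|mn] := leqP n m.
    rewrite -(subnKC nm); apply: (bd_sub (bnd_axioms _ _)); exact: key.
  by rewrite -(subnKC (ltnW mn)); exact: key.
have sA : A s.
  apply: (csubC (ca_csub cA)) => e /hs[N hN]; exists (sn N) => //; exact: hN.
have sad : ad s = s.
  apply: bnd_eps_eq => e e0; have e2 : 0 < e / 2 by rewrite divr_gt0.
  have [N hN] := hs _ e2; rewrite [e]splitr.
  apply: (bd_dist (bnd_axioms _ _) (u := sn N)).
    by rewrite -(snad N) -adB; apply: bnd_ad; [exact: ltW | exact: hN].
  by apply: (bd_sub (bnd_axioms _ _)); exact: hN.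
exists s; split => //.
have [b b0 hb_] := op_bnd s.
apply: bnd_eps_eq => e e0.
have k0 : 0 < 4 + b + c by rewrite ltr_wpDr// ltr_wpDr.
have [N hN] := hs _ (divr_gt0 e0 k0).
set e1 := e / _ in hN; have e10 : 0 <= e1 by rewrite ltW// divr_gt0.
have -> : s + s - s ** s - h =
    (s - sn N.+1) + (s - sn N.+1) - (s ** (s - sn N) + (s - sn N) ** sn N).
  rewrite -[sn N.+1]/(2^-1 *: (h + sn N ** sn N)).
  have half (T : Op H H) : 2^-1 *: T + 2^-1 *: T = T.
    by rewrite -scalerDl (_ : 2^-1 + 2^-1 = 1 :> C) ?scale1r//; by field.
  rewrite [(s - _) + (s - _)]addrACA -opprD half ocompBr ocompBl [X in _ = _ - X]addrA subrK.
  by abel.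
have hS : bnd (s - sn N.+1) e1 by apply: hN.
have hN' : bnd (s - sn N) e1 by apply: hN.
have h2 := bdD (bnd_axioms _ _) (bnd_comp b0 hb_ hN') (bnd_comp e10 hN' (snb N)).
have := bdB (bnd_axioms _ _) (bdD (bnd_axioms _ _) hS hS) h2.
apply: (bd_le (bnd_axioms _ _)).
apply: le_trans (_ : (4 + b + c) * e1 <= _).
  rewrite -subr_ge0 (_ : _ - _ = 2 * e1); last by ring.
  by rewrite mulr_ge0.
by rewrite /e1 mulrC divfK// gt_eqF.
Qed.

(** After scaling, [h = k a^* a] lies below 1 and [1 - h] is the square of [1 - s] with s
    self-adjoint in A. Consequently [1 - phi h] is the square of [1 - phi s], hence positive, which
    bounds [phi a] in terms of k; then k tends to [b^-2]. *)
Lemma hom_contr H K (A : Op H H -> Prop) (phi : Op H H -> Op K K) a b :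
  CA A -> hom A phi -> A a -> 0 <= b -> bnd a b -> bnd (phi a) b.
Proof.
move=> cA hphi Aa b0 ba.
have [bz|bn0] := eqVneq b 0.
  have -> : a = 0.
    by apply: (bnd_eps0 (c := 1)) => // e e0; apply: (bd_le (bnd_axioms _ _)) ba; rewrite bz mul1r ltW.
  by rewrite (hom0 cA hphi); exact: (bd0 (bnd_axioms _ _)).
have b1 : 0 < b by rewrite lt_def bn0.
move=> x; rewrite -(@ler_pXn2r _ 2)// ?nnegrE ?mulr_ge0// exprMn.
apply: (@le_rate R _ _ (`|phi a x| ^+ 2)); rewrite ?exprn_ge0//.
- by apply/ger0_real/mulr_ge0; exact: exprn_ge0.
(* The shifted index ensures [d < 1]. *)
move=> n; pose d := rate R n.+1.
have d0 : 0 < d by exact: rate_gt0.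
have d1 : d < 1 by rewrite invf_lt1 ?ltr0n// ltr1n.
pose k : C := (1 - d ^+ 2) / b ^+ 2.
have d2 : 0 <= 1 - d ^+ 2.
  by rewrite subr_ge0 -(expr1n _ 2) ler_pXn2r// ?nnegrE ltW.
have k0 : 0 <= k by rewrite mulr_ge0// invr_ge0 exprn_ge0.
pose h := k *: (ad a ** a).
have Ah : A h by apply: CAZ => //; apply: ca_mul => //; exact: ca_adj.
have hh : ad h = h by rewrite /h adZ adM adK conj_Creal// ger0_real.
have bh : bnd h (1 - d ^+ 2).
  have := bdZ (bnd_axioms _ _) k (bnd_comp b0 (bnd_ad b0 ba) ba).
  by rewrite ger0_norm// /k -expr2 divfK// expf_neq0.
have [s [As sad sE]] := sqrt_step cA Ah hh d0 d1 bh.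
have phis : ad (phi s) = phi s by rewrite -(hom_adj hphi)// sad.
have phih : phi h = phi s + phi s - phi s ** phi s.
  have A2 : A (s + s) by exact: CAD.
  have A3 : A (s ** s) by exact: ca_mul.
  by rewrite -sE (homB cA hphi A2 A3) (homD hphi As As) (hom_mul hphi As As).
have phih' : phi h = k *: (ad (phi a) ** phi a).
  have A2 : A (ad a) by exact: ca_adj.
  have A3 : A (ad a ** a) by exact: ca_mul.
  by rewrite /h (homZ cA hphi k A3) (hom_mul hphi A2 Aa) (hom_adj hphi Aa).
have : 0 <= inner x x - inner x (phi h x).
  have -> : inner x x - inner x (phi h x) = inner x ((oid K - phi h) x).
    by rewrite suboE innerB.
  rewrite (_ : oid K - phi h = ad (oid K - phi s) ** (oid K - phi s)).
    by rewrite ocompE adEr inner_ge0.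
  rewrite phih adB ad1 phis ocompBr !ocompBl !ocomp1 o1comp.
  by abel.
rewrite phih' scaleoE innerZ -ad_norm inner_norm subr_ge0 /k.
rewrite mulrAC ler_pdivrMr ?exprn_gt0// => hx.
have dd : d ^+ 2 <= rate R n.
  apply: le_trans (_ : d <= _); first by rewrite expr2 ler_piMr ?ltW.
  by rewrite /d /rate lef_pV2 ?posrE ?ltr0n// ler_nat.
rewrite [_ * `|x| ^+ 2]mulrC -[leLHS](subrK (d ^+ 2 * `|phi a x| ^+ 2)).
rewrite -{1}[X in X - _]mul1r -mulrBl lerD//.
by rewrite mulrC ler_wpM2l// exprn_ge0.
Qed.

Section ApproximateUnit.
Variables (H : hilbertType R) (h : Op H H).
Hypotheses (hh : ad h = h) (h0 : forall x, 0 <= inner x (h x))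
  (h1 : forall x, inner x (h x) <= inner x x).
Let g := oid H - h.
Let gg : ad g = g. Proof. by rewrite /g adB ad1 hh. Qed.
Let gh : g ** h = h ** g. Proof. by rewrite /g ocompBl ocompBr o1comp ocomp1. Qed.
Let g0 x : 0 <= inner x (g x). Proof. by rewrite /g suboE innerB subr_ge0. Qed.
(** The powers of [g = 1 - h]; the approximate unit will be [1 - g^n]. *)
Definition opow n := iter n (ocomp g) (oid H).
Let pD m n : opow (m + n) = opow m ** opow n.
Proof. by elim: m => [|m IH]; rewrite ?o1comp// addSn /= IH ocompA. Qed.
Let pg n : opow n ** g = g ** opow n.
Proof. by rewrite -[g in LHS]ocomp1 -[g ** oid H]/(opow 1) -pD addn1. Qed.
Let padj n : ad (opow n) = opow n.
Proof. by elim: n => [|n IH]; rewrite ?ad1//= adM IH gg pg. Qed.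
Let ph n : opow n ** h = h ** opow n.
Proof.
have -> : h = oid H - g by rewrite /g; abel.
by rewrite ocompBr ocompBl pg ocomp1 o1comp.
Qed.
Let gh0 x : 0 <= inner x (g (h x)).
Proof.
have gp : g + h = oid H by rewrite /g; abel.
have E : g ** h = g ** h ** g + h ** g ** h.
  by rewrite -[LHS]ocomp1 -gp ocompDr; congr (_ + _); rewrite gh.
rewrite -ocompE E addoE innerD !ocompE (sa_inner _ _ gg) [X in _ + X](sa_inner _ _ hh).
by rewrite addr_ge0.
Qed.
Let p n x := inner x (opow n x).
Let d n x := inner x ((opow n ** h) x).
Let dE n x : d n x = p n x - p n.+1 x.
Proof.
rewrite /d /p -innerB -suboE; congr (inner x (opf _ x)).
by rewrite -[opow n.+1]/(g ** opow n) -pg /g ocompBr ocomp1; abel.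
Qed.
Let even_odd n : exists k, n = (k + k)%N \/ n = (k + k).+1%N.
Proof.
exists n./2; rewrite addnn -{1 3}(odd_double_half n); case: (odd n); [right|left] => //.
Qed.
Let sandwich k T x : inner x ((opow k ** T ** opow k) x) = inner (opow k x) (T (opow k x)).
Proof. by rewrite !ocompE -{1}padj adEr. Qed.
Let d0 n x : 0 <= d n x.
Proof.
rewrite /d; have [k [->|->]] := even_odd n.
  by rewrite pD -ocompA ph ocompA sandwich.
rewrite -addn1 addnC pD [opow 1]ocomp1 pD.
rewrite [g ** _]ocompA -pg -!ocompA [opow k ** h]ph !ocompA -[opow k ** g ** h]ocompA sandwich.
exact: gh0.
Qed.
Let d_decr n x : d n.+1 x <= d n x.
Proof.
rewrite -subr_ge0 /d -innerB -suboE.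
have -> : opow n ** h - opow n.+1 ** h = opow n ** (h ** h).
  rewrite -[opow n.+1]/(g ** opow n) -pg /g ocompBr ocomp1 ocompBl -!ocompA; abel.
have [k [->|->]] := even_odd n.
  have phh : opow k ** (h ** h) = (h ** h) ** opow k.
    by rewrite ocompA ph -ocompA ph ocompA.
  by rewrite pD -ocompA phh ocompA sandwich ocompE (sa_inner _ _ hh) inner_ge0.
have -> : opow (k + k).+1 ** (h ** h) = opow k ** (h ** g ** h) ** opow k.
  have phh : opow k ** (h ** h) = (h ** h) ** opow k.
    by rewrite ocompA ph -ocompA ph ocompA.
  have E1 : opow (k + k).+1 = opow k ** g ** opow k.
    by rewrite -[LHS]/(g ** opow (k + k)) pD ocompA -pg.
  by rewrite E1 -ocompA phh !ocompA -[opow k ** g ** h]ocompA gh !ocompA.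
by rewrite sandwich !ocompE (sa_inner _ _ hh).
Qed.
(** With [d m = (x | g^m h x)] the left side is [d (2 n)]. It is at most each of [d 0, ..., d n],
    whose telescoping sum is at most [(x | x)]. *)
Lemma opow_small n x : inner (opow n x) (h (opow n x)) <= rate R n * inner x x.
Proof.
have -> : inner (opow n x) (h (opow n x)) = d (n + n) x.
  by rewrite /d pD -ocompA ph ocompA sandwich.
have dd m : d (n + n) x <= d m x \/ (n + n < m)%N.
  have [le|lt] := leqP m (n + n)%N; [left|by right].
  elim: (n + n)%N le => [|k IH]; first by rewrite leqn0 => /eqP ->.
  rewrite leq_eqVlt => /orP[/eqP ->//|]; rewrite ltnS => /IH.
  by apply: le_trans; exact: d_decr.
have tel m : \sum_(i < m) d i x = inner x x - p m x.
  elim: m => [|m IH]; first by rewrite big_ord0 /p subrr.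
  by rewrite big_ord_recr/= IH dE addrA subrK.
have p0 m : 0 <= p m x.
  rewrite /p; have [k [->|->]] := even_odd m.
    by rewrite pD -[opow k ** opow k]/(opow k ** opow k) -[X in X ** _]ocomp1 sandwich inner_ge0.
  rewrite -[opow (k + k).+1]/(g ** opow (k + k)) pD ocompA -pg sandwich; exact: g0.
have : n.+1%:R * d (n + n) x <= inner x x.
  apply: le_trans (_ : \sum_(i < n.+1) d i x <= _); last by rewrite tel lerBlDr lerDl.
  rewrite mulr_natl -[n.+1 in leLHS]card_ord -sumr_const; apply: ler_sum => i _.
  have [//|] := dd i; rewrite ltnNge => /negP[].
  by apply: leq_trans (leq_addr _ _); rewrite -ltnS.
by rewrite /rate -ler_pdivlMl ?ltr0n// .
Qed.
(** This amounts to [(x | g^(2 n) x) <= (x | g^n x)], the decrease of the powers. *)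
Lemma opow_proj n x : `|x - opow n x| ^+ 2 + `|opow n x| ^+ 2 <= `|x| ^+ 2.
Proof.
have le : p (n + n) x <= p n x.
  elim: {2}n => [|k IH]; first by rewrite addn0.
  by apply: le_trans IH; rewrite addnS -subr_ge0 -dE.
have pn : `|opow n x| ^+ 2 = p (n + n) x.
  by rewrite -inner_norm /p pD ocompE -{3}padj adEr.
rewrite pn -!inner_norm innerB !innerBl [inner (opow n x) (opow n x)]inner_norm pn.
rewrite -{1}(padj n) adE -/(p n x) -subr_ge0.
rewrite (_ : _ - _ = 2 * (p n x - p (n + n) x)); last by ring.
by rewrite mulr_ge0// subr_ge0.
Qed.
End ApproximateUnit.

(** Here [e = 1 - (1 - h)^n] with h a positive multiple of the sum of all [a a^* + a^* a], so that
    [opow_small] controls all a in F and their adjoints at once. The third property is stronger than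
    [|e| <= 1]: it is the Pythagorean estimate on which [tail_small] relies. *)
Lemma approx_unit H (A : Op H H -> Prop) (F : seq (Op H H)) (eps : C) :
  CA A -> (forall a, a \in F -> A a) -> 0 < eps ->
  exists e, [/\ A e, ad e = e, forall x, `|e x| ^+ 2 + `|x - e x| ^+ 2 <= `|x| ^+ 2 &
    forall a, a \in F -> bnd (a - e ** a) eps /\ bnd (a - a ** e) eps].
Proof.
move=> cA AF eps0.
pose h0 := \sum_(a <- F) (a ** ad a + ad a ** a).
have h0A : A h0.
  rewrite /h0 big_seq; apply: big_ind => [|a b Aa Ab|a /AF Aa]; [exact: CA0|exact: CAD|].
  by apply: CAD => //; apply: ca_mul => //; exact: ca_adj.
have h0ad : ad h0 = h0.
  rewrite /h0; elim: (F) => [|a r IH]; first by rewrite big_nil ad0.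
  by rewrite big_cons adD IH adD !adM !adK.
have h0p x : 0 <= inner x (h0 x).
  rewrite /h0 sumoE inner_sumr; apply: sumr_ge0 => a _.
  by rewrite addoE innerD -ad_norm -ad_norm' addr_ge0// exprn_ge0.
have h0le a x : a \in F -> `|ad a x| ^+ 2 <= inner x (h0 x) /\ `|a x| ^+ 2 <= inner x (h0 x).
  move=> aF; rewrite /h0 (big_rem a aF) addoE innerD.
  have : 0 <= inner x ((\sum_(y <- rem a F) (y ** ad y + ad y ** y)) x).
    rewrite sumoE inner_sumr; apply: sumr_ge0 => b _.
    by rewrite addoE innerD -ad_norm -ad_norm' addr_ge0// exprn_ge0.
  rewrite addoE innerD -ad_norm -ad_norm' => hr.
  by split; [rewrite -addrA lerDl addr_ge0// exprn_ge0 | rewrite addrAC lerDr addr_ge0// exprn_ge0].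
have [b b0 hb_] := op_bnd h0; pose c : C := b + 1.
have c0 : 0 < c by rewrite ltr_wpDl.
pose h := c^-1 *: h0.
have Ah : A h by exact: CAZ.
have hh : ad h = h by rewrite /h adZ h0ad conj_Creal// ger0_real// invr_ge0 ltW.
have hp x : 0 <= inner x (h x) by rewrite scaleoE innerZ mulr_ge0// invr_ge0 ltW.
have hle x : inner x (h x) <= inner x x.
  rewrite scaleoE innerZ mulrC ler_pdivrMr// inner_norm expr2.
  apply: le_trans (real_ler_norm (ger0_real (h0p x))) _.
  apply: le_trans (CS _ _) _; rewrite -mulrA ler_wpM2l// mulrC.
  by apply: le_trans (hb_ x) _; rewrite ler_wpM2r// lerDl.
have [n hn] := rate_small (divr_gt0 (exprn_gt0 2 eps0) c0).
have powA k : A (oid H - opow h k).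
  elim: k => [|k IH]; first by rewrite subrr; exact: CA0.
  have -> : oid H - opow h k.+1 = (oid H - opow h k) + h - h ** (oid H - opow h k).
    by rewrite -[opow h k.+1]/((oid H - h) ** opow h k) ocompBl o1comp ocompBr ocomp1; abel.
  by apply: CAB => //; [exact: CAD|exact: ca_mul].
have gg k : ad (opow h k) = opow h k.
  have pg m : opow h m ** (oid H - h) = (oid H - h) ** opow h m.
    elim: m => [|m IH]; first by rewrite ocomp1 o1comp.
    by rewrite -[opow h m.+1]/((oid H - h) ** opow h m) -ocompA IH.
  elim: k => [|k IH]; first exact: ad1.
  by rewrite -[opow h k.+1]/((oid H - h) ** opow h k) adM IH adB ad1 hh pg.
exists (oid H - opow h n); split => //.
- by rewrite adB ad1 gg.
- move=> x; have := opow_proj hh hp hle n x.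
  by rewrite suboE oidE (_ : x - (x - opow h n x) = opow h n x)//; vabel.
have small (T : Op H H) : (forall x, `|T x| ^+ 2 <= inner x (h0 x)) -> bnd (T ** opow h n) eps.
  move=> hT x; rewrite -(@ler_pXn2r _ 2)// ?nnegrE ?mulr_ge0 ?(ltW eps0)//.
  rewrite ocompE; apply: le_trans (hT _) _.
  have -> : inner (opow h n x) (h0 (opow h n x)) = c * inner (opow h n x) (h (opow h n x)).
    by rewrite scaleoE innerZ mulrA mulfV ?mul1r// gt_eqF.
  rewrite exprMn -inner_norm -ler_pdivlMl//. apply: le_trans (opow_small hh hle n x) _.
  by rewrite mulrA [c^-1 * _]mulrC ler_wpM2r// inner_ge0.
move=> a aF; split.
  have -> : a - (oid H - opow h n) ** a = ad (ad a ** opow h n).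
    by rewrite adM adK gg ocompBl o1comp; abel.
  by apply: bnd_ad (ltW eps0) _; apply: small => x; case: (h0le a x aF).
have -> : a - a ** (oid H - opow h n) = a ** opow h n.
  by rewrite ocompBr ocomp1; abel.
by apply: small => x; case: (h0le a x aF).
Qed.

Lemma bnd_proj H (e : Op H H) : (forall x, `|e x| ^+ 2 + `|x - e x| ^+ 2 <= `|x| ^+ 2) -> bnd e 1.
Proof.
move=> h x; rewrite mul1r -(@ler_pXn2r _ 2)// ?nnegrE//.
by apply: le_trans (h x); rewrite lerDl exprn_ge0.
Qed.

(** T is forced to send [phi a x] to [phi (m a) x]. For finitely many a, an approximate unit e makes
    [phi (m a)] close to [phi (m e) phi a], and [m e] has the bound of m. *)
Lemma ext_ex H K (A : Op H H -> Prop) (phi : Op H H -> Op K K) (m : Op H H) :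
  CA A -> hom A phi -> nd A phi -> (forall a, A a -> A (m ** a)) ->
  exists2 T : Op K K, (forall b, 0 <= b -> bnd m b -> bnd T b) &
    forall a, A a -> T ** phi a = phi (m ** a).
Proof.
move=> cA hphi nphi mA.
pose G (p : K * K) := exists a x, A a /\ p = (phi a x, phi (m ** a) x).
have dG : hdense (fun x => exists y, G (x, y)).
  apply: dense_sub nphi _ => _ [a [x [Aa ->]]].
  by exists (phi (m ** a) x), a, x.
have spG p : sp G p -> exists s : seq (Op H H * K), (forall q, q \in s -> A q.1) /\
    p = (\sum_(q <- s) phi q.1 q.2, \sum_(q <- s) phi (m ** q.1) q.2).
  elim=> [|c _ q [a [x [Aa ->]]] _ [s [sA ->]]]; first by exists [::]; rewrite !big_nil.
  exists ((a, c *: x) :: s); split; last by rewrite !big_cons/= !opZ.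
  by move=> q'; rewrite inE => /orP[/eqP ->//|]; exact: sA.
have bG b : 0 <= b -> bnd m b -> forall p, sp G p -> `|p.2| <= b * `|p.1|.
  move=> b0 hb_ p /spG[s [sA ->]] /=.
  pose c : C := b * \sum_(q <- s) `|q.2|.
  have c0 : 0 <= c by rewrite mulr_ge0// sumr_ge0.
  apply: (@le_eps _ _ _ c) => //; first by rewrite mulr_ge0.
  move=> eps eps0; have [|e [Ae ead e1 eF]] := @approx_unit _ A [seq q.1 | q <- s] eps cA _ eps0.
    by move=> _ /mapP[q qs ->]; exact: sA.
  have Ame : A (m ** e) by exact: mA.
  rewrite -(subrK (phi (m ** e) (\sum_(q <- s) phi q.1 q.2)) (\sum_(q <- s) phi (m ** q.1) q.2)).
  apply: le_trans (ler_normD _ _) _; rewrite addrC; apply: lerD.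
    apply: (@hom_contr _ _ _ phi (m ** e) b cA hphi Ame b0).
    by rewrite -[b]mulr1; apply: bnd_comp => //; exact: bnd_proj.
  rewrite op_sum -sumrB big_seq; apply: le_trans (ler_norm_sum _ _ _) _.
  rewrite /c mulr_sumr mulr_suml [leRHS]big_seq; apply: ler_sum => q qs.
  have Aq := sA q qs.
  rewrite -ocompE -(hom_mul hphi)// -suboE -(homB cA hphi); [|exact: mA|exact: ca_mul].
  have -> : m ** q.1 - m ** e ** q.1 = m ** (q.1 - e ** q.1) by rewrite ocompBr ocompA.
  rewrite mulrAC; apply: (@hom_contr _ _ _ phi _ (b * eps) cA hphi).
  - by apply: mA; apply: CAB => //; exact: ca_mul.
  - by rewrite mulr_ge0// ltW.
  - by apply: bnd_comp => //; have [] := eF q.1 (map_f _ qs).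
have [c c0 hc] := op_bnd m.
have [T bT hT] := op_extend c0 (bG c c0 hc) dG.
have TE a : A a -> T ** phi a = phi (m ** a).
  by move=> Aa; apply: op_ext => x; apply: hT; exists a, x.
exists T => // b b0 hb_.
have [T' bT' hT'] := op_extend b0 (bG b b0 hb_) dG.
suff -> : T = T' by [].
apply: (op_ext_dense dG) => s [y Gy].
by rewrite (hT _ _ Gy) (hT' _ _ Gy).
Qed.

Lemma nd_eq H K L (A : Op H H -> Prop) (phi : Op H H -> Op K K) (S T : Op K L) :
  nd A phi -> (forall a, A a -> S ** phi a = T ** phi a) -> S = T.
Proof.
move=> nphi h; apply: (op_ext_dense nphi) => _ [a [x [Aa ->]]].
by rewrite -!ocompE h.
Qed.

(** Every vector is nearly fixed by [phi e] for some contractive e in A, so T is tested on the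
    products [T ** phi e] only. *)
Lemma nd_bnd H K L (A : Op H H -> Prop) (phi : Op H H -> Op K K) (T : Op K L) c :
  CA A -> hom A phi -> nd A phi -> 0 <= c ->
  (forall a, A a -> bnd a 1 -> bnd (T ** phi a) c) -> bnd T c.
Proof.
move=> cA hphi nphi c0 h.
have [b b0 hb_] := op_bnd T.
move=> x; apply: (@le_eps _ _ _ (b * 3)); rewrite ?mulr_ge0// => eps eps0.
have [w sw xw] := nphi x _ eps0.
have [s [sA ws]] : exists s : seq (Op H H * K), (forall q, q \in s -> A q.1) /\
    w = \sum_(q <- s) phi q.1 q.2.
  elim: sw {xw} => [|d _ q [a [y [Aa ->]]] _ [s [sA ->]]]; first by exists [::]; rewrite big_nil.
  exists ((a, d *: y) :: s); split; last by rewrite big_cons/= opZ.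
  by move=> q'; rewrite inE => /orP[/eqP ->//|]; exact: sA.
pose d : C := \sum_(q <- s) `|q.2|.
have d0 : 0 <= d by rewrite sumr_ge0.
have d1 : 0 < d + 1 by rewrite ltr_wpDl.
have eps1 : 0 < eps / (d + 1) by rewrite divr_gt0.
have [|e [Ae ead e1 eF]] := @approx_unit _ A [seq q.1 | q <- s] _ cA _ eps1.
  by move=> _ /mapP[q qs ->]; exact: sA.
have be : bnd e 1 by exact: bnd_proj.
have we : `|w - phi e w| <= eps.
  rewrite ws op_sum -sumrB big_seq; apply: le_trans (ler_norm_sum _ _ _) _.
  apply: le_trans (_ : \sum_(q <- s) eps / (d + 1) * `|q.2| <= _).
    rewrite [leRHS]big_seq; apply: ler_sum => q qs; have Aq := sA q qs.
    rewrite -ocompE -(hom_mul hphi)// -suboE -(homB cA hphi)//; last exact: ca_mul.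
    apply: (@hom_contr _ _ _ phi _ _ cA hphi); first by apply: CAB => //; exact: ca_mul.
      exact: ltW.
    by have [] := eF q.1 (map_f _ qs).
  rewrite -mulr_sumr -/d mulrAC ler_pdivrMr// ler_wpM2l ?(ltW eps0)// lerDl//.
have -> : T x = T (phi e x) + T ((x - w) + (w - phi e w) + (phi e w - phi e x)).
  by rewrite -opD; congr (opf T _); vabel.
apply: le_trans (ler_normD _ _) _.
apply: le_trans (lerD (h e Ae be x) (hb_ _)) _; rewrite lerD2l.
apply: le_trans (_ : b * (eps + eps + eps) <= _).
  rewrite ler_wpM2l//; apply: le_trans (ler_normD _ _) _.
  apply: lerD; first by apply: le_trans (ler_normD _ _) _; apply: lerD.
  rewrite -opB; apply: le_trans (hom_contr cA hphi Ae ler01 be _) _.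
  by rewrite mul1r distrC.
by rewrite le_eqVlt; apply/orP; left; apply/eqP; ring.
Qed.

(** * Matrix ampliations and complete contractivity *)

Section Ampliation.
Variables (H K L : hilbertType R) (A : Op H H -> Prop) (phi : Op H H -> Op K K).
Hypotheses (cA : CA A) (hphi : hom A phi).
Variables (n : nat) (e : nat -> L).
Hypothesis on : orthonormal n e.

Definition oproj H : Op (htens H L) (htens H L) := \sum_(i < n) ir H (e i) ** ad (ir H (e i)).
(** The matrix algebra [M_n(A)], realized as a corner of the operators on H (x) L that is cut out by
    an orthonormal family of L; [phin] is phi applied to the entries. *)
Definition En (S : Op (htens H L) (htens H L)) :=
  oproj H ** S ** oproj H = S /\ forall j k : 'I_n, A (ad (ir H (e j)) ** S ** ir H (e k)).
Definition phin (S : Op (htens H L) (htens H L)) : Op (htens K L) (htens K L) :=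
  \sum_(j < n) \sum_(k < n) ir K (e j) ** phi (ad (ir H (e j)) ** S ** ir H (e k)) ** ad (ir K (e k)).

Let irr (V : hilbertType R) (i j : 'I_n) : ad (ir V (e i)) ** ir V (e j) = (i == j)%:R *: oid V.
Proof.
by apply: op_ext => x; rewrite ocompE irE ad_irE on// scaleoE.
Qed.
Let irp (V : hilbertType R) (i : 'I_n) : oproj V ** ir V (e i) = ir V (e i).
Proof.
rewrite /oproj ocomp_suml (bigD1 i)//= big1 => [|j ji].
  by rewrite -ocompA irr eqxx scale1r ocomp1 addr0.
by rewrite -ocompA irr (negbTE ji) scale0r ocomp0.
Qed.
Lemma oproj_ir V (i : 'I_n) : oproj V ** ir V (e i) = ir V (e i).
Proof. exact: irp. Qed.
Lemma oproj_ad V : ad (oproj V) = oproj V.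
Proof.
rewrite /oproj; elim: (index_enum _) => [|i r IH]; first by rewrite !big_nil ad0.
by rewrite !big_cons adD IH adM adK.
Qed.
Lemma oproj_idem V : oproj V ** oproj V = oproj V.
Proof.
rewrite {2 3}/oproj ocomp_sumr; apply: eq_bigr => i _.
by rewrite ocompA irp.
Qed.
Lemma oproj_bnd V : bnd (oproj V) 1.
Proof.
move=> x; rewrite mul1r; have [->|x0] := eqVneq `|oproj V x| 0; first exact: normr_ge0.
have E : inner x (oproj V x) = `|oproj V x| ^+ 2 by rewrite ad_norm oproj_ad oproj_idem.
by have := CS x (oproj V x); rewrite E normrX normr_id expr2 ler_pM2r// lt_def x0/=.
Qed.
Let entryM S T (j k : 'I_n) : En T -> ad (ir H (e j)) ** (S ** T) ** ir H (e k) =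
  \sum_(i < n) (ad (ir H (e j)) ** S ** ir H (e i)) ** (ad (ir H (e i)) ** T ** ir H (e k)).
Proof.
move=> [T1 _]; rewrite -{1}T1 -!ocompA irp {1}/oproj ocomp_suml !ocomp_sumr.
by apply: eq_bigr => i _; rewrite !ocompA.
Qed.
Let adir_phin T (i : 'I_n) : ad (ir K (e i)) ** phin T =
  \sum_(k < n) phi (ad (ir H (e i)) ** T ** ir H (e k)) ** ad (ir K (e k)).
Proof.
rewrite /phin ocomp_sumr (bigD1 i)//= [X in _ + X]big1 => [|j ji].
  rewrite addr0 ocomp_sumr; apply: eq_bigr => k _.
  by rewrite !ocompA irr eqxx scale1r o1comp.
rewrite ocomp_sumr big1// => k _.
by rewrite !ocompA irr eq_sym (negbTE ji) scale0r !o0comp.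
Qed.
Lemma En_CA : CA En.
Proof.
have BH := bnd_axioms (htens H L) (htens H L).
split.
- split.
  + split; first by rewrite ocomp0 o0comp.
    by move=> j k; rewrite ocomp0 o0comp; exact: CA0.
  + move=> c S T [S1 S2] [T1 T2]; split.
      by rewrite ocompDr ocompDl ocompZr ocompZl S1 T1.
    by move=> j k; rewrite ocompDr ocompDl ocompZr ocompZl; exact: (csubL (ca_csub cA) c (S2 j k) (T2 j k)).
  + move=> S hS; split.
      apply: bnd_eps_eq => d d0; have d2 : 0 < d / 2 by rewrite divr_gt0.
      have [T [T1 T2] ST] := hS _ d2; rewrite [d]splitr.
      apply: (bd_dist BH (u := T)); last exact: (bd_sub BH).
      rewrite -T1 -ocompBl -ocompBr -[d / 2]mul1r -[1 * _]mulr1.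
      apply: bnd_comp; [by rewrite mul1r ltW| |exact: oproj_bnd].
      by apply: bnd_comp => //; exact: oproj_bnd.
    move=> j k; apply: (csubC (ca_csub cA)) => d d0.
    have [T [T1 T2] ST] := hS _ d0; exists (ad (ir H (e j)) ** T ** ir H (e k)) => //.
    rewrite -ocompBl -ocompBr.
    have be (i : 'I_n) : bnd (ir H (e i)) 1.
      move=> x; apply: le_trans (bnd_ir _ _) _; rewrite ler_wpM2r//.
      by rewrite -(@ler_pXn2r _ 2)// ?nnegrE// -inner_norm on// eqxx expr1n.
    rewrite -[d]mul1r -[1 * _]mulr1; apply: bnd_comp => //; first by rewrite mul1r ltW.
    by apply: bnd_comp => //; apply: bnd_ad.
- move=> S T [S1 S2] [T1 T2]; split.
    have SP : oproj H ** S = S by rewrite -S1 !ocompA oproj_idem.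
    have TP : T ** oproj H = T by rewrite -T1 -!ocompA oproj_idem.
    by rewrite !ocompA SP -ocompA TP.
  move=> j k; rewrite entryM//.
  by apply: csub_sum (ca_csub cA) _ => i; apply: ca_mul.
- move=> S [S1 S2]; split.
    by rewrite -{2}S1 !adM oproj_ad ocompA.
  move=> j k; have -> : ad (ir H (e j)) ** ad S ** ir H (e k) = ad (ad (ir H (e k)) ** S ** ir H (e j)).
    by rewrite !adM adK ocompA.
  exact: ca_adj.
Qed.
Lemma phin_hom : hom En phin.
Proof.
split.
- move=> c S T [S1 S2] [T1 T2]; rewrite /phin scaler_sumr -big_split; apply: eq_bigr => j _.
  rewrite scaler_sumr -big_split; apply: eq_bigr => k _ /=.
  rewrite ocompDr ocompDl ocompZr ocompZl (hom_lin hphi c (S2 j k) (T2 j k)).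
  by rewrite ocompDr ocompDl ocompZr ocompZl.
- move=> S T ES ET; have [[S1 S2] [T1 T2]] := (ES, ET).
  rewrite [in RHS]/phin ocomp_suml {1}/phin; apply: eq_bigr => j _.
  rewrite ocomp_suml.
  transitivity (\sum_(k < n) \sum_(i < n) ir K (e j) **
    phi (ad (ir H (e j)) ** S ** ir H (e i)) **
    (phi (ad (ir H (e i)) ** T ** ir H (e k)) ** ad (ir K (e k)))).
    apply: eq_bigr => k _; rewrite entryM// (hom_sum cA hphi) => [|i]; last exact: ca_mul.
    rewrite ocomp_sumr ocomp_suml; apply: eq_bigr => i _.
    by rewrite (hom_mul hphi)// !ocompA.
  rewrite exchange_big; apply: eq_bigr => i _ /=.
  by rewrite -[RHS]ocompA adir_phin ocomp_sumr.
- move=> S [S1 S2]; rewrite /phin ad_sum exchange_big /=; apply: eq_bigr => j _.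
  rewrite ad_sum; apply: eq_bigr => k _.
  rewrite !adM adK -ocompA -(hom_adj hphi)//; congr (_ ** (phi _ ** _)).
  by rewrite !adM adK ocompA.
Qed.
End Ampliation.

Lemma dense_bnd_vec H (S : H -> Prop) (v : H) c : 0 <= c -> hdense S ->
  (forall x, sp S x -> `|inner x v| <= c * `|x|) -> `|v| <= c.
Proof.
move=> c0 dS h.
have [v0|v0] := eqVneq `|v| 0; first by rewrite v0.
rewrite -(ler_pM2l (x := `|v|)); last by rewrite lt_def v0/=.
rewrite -expr2 -inner_norm -[inner v v]ger0_norm ?inner_ge0//.
apply: (@le_eps _ _ _ (`|v| + c)); rewrite ?mulr_ge0 ?addr_ge0// => eps eps0.
have [w sw vw] := dS v _ eps0.
rewrite -(subrK w v) in vw *.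
have -> : inner (v - w + w) (v - w + w) = inner (v - w) v + inner w v.
  by rewrite subrK -innerDl subrK.
rewrite subrK in vw *; apply: le_trans (ler_normD _ _) _.
apply: le_trans (lerD (CS _ _) (h _ sw)) _.
apply: le_trans (_ : eps * `|v| + c * (`|v| + eps) <= _).
  apply: lerD; first by rewrite ler_wpM2r.
  rewrite ler_wpM2l// -{1}(subrK v w) addrC; apply: le_trans (ler_normD _ _) _.
  by rewrite lerD2l distrC.
by rewrite le_eqVlt; apply/orP; left; apply/eqP; ring.
Qed.

Lemma dense_bnd H K (S : H -> Prop) (T : Op H K) c : 0 <= c -> hdense S ->
  (forall x, sp S x -> `|T x| <= c * `|x|) -> bnd T c.
Proof.
move=> c0 dS h x; have [b b0 hb_] := op_bnd T.
apply: (@le_eps _ _ _ (b + c)); rewrite ?mulr_ge0 ?addr_ge0// => eps eps0.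
have [w sw xw] := dS x _ eps0.
have -> : T x = T (x - w) + T w by rewrite -opD subrK.
apply: le_trans (ler_normD _ _) _; apply: le_trans (lerD (hb_ _) (h _ sw)) _.
apply: le_trans (_ : b * eps + c * (`|x| + eps) <= _).
  apply: lerD; first by rewrite ler_wpM2l.
  rewrite ler_wpM2l// -{1}(subrK x w) addrC; apply: le_trans (ler_normD _ _) _.
  by rewrite lerD2l distrC.
by rewrite le_eqVlt; apply/orP; left; apply/eqP; ring.
Qed.

(** Two finite sums of tensors involve only finitely many second legs. An orthonormal family
    spanning them cuts out a corner [M_n(A)], to which [hom_contr] applies with [phin]. This is the
    complete contractivity of phi. *)
Lemma amp_contr H K L (A : Op H H -> Prop) (phi : Op H H -> Op K K)
    (l : seq (Op H H * Op L L)) c :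
  CA A -> hom A phi -> (forall p, p \in l -> A p.1) -> 0 <= c ->
  bnd (\sum_(p <- l) ot p.1 p.2) c -> bnd (\sum_(p <- l) ot (phi p.1) p.2) c.
Proof.
move=> cA hphi lA c0; set T := \sum_(p <- l) ot p.1 p.2; set T' := \sum_(p <- l) _.
move=> bT.
pose S (u : htens K L) := exists x y, u = tens x y.
have dS : hdense S by exact: dense_tens.
have spS u : sp S u -> exists s : seq (K * L), u = \sum_(q <- s) tens q.1 q.2.
  elim=> [|d _ v [x [y ->]] _ [s ->]]; first by exists [::]; rewrite big_nil.
  by exists ((d *: x, y) :: s); rewrite big_cons tensZl.
apply: (dense_bnd c0 dS) => u /spS[s us].
apply: (dense_bnd_vec _ dS); first by rewrite mulr_ge0.
move=> v /spS[t vt].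
have [n [e [on he]]] := gram_schmidt ([seq q.2 | q <- s] ++ [seq q.2 | q <- t]).
have fixP r w : (forall q, q \in r -> q.2 \in [seq q.2 | q <- s] ++ [seq q.2 | q <- t]) ->
    w = \sum_(q <- r) tens q.1 q.2 -> oproj n e K w = w.
  move=> hr ->; rewrite op_sum big_seq [RHS]big_seq; apply: eq_bigr => q qr.
  rewrite /oproj sumoE {2}(he q.2 (hr q qr)) tens_sumr; apply: eq_bigr => i _.
  by rewrite ocompE ad_irE irE tensZl tensZr.
have Pu : oproj n e K u = u.
  by apply: fixP us => q qs; rewrite mem_cat map_f.
have Pv : oproj n e K v = v.
  by apply: fixP vt => q qs; rewrite mem_cat; apply/orP; right; exact: map_f.
pose P := oproj n e H; pose P' := oproj n e K.
have Pad : ad P = P by exact: oproj_ad.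
have entry (V : hilbertType R) (f : Op H H -> Op V V) (j k : nat) :
    ad (ir V (e j)) ** (\sum_(p <- l) ot (f p.1) p.2) ** ir V (e k) =
    \sum_(p <- l) inner (e j) (p.2 (e k)) *: f p.1.
  rewrite ocomp_sumr ocomp_suml; apply: eq_bigr => p _.
  rewrite -ocompA ot_ir; apply: op_ext => x.
  by rewrite !ocompE irE ad_irE scaleoE.
have EnT : En A n e (P ** T ** P).
  split; first by rewrite !ocompA oproj_idem// -!ocompA oproj_idem.
  move=> j k; have -> : ad (ir H (e j)) ** (P ** T ** P) ** ir H (e k) =
     ad (ir H (e j)) ** T ** ir H (e k).
    have h1 (i : 'I_n) : P ** ir H (e i) = ir H (e i) by exact: oproj_ir.
    by rewrite -!ocompA h1 !ocompA -{1}Pad -adM h1.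
  rewrite (entry _ id) big_seq; apply: big_ind => [|a b|p pl]; [exact: CA0|exact: CAD|].
  by apply: CAZ => //; exact: lA.
have bPT : bnd (P ** T ** P) c.
  rewrite -[c]mul1r -[1 * _]mulr1; apply: bnd_comp; [by rewrite mul1r| |exact: oproj_bnd].
  by apply: bnd_comp => //; exact: oproj_bnd.
have := hom_contr (En_CA cA on) (phin_hom cA hphi on) EnT c0 bPT.
have -> : phin phi n e (P ** T ** P) = P' ** T' ** P'.
  have -> : P' ** T' ** P' = \sum_(j < n) \sum_(k < n)
      ir K (e j) ** (ad (ir K (e j)) ** T' ** ir K (e k)) ** ad (ir K (e k)).
    rewrite /P' /oproj !ocomp_suml; apply: eq_bigr => j _.
    by rewrite ocomp_sumr; apply: eq_bigr => k _; rewrite !ocompA.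
  rewrite /phin; apply: eq_bigr => j _; apply: eq_bigr => k _.
  congr (_ ** _ ** _).
  have -> : ad (ir H (e j)) ** (P ** T ** P) ** ir H (e k) =
     ad (ir H (e j)) ** T ** ir H (e k).
    have h1 (i : 'I_n) : P ** ir H (e i) = ir H (e i) by exact: oproj_ir.
    by rewrite -!ocompA h1 !ocompA -{1}Pad -adM h1.
  rewrite (entry _ id) (entry _ phi) (hom_sum_seq cA hphi) => [|p pl]; last by apply: CAZ => //; exact: lA.
  by rewrite big_seq [RHS]big_seq; apply: eq_bigr => p pl; apply: (homZ cA hphi); exact: lA.
move=> /(_ u) => h.
apply: le_trans (_ : `|inner v ((P' ** T' ** P') u)| <= _).
  by rewrite !ocompE Pu (sa_inner _ _ (oproj_ad _ _ _)) Pv.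
by apply: le_trans (CS _ _) _; rewrite mulrC ler_wpM2r.
Qed.

Definition at_ H K (A : Op H H -> Prop) (B : Op K K -> Prop) : Op (htens H K) (htens H K) -> Prop :=
  cs (@bnd R _ _) (fun t => exists a b, [/\ A a, B b & t = ot a b]).

Lemma at_in H K (A : Op H H -> Prop) (B : Op K K -> Prop) a b : A a -> B b -> at_ A B (ot a b).
Proof. by move=> Aa Bb; apply: (cs_in (bnd_axioms _ _)); exists a, b. Qed.

Lemma csub_compl H K L (P : Op H L -> Prop) (S : Op K L) : csub (@bnd R _ _) P ->
  csub (@bnd R _ _) (fun T : Op H K => P (S ** T)).
Proof.
move=> hP; have [b b0 hb_] := op_bnd S.
apply: (csub_preim (bnd_axioms _ _) (f := ocomp S) (M := b)) => //.
- by move=> c v w; rewrite ocompDr ocompZr.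
- by move=> v c c0 hv; exact: bnd_comp.
Qed.
Lemma csub_compr H K L (P : Op H L -> Prop) (S : Op H K) : csub (@bnd R _ _) P ->
  csub (@bnd R _ _) (fun T : Op K L => P (T ** S)).
Proof.
move=> hP; have [b b0 hb_] := op_bnd S.
apply: (csub_preim (bnd_axioms _ _) (f := fun T => ocomp T S) (M := b)) => //.
- by move=> c v w; rewrite ocompDl ocompZl.
- by move=> v c c0 hv; rewrite [b * c]mulrC; exact: bnd_comp.
Qed.

Section CPair.
Variables (H K L H' K' L' : hilbertType R).
Lemma cpair_l (P : Op H L * Op H' L' -> Prop) (S : Op K L) (S' : Op K' L') :
  csub (bpair (@bnd R _ _) (@bnd R _ _)) P ->
  csub (bpair (@bnd R _ _) (@bnd R _ _)) (fun p : Op H K * Op H' K' => P (S ** p.1, S' ** p.2)).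
Proof.
move=> hP; have [b b0 hb_] := op_bnd S; have [c c0 hc] := op_bnd S'.
apply: (csub_preim (bpair_axioms (bnd_axioms _ _) (bnd_axioms _ _))
  (f := fun p : Op H K * Op H' K' => (S ** p.1, S' ** p.2)) (M := b + c)) hP.
- by move=> d v w; rewrite /= !ocompDr !ocompZr.
- exact: addr_ge0.
- move=> v d d0 [h1 h2]; split => /=; rewrite mulrDl.
    apply: (bd_le (bnd_axioms _ _)) (bnd_comp b0 hb_ h1); by rewrite lerDl mulr_ge0.
  apply: (bd_le (bnd_axioms _ _)) (bnd_comp c0 hc h2); by rewrite lerDr mulr_ge0.
Qed.
Lemma cpair_r (P : Op H L * Op H' L' -> Prop) (S : Op H K) (S' : Op H' K') :
  csub (bpair (@bnd R _ _) (@bnd R _ _)) P ->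
  csub (bpair (@bnd R _ _) (@bnd R _ _)) (fun p : Op K L * Op K' L' => P (p.1 ** S, p.2 ** S')).
Proof.
move=> hP; have [b b0 hb_] := op_bnd S; have [c c0 hc] := op_bnd S'.
apply: (csub_preim (bpair_axioms (bnd_axioms _ _) (bnd_axioms _ _))
  (f := fun p : Op K L * Op K' L' => (p.1 ** S, p.2 ** S')) (M := b + c)) hP.
- by move=> d v w; rewrite /= !ocompDl !ocompZl.
- exact: addr_ge0.
- move=> v d d0 [h1 h2]; split => /=; rewrite mulrC.
    apply: (bd_le (bnd_axioms _ _)) (bnd_comp d0 h1 hb_); by rewrite ler_wpM2l// lerDl.
  apply: (bd_le (bnd_axioms _ _)) (bnd_comp d0 h2 hc); by rewrite ler_wpM2l// lerDr.
Qed.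
End CPair.
Lemma cpair_ad H K H' K' (P : Op K H * Op K' H' -> Prop) :
  csub (bpair (@bnd R _ _) (@bnd R _ _)) P ->
  csub (bpair (@bnd R _ _) (@bnd R _ _)) (fun p : Op H K * Op H' K' => P (ad p.1, ad p.2)).
Proof.
move=> hP; split.
- by rewrite /= !ad0; exact: (csub0 hP).
- by move=> c v w Pv Pw; rewrite /= !adD !adZ; exact: (csubL hP c^* Pv Pw).
- move=> v h; apply: (csubC hP) => e e0; have [w Pw [b1 b2]] := h e e0.
  exists (ad w.1, ad w.2) => //.
  by split; rewrite /= -adB; apply: bnd_ad => //; exact: ltW.
Qed.

Section CsPair.
Variables (H K L H' K' L' : hilbertType R).
Lemma cs_pl (G : Op H K * Op H' K' -> Prop) (G2 : Op H L * Op H' L' -> Prop) (S : Op K L) (S' : Op K' L') p :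
  (forall p, G p -> cs (bpair (@bnd R _ _) (@bnd R _ _)) G2 (S ** p.1, S' ** p.2)) ->
  cs (bpair (@bnd R _ _) (@bnd R _ _)) G p ->
  cs (bpair (@bnd R _ _) (@bnd R _ _)) G2 (S ** p.1, S' ** p.2).
Proof.
move=> h; move: p; apply: cs_min h; apply: cpair_l.
exact: (cs_csub (bpair_axioms (bnd_axioms _ _) (bnd_axioms _ _))).
Qed.
Lemma cs_pr (G : Op K L * Op K' L' -> Prop) (G2 : Op H L * Op H' L' -> Prop) (S : Op H K) (S' : Op H' K') p :
  (forall p, G p -> cs (bpair (@bnd R _ _) (@bnd R _ _)) G2 (p.1 ** S, p.2 ** S')) ->
  cs (bpair (@bnd R _ _) (@bnd R _ _)) G p ->
  cs (bpair (@bnd R _ _) (@bnd R _ _)) G2 (p.1 ** S, p.2 ** S').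
Proof.
move=> h; move: p; apply: cs_min h; apply: cpair_r.
exact: (cs_csub (bpair_axioms (bnd_axioms _ _) (bnd_axioms _ _))).
Qed.
Lemma cs_pad (G : Op H K * Op H' K' -> Prop) (G2 : Op K H * Op K' H' -> Prop) p :
  (forall p, G p -> cs (bpair (@bnd R _ _) (@bnd R _ _)) G2 (ad p.1, ad p.2)) ->
  cs (bpair (@bnd R _ _) (@bnd R _ _)) G p ->
  cs (bpair (@bnd R _ _) (@bnd R _ _)) G2 (ad p.1, ad p.2).
Proof.
move=> h; move: p; apply: cs_min h; apply: cpair_ad.
exact: (cs_csub (bpair_axioms (bnd_axioms _ _) (bnd_axioms _ _))).
Qed.
End CsPair.

Lemma csub_eq H K : csub (@bnd R _ _) (fun T : Op H K => T = 0).
Proof.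
split=> // [c v w -> ->|v h]; first by rewrite scaler0 addr0.
by apply: (bd_sep (bnd_axioms _ _)) => e /h[w ->]; rewrite subr0.
Qed.
Lemma csub_and (V : lmodType C) (bd : V -> C -> Prop) (P Q : V -> Prop) :
  csub bd P -> csub bd Q -> csub bd (fun v => P v /\ Q v).
Proof.
move=> hP hQ; split.
- by split; [exact: (csub0 hP)|exact: (csub0 hQ)].
- by move=> c v w [v1 v2] [w1 w2]; split; [exact: (csubL hP)|exact: (csubL hQ)].
- move=> v h; split; [apply: (csubC hP) => e /h|apply: (csubC hQ) => e /h] => -[w [w1 w2] b];
    by exists w.
Qed.
Lemma csub_forall (V : lmodType C) (bd : V -> C -> Prop) I (D : I -> Prop) (P : I -> V -> Prop) :
  (forall i, D i -> csub bd (P i)) -> csub bd (fun v => forall i, D i -> P i v).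
Proof.
move=> hP; split.
- by move=> i Di; exact: (csub0 (hP i Di)).
- by move=> c v w hv hw i Di; apply: (csubL (hP i Di)); [exact: hv|exact: hw].
- by move=> v h i Di; apply: (csubC (hP i Di)) => e /h[w hw b]; exists w => //; exact: hw.
Qed.

Lemma csub_adj H K (P : Op K H -> Prop) : csub (@bnd R _ _) P ->
  csub (@bnd R _ _) (fun T : Op H K => P (ad T)).
Proof.
move=> hP; split.
- by rewrite ad0; exact: (csub0 hP).
- by move=> c v w Pv Pw; rewrite adD adZ; exact: (csubL hP).
- move=> v h; apply: (csubC hP) => e e0; have [w Pw b] := h e e0.
  by exists (ad w) => //; rewrite -adB; apply: bnd_ad => //; exact: ltW.
Qed.

Lemma cs_mul H (S : Op H H -> Prop) : (forall a b, S a -> S b -> cs (@bnd R _ _) S (a ** b)) ->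
  forall a b, cs (@bnd R _ _) S a -> cs (@bnd R _ _) S b -> cs (@bnd R _ _) S (a ** b).
Proof.
have B := bnd_axioms H H.
move=> SM a b ha hb_; move: a ha; apply: (cs_min (csub_compr b (cs_csub B S))) => a Sa.
move: b hb_; apply: (cs_min (csub_compl a (cs_csub B S))) => b Sb.
exact: SM.
Qed.

Lemma cs_CA H (S : Op H H -> Prop) : (forall a b, S a -> S b -> cs (@bnd R _ _) S (a ** b)) ->
  (forall a, S a -> cs (@bnd R _ _) S (ad a)) -> CA (cs (@bnd R _ _) S).
Proof.
move=> SM SA; have B := bnd_axioms H H; split; [exact: cs_csub|exact: cs_mul|].
by apply: (cs_min (csub_adj (cs_csub B S))).
Qed.

Lemma at_CA H K (A : Op H H -> Prop) (B : Op K K -> Prop) : CA A -> CA B -> CA (at_ A B).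
Proof.
move=> cA cB; apply: cs_CA => [_ _ [a [b [Aa Bb ->]]] [a' [b' [Aa' Bb' ->]]]|_ [a [b [Aa Bb ->]]]].
  by rewrite ot_comp; apply: at_in; exact: ca_mul.
by rewrite ad_ot; apply: at_in; exact: ca_adj.
Qed.

Lemma hom_preim H K (A : Op H H -> Prop) (phi : Op H H -> Op K K) P : CA A -> hom A phi ->
  csub (@bnd R _ _) P -> csub (@bnd R _ _) (fun a => A a /\ P (phi a)).
Proof.
move=> cA hphi hP; split.
- by split; [exact: CA0|rewrite (hom0 cA hphi); exact: (csub0 hP)].
- move=> c v w [v1 v2] [w1 w2]; split; first exact: (csubL (ca_csub cA)).
  by rewrite (hom_lin hphi)//; exact: (csubL hP).
- move=> v h.
  have Av : A v by apply: (csubC (ca_csub cA)) => e /h[w [Aw _] b]; exists w.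
  split => //; apply: (csubC hP) => e e0; have [w [Aw Pw] b] := h e e0.
  exists (phi w) => //; rewrite -(homB cA hphi)//; apply: (hom_contr cA hphi) => //.
    exact: CAB.
  exact: ltW.
Qed.

Lemma hom_eq H K (S : Op H H -> Prop) (A : Op H H -> Prop) (phi psi : Op H H -> Op K K) :
  CA A -> hom A phi -> hom A psi -> (forall a, S a -> A a /\ phi a = psi a) ->
  forall a, cs (@bnd R _ _) S a -> phi a = psi a.
Proof.
move=> cA h1 h2 hS a ha.
suff: A a /\ phi a = psi a by case.
move: a ha; apply: cs_min => //; split.
- by split; [exact: CA0|rewrite (hom0 cA h1) (hom0 cA h2)].
- move=> c v w [v1 v2] [w1 w2]; split; first exact: (csubL (ca_csub cA)).
  by rewrite (hom_lin h1)// (hom_lin h2)// v2 w2.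
- move=> v h.
  have Av : A v by apply: (csubC (ca_csub cA)) => e /h[w [Aw _] b]; exists w.
  split => //; apply: bnd_eps_eq => e e0; have e2 : 0 < e / 2 by rewrite divr_gt0.
  have [w [Aw Pw] b] := h _ e2; rewrite [e]splitr.
  apply: (bd_dist (bnd_axioms _ _) (u := phi w)).
    rewrite -(homB cA h1)//; apply: (hom_contr cA h1) => //; [exact: CAB|exact: ltW].
  rewrite Pw -(homB cA h2)//; apply: (hom_contr cA h2) => //; [exact: CAB|exact: ltW|].
  exact: (bd_sub (bnd_axioms _ _)).
Qed.

Definition tgraph H1 H2 K1 K2 (A : Op H1 H1 -> Prop) (B : Op H2 H2 -> Prop)
    (phi : Op H1 H1 -> Op K1 K1) (psi : Op H2 H2 -> Op K2 K2)
    (p : Op (htens H1 H2) (htens H1 H2) * Op (htens K1 K2) (htens K1 K2)) :=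
  exists a b, [/\ A a, B b & p = (ot a b, ot (phi a) (psi b))].

Section TensorHom.
Variables (H1 H2 K1 K2 : hilbertType R) (A : Op H1 H1 -> Prop) (B : Op H2 H2 -> Prop).
Variables (phi : Op H1 H1 -> Op K1 K1) (psi : Op H2 H2 -> Op K2 K2).
Hypotheses (cA : CA A) (cB : CA B) (hphi : hom A phi) (hpsi : hom B psi).

Let G := tgraph A B phi psi.
Let BP := bpair_axioms (bnd_axioms (htens H1 H2) (htens H1 H2))
  (bnd_axioms (htens K1 K2) (htens K1 K2)).

(** [amp_contr] is applied to each leg in turn, with a flip in between. *)
Lemma tgraph_contr p : sp G p -> forall b, 0 <= b -> bnd p.1 b -> bnd p.2 (1 * b).
Proof.
move=> sp b b0 hb_; rewrite mul1r.
have [l [lA lB lE]] : exists l : seq (Op H1 H1 * Op H2 H2), [/\ forall p, p \in l -> A p.1,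
    forall p, p \in l -> B p.2 & p = (\sum_(q <- l) ot q.1 q.2, \sum_(q <- l) ot (phi q.1) (psi q.2))].
  elim: sp {hb_} => [|c _ q [a [d [Aa Bd ->]]] _ [l [lA lB ->]]]; first by exists [::]; rewrite !big_nil.
  exists ((c *: a, d) :: l); split.
  - by move=> q'; rewrite inE => /orP[/eqP ->/=|/lA//]; exact: CAZ.
  - by move=> q'; rewrite inE => /orP[/eqP ->/=|/lB//].
  - rewrite !big_cons/= (homZ cA hphi)//.
    have zl (V V' W W' : hilbertType R) (x : Op V V') (y : Op W W') : ot (c *: x) y = c *: ot x y.
      by apply: tens_ext => s t; rewrite scaleoE !otE scaleoE tensZl.
    by rewrite !zl.
rewrite lE /= in hb_ *.
have h1 : bnd (\sum_(q <- l) ot (phi q.1) q.2) b by exact: (amp_contr cA hphi lA b0 hb_).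
have swb (V W V' W' : hilbertType R) (T : Op (htens V W) (htens V W)) : bnd T b ->
    bnd (sw V W ** T ** sw W V) b.
  move=> hT; rewrite -[b]mul1r -[1 * b]mulr1; apply: bnd_comp; first by rewrite mul1r.
    by apply: bnd_comp => //; exact/unit_bnd/sw_unit.
  exact/unit_bnd/sw_unit.
have swS (V W : hilbertType R) (f : Op H1 H1 -> Op V V) (g : Op H2 H2 -> Op W W) :
    sw V W ** (\sum_(q <- l) ot (f q.1) (g q.2)) ** sw W V = \sum_(q <- l) ot (g q.2) (f q.1).
  rewrite ocomp_sumr ocomp_suml; apply: eq_bigr => q _.
  by rewrite sw_ot -ocompA -{1}ad_sw; have [-> _] := sw_unit W V; rewrite ocomp1.
have h2 := @amp_contr _ _ _ _ psi [seq (q.2, phi q.1) | q <- l] b cB hpsi _ b0.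
rewrite !big_map /= in h2.
have {}h2 : bnd (\sum_(q <- l) ot (psi q.2) (phi q.1)) b.
  apply: h2; first by move=> q' /mapP[q ql ->]; exact: (lB q ql).
  by rewrite -(swS _ _ phi id); exact: swb.
rewrite -(swS _ _ phi psi) in h2.
have := @swb K2 K1 K1 K2 _ h2.
by rewrite !ocompA -{1}ad_sw; have [-> _] := sw_unit K1 K2; rewrite o1comp -ocompA -{1}ad_sw;
  have [-> _] := sw_unit K1 K2; rewrite ocomp1.
Qed.

(** The closed span of the elementary pairs is the graph of a function on [at_ A B]. The algebraic
    rules hold for generators and pass to the closure; uniqueness of values then gives them for the
    function. *)
Lemma thom_ex : exists Phi, hom (at_ A B) Phi /\ forall t, at_ A B t ->
  cs (bpair (@bnd R _ _) (@bnd R _ _)) G (t, Phi t).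
Proof.
have /choice[Phi hPhi] : forall t, exists T, at_ A B t -> cs (bpair (@bnd R _ _) (@bnd R _ _)) G (t, T).
  move=> t; have [ht|nt] := pselect (at_ A B t); last by exists 0.
  have [|T hT] := @graph_total _ _ _ (@bnd R _ _) (@bnd R _ _) (bnd_axioms _ _) (bnd_axioms _ _)
    (@op_complete _ _ _) G 1 ler01 tgraph_contr t.
    move=> e e0; have [w sw_ bw] := ht e e0; exists w => //.
    apply: sp_min sw_ => [||v [a [b [Aa Bb ->]]]]; [exact: sp0|exact: sp_lin|].
    by apply: sp_in; exists (ot (phi a) (psi b)), a, b.
  by exists T.
have uniq t T T' : cs (bpair (@bnd R _ _) (@bnd R _ _)) G (t, T) ->
    cs (bpair (@bnd R _ _) (@bnd R _ _)) G (t, T') -> T = T'.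
  exact: (graph_fun (bnd_axioms _ _) (bnd_axioms _ _) ler01 tgraph_contr).
have cAB := at_CA cA cB.
exists Phi; split; last exact: hPhi.
split.
- move=> c a b Aa Ab; apply: uniq (hPhi _ _) _; first exact: (csubL (ca_csub cAB)).
  exact: (csubL (cs_csub BP G) c (hPhi _ Aa) (hPhi _ Ab)).
- move=> a b Aa Ab; apply: uniq (hPhi _ (ca_mul cAB Aa Ab)) _.
  have key p : G p -> cs (bpair (@bnd R _ _) (@bnd R _ _)) G (p.1 ** b, p.2 ** Phi b).
    move=> [x [y [Ax By ->]]] /=; apply: (cs_pl (p := (b, Phi b)) _ (hPhi _ Ab)).
    move=> _ [x' [y' [Ax' By' ->]]] /=.
    rewrite !ot_comp -(hom_mul hphi)// -(hom_mul hpsi)//; apply: (cs_in BP).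
    by exists (x ** x'), (y ** y'); split=> //; exact: ca_mul.
  exact: (cs_pr (p := (a, Phi a)) key (hPhi _ Aa)).
- move=> a Aa; apply: uniq (hPhi _ (ca_adj cAB Aa)) _.
  apply: (cs_pad (p := (a, Phi a)) _ (hPhi _ Aa)).
  move=> _ [x [y [Ax By ->]]] /=; rewrite !ad_ot -(hom_adj hphi)// -(hom_adj hpsi)//.
  by apply: (cs_in BP); exists (ad x), (ad y); split=> //; exact: ca_adj.
Qed.

Definition thom := projT1 (cid thom_ex).
Lemma thom_hom : hom (at_ A B) thom.
Proof. by rewrite /thom; case: cid => /= ? []. Qed.
Lemma thom_graph t : at_ A B t -> cs (bpair (@bnd R _ _) (@bnd R _ _)) G (t, thom t).
Proof. by rewrite /thom; case: cid => /= f [_]; apply. Qed.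
Lemma thomE a b : A a -> B b -> thom (ot a b) = ot (phi a) (psi b).
Proof.
move=> Aa Bb; apply: (graph_fun (bnd_axioms _ _) (bnd_axioms _ _) ler01 tgraph_contr (v := ot a b)).
  by apply: thom_graph; exact: at_in.
by apply: (cs_in BP); exists a, b.
Qed.
Lemma thom_nd : nd A phi -> nd B psi -> nd (at_ A B) thom.
Proof.
move=> n1 n2; apply: dense_cs (@dense_tens _ _ _) _ => _ [x [y ->]].
have HB := hb_axioms (htens K1 K2).
have h1 (z : K2) (P : htens K1 K2 -> Prop) : csub (@hb R _) P ->
    csub (@hb R _) (fun x : K1 => P (tens x z)).
  move=> hP; apply: (csub_preim (hb_axioms _) (f := ir K1 z) (M := `|z|)) hP => //.
    by move=> *; exact: opL.
  by move=> v b b0 hv; apply: le_trans (@bnd_ir _ _ _ z v) _; rewrite ler_wpM2l.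
have h2 (z : K1) (P : htens K1 K2 -> Prop) : csub (@hb R _) P ->
    csub (@hb R _) (fun x : K2 => P (tens z x)).
  move=> hP; apply: (csub_preim (hb_axioms _) (f := il K2 z) (M := `|z|)) hP => //.
    by move=> *; exact: opL.
  by move=> v b b0 hv; apply: le_trans (@bnd_il _ _ _ z v) _; rewrite ler_wpM2l.
move: x (n1 x); apply: (cs_min (h1 _ _ (cs_csub HB _))) => _ [a [x [Aa ->]]].
move: y (n2 y); apply: (cs_min (h2 _ _ (cs_csub HB _))) => _ [b [y [Bb ->]]].
apply: (cs_in HB); exists (ot a b), (tens x y); split; first exact: at_in.
by rewrite thomE// otE.
Qed.
End TensorHom.
End CAlgebra.

(** * Slicing maps on Hilbert modules *)

Section Module.
Variable R : realType.
Notation C := (Cplx R).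
Implicit Types E H K L : hilbertType R.

Notation Bd E L := (Op (htens E L) (htens E L)).
Notation csp := (cs (bpair (@bnd R _ _) (@bnd R _ _))).
Notation bpx := (bpair_axioms (bnd_axioms _ _) (bnd_axioms _ _)).

(* The Hilbert module E (x) A is realized by operators L -> E (x) L; [mg] is the
   graph of the map id (x) phi between such modules. *)
Definition mgen E L K (A : Op L L -> Prop) (phi : Op L L -> Op K K)
    (p : Op L (htens E L) * Op K (htens E K)) : Prop :=
  exists x a, A a /\ p = (il L x ** a, il K x ** phi a).
Definition mg E L K (A : Op L L -> Prop) (phi : Op L L -> Op K K) := csp (@mgen E L K A phi).

(* (id (x) phi)(T) = T' for a multiplier T of K(E) (x) A *)
Definition rel E L K (A : Op L L -> Prop) (phi : Op L L -> Op K K)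
    (T : Op (htens E L) (htens E L)) (T' : Op (htens E K) (htens E K)) : Prop :=
  forall p, mg A phi p -> mg A phi (T ** p.1, T' ** p.2).

Section MgTheory.
Variables (E L K : hilbertType R) (A : Op L L -> Prop) (phi : Op L L -> Op K K).
Hypotheses (cA : CA A) (hphi : hom A phi).
Notation mgA := (@mg E L K A phi).

Lemma mg_in x a : A a -> mgA (il L x ** a, il K x ** phi a).
Proof. by move=> Aa; apply: (cs_in bpx); exists x, a. Qed.

Lemma mg_csub : csub (bpair (@bnd R _ _) (@bnd R _ _)) mgA.
Proof. exact: (cs_csub bpx). Qed.

(** On the span, [ad p.1 ** p.1] lies in A and phi maps it to [ad p.2 ** p.2]: the map of modules
    respects A-valued inner products. Contractivity of phi then bounds [p.2]. *)
Lemma mg_contr p : sp (@mgen E L K A phi) p -> forall b, 0 <= b -> bnd p.1 b -> bnd p.2 (1 * b).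
Proof.
move=> spp b b0 hb_; rewrite mul1r.
have [A1 A2] : A (ad p.1 ** p.1) /\ phi (ad p.1 ** p.1) = ad p.2 ** p.2.
  have cross q q' : mgen A phi q -> sp (@mgen E L K A phi) q' ->
      A (ad q.1 ** q'.1) /\ phi (ad q.1 ** q'.1) = ad q.2 ** q'.2.
    move=> [x [a [Aa ->]]] /=; elim=> [|c _ r [y [d [Ad ->]]] _ [IH1 IH2]].
      by rewrite !ocomp0; split; [exact: CA0|exact: hom0 cA hphi].
    have E1 (M : hilbertType R) (u v : Op M M) : ad (il M x ** u) ** (il M y ** v) =
        inner x y *: (ad u ** v).
      rewrite adM -!ocompA -ocompZr; congr (_ ** _); apply: op_ext => z.
      by rewrite !ocompE ilE ad_ilE scaleoE.
    rewrite /= !ocompDr !ocompZr !E1.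
    have A3 : A (ad a ** d) by apply: ca_mul => //; exact: ca_adj.
    split; first by apply: CAD => //; do 2 apply: CAZ => //.
    rewrite (hom_lin hphi) ?(homZ cA hphi) ?(hom_mul hphi) ?(hom_adj hphi) ?IH2//.
    - exact: ca_adj.
    - exact: CAZ.
  elim: spp {hb_} => [|c q r Gq sr [IH1 IH2]].
    by rewrite /= !ocomp0; split; [exact: CA0|exact: hom0 cA hphi].
  have sq : sp (@mgen E L K A phi) q by exact: sp_in.
  have [q1 q2] := cross _ _ Gq sq; have [r1 r2] := cross _ _ Gq sr.
  have [r1' r2'] : A (ad r.1 ** q.1) /\ phi (ad r.1 ** q.1) = ad r.2 ** q.2.
    have -> : ad r.1 ** q.1 = ad (ad q.1 ** r.1) by rewrite adM adK.
    split; first exact: ca_adj.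
    by rewrite (hom_adj hphi)// r2 adM adK.
  have E2 (M N : hilbertType R) (u v : Op M N) : ad (c *: u + v) ** (c *: u + v) =
      (c^* * c) *: (ad u ** u) + (c^* *: (ad u ** v) + (c *: (ad v ** u) + ad v ** v)).
    rewrite adD adZ ocompDl !ocompDr !ocompZl !ocompZr -scalerA.
    by rewrite -!addrA.
  have -> : (c *: q + r).1 = c *: q.1 + r.1 by [].
  have -> : (c *: q + r).2 = c *: q.2 + r.2 by [].
  rewrite (E2 _ _ q.1 r.1) (E2 _ _ q.2 r.2).
  have a1 := CAD cA (CAZ cA c r1') IH1.
  have a2 := CAD cA (CAZ cA c^* r1) a1.
  split; first by apply: CAD => //; exact: CAZ.
  by rewrite (hom_lin hphi)// (hom_lin hphi)// (hom_lin hphi)// q2 r2 r2' IH2.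
move=> x; rewrite -(@ler_pXn2r _ 2)// ?nnegrE ?mulr_ge0// ad_norm -A2.
rewrite -[inner _ _]ger0_norm; last by rewrite A2 -ad_norm exprn_ge0.
apply: le_trans (CS _ _) _.
have := hom_contr cA hphi A1 (mulr_ge0 b0 b0) (bnd_comp b0 (bnd_ad b0 hb_) hb_) x.
move=> /(ler_wpM2l (normr_ge0 x)) h; apply: le_trans h _.
by rewrite le_eqVlt; apply/orP; left; apply/eqP; ring.
Qed.

Lemma mg_bnd p b : mgA p -> 0 <= b -> bnd p.1 b -> bnd p.2 b.
Proof.
move=> hp b0 hb_; rewrite -[b]mul1r.
exact: (graph_contr (bnd_axioms _ _) (bnd_axioms _ _) ler01 mg_contr hp b0 hb_).
Qed.

Lemma mg_fun m m1 m2 : mgA (m, m1) -> mgA (m, m2) -> m1 = m2.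
Proof. exact: (graph_fun (bnd_axioms _ _) (bnd_axioms _ _) ler01 mg_contr). Qed.

Lemma rel_dense (D : E -> Prop) (T : Bd E L) (T' : Bd E K) : hdense D ->
  (forall x a, D x -> A a -> mgA (T ** (il L x ** a), T' ** (il K x ** phi a))) ->
  rel A phi T T'.
Proof.
move=> dD h p; apply: cs_pl => _ [x [a [Aa ->]]] /=.
move: x (dD x); apply: cs_min => [|x Dx]; last exact: h.
have [b b0 hb_] := op_bnd T; have [c c0 hc] := op_bnd T'.
have [d d0 hd] := op_bnd a; have [e e0 he] := op_bnd (phi a).
apply: (csub_preim bpx (f := fun x => (T ** (il L x ** a), T' ** (il K x ** phi a)))
  (M := b * d + c * e)) mg_csub.
- by move=> k v w; rewrite !ilL !ocompDl !ocompDr !ocompZl !ocompZr.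
- by rewrite addr_ge0// mulr_ge0.
- move=> v k k0 hv; split => /=.
    have h1 : bnd (il L v) k by apply: (bd_le (bnd_axioms _ _)) hv (@bnd_il _ _ _ v).
    apply: (bd_le (bnd_axioms _ _)) (bnd_comp b0 hb_ (bnd_comp k0 h1 hd)).
    rewrite mulrDl [k * d]mulrC mulrA lerDl !mulr_ge0//.
  have h1 : bnd (il K v) k by apply: (bd_le (bnd_axioms _ _)) hv (@bnd_il _ _ _ v).
  apply: (bd_le (bnd_axioms _ _)) (bnd_comp c0 hc (bnd_comp k0 h1 he)).
  by rewrite mulrDl [k * e]mulrC mulrA lerDr !mulr_ge0.
Qed.

Lemma rel_gen (T : Bd E L) (T' : Bd E K) :
  (forall x a, A a -> mgA (T ** (il L x ** a), T' ** (il K x ** phi a))) -> rel A phi T T'.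
Proof.
move=> h; apply: (@rel_dense (fun=> True)) => [x|x a _]; last exact: h.
by apply: (cs_in (hb_axioms E)).
Qed.

Lemma rel_comp (S : Bd E L) (S' : Bd E K) T T' : rel A phi S S' -> rel A phi T T' -> rel A phi (S ** T) (S' ** T').
Proof. by move=> h1 h2 p /h2/h1; rewrite /= !ocompA. Qed.

Lemma rel_ot (T : Op E E) : rel A phi (ot T (oid L)) (ot T (oid K)).
Proof. by apply: rel_gen => x a Aa; rewrite !ocompA !ot_il !ocomp1; exact: mg_in. Qed.

Lemma rel_fun (T : Bd E L) (T1 T2 : Bd E K) : nd A phi -> rel A phi T T1 -> rel A phi T T2 -> T1 = T2.
Proof.
move=> nphi h1 h2; apply: tens_ext => x y; rewrite -!ilE -!ocompE; congr (opf _ y).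
apply: (nd_eq nphi) => a Aa.
have := mg_fun (h1 _ (mg_in x Aa)) (h2 _ (mg_in x Aa)); rewrite /= !ocompA; exact.
Qed.

End MgTheory.

Lemma rel_congr E L K (A : Op L L -> Prop) (phi psi : Op L L -> Op K K)
    (T : Op (htens E L) (htens E L)) T' :
  (forall a, A a -> phi a = psi a) -> rel A phi T T' -> rel A psi T T'.
Proof.
move=> h; have -> // : rel A phi T T' = rel A psi T T'.
rewrite /rel /mg; suff -> : @mgen E L K A phi = mgen A psi by [].
apply/funext => p; apply/propext; split=> -[x [a [Aa ->]]]; exists x, a; split => //.
  by rewrite h.
by rewrite h.
Qed.

Section Legs.
Variables (E1 E2 L K : hilbertType R) (A : Op L L -> Prop) (phi : Op L L -> Op K K).

(* insertion of a vector of E1, resp. of E2, in E1 (x) E2 (x) M *)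
Definition ins1 M (x : E1) : Op (htens E2 M) (htens (htens E1 E2) M) := locked (ua E1 E2 M ** il _ x).
Definition ins2 M (y : E2) : Op (htens E1 M) (htens (htens E1 E2) M) := locked (s23 E1 M E2 ** ir _ y).
Lemma ins1E (M : hilbertType R) x y (z : M) : ins1 M x (tens y z) = tens (tens x y) z.
Proof. by rewrite /ins1 -lock ocompE ilE uaE. Qed.
Lemma ins2E (M : hilbertType R) x y (z : M) : ins2 M y (tens x z) = tens (tens x y) z.
Proof. by rewrite /ins2 -lock ocompE irE s23E. Qed.
Lemma ins1_il M x y : ins1 M x ** il M y = il M (tens x y).
Proof. by apply: op_ext => z; rewrite ocompE !ilE ins1E. Qed.
Lemma ins2_il M x y : ins2 M y ** il M x = il M (tens x y).
Proof. by apply: op_ext => z; rewrite ocompE !ilE ins2E. Qed.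
Lemma ad_ins1E (M : hilbertType R) x x' y (z : M) : ad (ins1 M x) (tens (tens x' y) z) = inner x x' *: tens y z.
Proof. by rewrite /ins1 -lock adM ocompE ad_ua asE ad_ilE. Qed.
Lemma ad_ins2E (M : hilbertType R) x y y' (z : M) : ad (ins2 M y) (tens (tens x y') z) = inner y y' *: tens x z.
Proof. by rewrite /ins2 -lock adM ocompE ad_s23 s23E ad_irE. Qed.
Lemma l23_ins1 M (T : Op (htens E2 M) (htens E2 M)) x : l23 E1 T ** ins1 M x = ins1 M x ** T.
Proof.
rewrite /l23 /ins1 -!lock -!ocompA; congr (_ ** _).
by rewrite unitVK ?ot_il ?ocompA//; exact: as_unit.
Qed.
Lemma l13_ins2 M (T : Op (htens E1 M) (htens E1 M)) y : l13 E2 T ** ins2 M y = ins2 M y ** T.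
Proof.
rewrite /l13 /ins2 -!lock -!ocompA; congr (_ ** _).
by rewrite -ad_s23 unitK ?ot_ir//; exact: s23_unit.
Qed.
Lemma ins1_iso M x : inner x x = 1 -> ad (ins1 M x) ** ins1 M x = oid _.
Proof. by move=> h; apply: tens_ext => y z; rewrite ocompE ins1E ad_ins1E h scale1r. Qed.
Lemma ins2_iso M y : inner y y = 1 -> ad (ins2 M y) ** ins2 M y = oid _.
Proof. by move=> h; apply: tens_ext => x z; rewrite ocompE ins2E ad_ins2E h scale1r. Qed.

Hypotheses (cA : CA A) (hphi : hom A phi).

Lemma mg_ins1 x p : mg A phi p -> @mg (htens E1 E2) L K A phi (ins1 L x ** p.1, ins1 K x ** p.2).
Proof.
apply: cs_pl => _ [y [a [Aa ->]]] /=; rewrite !ocompA !ins1_il; exact: mg_in.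
Qed.
Lemma mg_ins2 y p : mg A phi p -> @mg (htens E1 E2) L K A phi (ins2 L y ** p.1, ins2 K y ** p.2).
Proof.
apply: cs_pl => _ [x [a [Aa ->]]] /=; rewrite !ocompA !ins2_il; exact: mg_in.
Qed.
Lemma mg_adins1 x p : @mg (htens E1 E2) L K A phi p ->
  mg A phi (ad (ins1 L x) ** p.1, ad (ins1 K x) ** p.2).
Proof.
apply: cs_pl => _ [w [a [Aa ->]]] /=.
have E3 M : ad (ins1 M x) ** il M w = il M (ad (il E2 x) w).
  apply: op_ext => z; rewrite ocompE !ilE -!irE -!ocompE; congr (opf _ w).
  by apply: tens_ext => u v; rewrite !ocompE !irE ad_ins1E ad_ilE tensZl.
by rewrite !ocompA !E3; exact: mg_in.
Qed.
Lemma mg_adins2 y p : @mg (htens E1 E2) L K A phi p ->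
  mg A phi (ad (ins2 L y) ** p.1, ad (ins2 K y) ** p.2).
Proof.
apply: cs_pl => _ [w [a [Aa ->]]] /=.
have E3 M : ad (ins2 M y) ** il M w = il M (ad (ir E1 y) w).
  apply: op_ext => z; rewrite ocompE !ilE -!irE -!ocompE; congr (opf _ w).
  by apply: tens_ext => u v; rewrite !ocompE !irE ad_ins2E ad_irE tensZl.
by rewrite !ocompA !E3; exact: mg_in.
Qed.

Let l23_eq (M : hilbertType R) (S : Bd E2 M) x y (c : Op M M) :
  l23 E1 S ** (il M (tens x y) ** c) = ins1 M x ** (S ** (il M y ** c)).
Proof. by rewrite -(ins1_il M x y) !ocompA (l23_ins1 S x). Qed.
Let l13_eq (M : hilbertType R) (S : Bd E1 M) x y (c : Op M M) :
  l13 E2 S ** (il M (tens x y) ** c) = ins2 M y ** (S ** (il M x ** c)).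
Proof. by rewrite -(ins2_il M x y) !ocompA (l13_ins2 S y). Qed.
Lemma rel_l23 (T : Bd E2 L) (T' : Bd E2 K) : rel A phi T T' -> rel A phi (l23 E1 T) (l23 E1 T').
Proof.
move=> h; apply: (rel_dense (@dense_tens _ _ _)) => _ a [x [y ->]] Aa.
rewrite !l23_eq; exact: (mg_ins1 x (h _ (mg_in phi y Aa))).
Qed.
Lemma rel_l13 (T : Bd E1 L) (T' : Bd E1 K) : rel A phi T T' -> rel A phi (l13 E2 T) (l13 E2 T').
Proof.
move=> h; apply: (rel_dense (@dense_tens _ _ _)) => _ a [x [y ->]] Aa.
rewrite !l13_eq; exact: (mg_ins2 y (h _ (mg_in phi x Aa))).
Qed.
(** Inserting the unit vector e in the idle leg and removing it again recovers T from its leg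
    embedding. *)
Lemma rel_l23_inv (e : E1) (T : Bd E2 L) (T' : Bd E2 K) : inner e e = 1 ->
  rel A phi (l23 E1 T) (l23 E1 T') -> rel A phi T T'.
Proof.
move=> e1 h p hp.
have E3 (M N : hilbertType R) (S : Bd E2 M) (m : Op N _) :
    ad (ins1 M e) ** (l23 E1 S ** (ins1 M e ** m)) = S ** m.
  by rewrite (ocompA (l23 E1 S)) (l23_ins1 S e) !ocompA (ins1_iso M e1) o1comp.
have := mg_adins1 e (h _ (mg_ins1 e hp)).
by rewrite /= (E3 L) (E3 K).
Qed.
Lemma rel_l13_inv (e : E2) (T : Bd E1 L) (T' : Bd E1 K) : inner e e = 1 ->
  rel A phi (l13 E2 T) (l13 E2 T') -> rel A phi T T'.
Proof.
move=> e1 h p hp.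
have E3 (M N : hilbertType R) (S : Bd E1 M) (m : Op N _) :
    ad (ins2 M e) ** (l13 E2 S ** (ins2 M e ** m)) = S ** m.
  by rewrite (ocompA (l13 E2 S)) (l13_ins2 S e) !ocompA (ins2_iso M e1) o1comp.
have := mg_adins2 e (h _ (mg_ins2 e hp)).
by rewrite /= (E3 L) (E3 K).
Qed.
Lemma rel_l12 (T : Bd E1 E2) : rel A phi (l12 L T) (l12 K T).
Proof. by rewrite /l12 -!lock; exact: rel_ot. Qed.
End Legs.

Section Amplify.
Variables (E L K : hilbertType R) (A : Op L L -> Prop) (phi : Op L L -> Op K K).
Hypotheses (cA : CA A) (hphi : hom A phi).

(* an operator on E (x) L, as an operator on the first two legs of E (x) (L (x) M) *)
Definition amp1 E L M (T : Op (htens E L) (htens E L)) : Op (htens E (htens L M)) (htens E (htens L M)) :=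
  locked (as_ E L M ** ot T (oid M) ** ua E L M).

Lemma sh_amp1 E' L' M : starhom (@amp1 E' L' M).
Proof.
have := sh_comp (sh_otl (htens E' L') M) (sh_conj (ua_unit E' L' M)).
by congr starhom; apply/funext => T; rewrite /amp1 -lock /= ad_ua.
Qed.

Lemma il_amp (E' L' M M' : hilbertType R) (N : hilbertType R) (x : E') (a : Op L' N) (b : Op M M') :
  il _ x ** ot a b = as_ E' N M' ** ot (il N x ** a) b.
Proof. by apply: tens_ext => y z; rewrite !ocompE !otE ilE asE. Qed.

Lemma amp1_il E' L' M (T : Op (htens E' L') (htens E' L')) x (a : Op L' L') (b : Op M M) :
  amp1 M T ** (il _ x ** ot a b) = as_ _ _ _ ** ot (T ** (il _ x ** a)) b.
Proof.
rewrite il_amp /amp1 -lock -!ocompA /ua unitK ?ot_comp ?o1comp//; exact: as_unit.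
Qed.

Lemma mg_linear (E' L2 K2 : hilbertType R) (A2 : Op L2 L2 -> Prop) (phi2 : Op L2 L2 -> Op K2 K2)
    (f : Op L (htens E L) -> Op L2 (htens E' L2)) (f' : Op K (htens E K) -> Op K2 (htens E' K2)) M p :
  (forall c v w, f (c *: v + w) = c *: f v + f w) ->
  (forall c v w, f' (c *: v + w) = c *: f' v + f' w) -> 0 <= M ->
  (forall v b, 0 <= b -> bnd v b -> bnd (f v) (M * b)) ->
  (forall v b, 0 <= b -> bnd v b -> bnd (f' v) (M * b)) ->
  (forall x a, A a -> mg A2 phi2 (f (il L x ** a), f' (il K x ** phi a))) ->
  mg A phi p -> mg A2 phi2 (f p.1, f' p.2).
Proof.
move=> fL fL' M0 fb fb' h; move: p; apply: cs_min => [|_ [x [a [Aa ->]]]]; last exact: h.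
apply: (csub_preim bpx (f := fun p => (f p.1, f' p.2)) (M := M)) (mg_csub _ _ _) => //.
- by move=> c v w /=; rewrite fL fL'.
- by move=> v b b0 [h1 h2]; split; [exact: fb|exact: fb'].
Qed.

Lemma bnd_ot1 (V V' W W' : hilbertType R) (b : Op W W') (c : C) : 0 <= c -> bnd b c ->
  forall (v : Op V V') d, 0 <= d -> bnd v d -> bnd (ot v b) (c * d).
Proof. by move=> c0 hc v d d0 hd; rewrite mulrC; exact: bnd_ot. Qed.

Lemma bnd_unit_l (V W X : hilbertType R) (U : Op W X) (T : Op V W) b :
  unit_ U -> bnd T b -> bnd (U ** T) b.
Proof. by move=> hU hT; rewrite -[b]mul1r; apply: bnd_comp => //; exact: unit_bnd. Qed.
Lemma bnd_unit_r (V W X : hilbertType R) (U : Op V W) (T : Op W X) b :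
  0 <= b -> unit_ U -> bnd T b -> bnd (T ** U) b.
Proof. by move=> b0 hU hT; rewrite -[b]mulr1; apply: bnd_comp => //; exact: unit_bnd. Qed.

Lemma mg_amp1 (L2 K2 : hilbertType R) (A2 : Op (htens L L2) (htens L L2) -> Prop)
    (phi2 : Op (htens L L2) (htens L L2) -> Op (htens K K2) (htens K K2)) (b : Op L2 L2) (b' : Op K2 K2) p :
  (forall a, A a -> A2 (ot a b) /\ phi2 (ot a b) = ot (phi a) b') ->
  @mg E L K A phi p ->
    @mg E _ _ A2 phi2 (as_ E L L2 ** ot p.1 b, as_ E K K2 ** ot p.2 b').
Proof.
move=> h.
have [c c0 hc] := op_bnd b; have [d d0 hd] := op_bnd b'.
apply: (mg_linear (f := fun m => as_ E L L2 ** ot m b)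
  (f' := fun m => as_ E K K2 ** ot m b') (M := c + d)).
- by move=> k v w; rewrite otLl ocompDr ocompZr.
- by move=> k v w; rewrite otLl ocompDr ocompZr.
- exact: addr_ge0.
- move=> v k k0 hv; apply: bnd_unit_l (as_unit _ _ _) _.
  by apply: (bd_le (bnd_axioms _ _)) (bnd_ot1 c0 hc k0 hv); rewrite ler_wpM2r// lerDl.
- move=> v k k0 hv; apply: bnd_unit_l (as_unit _ _ _) _.
  by apply: (bd_le (bnd_axioms _ _)) (bnd_ot1 d0 hd k0 hv); rewrite ler_wpM2r// lerDr.
- move=> x a Aa; have [A2a E2] := h a Aa.
  by rewrite -!il_amp -E2; exact: mg_in.
Qed.

Lemma rel_amp (M : hilbertType R) (T : Bd E L) (T' : Bd E K) :
  rel A phi T T' -> rel A (fun a => ot (phi a) (oid M)) T (amp1 M T').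
Proof.
move=> h; apply: rel_gen => x a Aa.
have hT := h _ (mg_in phi x Aa); rewrite /= in hT.
rewrite amp1_il; move: hT; move: (T ** _) (T' ** _) => m m' hm.
apply: (mg_linear (f := id) (f' := fun m => as_ E K M ** ot m (oid M)) (M := 1) (p := (m, m')) _ _ _ _ _ _ hm).
- by [].
- by move=> k v w; rewrite otLl ocompDr ocompZr.
- exact: ler01.
- by move=> v k k0; rewrite mul1r.
- move=> v k k0 hv; apply: bnd_unit_l (as_unit _ _ _) _.
  by apply: bnd_ot1 => //; exact: bnd_id.
- by move=> y d Ad; rewrite -il_amp; exact: mg_in.
Qed.

Lemma rel_conj (K2 : hilbertType R) (U : Op K K2) (T : Bd E L) (T' : Bd E K) : unit_ U ->
  rel A phi T T' ->
  rel A (fun a => U ** phi a ** ad U) T (ot (oid E) U ** T' ** ot (oid E) (ad U)).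
Proof.
move=> hU h; apply: rel_gen => x a Aa.
have hT := h _ (mg_in phi x Aa); rewrite /= in hT.
have -> : ot (oid E) U ** T' ** ot (oid E) (ad U) ** (il K2 x ** (U ** phi a ** ad U)) =
    ot (oid E) U ** (T' ** (il K x ** phi a)) ** ad U.
  rewrite !ocompA -(ocompA _ _ (il K2 x)) ot_il !ocompA oidE -(ocompA _ (ad U) U).
  by have [-> _] := hU; rewrite ocomp1.
move: hT; move: (T ** _) (T' ** _) => m m' hm.
have hU2 : unit_ (ot (oid E) U) by apply: ot_unit => //; exact: unit_id.
apply: (mg_linear (f := id) (f' := fun m => ot (oid E) U ** m ** ad U) (M := 1) (p := (m, m')) _ _ _ _ _ _ hm).
- by [].
- by move=> k v w; rewrite ocompDr ocompDl ocompZr ocompZl.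
- exact: ler01.
- by move=> v k k0; rewrite mul1r.
- move=> v k k0 hv; rewrite mul1r; apply: bnd_unit_r => //; first exact: unit_ad.
  exact: bnd_unit_l.
- move=> y d Ad; rewrite !ocompA ot_il oidE -!(ocompA (il _ _)) ocompA; exact: mg_in.
Qed.
End Amplify.

Section TensorModule.
Variables (E L1 L2 K1 K2 : hilbertType R) (A1 : Op L1 L1 -> Prop) (A2 : Op L2 L2 -> Prop).
Variables (phi : Op L1 L1 -> Op K1 K1) (psi : Op L2 L2 -> Op K2 K2).
Hypotheses (c1 : CA A1) (c2 : CA A2) (hphi : hom A1 phi) (hpsi : hom A2 psi).
Notation Phi := (thom c1 c2 hphi hpsi).

Lemma rel_tgen (T : Bd E (htens L1 L2)) (T' : Bd E (htens K1 K2)) :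
  (forall x a b, A1 a -> A2 b ->
    mg (at_ A1 A2) Phi (T ** (il _ x ** ot a b), T' ** (il _ x ** ot (phi a) (psi b)))) ->
  rel (at_ A1 A2) Phi T T'.
Proof.
move=> h; apply: rel_gen => x t At; rewrite !ocompA.
apply: (cs_pl (p := (t, Phi t)) _ (thom_graph c1 c2 hphi hpsi At)).
by move=> _ [a [b [Aa Ab ->]]] /=; rewrite -!ocompA; exact: h.
Qed.

Lemma rel_amp1 (T : Bd E L1) (T' : Bd E K1) : rel A1 phi T T' ->
  rel (at_ A1 A2) Phi (amp1 L2 T) (amp1 K2 T').
Proof.
move=> h; apply: rel_tgen => x a b Aa Ab; rewrite !amp1_il.
apply: (mg_amp1 (phi2 := Phi) (p := (T ** (il L1 x ** a), T' ** (il K1 x ** phi a))) _ (h _ (mg_in phi x Aa))).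
by move=> a' Aa'; rewrite thomE//; split => //; exact: at_in.
Qed.

(* an operator on E (x) M, as an operator on the first and third leg of E (x) (L (x) M) *)
Definition amp2 E L M (T : Bd E M) : Bd E (htens L M) :=
  locked (ot (oid E) (sw M L) ** amp1 L T ** ot (oid E) (sw L M)).

Lemma sh_amp2 E' L' M : starhom (@amp2 E' L' M).
Proof.
have hU : unit_ (ot (oid E') (sw L' M)) by apply: ot_unit; [exact: unit_id|exact: sw_unit].
have := sh_comp (sh_amp1 E' M L') (sh_conj hU).
by congr starhom; apply/funext => T; rewrite /amp2 -lock /= ad_ot ad1 ad_sw.
Qed.

Lemma amp2_il E' L' M (T : Bd E' M) x (a : Op L' L') (b : Op M M) :
  amp2 L' T ** (il (htens L' M) x ** ot a b) =
  ot (oid E') (sw M L') ** (as_ _ _ _ ** ot (T ** (il M x ** b)) a) ** sw L' M.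
Proof.
rewrite /amp2 -lock -!ocompA; congr (_ ** _).
rewrite (ocompA _ (il _ x)) ot_il oidE -!ocompA sw_ot.
by rewrite (ocompA (il _ _)) (ocompA (amp1 _ _)) amp1_il -!ocompA.
Qed.

Lemma rel_amp2 (T : Bd E L2) (T' : Bd E K2) : rel A2 psi T T' ->
  rel (at_ A1 A2) Phi (amp2 L1 T) (amp2 K1 T').
Proof.
move=> h; apply: rel_tgen => x a b Aa Ab; rewrite !amp2_il.
have := h _ (mg_in psi x Ab); rewrite /=.
move: (T ** _) (T' ** _) => m m' hm.
have [c c0 hc] := op_bnd a; have [d d0 hd] := op_bnd (phi a).
apply: (mg_linear
  (f := fun m => ot (oid E) (sw L2 L1) ** (as_ E L2 L1 ** ot m a) ** sw L1 L2)
  (f' := fun m => ot (oid E) (sw K2 K1) ** (as_ E K2 K1 ** ot m (phi a)) ** sw K1 K2) (M := c + d) (p := (m, m')) _ _ _ _ _ _ hm).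
- by move=> k v w; rewrite otLl !(ocompDr, ocompDl, ocompZr, ocompZl).
- by move=> k v w; rewrite otLl !(ocompDr, ocompDl, ocompZr, ocompZl).
- exact: addr_ge0.
- move=> v k k0 hv; apply: bnd_unit_r; [by rewrite mulr_ge0// addr_ge0|exact: sw_unit|].
  apply: bnd_unit_l; first by apply: ot_unit; [exact: unit_id|exact: sw_unit].
  apply: bnd_unit_l (as_unit _ _ _) _.
  by apply: (bd_le (bnd_axioms _ _)) (bnd_ot1 c0 hc k0 hv); rewrite ler_wpM2r// lerDl.
- move=> v k k0 hv; apply: bnd_unit_r; [by rewrite mulr_ge0// addr_ge0|exact: sw_unit|].
  apply: bnd_unit_l; first by apply: ot_unit; [exact: unit_id|exact: sw_unit].
  apply: bnd_unit_l (as_unit _ _ _) _.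
  by apply: (bd_le (bnd_axioms _ _)) (bnd_ot1 d0 hd k0 hv); rewrite ler_wpM2r// lerDr.
- move=> y b1 Ab1.
  have E3 (V V' W W' : hilbertType R) (u : Op V V') (v : Op W W') :
      ot (oid E) (sw V' W') ** (as_ E V' W' ** ot (il V' y ** u) v) ** sw W V = il _ y ** ot v u.
    by rewrite -il_amp !ocompA ot_il oidE -!ocompA -sw_ot (ocompA (sw _ _)) -{1}ad_sw;
      have [-> _] := sw_unit W' V'; rewrite o1comp.
  by rewrite !E3 -(thomE c1 c2 hphi hpsi)//; apply: mg_in; exact: at_in.
Qed.
End TensorModule.

Section Composite.
Variables (E L K M : hilbertType R) (A : Op L L -> Prop) (B : Op K K -> Prop).
Variables (phi : Op L L -> Op K K) (psi : Op K K -> Op M M) (theta : Op L L -> Op M M).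
Hypotheses (cA : CA A) (cB : CA B) (hphi : hom A phi) (hpsi : hom B psi) (htheta : hom A theta).
Hypotheses (npsi : nd B psi).
Hypothesis phiB : forall a b, A a -> B b -> B (phi a ** b).
Hypothesis thetaE : forall a b, A a -> B b -> theta a ** psi b = psi (phi a ** b).

(** theta is psi, extended to multipliers, after phi. Since [phi a] need not lie in B, values are
    compared after multiplication by [psi b]: both candidates then become the image under id (x) psi
    of the same element of the module over B. *)
Lemma rel_theta (T : Bd E L) (T' : Bd E K) (T'' : Bd E M) :
  rel A phi T T' -> rel B psi T' T'' -> rel A theta T T''.
Proof.
move=> h1 h2; apply: rel_gen => x a Aa.
have hT := h1 _ (mg_in phi x Aa); rewrite /= in hT.
have [m'' hm''] : exists m'', mg A theta (T ** (il L x ** a), m'').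
  have := @graph_total _ _ _ (@bnd R _ _) (@bnd R _ _) (bnd_axioms _ _) (bnd_axioms _ _)
    (@op_complete _ _ _) (@mgen E L M A theta) 1 ler01 (mg_contr cA htheta) (T ** (il L x ** a)).
  apply => e e0; have [w sw_ [bw _]] := hT e e0; exists w.1 => //.
  elim: sw_ {bw} => [|c q r [y [d [Ad ->]]] _ IH]; first exact: sp0.
  by apply: (spS c (v := il L y ** d)) => //; exists (il M y ** theta d), y, d.
suff -> : T'' ** (il M x ** theta a) = m'' by [].
have npsi' : forall S S' : Op M (htens E M), (forall b, B b -> S ** psi b = S' ** psi b) -> S = S'.
  by move=> S S'; exact: nd_eq.
apply: npsi' => b Bb.
have key : mg B psi (T' ** (il K x ** phi a) ** b, m'' ** psi b).
  apply: (csubC (mg_csub _ _ _)) => e e0.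
  have [c c0 hc] := op_bnd b; have [d d0 hd] := op_bnd (psi b).
  have k0 : 0 < c + d + 1 by rewrite ltr_wpDl// addr_ge0.
  have e1 : 0 < e / (c + d + 1) by rewrite divr_gt0.
  have [w sw_ [/= b1 b2]] := hT _ e1.
  have [w3 [s3 r3]] : exists w3, sp (@mgen E L M A theta) (w.1, w3) /\ mg B psi (w.2 ** b, w3 ** psi b).
    elim: sw_ {b1 b2} => [|k q r [y [a' [Aa' ->]]] _ [r3 [s3 IH]]].
      exists 0; split; first exact: sp0.
      by rewrite /= !o0comp; exact: (csub0 (mg_csub _ _ _)).
    exists (k *: (il M y ** theta a') + r3); split.
      by apply: (spS k (v := (il L y ** a', il M y ** theta a')) (w := (r.1, r3))) => //; exists y, a'.
    have -> : (k *: (il L y ** a', il K y ** phi a') + r).2 = k *: (il K y ** phi a') + r.2 by [].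
    have -> : (k *: (il K y ** phi a') + r.2) ** b = k *: (il K y ** (phi a' ** b)) + r.2 ** b.
      by rewrite ocompDl ocompZl -ocompA.
    have -> : (k *: (il M y ** theta a') + r3) ** psi b = k *: (il M y ** psi (phi a' ** b)) + r3 ** psi b.
      by rewrite ocompDl ocompZl -ocompA thetaE.
    exact: (csubL (mg_csub _ _ _) k (mg_in psi y (phiB Aa' Bb)) IH).
  exists (w.2 ** b, w3 ** psi b) => //.
  have b3 : bnd (m'' - w3) (e / (c + d + 1)).
    have hd' := csubB (mg_csub _ _ _) hm'' (sp_cs bpx s3).
    exact: (mg_bnd cA htheta hd' (ltW e1)).
  have kk (f : C) : 0 <= f -> f <= c + d -> e / (c + d + 1) * f <= e.
    move=> f0 fl; rewrite mulrAC ler_pdivrMr// ler_wpM2l ?(ltW e0)//.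
    by apply: le_trans fl _; rewrite lerDl.
  split; rewrite /= -ocompBl.
    apply: (bd_le (bnd_axioms _ _)) (bnd_comp (ltW e1) b2 hc); apply: kk => //; by rewrite lerDl.
  apply: (bd_le (bnd_axioms _ _)) (bnd_comp (ltW e1) b3 hd); apply: kk => //; by rewrite lerDr.
have h3 : mg B psi (T' ** (il K x ** (phi a ** b)), T'' ** (il M x ** (theta a ** psi b))).
  rewrite (thetaE Aa Bb).
  exact: (h2 (il K x ** (phi a ** b), il M x ** psi (phi a ** b)) (mg_in psi x (phiB Aa Bb))).
have E4 : T' ** (il K x ** phi a) ** b = T' ** (il K x ** (phi a ** b)) by rewrite -!ocompA.
rewrite E4 in key; rewrite -(mg_fun cB hpsi h3 key).
by rewrite -!ocompA.
Qed.
End Composite.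
End Module.

(** * Resolvents of symmetric graphs and a Stein equation *)

Section GramSpace.
Variable R : realType.
Notation C := (Cplx R).

Lemma gram_space (I : Type) (k : Defs.kernel R I) : exists (G : hilbertType R) (g : I -> G),
  (forall p q, inner (g p) (g q) = k p q) /\ hdense (fun v => exists p, v = g p).
Proof.
have km x : kf k [:: (1, x)] \in mem_rkhs k by apply/rkhsP/kf_rkhs.
pose g x : rkhs k := Rkhs (km x).
exists (rkhs k), g; split=> [p q|f e e0].
  rewrite -[LHS]/(ip _ (kf _ _) _) ip_kf; last exact: rkhs_valP.
  by rewrite ev1 /= /kf big_seq1 mul1r.
have e3 : 0 < e / 3 by rewrite divr_gt0.
have [s Hs] := rkhs_valP f e3.
exists (\sum_(p <- s) p.1 *: g p.2).
  elim: (s) => [|p r IH]; first by rewrite big_nil; exact: sp0.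
  by rewrite big_cons; apply: spS => //; exists p.2.
have gE : rkhs_val (\sum_(p <- s) p.1 *: g p.2) = kf k s.
  rewrite (big_morph (@rkhs_val _ _ _) (@rkhs_valD _ _ _) (erefl _ : rkhs_val 0 = 0)).
  apply/funext => p; rewrite fct_sumE; apply: eq_bigr => q _.
  rewrite -[LHS]/(q.1 * kf k [:: (1, q.2)] p) /kf big_seq1 mul1r//.
rewrite /hb (_ : e = 3 * (e / 3)); last by field.
rewrite -[`|_|]/(nrm k (rkhs_val (_ - _))) rkhs_valB gE.
apply: nrm_le => //.
by have := rkhs_valP (f - \sum_(p <- s) p.1 *: g p.2); rewrite rkhs_valB gE.
Qed.

(** G is the completion of the formal combinations of points of I for the sum of the two Gram
    kernels, that is, the closed span of the pairs [(f p, h p)]. For a self-adjoint graph it yields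
    the resolvent, for [h = 0] the closed span of f. *)
Lemma graph_space (I : Type) (H K : hilbertType R) (f : I -> H) (h : I -> K) :
  exists (G : hilbertType R) (p1 : Op G H) (p2 : Op G K) (g : I -> G),
  [/\ forall p, p1 (g p) = f p, forall p, p2 (g p) = h p,
      hdense (fun v => exists p, v = g p) & ad p1 ** p1 + ad p2 ** p2 = oid G].
Proof.
pose kf p q : C := inner (f p) (f q) + inner (h p) (h q).
have kherm p q : kf q p = (kf p q)^* by rewrite /kf rmorphD/= -!innerC.
have kpsd (s : seq (C * I)) : 0 <= \sum_(p <- s) \sum_(q <- s) p.1^* * q.1 * kf p.2 q.2.
  have := addr_ge0 (inner_ge0 (\sum_(p <- s) p.1 *: f p.2)) (inner_ge0 (\sum_(p <- s) p.1 *: h p.2)).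
  rewrite !inner_suml -big_split; congr (0 <= _); apply: eq_bigr => p _.
  rewrite !inner_sumr -big_split; apply: eq_bigr => q _.
  by rewrite /kf !innerZl !innerZ /=; ring.
have [G [g [gg dg]]] := gram_space (Defs.Kernel kherm kpsd).
have ext (L : hilbertType R) (l : I -> L) :
    (forall s : seq (C * I), `|\sum_(p <- s) p.1 *: l p.2| <= `|\sum_(p <- s) p.1 *: g p.2|) ->
    exists T : Op G L, forall p, T (g p) = l p.
  move=> hl; pose GG (p : G * L) := exists x, p = (g x, l x).
  have [|||T _ hT] := @op_extend _ _ _ GG 1.
  - exact: ler01.
  - move=> p sp_; rewrite mul1r.
    have [s ->] : exists s : seq (C * I), p = (\sum_(p <- s) p.1 *: g p.2, \sum_(p <- s) p.1 *: l p.2).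
      elim: sp_ => [|c _ w [x ->] _ [s ->]]; first by exists [::]; rewrite !big_nil.
      by exists ((c, x) :: s); rewrite !big_cons.
    exact: hl.
  - by apply: dense_sub dg _ => _ [x ->]; exists (l x), x.
  by exists T => x; apply: hT; exists x.
have nE (s : seq (C * I)) : `|\sum_(p <- s) p.1 *: g p.2| ^+ 2 =
    `|\sum_(p <- s) p.1 *: f p.2| ^+ 2 + `|\sum_(p <- s) p.1 *: h p.2| ^+ 2.
  rewrite -!inner_norm !inner_suml -big_split; apply: eq_bigr => p _.
  rewrite !inner_sumr -big_split; apply: eq_bigr => q _.
  by rewrite /= !innerZl !innerZ gg /= /kf; ring.
have [p1 h1] : exists T : Op G H, forall p, T (g p) = f p.
  by apply: ext => s; rewrite -(@ler_pXn2r _ 2)// ?nnegrE// nE lerDl exprn_ge0.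
have [p2 h2] : exists T : Op G K, forall p, T (g p) = h p.
  by apply: ext => s; rewrite -(@ler_pXn2r _ 2)// ?nnegrE// nE lerDr exprn_ge0.
exists G, p1, p2, g; split=> //.
apply: (op_ext_dense dg) => _ [p ->]; apply/eqP; rewrite -subr_eq0; apply/eqP.
apply: (dense_total dg) => _ [q ->].
by rewrite innerB addoE innerD !ocompE !adEr !h1 !h2 gg /= /kf subrr.
Qed.

(** With second component 0 the map p1 is an isometry of G onto the closed span of S. Totality gives
    [p1 p1^* = 1], so this span is everything. *)
Lemma total_dense (H : hilbertType R) (S : H -> Prop) : htotal S -> hdense S.
Proof.
move=> tS; have [G [p1 [p2 [g [h1 h2 dg hg]]]]] :=
  graph_space (fun s : {x | S x} => sval s) (fun _ => 0 : H).
have p20 : p2 = 0 by apply: (op_ext_dense dg) => _ [p ->]; rewrite h2.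
have iso : ad p1 ** p1 = oid G by rewrite -hg p20 ad0 ocomp0 addr0.
have onto : p1 ** ad p1 = oid H.
  apply: op_ext => x; apply/eqP; rewrite -subr_eq0; apply/eqP/tS => s Ss.
  have -> : s = p1 (g (exist S s Ss)) by rewrite h1.
  rewrite innerB !ocompE oidE -!adE -[ad p1 (p1 _)]ocompE.
  by rewrite iso adK subrr.
apply: (@dense_map _ _ _ p1 _ S dg); first by move=> _ [[s Ss] ->]; rewrite h1.
move=> x; apply: (cs_in (hb_axioms H)); exists (ad p1 x).
by rewrite -ocompE onto.
Qed.
Lemma range_dense (H K : hilbertType R) (T : Op H K) : (forall x, ad T x = 0 -> x = 0) ->
  hdense (fun y => exists x, y = T x).
Proof.
move=> hT; apply: total_dense => v hv; apply: hT; apply: inner_ext => x.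
by rewrite inner0 adEr; apply: hv; exists x.
Qed.
End GramSpace.

(** * The operators B = (1 + P^2)^-1 and K = P (1 + P^2)^-1 of a symmetric graph P *)

Section Resolvent.
Variables (R : realType) (H : hilbertType R) (P : H * H -> Prop) (B K : Op H H).
Notation C := (Cplx R).
Hypothesis PL : forall (a : C) p q, P p -> P q -> P (a *: p + q).
Hypothesis Psym : forall p q, P p -> P q -> inner p.2 q.1 = inner p.1 q.2.
Hypothesis PB : forall x, P (B x, K x).
Hypothesis PK : forall x, P (K x, x - B x).

(** For the differences [a = u - B y] and [b = u' - K y] the graph contains [(a, b)] and [(b, -a)];
    symmetry of P gives [|b|^2 = -|a|^2]. *)
Lemma res_uniq u u' y : P (u, u') -> P (u', y - u) -> u = B y /\ u' = K y.
Proof.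
move=> h1 h2.
have P1 : P (u - B y, u' - K y).
  by have := PL (-1) (PB y) h1; rewrite scaleN1r [_ + _]addrC.
have P2 : P (u' - K y, - (u - B y)).
  have := PL (-1) (PK y) h2; rewrite scaleN1r.
  have -> : - (K y, y - B y) + (u', y - u) = (- K y + u', - (y - B y) + (y - u)) by [].
  have -> : - (y - B y) + (y - u) = - (u - B y) by vabel.
  by rewrite addrC.
have := Psym P1 P2; rewrite -[_.2]/(u' - K y) -[_.1]/(u' - K y) -[(_, _).1]/(u - B y).
rewrite -[(_, _).2]/(- (u - B y)) innerN !inner_norm => h.
have : `|u' - K y| ^+ 2 + `|u - B y| ^+ 2 == 0 by rewrite h addNr.
rewrite paddr_eq0 ?exprn_ge0// !sqrf_eq0 !normr_eq0 !subr_eq0 => /andP[/eqP -> /eqP ->].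
by [].
Qed.

Lemma resE x y : inner (K x) (B y) = inner (B x) (K y) /\
  inner (B x) y = inner (K x) (K y) + inner (B x) (B y).
Proof.
split; first exact: Psym (PB x) (PB y).
by have := Psym (PB x) (PK y); rewrite /= innerB => ->; rewrite subrK.
Qed.

Lemma res_adB : ad B = B.
Proof.
apply/esym/ad_uniq => x y; rewrite (resE x y).2 [RHS]innerC (resE y x).2.
by rewrite rmorphD/= -!innerC.
Qed.

Lemma res_adK : ad K = K.
Proof.
apply/esym/ad_uniq => x y; have := Psym (PK x) (PK y).
rewrite /= innerB innerBl (resE x y).1 => h.
by apply: (addIr (- inner (B x) (K y))).
Qed.

Lemma res_comm : B ** K = K ** B.
Proof.
apply: op_ext => y; apply: inner_ext => x; rewrite !ocompE.
by rewrite (sa_inner _ _ res_adB) -(resE x y).1 (sa_inner _ _ res_adK).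
Qed.

Lemma res_sq : K ** K = B - B ** B.
Proof.
apply: op_ext => y; apply: inner_ext => x; rewrite suboE innerB !ocompE.
rewrite (sa_inner _ _ res_adK) (sa_inner x (B y) res_adB) (sa_inner x y res_adB).
by rewrite (resE x y).2 addrK.
Qed.
(** The operator [(1 - P^2) (1 + P^2)^-1], which is the T of the Stein equation below. *)
Definition cayley := locked (B + B - oid H).

Lemma cayleyP : [/\ ad cayley = cayley, cayley ** K = K ** cayley &
  cayley ** cayley = oid H - 4 *: (K ** K)].
Proof.
split; rewrite /cayley -!lock.
- by rewrite adB adD res_adB ad1.
- by rewrite ocompBl ocompDl ocompBr ocompDr res_comm o1comp ocomp1.
- rewrite res_sq ocompBl ocompDl !ocompBr !ocompDr ocomp1 o1comp; abel.
Qed.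
End Resolvent.

(* With K = P (1 + P^2)^-1 and T = (1 - P^2) (1 + P^2)^-1 one has
   T^2 = 1 - 4 K^2, and e - T e T = 2 K d K is solved by the series
   e = 2 \sum_n T^n K d K T^n, which converges strongly because
   \sum_n |K T^n x|^2 <= |x|^2 / 4. *)
Section Stein.
Variables (R : realType) (H : hilbertType R) (K T : Op H H).
Notation C := (Cplx R).
Hypotheses (aK : ad K = K) (aT : ad T = T) (TK : T ** K = K ** T).
Hypothesis TT : T ** T = oid H - 4 *: (K ** K).
Hypothesis Ki : forall x, K x = 0 -> x = 0.

Definition tpow n := iter n (ocomp T) (oid H).
Notation Tn := tpow.
Let TnS n : Tn n.+1 = T ** Tn n. Proof. by []. Qed.
Let TnD m n : Tn (m + n) = Tn m ** Tn n.
Proof. by elim: m => [|m IH]; rewrite ?o1comp// addSn !TnS IH ocompA. Qed.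
Let TnSr n : Tn n.+1 = Tn n ** T.
Proof. by rewrite -addn1 TnD /= ocomp1. Qed.
Let aTn n : ad (Tn n) = Tn n.
Proof. by elim: n => [|n IH]; [exact: ad1|rewrite TnS adM IH aT -TnSr]. Qed.
Lemma tpowK n : Tn n ** K = K ** Tn n.
Proof.
elim: n => [|n IH]; first by rewrite ocomp1 o1comp.
by rewrite TnS -ocompA IH !ocompA TK.
Qed.

Lemma stein_step x : `|T x| ^+ 2 = `|x| ^+ 2 - 4 * `|K x| ^+ 2.
Proof.
by rewrite ad_norm aT TT suboE innerB scaleoE innerZ ocompE (sa_inner _ _ aK) !inner_norm.
Qed.

Let T_contr x : `|T x| <= `|x|.
Proof.
by rewrite -(@ler_pXn2r _ 2)// ?nnegrE// stein_step lerBlDr lerDl mulr_ge0// exprn_ge0.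
Qed.

Lemma tpow_contr n x : `|Tn n x| <= `|x|.
Proof. by elim: n => //= n IH; apply: le_trans (T_contr _) IH. Qed.

Let Tn_decr m n x : (m <= n)%N -> `|Tn n x| <= `|Tn m x|.
Proof. by move=> mn; rewrite -(subnK mn) TnD; exact: tpow_contr. Qed.

Let tele m x : 4 * \sum_(i < m) `|K (Tn i x)| ^+ 2 = `|x| ^+ 2 - `|Tn m x| ^+ 2.
Proof.
elim: m => [|m IH]; first by rewrite big_ord0 mulr0 subrr.
by rewrite big_ord_recr mulrDr IH TnS ocompE stein_step; ring.
Qed.

(** The i-th term of the telescoping sum is at least [|T^m K x|^2] for every [i <= m]. *)
Let pK m x : 4 * m.+1%:R * `|Tn m (K x)| ^+ 2 <= `|x| ^+ 2.
Proof.
apply: le_trans (_ : 4 * \sum_(i < m.+1) `|K (Tn i x)| ^+ 2 <= _).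
  rewrite -mulrA ler_wpM2l// -[m.+1 in leLHS]card_ord mulr_natl -sumr_const.
  apply: ler_sum => i _; rewrite ler_pXn2r ?nnegrE//.
  have /= <- := congr1 (fun F : Op H H => F x) (tpowK i).
  by apply: Tn_decr; rewrite -ltnS.
by rewrite tele lerBlDr lerDl exprn_ge0.
Qed.

Lemma K_dense : hdense (fun y => exists x, y = K x).
Proof. by apply: range_dense; rewrite aK. Qed.

(** The powers of T tend to 0 on the dense range of K by [pK], and then everywhere because T is
    contractive. *)
Lemma Tn_small x e : 0 < e -> exists N, forall n, (N <= n)%N -> `|Tn n x| <= e.
Proof.
move=> e0; have e2 : 0 < e / 2 by rewrite divr_gt0.
have [y hy xy] := K_dense x e2.
have [w yw] : exists w, y = K w.
  elim: hy => [|c _ r [a ->] _ [b ->]]; first by exists 0; rewrite op0.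
  by exists (c *: a + b); rewrite opL.
pose d := (e / 2 / (`|w| + 1)) ^+ 2.
have w1 : 0 < `|w| + 1 by rewrite ltr_wpDl.
have d0 : 0 < d by rewrite exprn_gt0// divr_gt0.
have [N hN] := rate_small d0.
exists N => n /Tn_decr Nn; apply: le_trans (Nn x) _.
rewrite -(subrK y x) opD (_ : e = e / 2 + e / 2); last by field.
apply: le_trans (ler_normD _ _) _; apply: lerD; first exact: le_trans (tpow_contr _ _) xy.
rewrite yw -(@ler_pXn2r _ 2)// ?nnegrE ?(ltW e2)//.
have k0 : 0 < N.+1%:R :> C by rewrite ltr0n.
apply: (@le_trans _ _ (rate R N * `|w| ^+ 2)).
  rewrite /rate ler_pdivlMl//; apply: le_trans (pK N w).
  by rewrite ler_wpM2r ?exprn_ge0// ler_peMl ?ler0n// ler1n.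
apply: le_trans (_ : d * (`|w| + 1) ^+ 2 <= _).
  by apply: ler_pM; rewrite ?rate_ge0 ?exprn_ge0// ler_pXn2r ?nnegrE ?(ltW w1)// lerDl.
by rewrite /d -exprMn divfK// gt_eqF.
Qed.

(** Iteration gives [g = T^n g T^n], which tends strongly to 0. *)
Lemma stein_uniq (g : Op H H) : g = T ** g ** T -> g = 0.
Proof.
move=> hg; have hn n : g = Tn n ** g ** Tn n.
  elim: n => [|n IH]; first by rewrite ocomp1 o1comp.
  have E : Tn n ** T = T ** Tn n by rewrite -TnSr.
  by rewrite [in RHS]TnS -{1}E [LHS]IH {1}hg !ocompA.
apply: op_ext => x; apply: (@norm_eps0 _ _ _ 1) => // e e0; rewrite mul1r.
have [b b0 hb_] := op_bnd g.
have b1 : 0 < b + 1 by rewrite ltr_wpDl.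
have [N /(_ N (leqnn _)) hN] := Tn_small x (divr_gt0 e0 b1).
rewrite (hn N) !ocompE; apply: le_trans (tpow_contr _ _) _; apply: le_trans (hb_ _) _.
apply: le_trans (_ : (b + 1) * (e / (b + 1)) <= e).
  by apply: ler_pM => //; rewrite lerDl.
by rewrite mulrC divfK// gt_eqF.
Qed.

Let ssum d N M := \sum_(N <= i < M) Tn i ** (K ** d ** K) ** Tn i.

(** Paired with its own value z, the partial sum is at most [c \sum |K T^i z| |K T^i x|]. The two
    sums of squares are bounded by telescoping, and the one with z is absorbed into the left
    side. *)
Let ssum_bnd d c N M x : 0 <= c -> bnd d c -> (N <= M)%N ->
  `|ssum d N M x| <= c * `|Tn N x|.
Proof.
move=> c0 hd NM; set D := ssum d N M; set z := D x.
have aD : `|z| ^+ 2 <= \sum_(N <= i < M) c * `|K (Tn i z)| * `|K (Tn i x)|.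
  rewrite -[X in X <= _]ger0_norm ?exprn_ge0// -inner_norm {2}/z /D /ssum sumoE inner_sumr.
  apply: le_trans (ler_norm_sum _ _ _) _; apply: ler_sum => i _.
  rewrite !ocompE (sa_inner _ _ (aTn i)) (sa_inner _ _ aK); apply: le_trans (CS _ _) _.
  by rewrite [c * _]mulrC -mulrA ler_wpM2l.
have hz : \sum_(N <= i < M) `|K (Tn i z)| ^+ 2 <= `|z| ^+ 2 / 4.
  rewrite ler_pdivlMr// mulrC; apply: le_trans (_ : 4 * \sum_(i < M) `|K (Tn i z)| ^+ 2 <= _).
    rewrite ler_wpM2l// -(big_mkord xpredT (fun i => `|K (Tn i z)| ^+ 2)).
    by rewrite (@big_cat_nat _ _ _ N 0 M)//= lerDr sumr_ge0// => i _; rewrite exprn_ge0.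
  by rewrite tele lerBlDr lerDl exprn_ge0.
have hx : \sum_(N <= i < M) `|K (Tn i x)| ^+ 2 <= `|Tn N x| ^+ 2 / 4.
  rewrite -[N in X in X <= _]add0n -(subnK NM) big_addn addnK big_mkord.
  under eq_bigr do rewrite TnD ocompE.
  by rewrite ler_pdivlMr// mulrC tele lerBlDr lerDl exprn_ge0.
rewrite -(@ler_pXn2r _ 2)// ?nnegrE ?mulr_ge0// exprMn.
have : 2 * `|z| ^+ 2 <= 2 * (`|z| ^+ 2 / 4) + c ^+ 2 / 2 * (`|Tn N x| ^+ 2 / 4).
  apply: le_trans (_ : 2 * \sum_(N <= i < M) c * `|K (Tn i z)| * `|K (Tn i x)| <= _).
    by rewrite ler_wpM2l.
  apply: le_trans (lerD (ler_wpM2l _ hz) (ler_wpM2l _ hx)) => //; last first.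
    by rewrite divr_ge0// exprn_ge0.
  rewrite !mulr_sumr -big_split; apply: ler_sum => i _ /=.
  set a := `|K (Tn i z)|; set b := `|K (Tn i x)|.
  rewrite -subr_ge0 (_ : _ - _ = 2 * (a - c / 2 * b) ^+ 2); last by field.
  apply: mulr_ge0 => //; apply: real_exprn_even_ge0 => //.
  by apply: realB; apply: ger0_real; rewrite /a /b ?mulr_ge0 ?invr_ge0.
set p := `|z| ^+ 2; set q := `|Tn N x| ^+ 2 => h.
have q0 : 0 <= c ^+ 2 * q by rewrite mulr_ge0// exprn_ge0.
rewrite -subr_ge0.
(* The estimate in fact gives [12 p <= c^2 q]; the rest is slack. *)
rewrite (_ : _ - p = 2 / 3 * (2 * (p / 4) + c ^+ 2 / 2 * (q / 4) - 2 * p) + 11 / 12 * (c ^+ 2 * q)); last by field.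
by rewrite addr_ge0// mulr_ge0// ?subr_ge0// divr_ge0.
Qed.

Lemma stein_ex (d : Op H H) : exists e, e - T ** e ** T = 2 *: (K ** d ** K).
Proof.
have [c c0 hd] := op_bnd d.
have c1 : 0 < c + 1 by rewrite ltr_wpDl.
have cvg_ x : exists l, forall e, 0 < e -> exists N, forall n, (N <= n)%N -> `|l - ssum d 0 n x| <= e.
  apply: hcauchy => e e0; have [N hN] := Tn_small x (divr_gt0 e0 c1).
  have key n m : (N <= n)%N -> (n <= m)%N -> `|ssum d 0 m x - ssum d 0 n x| <= e.
    move=> Nn nm; have -> : ssum d 0 m = ssum d 0 n + ssum d n m by rewrite /ssum -big_cat_nat.
    rewrite addoE addrC addKr.
    apply: le_trans (ssum_bnd _ c0 hd nm) _.
    apply: le_trans (_ : (c + 1) * (e / (c + 1)) <= e).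
      by apply: ler_pM => //; [rewrite lerDl|exact: hN].
    by rewrite mulrC divfK// gt_eqF.
  exists N => n m Nn Nm; case: (leqP n m) => [|/ltnW] nm; last exact: key.
  by rewrite distrC; exact: key.
have [f hf] := choice cvg_.
have fb : bounded_op f.
  apply: (@mk_bounded _ _ _ _ c) => [a x y|x].
    apply/eqP; rewrite -subr_eq0; apply/eqP; apply: (@norm_eps0 _ _ _ (1 + `|a| + 1)).
      by rewrite !addr_ge0.
    move=> e e0; have [[N1 h1] [[N2 h2] [N3 h3]]] := (hf (a *: x + y) _ e0, (hf x _ e0, hf y _ e0)).
    pose n := (N1 + N2 + N3)%N.
    have {}h1 := h1 n (leq_trans (leq_addr _ _) (leq_addr _ _)).
    have {}h2 := h2 n (leq_trans (leq_addl _ _) (leq_addr _ _)).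
    have {}h3 := h3 n (leq_addl _ _).
    have -> : f (a *: x + y) - (a *: f x + f y) = (f (a *: x + y) - ssum d 0 n (a *: x + y))
        - a *: (f x - ssum d 0 n x) - (f y - ssum d 0 n y) by rewrite opL; vabel.
    rewrite !mulrDl !mul1r; apply: le_trans (ler_normB _ _) _; apply: lerD => //.
    apply: le_trans (ler_normB _ _) _; apply: lerD => //.
    by rewrite normrZ ler_wpM2l.
  apply: (@le_eps _ _ _ 1) => //; first by rewrite mulr_ge0.
  move=> e e0; have [N hN] := hf x _ e0; rewrite mul1r.
  rewrite -(subrK (ssum d 0 N x) (f x)) addrC; apply: le_trans (ler_normD _ _) _.
  by apply: lerD; [exact: ssum_bnd|exact: hN].
exists (2 *: MkOp fb); rewrite ocompZr ocompZl -scalerBr; congr (_ *: _).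
apply: op_ext => x; apply/eqP; rewrite -subr_eq0; apply/eqP; apply: (@norm_eps0 _ _ _ 2) => // e e0.
have [[N1 h1] [N2 h2]] := (hf x _ e0, hf (T x) _ e0).
have {}h1 := h1 (N1 + N2).+1 (leqW (leq_addr _ _)).
have {}h2 := h2 (N1 + N2)%N (leq_addl _ _).
set n := (N1 + N2)%N in h1 h2.
have -> : (MkOp fb - T ** MkOp fb ** T) x - (K ** d ** K) x =
   (f x - ssum d 0 n.+1 x) - T (f (T x) - ssum d 0 n (T x)).
  rewrite suboE !ocompE -[MkOp fb x]/(f x) -[MkOp fb (T x)]/(f (T x)).
  have -> : ssum d 0 n.+1 x = K (d (K x)) + T (ssum d 0 n (T x)).
    have -> : ssum d 0 n.+1 = K ** d ** K + T ** ssum d 0 n ** T.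
      rewrite /ssum big_nat_recl// ocomp_sumr ocomp_suml; congr (_ + _).
        by rewrite ocomp1 o1comp.
      by apply: eq_bigr => i _; rewrite {1}TnS TnSr !ocompA.
    by [].
  by rewrite opB; vabel.
rewrite mulr2n mulrDl mul1r; apply: le_trans (ler_normB _ _) _; apply: lerD => //.
exact: le_trans (T_contr _) h2.
Qed.

Lemma stein_iter (d e : Op H H) n : e - T ** e ** T = 2 *: (K ** d ** K) ->
  e = 2 *: ssum d 0 n + Tn n ** e ** Tn n.
Proof.
move=> he; elim: n => [|n IH]; first by rewrite /ssum big_nil scaler0 add0r ocomp1 o1comp.
rewrite /ssum big_nat_recr//= -/(ssum _ _ _) scalerDr {1}IH -addrA; congr (_ + _).
have E : Tn n ** T = T ** Tn n by rewrite -TnSr.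
rewrite -ocompZl -ocompZr -he -{1}E.
by rewrite ocompBr ocompBl !ocompA subrK.
Qed.

(** With j the integer part of m / 4, each K takes j of the factors T and gains [(m + 1)^(-1/2)] by
    [pK]; four of them give a summable rate. *)
Lemma pK4 m x : `|Tn m (K (K (K (K x))))| <= `|x| / m.+1%:R ^+ 2.
Proof.
have k1 j y : `|Tn j (K y)| ^+ 2 <= `|y| ^+ 2 / (4 * j.+1%:R).
  by rewrite ler_pdivlMr ?mulr_gt0 ?ltr0n// mulrC.
pose j := (m %/ 4)%N.
have jm : (j + (j + (j + j)) <= m)%N by have := divn_eq m 4; rewrite -/j; lia.
apply: le_trans (Tn_decr _ jm) _.
have cK i y : K (Tn i y) = Tn i (K y) by rewrite -!ocompE tpowK.
have mj : (m.+1 <= 4 * j.+1)%N by have := ltn_pmod m (isT : (0 < 4)%N); have := divn_eq m 4; rewrite -/j; lia.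
rewrite ler_pdivlMr ?exprn_gt0 ?ltr0n//.
have j0 : 0 < 4 * j.+1%:R :> C by rewrite mulr_gt0 ?ltr0n.
rewrite -(@ler_pXn2r _ 2)// ?nnegrE ?mulr_ge0 ?exprn_ge0 ?ler0n// exprMn -exprM.
set z := `|_|; apply: (@le_trans _ _ (z ^+ 2 * (4 * j.+1%:R) ^+ 4)); rewrite {}/z.
  by rewrite ler_wpM2l ?exprn_ge0// ler_pXn2r ?nnegrE ?ler0n ?(ltW j0)// -natrM ler_nat.
rewrite !TnD !ocompE.
have := k1 j (Tn j (Tn j (Tn j (K (K (K x)))))); rewrite !cK ler_pdivlMr// => e1.
have := k1 j (Tn j (Tn j (K (K x)))); rewrite !cK ler_pdivlMr// => e2.
have := k1 j (Tn j (K x)); rewrite !cK ler_pdivlMr// => e3.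
have := k1 j x; rewrite ler_pdivlMr// => e4.
have q0 := ltW j0.
have -> z q : z * q ^+ 4 = z * q * q * q * q :> C by ring.
apply: le_trans (ler_wpM2r q0 (ler_wpM2r q0 (ler_wpM2r q0 e1))) _.
apply: le_trans (ler_wpM2r q0 (ler_wpM2r q0 e2)) _.
by apply: le_trans (ler_wpM2r q0 e3) _.
Qed.
End Stein.

(** * Operators intertwined by a manageable multiplicative unitary *)

Section Manageable.
Variable R : realType.
Notation C := (Cplx R).
Notation bp := (bpair (@hb R _) (@hb R _)).
Notation bpx := (bpair_axioms (hb_axioms _) (hb_axioms _)).

Lemma csub_inner (H K : hilbertType R) (a : H) (b : K) :
  csub bp (fun p : K * H => inner p.1 b = inner p.2 a).
Proof.
split=> [|c p q hp hq|p h].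
- by rewrite !inner0l.
- rewrite -[(_ + _).1]/(c *: p.1 + q.1) -[(_ + _).2]/(c *: p.2 + q.2).
  by rewrite !innerDl !innerZl hp hq.
apply/eqP; rewrite -subr_eq0 -normr_le0; apply: (@le_eps _ _ _ (`|b| + `|a|)) => //.
move=> e e0; rewrite add0r; have [q hq [h1 h2]] := h e e0.
have -> : inner p.1 b - inner p.2 a = inner (p - q).1 b - inner (p - q).2 a.
  rewrite -[(p - q).1]/(p.1 - q.1) -[(p - q).2]/(p.2 - q.2) !innerBl hq.
  by ring.
rewrite mulrDl; apply: le_trans (ler_normB _ _) _; apply: lerD; apply: le_trans (CS _ _) _;
  by rewrite mulrC ler_wpM2l.
Qed.

Lemma graph_tensP (H : hilbertType R) (Q : set (H * H)) p :
  graph_tens Q p <-> cs bp [set (tens p.1 q.1, tens p.2 q.2) | p in Q & q in Q] p.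
Proof.
case: p => u v; split=> [h e e0|h A].
  have [y [/lspan_sp Sy [b1 b2]]] := h _ (nbhsx_ballx (u, v) e e0).
  exists y => //; split.
    by move: b1; rewrite -ball_normE /= => /ltW.
  by move: b2; rewrite -ball_normE /= => /ltW.
move=> /nbhs_ballP[e /= e0 eA]; have e2 : 0 < e / 2 by rewrite divr_gt0.
have e2e : e / 2 < e by rewrite ltr_pdivrMr// ltr_pMr// ltr1n.
have [y /sp_lspan Sy [b1 b2]] := h _ e2.
exists y; split=> //; apply: eA; split; rewrite -ball_normE /=.
  exact: le_lt_trans b1 e2e.
exact: le_lt_trans b2 e2e.
Qed.

Lemma cs_dense (H K L : hilbertType R) (T1 : Op H K) (T2 : Op H L) (D : H -> Prop) (G : K * L -> Prop) :
  hdense D -> (forall x, D x -> cs bp G (T1 x, T2 x)) -> forall x, cs bp G (T1 x, T2 x).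
Proof.
move=> dD h x.
have [b1 b10 h1] := op_bnd T1; have [b2 b20 h2] := op_bnd T2.
suff h' : forall v, cs (@hb R H) D v -> cs bp G (T1 v, T2 v) by apply: h'; exact: dD.
apply: (@cs_map R H (K * L)%type (@hb R H) bp bpx (fun x => (T1 x, T2 x)) (b1 + b2)) => //.
- by move=> c v w; rewrite !opL.
- by rewrite addr_ge0.
move=> v b b0 hv; split; rewrite /hb.
  apply: le_trans (h1 v) _; apply: ler_pM => //; first by rewrite lerDl.
apply: le_trans (h2 v) _; apply: ler_pM => //; by rewrite lerDr.
Qed.

Section Graph.
Variables (H : hilbertType R) (Q : set (H * H)).
Hypotheses (Qd : closure [set p.1 | p in Q] = setT) (Qa : adj_graph Q = Q).
Hypothesis Qi : forall x, Q (x, 0) -> x = 0.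

Lemma QP p : Q p <-> forall q, Q q -> inner q.2 p.1 = inner q.1 p.2.
Proof. by rewrite -{1}Qa. Qed.
Lemma Q_sym p q : Q p -> Q q -> inner p.2 q.1 = inner p.1 q.2.
Proof. by move=> hp /QP; apply. Qed.
Lemma Q_dense : hdense (fun x => exists y, Q (x, y)).
Proof.
move=> x e e0; have : closure [set p.1 | p in Q] x by rewrite Qd.
move=> /closure_approx/(_ e e0)[y [[a b] ab <-] xy]; exists a => //.
by apply: sp_in; exists b.
Qed.

(** On the completed graph with coordinates p1 and p2, [B = p1 p1^*] is [(1 + Q^2)^-1] and
    [K = p2 p1^*] is [Q (1 + Q^2)^-1]; self-adjointness, in the form [QP], puts the required pairs
    into Q. *)
Lemma Q_res : exists B K : Op H H,
  [/\ forall x, Q (B x, K x), forall x, Q (K x, x - B x) & forall x, K x = 0 -> x = 0].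
Proof.
have [G [p1 [p2 [g [h1 h2 dg hg]]]]] :=
  graph_space (fun s : {p | Q p} => (sval s).1) (fun s : {p | Q p} => (sval s).2).
have gQ (q : H * H) : Q q -> exists v, p1 v = q.1 /\ p2 v = q.2.
  by move=> hq; exists (g (exist Q q hq)); rewrite h1 h2.
have Qp v : Q (p1 v, p2 v).
  apply/QP => q hq; rewrite /= -!adE; congr (inner _ v).
  apply/eqP; rewrite -subr_eq0; apply/eqP; apply: (dense_total dg) => _ [s ->].
  by rewrite innerB !adEr h1 h2 (Q_sym (svalP s) hq) subrr.
exists (p1 ** ad p1), (p2 ** ad p1).
have PB x : Q ((p1 ** ad p1) x, (p2 ** ad p1) x) by exact: Qp.
have PK x : Q ((p2 ** ad p1) x, x - (p1 ** ad p1) x).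
  apply/QP => q hq; have [v [v1 v2]] := gQ q hq.
  have e := congr1 (fun F : Op G G => inner v (F (ad p1 x))) hg.
  rewrite addoE innerD !ocompE oidE !adEr v1 v2 in e.
  by rewrite innerB -e addrAC subrr add0r.
split=> // x hx.
have xB : (p1 ** ad p1) x = 0 by apply: Qi; rewrite -hx.
have := PK x; rewrite hx xB subr0 => h.
apply: (dense_total Q_dense) => s [t st].
by rewrite -(Q_sym st h) inner0.
Qed.
End Graph.

Lemma otZl (H H' K K' : hilbertType R) c (a : Op H H') (b : Op K K') :
  ot (c *: a) b = c *: ot a b.
Proof. by apply: tens_ext => x y; rewrite scaleoE !otE scaleoE tensZl. Qed.
Lemma otZr (H H' K K' : hilbertType R) c (a : Op H H') (b : Op K K') :
  ot a (c *: b) = c *: ot a b.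
Proof. by apply: tens_ext => x y; rewrite scaleoE !otE scaleoE tensZr. Qed.

Lemma tens_total (H K : hilbertType R) (D : K -> Prop) : hdense D ->
  htotal (fun u : htens H K => exists x y, D y /\ u = tens x y).
Proof.
move=> dD u hu; apply: vec_ext => x y; rewrite inner0.
have : ad (il K x) u = 0.
  by apply: (dense_total dD) => s Ds; rewrite adEr; apply: hu; exists x, s.
by move=> h; rewrite -[tens x y]/(il K x y) -adEr h inner0.
Qed.

Lemma series_rate (H : hilbertType R) (F : nat -> H) (c : C) : 0 <= c ->
  (forall i, `|F i| <= c / i.+1%:R ^+ 2) ->
  exists l, forall n, `|l - \sum_(i < n) F i| <= 2 * c * rate R n.
Proof.
move=> c0 hF; apply: hcauchy_rate; first by rewrite mulr_ge0.
(* Comparison with a telescoping series: [1 / (i+1)^2 <= 2 / (i+1) - 2 / (i+2)]. *)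
have step i : `|F i| <= 2 * c * rate R i - 2 * c * rate R i.+1.
  apply: le_trans (hF i) _; rewrite /rate.
  have i1 : 0 < i.+1%:R :> C by rewrite ltr0n.
  have i2 : 0 < i.+2%:R :> C by rewrite ltr0n.
  have e2 : i.+2%:R = i.+1%:R + 1 :> C by rewrite -natr1.
  rewrite -subr_ge0.
  rewrite (_ : _ - _ = c * (i%:R / (i.+1%:R ^+ 2 * i.+2%:R))).
    by rewrite mulr_ge0// divr_ge0// ?mulr_ge0 ?exprn_ge0 ?ler0n.
  rewrite e2 -[i.+1%:R]natr1; field.
  by rewrite !natr1 !pnatr_eq0.
have key n m : (n <= m)%N -> `|\sum_(i < m) F i - \sum_(i < n) F i| <=
    2 * c * (rate R n + rate R m).
  move=> nm; rewrite -!(big_mkord xpredT F) (@big_cat_nat _ _ _ n 0 m)//= [X in `|X|]addrC addKr.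
  apply: le_trans (ler_norm_sum _ _ _) _.
  apply: le_trans (_ : \sum_(n <= i < m) (2 * c * rate R i - 2 * c * rate R i.+1) <= _).
    exact: ler_sum.
  have -> : \sum_(n <= i < m) (2 * c * rate R i - 2 * c * rate R i.+1) =
      2 * c * rate R n - 2 * c * rate R m.
    rewrite -[RHS]opprB -(telescope_sumr (fun i => 2 * c * rate R i) nm) -sumrN.
    by apply: eq_bigr => i _; rewrite opprB.
  rewrite mulrDr lerD2l -subr_ge0 opprK; apply: addr_ge0; apply: mulr_ge0;
    rewrite ?rate_ge0// mulr_ge0//.
move=> n m; case: (leqP n m) => [|/ltnW] nm.
  by rewrite distrC; exact: key.
by rewrite [rate R n + _]addrC; exact: key.
Qed.

Lemma unit_adI (H K : hilbertType R) (U : Op H K) a b : unit_ U -> ad U a = ad U b -> a = b.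
Proof. by move=> [_ h] e; rewrite -[a]oidE -[b]oidE -h !ocompE e. Qed.

Section TensorGraph.
Variables (H : hilbertType R) (Q : set (H * H)).
Hypotheses (Qd : closure [set p.1 | p in Q] = setT) (Qa : adj_graph Q = Q).
Variables B K : Op H H.
Hypothesis PB : forall x, Q (B x, K x).
Hypothesis PK : forall x, Q (K x, x - B x).
Hypothesis Ki : forall x, K x = 0 -> x = 0.
Notation H2 := (htens H H).
Let P : H2 * H2 -> Prop := cs bp [set (tens p.1 q.1, tens p.2 q.2) | p in Q & q in Q].
(** Formally [Cb = Q^2 B], so S is [1 + Q^2 (x) Q^2] times [B (x) B] and M is [1 - Q^2 (x) Q^2]
    times [B (x) B]. The resolvents of the graph P of Q (x) Q are therefore known on the range of
    S. *)
Let Cb := oid H - B.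
Let S := ot B B + ot Cb Cb.
Let M := ot B B - ot Cb Cb.
Let aB := res_adB (Q_sym Qa) PB PK.
Let aK := res_adK (Q_sym Qa) PB PK.

Lemma P_lin (a : C) p q : P p -> P q -> P (a *: p + q).
Proof. by apply: csubL; exact: cs_csub bpx _. Qed.

Lemma P_sym p q : P p -> P q -> inner p.2 q.1 = inner p.1 q.2.
Proof.
move=> hp hq; have h1 r : P r -> forall a b, Q a -> Q b ->
    inner r.1 (tens a.2 b.2) = inner r.2 (tens a.1 b.1).
  move=> hr a b qa qb.
  move: r hr; apply: (cs_min (csub_inner _ _)) => _ [p' qp [q' qq <-]].
  by rewrite /= !inner_tens (Q_sym Qa qp qa) (Q_sym Qa qq qb).
rewrite innerC [RHS]innerC; congr (_^*).
move: q hq; apply: (cs_min (csub_inner _ _)) => _ [p' qp [q' qq <-]] /=.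
by rewrite innerC -(h1 p hp p' q' qp qq) -innerC.
Qed.

Let P_ot (T1 T2 T1' T2' : Op H H) : (forall x, Q (T1 x, T1' x)) -> (forall x, Q (T2 x, T2' x)) ->
  forall z, P (ot T1 T2 z, ot T1' T2' z).
Proof.
move=> h1 h2; apply: (cs_dense (@dense_tens _ _ _)) => _ [x [y ->]].
rewrite !otE; apply: (cs_in bpx); exists (T1 x, T1' x) => //; by exists (T2 y, T2' y).
Qed.
Let Pb z : P (ot B B z, ot K K z). Proof. exact: P_ot. Qed.
Let Pc z : P (ot K K z, ot Cb Cb z).
Proof. by apply: P_ot => x; rewrite /Cb suboE. Qed.

(** The cross term of [B (x) B z] and [Cb (x) Cb z] equals [|K (x) K z|^2] by symmetry of P. *)
Let S_norm z : `|S z| ^+ 2 = `|ot B B z| ^+ 2 + 2 * `|ot K K z| ^+ 2 + `|ot Cb Cb z| ^+ 2.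
Proof.
have h : inner (ot B B z) (ot Cb Cb z) = `|ot K K z| ^+ 2.
  by rewrite -inner_norm -(P_sym (Pb z) (Pc z)).
rewrite /S addoE -inner_norm innerDl !innerD h [inner (ot Cb Cb z) _]innerC h !inner_norm.
by rewrite rmorphXn /= conj_Creal ?ger0_real//; ring.
Qed.

Let aS : ad S = S.
Proof. by rewrite /S adD !ad_ot /Cb adB aB ad1. Qed.

Let ot_inj z : ot K K z = 0 -> z = 0.
Proof.
have dK : hdense (fun y => exists x, y = K x) by apply: range_dense; rewrite aK.
move=> h; apply: (dense_total (@dense_tens _ _ _)) => _ [x [y ->]].
suff : htotal (fun u : H2 => exists x y, u = tens (K x) (K y)).
  move=> ht; apply: (_ : forall v, v = z -> inner (tens x y) v = 0) => // v vz.
  rewrite (ht v) ?inner0// => _ [a [b ->]].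
  by rewrite vz -otE -aK -ad_ot adE h inner0.
move=> v hv; apply: (tens_total dK) => _ [a [_ [[b ->] ->]]].
rewrite -[tens a _]/(ir H (K b) a) -adEr.
have -> : ad (ir H (K b)) v = 0; last by rewrite inner0.
apply: (dense_total dK) => _ [c ->]; rewrite adEr irE; apply: hv; by exists c, b.
Qed.

Let S_inj z : S z = 0 -> z = 0.
Proof.
move=> h; apply: ot_inj; apply/eqP; rewrite -normr_eq0 -sqrf_eq0.
have := S_norm z; rewrite h normr0 expr0n /= => /esym/eqP.
rewrite !paddr_eq0 ?addr_ge0 ?mulr_ge0 ?exprn_ge0// => /andP[/andP[_ h1] _].
by move: h1; rewrite mulf_eq0 pnatr_eq0.
Qed.

Let S_dense : hdense (fun y => exists x, y = S x).
Proof. by apply: range_dense; rewrite aS. Qed.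

Let S_ext (T : Op H2 H2) : (forall z, `|T z| <= `|S z|) -> exists U : Op H2 H2, U ** S = T.
Proof.
move=> hT; have [|||U _ hU] := @op_extend R H2 H2 (fun p => exists z, p = (S z, T z)) 1.
- exact: ler01.
- move=> p sp_; rewrite mul1r.
  have [z ->] : exists z, p = (S z, T z).
    elim: sp_ => [|c _ w [x ->] _ [y ->]]; first by exists 0; rewrite !op0.
    by exists (c *: x + y); rewrite !opL.
  exact: hT.
- by apply: dense_sub S_dense _ => _ [x ->]; exists (T x), x.
by exists U; apply: op_ext => z; apply: hU; exists z.
Qed.

(** [S_norm] bounds both [B (x) B] and [K (x) K] by S, so they factor through S, whose range is
    dense. *)
Lemma tens_res : exists BP KP : Op H2 H2,
  [/\ forall x, P (BP x, KP x), forall x, P (KP x, x - BP x),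
    BP ** S = ot B B & KP ** S = ot K K].
Proof.
have [BP hB] : exists U : Op H2 H2, U ** S = ot B B.
  apply: S_ext => z; rewrite -(@ler_pXn2r _ 2)// ?nnegrE// [X in _ <= X]S_norm.
  by rewrite -addrA lerDl addr_ge0 ?mulr_ge0 ?exprn_ge0.
have [KP hK] : exists U : Op H2 H2, U ** S = ot K K.
  apply: S_ext => z; rewrite -(@ler_pXn2r _ 2)// ?nnegrE// [X in _ <= X]S_norm.
  rewrite addrAC; apply: le_trans (_ : 2 * `|ot K K z| ^+ 2 <= _).
    by rewrite ler_peMl ?exprn_ge0// ler1n.
  by rewrite lerDr addr_ge0 ?exprn_ge0.
exists BP, KP; split; [| | exact: hB | exact: hK].
  apply: (cs_dense S_dense) => _ [z ->].
  by rewrite -!ocompE hB hK; exact: Pb.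
move=> x; have -> : x - BP x = (oid H2 - BP) x by rewrite suboE.
move: x; apply: (cs_dense S_dense) => _ [z ->].
rewrite suboE oidE -!ocompE hB hK.
have -> : S z - ot B B z = ot Cb Cb z by rewrite /S addoE addrAC subrr add0r.
exact: Pc.
Qed.

Variables BP KP : Op H2 H2.
Hypothesis PBP : forall x, P (BP x, KP x).
Hypothesis PKP : forall x, P (KP x, x - BP x).
Hypotheses (BPS : BP ** S = ot B B) (KPS : KP ** S = ot K K).
Let T := cayley B.
Let TP := cayley BP.

Lemma KP_inj x : KP x = 0 -> x = 0.
Proof.
move=> h; apply: ot_inj.
have : ad (KP ** S) = S ** KP by rewrite adM aS (res_adK P_sym PBP PKP).
by rewrite KPS ad_ot aK => ->; rewrite ocompE h op0.
Qed.

Let cancel_S (X : Op H2 H2) : S ** X ** S = 0 -> X = 0.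
Proof.
move=> h; apply: (op_ext_dense S_dense) => _ [z ->]; apply: S_inj.
by rewrite -!ocompE h.
Qed.

(** S is injective with dense range, so the equation may be checked after multiplication by S on
    both sides, where [TP S = S TP = M] and [KP S = S KP = K (x) K]. *)
Lemma tens_stein (g D : Op H2 H2) :
  S ** g ** S - M ** g ** M = 2 *: (ot K K ** D ** ot K K) ->
  g - TP ** g ** TP = 2 *: (KP ** D ** KP).
Proof.
move=> h; apply/eqP; rewrite -subr_eq0; apply/eqP; apply: cancel_S.
have TS : TP ** S = M.
  by rewrite /TP /cayley -!lock ocompBl ocompDl BPS o1comp /S /M; abel.
have ST : S ** TP = M.
  rewrite -[S ** TP]adK adM aS /TP [ad (cayley _)](_ : _ = TP) ?TS.
    by rewrite /M adB !ad_ot /Cb adB aB ad1.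
  by have [] := cayleyP P_sym PBP PKP.
have SK : S ** KP = ot K K.
  have : ad (KP ** S) = S ** KP by rewrite adM aS (res_adK P_sym PBP PKP).
  by rewrite KPS ad_ot aK.
rewrite !ocompBr !ocompBl ocompZr ocompZl !ocompA SK ST.
rewrite -(ocompA _ TP S) TS -(ocompA _ KP S) KPS -!ocompA in h *.
by rewrite h subrr.
Qed.

Let BC : B ** Cb = K ** K /\ Cb ** B = K ** K.
Proof.
by rewrite /Cb ocompBr ocompBl ocomp1 o1comp (res_sq (Q_sym Qa) PB PK).
Qed.

(** Since [T = B - Cb] and [1 = B + Cb], the Stein equation reads [B e Cb + Cb e B = K d K];
    formally this is [Q^2 e + e Q^2 = Q d Q]. *)
Let BeC (d e : Op H H) : e - T ** e ** T = 2 *: (K ** d ** K) ->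
  2 *: (B ** e ** Cb + Cb ** e ** B) = 2 *: (K ** d ** K).
Proof.
move=> <-; rewrite /T /cayley -!lock /Cb !ocompBr !ocompBl !ocompDr !ocompDl ?ocompBr !ocomp1 !o1comp.
rewrite ?ocompBl ?ocompDl ?ocompA; abel.
Qed.

Let SM (g : Op H2 H2) : S ** g ** S - M ** g ** M =
  2 *: (ot B B ** g ** ot Cb Cb + ot Cb Cb ** g ** ot B B).
Proof.
rewrite /S /M; set b := ot B B; set c := ot Cb Cb.
rewrite !ocompDr !ocompDl ?ocompNr ?ocompNl; abel.
Qed.

(** Tensoring [Q^2 e + e Q^2 = Q d Q] with [Q^2] yields the same equation for Q (x) Q and e (x) 1;
    in bounded form the second factor is [B Cb = Cb B = K^2]. *)
Lemma stein_l (d e : Op H H) : e - T ** e ** T = 2 *: (K ** d ** K) ->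
  ot e (oid H) - TP ** ot e (oid H) ** TP = 2 *: (KP ** ot d (oid H) ** KP).
Proof.
move=> /BeC he; apply: tens_stein; rewrite SM !ot_comp !ocomp1 BC.1 BC.2.
rewrite -[ot _ _ + ot _ _]scale1r -[ot (_ ** _ ** Cb) _]scale1r -otLl.
by rewrite scale1r scale1r -!otZl he.
Qed.

Lemma stein_r (d e : Op H H) : e - T ** e ** T = 2 *: (K ** d ** K) ->
  ot (oid H) e - TP ** ot (oid H) e ** TP = 2 *: (KP ** ot (oid H) d ** KP).
Proof.
move=> /BeC he; apply: tens_stein; rewrite SM !ot_comp !ocomp1 BC.1 BC.2.
rewrite -[ot _ _ + ot _ _]scale1r -[ot _ (_ ** _ ** Cb)]scale1r -otLr.
by rewrite scale1r scale1r -!otZr he.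
Qed.

Variable W : Op H2 H2.
Hypothesis uW : unit_ W.
Hypothesis WP : forall u v, P (W u, W v) <-> P (u, v).

(** W commutes with the resolvents of Q (x) Q by their uniqueness. Hence [W (e (x) 1) W^*] and
    [1 (x) e] solve the same Stein equation, and [stein_uniq] identifies them. *)
Lemma stein_intertwine (d e : Op H H) : e - T ** e ** T = 2 *: (K ** d ** K) ->
  W ** ot d (oid H) = ot (oid H) d ** W -> W ** ot e (oid H) = ot (oid H) e ** W.
Proof.
move=> he hd.
have WBK x : W (BP x) = BP (W x) /\ W (KP x) = KP (W x).
  apply: (res_uniq P_lin P_sym PBP PKP); first exact/WP.
  by rewrite -opB; exact/WP.
have WB : W ** BP = BP ** W by apply: op_ext => x; exact: (WBK x).1.
have WK : W ** KP = KP ** W by apply: op_ext => x; exact: (WBK x).2.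
have WT : W ** TP = TP ** W.
  by rewrite /TP /cayley -!lock ocompBr ocompDr ocompBl ocompDl WB ocomp1 o1comp.
have [aTP TPK TPTP] := cayleyP P_sym PBP PKP.
have e1 := stein_l he; have e2 := stein_r he.
set g1 := ot e _ in e1 *; set g2 := ot _ e in e2 *.
have hh : W ** g1 ** ad W - g2 = 0.
  apply: (stein_uniq (res_adK P_sym PBP PKP) aTP TPK TPTP KP_inj).
  have e3 : W ** g1 ** ad W - TP ** (W ** g1 ** ad W) ** TP = 2 *: (KP ** ot (oid H) d ** KP).
    have TW : ad W ** TP = TP ** ad W.
      by apply: (unit_injl uW); rewrite unitVK// !ocompA WT -ocompA (proj2 uW) ocomp1.
    have KW : ad W ** KP = KP ** ad W.
      by apply: (unit_injl uW); rewrite unitVK// !ocompA WK -ocompA (proj2 uW) ocomp1.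
    have := congr1 (fun X => W ** X ** ad W) e1.
    rewrite ocompBr ocompBl ocompZr ocompZl !ocompA WT WK.
    rewrite -(ocompA _ TP (ad W)) -TW -(ocompA _ KP (ad W)) -KW.
    rewrite -(ocompA KP W) hd -!ocompA (ocompA W (ad W)) (proj2 uW) o1comp.
    exact.
  rewrite ocompBr ocompBl; apply/eqP; rewrite -subr_eq0; apply/eqP.
  set a := W ** g1 ** ad W in e3 *; set b := cayley BP ** a ** _; set c := cayley BP ** g2 ** _.
  have -> : a - g2 - (b - c) = (a - b) - (g2 - c) by abel.
  by rewrite e2 e3 subrr.
apply: (unit_injr (unit_ad uW)); rewrite unitrK//.
by apply/eqP; rewrite -subr_eq0 hh.
Qed.
End TensorGraph.

Section CommutantScalar.
Variables (H : hilbertType R) (Q : set (H * H)).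
Variables (W : Op (htens H H) (htens H H)) (W' : Op (htens (Defs.conjg H) H) (htens (Defs.conjg H) H)).
Hypotheses (Qd : closure [set p.1 | p in Q] = setT) (Qa : adj_graph Q = Q).
Hypothesis Qi : forall x, Q (x, 0) -> x = 0.
Hypotheses (uW : unit_ W) (uW' : unit_ W').
Hypothesis WQ : forall u v, graph_tens Q (W u, W v) <-> graph_tens Q (u, v).
Hypothesis WW' : forall (x z v v' y y' : H), Q (v, v') -> Q (y', y) ->
  inner (tens x v) (W (tens z y)) = inner (tens (bar z) v') (W' (tens (bar x) y')).

(* If e (x) 1 is intertwined with 1 (x) e and both v and e^* v are in the
   domain of Q, the defining identity of manageability gives
   bar (e z) (x) Q v = bar z (x) Q (e^* v) for all z. *)
Lemma intertwine_bar (e : Op H H) v v' s z :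
  W ** ot e (oid H) = ot (oid H) e ** W -> Q (v, v') -> Q (ad e v, s) ->
  tens (bar (e z)) v' = tens (bar z) s.
Proof.
move=> he hv hs.
have h : ad W' (tens (bar (e z)) v') = ad W' (tens (bar z) s).
  apply/eqP; rewrite -subr_eq0; apply/eqP.
  apply: (tens_total (@Q_dense _ _ Qd)) => _ [x [y' [[y hy] ->]]].
  rewrite innerB !adEr; apply/eqP; rewrite subr_eq0; apply/eqP.
  rewrite innerC [RHS]innerC; congr (_^*).
  rewrite -(WW' x (e z) hv hy) -(WW' x z hs hy).
  have -> : tens (e z) y = ot e (oid H) (tens z y) by rewrite otE.
  rewrite -ocompE he ocompE -adE ad_ot ad1 otE //.
exact: unit_adI uW' h.
Qed.

Theorem commutant_scalar (d : Op H H) : W ** ot d (oid H) = ot (oid H) d ** W ->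
  exists c : C, d = c *: oid H.
Proof.
move=> hd; have [B [K [PB PK Ki]]] := Q_res Qd Qa Qi.
have [BP [KP [PBP PKP BPS KPS]]] := tens_res Qa PB PK Ki.
have [aT TK TT] := cayleyP (Q_sym Qa) PB PK.
have aK := res_adK (Q_sym Qa) PB PK.
have KK := res_sq (Q_sym Qa) PB PK.
set T := cayley B in aT TK TT.
have [e he] := stein_ex aK aT TK TT Ki d.
have We : W ** ot e (oid H) = ot (oid H) e ** W.
  apply: (stein_intertwine Qa PB PK Ki PBP PKP BPS KPS uW _ he hd).
  by move=> u v; rewrite -!graph_tensP.
set f := ad e.
have hf : f - T ** f ** T = 2 *: (K ** ad d ** K).
  have := congr1 (@ad _ _ _) he; rewrite adB adZ !adM aT aK conj_Creal ?realn//.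
  by rewrite !ocompA.
(* A vector v with [Q v] nonzero is required below. If none arises in this way then [K^4 = 0], and
   injectivity of K makes the space trivial. *)
have [[w hw]|h0] := pselect (exists w, K (K w) - B (K (K w)) != 0); last first.
  exists 0; apply: op_ext => x; suff -> : x = 0 by rewrite !op0.
  do 4! (apply: (Ki _)); rewrite -ocompE KK suboE ocompE -opB.
  have -> : K (K x) - B (K (K x)) = 0; last by rewrite op0.
  by apply/eqP/negPn/negP => h; apply: h0; exists x.
(* Three factors K here and one from the Stein series make [pK4] applicable to [K v]. *)
pose v := K (K (K w)); pose v' := K (K w) - B (K (K w)).
have Qv : Q (v, v') by exact: PK.
have [c c0 hc] := op_bnd (ad d).
pose F i := tpow T i (ad d (tpow T i (K v))).
have [|i|l hl] := @series_rate H F (c * `|w|).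
- by rewrite mulr_ge0.
- apply: le_trans (tpow_contr aK aT TT _ _) _; apply: le_trans (hc _) _.
  by rewrite -mulrA ler_wpM2l//; exact: pK4.
(* One K is pulled out of every term of the series for [f v], and what is left still converges in
   norm. So [f v] lies in the range of K, which is contained in the domain of Q. *)
have fv : f v = K (2 *: l).
  have [b b0 hf_] := op_bnd f; have [k k0 hk] := op_bnd K.
  apply/eqP; rewrite -subr_eq0; apply/eqP.
  apply: (@norm_eps0 _ _ _ (b + 2 * k)) => [|eps eps0]; first by rewrite addr_ge0 ?mulr_ge0.
  have [N1 h1] := Tn_small aK aT TK TT Ki v eps0.
  have cw : 0 < 2 * (c * `|w|) + 1 by rewrite ltr_wpDl// !mulr_ge0.
  have [N2 h2] := rate_small (divr_gt0 eps0 cw).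
  pose n := (N1 + N2)%N.
  have {}h1 := h1 n (leq_addr _ _).
  have {}h2 : 2 * (c * `|w|) * rate R n <= eps.
    apply: le_trans (_ : (2 * (c * `|w|) + 1) * (eps / (2 * (c * `|w|) + 1)) <= _); last first.
      by rewrite mulrC divfK// gt_eqF.
    apply: ler_pM; rewrite ?rate_ge0 ?mulr_ge0 ?lerDl//.
    apply: le_trans h2; rewrite /rate lef_pV2 ?posrE ?ltr0n// ler_nat ltnS.
    exact: leq_addl.
  have -> : f v - K (2 *: l) = tpow T n (f (tpow T n v)) - 2 *: K (l - \sum_(i < n) F i).
    rewrite {1}(stein_iter n hf) big_mkord addoE scaleoE sumoE.
    have -> : \sum_(i < n) (tpow T i ** (K ** ad d ** K) ** tpow T i) v = K (\sum_(i < n) F i).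
      rewrite op_sum; apply: eq_bigr => i _.
      have -> // : tpow T i ** (K ** ad d ** K) ** tpow T i =
        K ** (tpow T i ** ad d ** tpow T i ** K).
      by rewrite -!ocompA -(tpowK TK) !ocompA -(tpowK TK).
    by rewrite !ocompE opB opZ; vabel.
  rewrite mulrDl; apply: le_trans (ler_normB _ _) _; apply: lerD.
    apply: le_trans (tpow_contr aK aT TT _ _) _; apply: le_trans (hf_ _) _.
    by rewrite ler_wpM2l.
  rewrite normrZ normr_nat -mulrA ler_wpM2l//; apply: le_trans (hk _) _.
  by rewrite ler_wpM2l//; apply: le_trans (hl n) h2.
have Qfv : Q (f v, 2 *: l - B (2 *: l)) by rewrite fv; exact: PK.
set s := 2 *: l - _ in Qfv.
have eE z : (inner v' v')^* *: e z = (inner v' s)^* *: z.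
  have := congr1 (ad (ir (Defs.conjg H) v')) (intertwine_bar z We Qv Qfv).
  by rewrite !ad_irE; exact.
have v0 : (inner v' v')^* != 0 by rewrite conjC_eq0 inner_eq0.
pose lam := (inner v' v')^*^-1 * (inner v' s)^*.
have el : e = lam *: oid H.
  by apply: op_ext => z; rewrite scaleoE oidE /lam -scalerA -eE scalerA mulVf// scale1r.
(* With [e = lam] the Stein equation becomes [2 K d K = lam (1 - T^2) = 4 lam K^2]. *)
exists (2 * lam); apply: (op_ext_dense (K_dense aK Ki)) => _ [x ->].
apply/eqP; rewrite -subr_eq0; apply/eqP; apply: Ki.
have : 2 *: (K ** d ** K) = 2 *: ((2 * lam) *: (K ** K)).
  rewrite -he el ocompZr ocompZl ocomp1 TT; abel.
move=> /(congr1 (fun X : Op H H => 2^-1 *: X)); rewrite !scalerA mulVf ?pnatr_eq0// !scale1r.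
move=> /(congr1 (fun X : Op H H => X x)); rewrite scaleoE !ocompE => h.
by rewrite opB h mul1r scaleoE oidE opZ subrr.
Qed.
End CommutantScalar.
End Manageable.

(** * The two legs of a manageable multiplicative unitary *)

Section Slices.
Variable R : realType.

(** The slice of T by the vector functional [(x | . | z)] of the first leg; [sr] is the one for the
    second leg. *)
Definition sl (H K : hilbertType R) (T : Op (htens H K) (htens H K)) x z : Op K K :=
  ad (il K x) ** T ** il K z.
Definition sr (H K : hilbertType R) (T : Op (htens H K) (htens H K)) u v : Op H H :=
  ad (ir H u) ** T ** ir H v.

Section SliceTheory.
Variables H K : hilbertType R.
Implicit Types T : Op (htens H K) (htens H K).

Lemma slE T x z y y' : inner y (sl T x z y') = inner (tens x y) (T (tens z y')).
Proof. by rewrite /sl !ocompE adEr. Qed.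
Lemma srE T u v x x' : inner x (sr T u v x') = inner (tens x u) (T (tens x' v)).
Proof. by rewrite /sr !ocompE adEr. Qed.
Lemma ad_sl T x z : ad (sl T x z) = sl (ad T) z x.
Proof. by rewrite /sl !adM adK ocompA. Qed.
Lemma ad_sr T u v : ad (sr T u v) = sr (ad T) v u.
Proof. by rewrite /sr !adM adK ocompA. Qed.
Lemma sl_linr T x c z z' : sl T x (c *: z + z') = c *: sl T x z + sl T x z'.
Proof. by rewrite /sl ilL ocompDr ocompZr. Qed.
Lemma sl_bnd T b x z : 0 <= b -> bnd T b -> bnd (sl T x z) (b * `|x| * `|z|).
Proof.
move=> b0 hT; rewrite /sl; apply: bnd_comp; rewrite ?mulr_ge0//; last exact: bnd_il.
rewrite mulrC; apply: bnd_comp => //; apply: bnd_ad => //; exact: bnd_il.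
Qed.

Lemma sl_dense_r T (D : H -> Prop) x z : hdense D ->
  cs (@bnd R K K) (fun a => exists z, D z /\ a = sl T x z) (sl T x z).
Proof.
move=> dD; have [b b0 hT] := op_bnd T.
apply: (@cs_map R H (Op K K) (@hb R H) _ (bnd_axioms K K) (sl T x) (b * `|x|) D) => //.
- by move=> c v w; exact: sl_linr.
- by rewrite mulr_ge0.
- move=> v d d0 hv; apply: (bd_le (bnd_axioms K K)) (sl_bnd x v b0 hT).
  by rewrite ler_wpM2l// mulr_ge0.
- by move=> v Dv; apply: (cs_in (bnd_axioms K K)); exists v.
Qed.

Lemma sl_dense T (D D' : H -> Prop) x z : hdense D -> hdense D' ->
  cs (@bnd R K K) (fun a => exists x z, [/\ D x, D' z & a = sl T x z]) (sl T x z).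
Proof.
move=> dD dD'; have cS := cs_csub (bnd_axioms K K).
apply: (cs_min (cS _) _ (sl_dense_r T x z dD')) => _ [z' [Dz' ->]].
rewrite -[sl _ _ _]adK ad_sl.
have := sl_dense_r (ad T) z' x dD.
apply: (cs_min (P := fun a => cs (@bnd R K K) _ (ad a))).
  by apply: csub_adj; exact: cS.
move=> _ [x' [Dx' ->]]; rewrite ad_sl adK; apply: (cs_in (bnd_axioms K K)).
by exists x', z'.
Qed.
End SliceTheory.

Section Insertions.
Variables E K L : hilbertType R.
Lemma ad_ins1_ir a (v : L) : ad (@ins1 R E K L a) ** ir _ v = ir _ v ** ad (il K a).
Proof.
by apply: tens_ext => x y; rewrite !ocompE !irE ad_ins1E ad_ilE tensZl.
Qed.
Lemma ins1_coef (t : htens E K) (r : htens E L) (u : K) (v : L) :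
  inner (tens t v) (s23 E L K (tens r u)) = inner (ad (ir E u) t) (ad (ir E v) r).
Proof.
have e : ad (ir (htens E K) v) ** s23 E L K ** ir _ u = ir _ u ** ad (ir E v).
  by apply: tens_ext => x y; rewrite !ocompE !irE s23E !ad_irE tensZl.
rewrite -[tens t v]/(ir _ v t) -adEr -[tens r u]/(ir _ u r) -!ocompE e.
by rewrite ocompE adE.
Qed.
Lemma slice_l12 (T : Op (htens E K) (htens E K)) a c :
  ad (ins1 K L a) ** l12 L T ** ins1 K L c = ot (sl T a c) (oid L).
Proof.
apply: tens_ext => x y; rewrite !ocompE ins1E otE /l12 -lock otE oidE.
by rewrite -[tens (T _) y]/(ir _ y (T (tens c x))) -!ocompE ad_ins1_ir.
Qed.
Lemma ad_ins1_l23 (T : Op (htens K L) (htens K L)) a :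
  ad (ins1 K L a) ** l23 E T = T ** ad (ins1 K L a).
Proof.
rewrite -[LHS]adK adM adK -(shA (sh_l23 E K L)) l23_ins1 adM adK.
by [].
Qed.
Lemma slide_l (T : Op (htens K L) (htens K L)) X (a c : E) :
  ad (ins1 K L a) ** (l23 E T ** X) ** ins1 K L c = T ** (ad (ins1 K L a) ** X ** ins1 K L c).
Proof. by rewrite !ocompA ad_ins1_l23. Qed.
Lemma slide_r (T : Op (htens K L) (htens K L)) X (a c : E) :
  ad (ins1 K L a) ** (X ** l23 E T) ** ins1 K L c = ad (ins1 K L a) ** X ** ins1 K L c ** T.
Proof. by rewrite -!ocompA l23_ins1. Qed.
Lemma slice_l13 (T : Op (htens E L) (htens E L)) a c :
  ad (ins1 K L a) ** l13 K T ** ins1 K L c = ot (oid K) (sl T a c).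
Proof.
have e x : ad (ins1 K L a) ** s23 E L K ** ir _ x = il L x ** ad (il L a).
  by apply: tens_ext => p q; rewrite !ocompE irE s23E ad_ins1E ad_ilE opZ.
apply: tens_ext => x y; rewrite !ocompE ins1E otE /l13 -lock !ocompE s23E otE oidE.
by rewrite -[tens (T _) x]/(ir _ x (T (tens c y))) -[s23 _ _ _ (_ _)]ocompE -ocompE ocompA e.
Qed.
Lemma sl_l13_l23 (S : Op (htens E L) (htens E L)) (T : Op (htens K L) (htens K L)) a b c d :
  sl (l13 K S ** l23 E T) (tens a b) (tens c d) = sl S a c ** sl T b d.
Proof.
rewrite /sl -!ins1_il adM -!ocompA (ocompA _ (ins1 K L c)) l23_ins1 -!ocompA.
rewrite (ocompA (l13 K S)) (ocompA (ad (ins1 K L a))) (ocompA (ad (ins1 K L a)) (l13 K S)) slice_l13.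
rewrite !ocompA; congr (_ ** _ ** _).
by rewrite -[ad (il L b) ** _]adK adM adK ad_ot ad1 ot_il adM !adK.
Qed.
Lemma sl_l23 (T : Op (htens K L) (htens K L)) (a c : E) b d :
  sl (l23 E T) (tens a b) (tens c d) = inner a c *: sl T b d.
Proof.
apply: op_ext => y; apply: inner_ext => x.
by rewrite scaleoE innerZ !slE l23c.
Qed.
Lemma sl_l12_conj (U : Op (htens E K) (htens E K)) X t s :
  sl (l12 L U ** X ** l12 L (ad U)) t s = sl X (ad U t) (ad U s).
Proof.
rewrite /sl /l12 -!lock -!ocompA ot_il ocomp1 !ocompA.
congr (_ ** _ ** _); rewrite -[ad (il L t) ** _]adK adM adK ad_ot ad1 ot_il ocomp1.
by [].
Qed.
Lemma ins1_ir a (y : K) (z : L) : ins1 K L a (tens y z) = ir (htens E K) z (ir E y a).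
Proof. exact: ins1E. Qed.
Lemma ins1_total (D : E -> Prop) (u : htens (htens E K) L) : hdense D ->
  (forall a, D a -> ad (ins1 K L a) u = 0) -> u = 0.
Proof.
move=> dD h; apply: vec_ext2 => x y z; rewrite inner0.
have : ad (ir E y) (ad (ir _ z) u) = 0.
  apply: (dense_total dD) => a Da.
  by rewrite !adEr -ins1_ir -adEr h// inner0.
by move=> e; rewrite -[tens _ z]/(ir _ z (ir E y x)) -!adEr e inner0.
Qed.
Lemma ins1_ext (D D' : E -> Prop) (S T : Op (htens (htens E K) L) (htens (htens E K) L)) :
  hdense D -> hdense D' -> (forall a c, D a -> D' c ->
    ad (ins1 K L a) ** S ** ins1 K L c = ad (ins1 K L a) ** T ** ins1 K L c) -> S = T.
Proof.
move=> dD dD' h; apply: tens_ext2 => x y z.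
have e : S ** ir _ z ** ir E y = T ** ir _ z ** ir E y.
  apply: (op_ext_dense dD') => c Dc; rewrite !ocompE -!ins1_ir.
  apply/eqP; rewrite -subr_eq0; apply/eqP; apply: (ins1_total dD) => a Da.
  have /(congr1 (fun F : Op _ _ => F (tens y z))) := h a c Da Dc.
  by rewrite !ocompE opB => ->; rewrite subrr.
exact: (congr1 (fun F : Op _ _ => F x) e).
Qed.
Lemma il0 : il K (0 : E) = 0.
Proof. by apply: op_ext => x; rewrite ilE tens0l. Qed.
Lemma sl_l23_in (T : Op (htens K L) (htens K L)) t s :
  cs (@bnd R L L) (fun a => exists x z, a = sl T x z) (sl (l23 E T) t s).
Proof.
have hC := cs_csub (bnd_axioms L L).
apply: (cs_min (hC _) _ (sl_dense _ _ _ (@dense_tens _ _ _) (@dense_tens _ _ _))).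
move=> _ [_ [_ [[a [b ->]] [c [d ->]] ->]]]; rewrite sl_l23; apply: (csubZ _ (hC _)).
by apply: (cs_in (bnd_axioms L L)); exists b, d.
Qed.
End Insertions.

Section Star.
Variables (H : hilbertType R) (Q : set (H * H)).
Notation Hb := (Defs.conjg H).
Variables (W : Op (htens H H) (htens H H)) (W' : Op (htens Hb H) (htens Hb H)).
Hypotheses (Qd : closure [set p.1 | p in Q] = setT) (Qa : adj_graph Q = Q).
Hypothesis Qi : forall x, Q (x, 0) -> x = 0.
Hypotheses (uW : unit_ W) (uW' : unit_ W').
Hypothesis pent : l23 H W ** l12 H W = l12 H W ** l13 H W ** l23 H W.
Hypothesis slb : forall x x' z z' : H, Q (x, x') -> Q (z', z) ->
  sl W x' z' = sl W' (bar z) (bar x).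

Lemma Q_ran_dense : hdense (fun y => exists x, Q (x, y)).
Proof.
apply: total_dense => v hv; apply: Qi; apply/(QP Qa) => -[a b] hq.
by rewrite inner0; apply: hv; exists a.
Qed.

Lemma bar_dense (D : H -> Prop) : hdense D -> hdense (fun y : Hb => exists x, D x /\ y = bar x).
Proof.
move=> dD; apply: total_dense => v hv.
apply: (dense_total dD) => s Ds; rewrite innerC.
have h : inner (v : H) s = 0 := hv (bar s) (ex_intro _ s (conj Ds erefl)).
by rewrite h conjC0.
Qed.

(** In coefficients each side is an inner product of two vectors. Self-adjointness of Q and [slb]
    put each vector of one side and its partner on the other into the graph of Q ([h1], [h2]); the
    symmetry of Q is then the claim. *)
Let slice_prod x x' z z' : Q (x, x') -> Q (z', z) ->
  ad (ins1 H H x') ** (l12 H W ** l13 H W) ** ins1 H H z' =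
  ad (ins1 H H (bar z)) ** (l13 H W' ** l12 H W') ** ins1 H H (bar x).
Proof.
move=> hx hz; apply: tens_ext => u2 v2; apply: vec_ext => u v.
rewrite !ocompE !adEr !ins1E.
rewrite -[l12 H W _](congr1 (fun F : Op _ _ => F _) (adK (l12 H W))) adEr.
rewrite -(shA (sh_l12 H H H)).
rewrite -[l13 H W' _](congr1 (fun F : Op _ _ => F _) (adK (l13 H W'))) adEr.
rewrite -(shA (sh_l13 Hb H H)).
rewrite /l12 /l13 -!lock !otE !oidE !ocompE !s23E !otE !oidE.
set t := ad W _; set r := W _; set r2 := ad W' _; set t2 := W' _.
rewrite ins1_coef [RHS]innerC ins1_coef -innerC.
have h1 : Q (ad (ir Hb u) t2, ad (ir H u2) t).
  apply/(QP Qa) => -[a b] hq /=.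
  rewrite [LHS]innerC [RHS]innerC; congr (_^*).
  rewrite adE -[inner (ad (ir Hb u) t2 : H) b]/(inner (bar b) (ad (ir Hb u) t2)) adEr.
  by rewrite !irE /t adE -!slE (slb hx hq).
have h2 : Q (ad (ir H v) r, ad (ir Hb v2) r2).
  apply/(QP Qa) => -[a b] hq /=.
  rewrite adEr -[inner a (ad (ir Hb v2) r2)]/(inner (ad (ir Hb v2) r2) (bar a)) adE.
  by rewrite /r2 adE -!slE (slb hq hz).
exact: (Q_sym Qa h1 h2).
Qed.

(** The pentagon equation transposed in its first leg: transposition turns W into W' and reverses
    the order of the factors acting there. *)
Lemma star : l23 Hb W ** l12 H W' = l13 H W' ** l12 H W' ** l23 Hb W.
Proof.
apply: (ins1_ext (bar_dense Q_ran_dense) (bar_dense (Q_dense Qd))) => _ _ [z [[z' hz] ->]] [x [[x' hx] ->]].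
rewrite slide_l slide_r slice_l12 -(slb hx hz) -(slice_l12 H W) -slide_l pent slide_r.
by rewrite (slice_prod hx hz).
Qed.

Definition slices := cs (@bnd R H H) (fun a => exists x z, a = sl W x z).

Let slices' := cs (@bnd R H H) (fun a => exists x z, a = sl W' x z).

Lemma slicesE a : slices a <-> slices' a.
Proof.
have hC := cs_csub (bnd_axioms H H).
split; apply: (cs_min (hC _)) => _ [x [z ->]].
  apply: (cs_min (hC _)) (sl_dense W x z Q_ran_dense (Q_dense Qd)) => _ [x' [z' [[y hx] [y' hz] ->]]].
  rewrite (slb hx hz); apply: (cs_in (bnd_axioms H H)); by exists (bar y'), (bar y).
apply: (cs_min (hC _)) (sl_dense W' x z (bar_dense Q_ran_dense) (bar_dense (Q_dense Qd))).
move=> _ [x' [z' [[y [[a1 h1] ->]] [y' [[a2 h2] ->]] ->]]].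
rewrite -(slb h2 h1); apply: (cs_in (bnd_axioms H H)); by exists a2, a1.
Qed.

(* Slicing W'_13^* W_23 = W'_12 W_23 W'_12^*, a form of the previous lemma,
   on the first two legs gives the products a^* b of slices on the left, and
   slices of W on the right. *)
Let prodE : l13 H (ad W') ** l23 Hb W = l12 H W' ** l23 Hb W ** l12 H (ad W').
Proof.
rewrite (shA (sh_l13 Hb H H)) (shA (sh_l12 Hb H H)).
have u12 : unit_ (l12 H W') by apply: sh_unit uW'; exact: sh_l12.
have u13 : unit_ (l13 H W') by apply: sh_unit uW'; exact: sh_l13.
apply: (unit_injl u13); rewrite unitVK//; apply: (unit_injr u12).
by rewrite -!ocompA (proj1 u12) ocomp1 !ocompA star.
Qed.

Lemma slices_adM a b : slices a -> slices b -> slices (ad a ** b).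
Proof.
have hC := cs_csub (bnd_axioms H H).
move=> /slicesE ha hb_; move: a ha.
apply: cs_min => [|_ [c [a ->]]].
  by apply: (csub_adj (P := fun t => slices (t ** b))); apply: csub_compr; exact: hC.
move: b hb_; apply: cs_min => [|_ [b [d ->]]]; first by apply: csub_compl; exact: hC.
by rewrite ad_sl -sl_l13_l23 prodE sl_l12_conj; exact: sl_l23_in.
Qed.

(** [prodE] solved for its other side: [W_23] is the conjugate by [W'_12] of [W'_13^* W_23], whose
    slices are products [a^* b]. *)
Lemma slices_sub a : slices a ->
  cs (@bnd R H H) (fun t => exists a b, [/\ slices a, slices b & t = ad a ** b]) a.
Proof.
have hC := cs_csub (bnd_axioms H H).
apply: (cs_min (hC _)) => _ [b [d ->]].
have [->|b0] := eqVneq b 0.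
  by rewrite /sl il0 ad0 !o0comp; exact: (csub0 (hC _)).
have -> : sl W b d = (inner (bar b) (bar b))^-1 *: (inner (bar b) (bar b) *: sl W b d).
  by rewrite scalerA mulVf ?scale1r// inner_eq0.
apply: (csubZ _ (hC _)); rewrite -sl_l23.
have -> : l23 Hb W = l12 H (ad W') ** (l13 H (ad W') ** l23 Hb W) ** l12 H (ad (ad W')).
  rewrite prodE adK (shA (sh_l12 Hb H H)).
  have u12 : unit_ (l12 H W') by apply: sh_unit uW'; exact: sh_l12.
  by rewrite !ocompA (proj1 u12) o1comp -ocompA (proj1 u12) ocomp1.
rewrite sl_l12_conj adK.
apply: (cs_min (hC _) _ (sl_dense _ _ _ (@dense_tens _ _ _) (@dense_tens _ _ _))).
move=> _ [_ [_ [[x [y ->]] [x' [y' ->]] ->]]].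
rewrite sl_l13_l23 -ad_sl; apply: (cs_in (bnd_axioms H H)).
exists (sl W' x' x), (sl W y y'); split=> //.
  by apply/slicesE; apply: (cs_in (bnd_axioms H H)); exists x', x.
by apply: (cs_in (bnd_axioms H H)); exists y, y'.
Qed.

(** The slices form the closed span of products [a^* b] of slices, and adjoints of such products are
    of the same kind. This gives adjoints, and then [slices_adM] gives products. *)
Theorem slices_CA : CA slices.
Proof.
have hC := cs_csub (bnd_axioms H H).
have ha a : slices a -> slices (ad a).
  move=> /slices_sub; apply: (cs_min (P := fun a => slices (ad a))).
    by apply: csub_adj; exact: hC.
  by move=> _ [b [c [hb_ hc ->]]]; rewrite adM adK; exact: slices_adM.
split=> //; first exact: hC.
by move=> a b /ha; rewrite -{2}[a]adK; exact: slices_adM.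
Qed.

(** A vector v orthogonal to the ranges of all slices satisfies [W^* (v (x) v) = 0], hence
    vanishes. *)
Lemma slices_nd : hdense (fun y => exists a x, slices a /\ y = a x).
Proof.
apply: total_dense => v hv; apply/eqP; rewrite -inner_eq0 -[X in X == _]sqrtCK.
have h0 : tens v v = 0.
  rewrite -[tens v v]oidE -(proj2 uW) ocompE.
  have -> : ad W (tens v v) = 0; last by rewrite op0.
  apply: (dense_total (@dense_tens _ _ _)) => _ [z [y ->]].
  rewrite adEr innerC -slE innerC.
  have -> : inner (sl W v z y) v = 0; last by rewrite !conjC0.
  by apply: hv; exists (sl W v z), y; split=> //; apply: (cs_in (bnd_axioms H H)); exists v, z.
have := inner_tens v v v v; rewrite h0 inner0 => /esym/eqP.
by rewrite mulf_eq0 => /orP[] /eqP ->; rewrite sqrtC0 expr0n.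
Qed.
End Star.

Section Dual.
Variable H : hilbertType R.
Implicit Type T : Op (htens H H) (htens H H).

Lemma inner_sw (L K : hilbertType R) u v : inner u (sw L K v) = inner (sw K L u) v.
Proof. by rewrite -(ad_sw K L) adEr. Qed.

(** The multiplicative unitary of the dual. Its right slices are the adjoints of the left slices of
    W ([sl_dual]), so one argument serves both legs. *)
Definition dual T := sw H H ** ad T ** sw H H.

Lemma dual_unit T : unit_ T -> unit_ (dual T).
Proof.
by move=> h; do 2?apply: unit_comp; rewrite /=; try exact: sw_unit; exact: unit_ad.
Qed.

Definition rev3 := locked (ua H H H ** ot (oid H) (sw H H) ** sw (htens H H) H).
Lemma rev3E x y z : rev3 (tens (tens x y) z) = tens (tens z y) x.
Proof. by rewrite /rev3 -lock !ocompE swE otE swE uaE. Qed.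
Lemma rev3_unit : unit_ rev3.
Proof.
rewrite /rev3 -lock; apply: unit_comp; last exact: sw_unit.
by apply: unit_comp; [exact: ua_unit|apply: ot_unit; [exact: unit_id|exact: sw_unit]].
Qed.

Let dualc T x y x' y' : inner (tens x y) (dual T (tens x' y')) =
  inner (tens y x) (ad T (tens y' x')).
Proof. by rewrite /dual !ocompE swE inner_sw swE. Qed.

Lemma rev3_l12 T : l23 H (dual T) = ad rev3 ** l12 H (ad T) ** rev3.
Proof.
apply: op3_ext => x x' y y' z z'.
by rewrite !ocompE adEr !rev3E l12c l23c dualc mulrC.
Qed.
Lemma rev3_l23 T : l12 H (dual T) = ad rev3 ** l23 H (ad T) ** rev3.
Proof.
apply: op3_ext => x x' y y' z z'.
by rewrite !ocompE adEr !rev3E l12c l23c dualc mulrC.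
Qed.
Lemma rev3_l13 T : l13 H (dual T) = ad rev3 ** l13 H (ad T) ** rev3.
Proof.
apply: op3_ext => x x' y y' z z'.
by rewrite !ocompE adEr !rev3E !l13c dualc.
Qed.

Lemma dual_pent T : l23 H T ** l12 H T = l12 H T ** l13 H T ** l23 H T ->
  l23 H (dual T) ** l12 H (dual T) = l12 H (dual T) ** l13 H (dual T) ** l23 H (dual T).
Proof.
move=> h; have sj := sh_conj rev3_unit.
rewrite rev3_l12 rev3_l23 rev3_l13 -!(shM sj); congr (_ ** _ ** _).
have := congr1 (@ad _ _ _) h; rewrite !adM !(shA (sh_l12 _ _ _), shA (sh_l13 _ _ _), shA (sh_l23 _ _ _)).
by move=> ->; rewrite !ocompA.
Qed.

Lemma sl_dual T u v : sl (dual T) u v = ad (sr T v u).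
Proof.
have e x : sw H H ** il H x = ir H x by apply: op_ext => y; rewrite !ocompE ilE irE swE.
by rewrite /sl /dual ad_sr /sr -!ocompA e !ocompA -[ad (il H u) ** _]adK adM adK ad_sw e.
Qed.
End Dual.

Section Conjugation.
Variable K : hilbertType R.
Notation Kb := (Defs.conjg K).

Lemma cop_subproof (T : Op K K) : bounded_op (T : Kb -> Kb).
Proof.
have [b b0 hb_] := op_bnd T; apply: (@mk_bounded _ _ _ _ b) => [a x y|x]; last exact: hb_.
exact: (opL T a^* x y).
Qed.
Definition cop (T : Op K K) : Op Kb Kb := MkOp (cop_subproof T).
Lemma cop_unit (T : Op K K) : unit_ T -> unit_ (cop T).
Proof.
have h (S : Op K K) : cop (ad S) = ad (cop S).
  apply: ad_uniq => x y.
  by rewrite -[LHS]/(inner (y : K) (ad S (x : K))) adEr.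
by move=> [h1 h2]; split; rewrite -h; apply: op_ext => x;
  [exact: (congr1 (fun F : Op K K => F x) h1)|exact: (congr1 (fun F : Op K K => F x) h2)].
Qed.
End Conjugation.

Section ConjFlip.
Variable H : hilbertType R.
Notation Hb := (Defs.conjg H).

(** The flip that takes [bar q (x) p] to [bar p (x) q] is antilinear, hence linear as a map into the
    conjugate space. *)
Lemma jflip_ex : exists2 J : Op (htens Hb H) (Defs.conjg (htens Hb H)), unit_ J &
  forall q p, J (tens (bar q) p) = bar (tens (bar p) q).
Proof.
pose G := fun r : htens Hb H * Defs.conjg (htens Hb H) => exists q p : H,
  r = (tens (bar q) p, bar (tens (bar p) q)).
have [|||J uJ hJ] := @unit_extend R (htens Hb H) (Defs.conjg (htens Hb H)) G.
- move=> _ _ [q [p ->]] [q' [p' ->]] /=.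
  rewrite -[LHS]/(inner (tens (bar p') q') (tens (bar p) q)) !inner_tens mulrC.
  by [].
- apply: dense_sub (@dense_tens _ _ _) _ => _ [q [p ->]].
  by exists (bar (tens (bar p) (q : H))), (q : H), p.
- apply: dense_sub (bar_dense (@dense_tens _ Hb H)) _ => _ [_ [[p [q ->]] ->]].
  by exists (tens (bar q) (p : H)), q, (p : H).
by exists J => // q p; apply: hJ; exists q, p.
Qed.
End ConjFlip.

Section ManageableSlices.
Variables (H : hilbertType R) (Q : set (H * H)).
Notation Hb := (Defs.conjg H).
Variables (W : Op (htens H H) (htens H H)) (W' : Op (htens Hb H) (htens Hb H)).
Hypotheses (Qd : closure [set p.1 | p in Q] = setT) (Qa : adj_graph Q = Q).
Hypothesis Qi : forall x, Q (x, 0) -> x = 0.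
Hypotheses (uW : unit_ W) (uW' : unit_ W').
Hypothesis pent : l23 H W ** l12 H W = l12 H W ** l13 H W ** l23 H W.
Hypothesis WQ : forall u v, graph_tens Q (W u, W v) <-> graph_tens Q (u, v).
Hypothesis WW' : forall (x z v v' y y' : H), Q (v, v') -> Q (y', y) ->
  inner (tens x v) (W (tens z y)) = inner (tens (bar z) v') (W' (tens (bar x) y')).

(** Manageability places Q on the vectors of the second leg. As W commutes with Q (x) Q, the
    symmetry of that graph moves Q to the first leg, and the identity becomes one between slices. *)
Lemma man_slb x x' z z' : Q (x, x') -> Q (z', z) -> sl W x' z' = sl W' (bar z) (bar x).
Proof.
move=> hx hz; apply: (op_ext_dense (Q_dense Qd)) => y' [y hy].
apply/eqP; rewrite -subr_eq0; apply/eqP.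
apply: (dense_total (Q_ran_dense Qa Qi)) => v' [v hv].
apply/eqP; rewrite innerB subr_eq0 !slE -(WW' _ _ hv hy); apply/eqP.
have gt p q : Q p -> Q q -> graph_tens Q (tens p.1 q.1, tens p.2 q.2).
  by move=> hp hq; apply/graph_tensP; apply: (cs_in (bpair_axioms (hb_axioms _) (hb_axioms _))); exists p => //; exists q.
have /graph_tensP h1 := gt _ _ hx hv.
have /WQ/graph_tensP h2 := gt _ _ hz hy.
exact: (P_sym Qa h1 h2).
Qed.

Definition lslices := cs (@bnd R H H) (fun a => exists u v, a = sr W u v).

Lemma lslicesE a : lslices a <-> slices (dual W) (ad a).
Proof.
have hC := cs_csub (bnd_axioms H H).
split.
  apply: (cs_min (P := fun a => slices (dual W) (ad a))); first by apply: csub_adj; exact: hC.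
  by move=> _ [u [v ->]]; apply: (cs_in (bnd_axioms H H)); exists v, u; rewrite sl_dual.
rewrite -{2}[a]adK; move: (ad a).
apply: (cs_min (P := fun a => lslices (ad a))); first by apply: csub_adj; exact: hC.
move=> _ [x [z ->]]; rewrite sl_dual adK; apply: (cs_in (bnd_axioms H H)); by exists z, x.
Qed.

(** W' conjugated by the antilinear flip plays for [dual W] the role that W' plays for W, so the
    results on right slices apply to [dual W]. *)
Let dual_data : exists2 Wd : Op (htens Hb H) (htens Hb H), unit_ Wd &
  forall x x' z z', Q (x, x') -> Q (z', z) -> sl (dual W) x' z' = sl Wd (bar z) (bar x).
Proof.
have [J uJ hJ] := jflip_ex H.
exists (ad J ** cop W' ** J).
  by apply: (unit_comp _ uJ); apply: unit_comp; [exact: unit_ad|exact: cop_unit].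
move=> x x' z z' hx hz; apply: op_ext => u2; apply: inner_ext => u.
rewrite !slE !ocompE swE adEr !hJ.
rewrite -[RHS]/(inner (W' (tens (bar u2) x)) (tens (bar u) z)) [RHS]innerC -(WW' u2 u hz hx) -innerC.
by rewrite inner_sw swE adEr.
Qed.

Lemma rslices_CA : CA (slices W).
Proof. exact: slices_CA uW' pent man_slb. Qed.

Lemma lslices_CA : CA lslices.
Proof.
have [Wd uWd hWd] := dual_data.
have c := slices_CA Qd Qa Qi uWd (dual_pent pent) hWd.
split; first exact: cs_csub (bnd_axioms H H) _.
  by move=> a b /lslicesE ha /lslicesE hb_; apply/lslicesE; rewrite adM; exact: (ca_mul c).
by move=> a /lslicesE ha; apply/lslicesE; apply: (ca_adj c).
Qed.

Lemma lslices_nd : hdense (fun y => exists a x, lslices a /\ y = a x).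
Proof.
have [Wd uWd hWd] := dual_data.
apply: dense_sub (slices_nd (dual_unit uW)) _ => y [a [x [ha ->]]].
by exists a, x; split=> //; apply/lslicesE; apply: (ca_adj (slices_CA Qd Qa Qi uWd (dual_pent pent) hWd)).
Qed.
End ManageableSlices.
End Slices.

(** * Packaged operators and morphisms *)

Section Boundary.
Variable R : realType.
Notation C := (Cplx R).
Notation Hil := (hilbertType R).

Lemma adjE (H K : Hil) (T : Op H K) : adj T = ad T :> (K -> H).
Proof.
apply: xget_unique => [x y|S hS]; first exact: adE.
by apply/funext => x; apply/esym/inner_ext => y; rewrite innerC adE -hS -innerC.
Qed.

Lemma tens_liftE (H K L : Hil) (f : H -> K -> L) (F : Op (htens H K) L) :
  (forall x y, F (tens x y) = f x y) -> tens_lift f = F.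
Proof.
move=> hF; apply: xget_unique => [|G [bG hG]]; first by split; [exact: opP|].
by rewrite -[G]/(opf (MkOp bG)); congr opf; apply: tens_ext => x y; rewrite hF; exact: hG.
Qed.

Lemma otensE (H H' K K' : Hil) (a : Op H H') (b : Op K K') : otens a b = ot a b.
Proof. by apply: tens_liftE => x y; rewrite otE. Qed.
Lemma swapE (H K : Hil) : @swap R H K = sw H K.
Proof. by apply: tens_liftE => x y; rewrite swE. Qed.
Lemma assocE (H K L : Hil) : @assoc R H K L = as_ H K L.
Proof.
apply: tens_liftE => u z.
have -> : tens_lift (fun x y => tens x (tens y z)) = as_ H K L ** ir _ z.
  by apply: tens_liftE => x y; rewrite ocompE irE asE.
by [].
Qed.
Lemma unassocE (H K L : Hil) : @unassoc R H K L = ua H K L.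
Proof.
apply: tens_liftE => x v.
have -> : tens_lift (fun y z => tens (tens x y) z) = ua H K L ** il _ x.
  by apply: tens_liftE => y z; rewrite ocompE ilE uaE.
by [].
Qed.
Lemma reassocE (H K L : Hil) (T : Op (htens H (htens K L)) (htens H (htens K L))) :
  reassoc T = ua H K L ** T ** as_ H K L.
Proof. by rewrite /reassoc unassocE assocE. Qed.
Lemma leg12E (H K L : Hil) (T : Op (htens H K) (htens H K)) : leg12 L T = l12 L T.
Proof. by rewrite /leg12 -[id]/(opf (oid L)) otensE /l12 -lock. Qed.
Lemma leg23E (H K L : Hil) (T : Op (htens K L) (htens K L)) : leg23 H T = l23 H T.
Proof. by rewrite /leg23 -[id]/(opf (oid H)) otensE reassocE /l23 -lock. Qed.
Lemma leg13E (H K L : Hil) (T : Op (htens H L) (htens H L)) : leg13 K T = l13 K T.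
Proof.
rewrite /leg13 !unassocE !assocE !swapE /l13 /s23 -!lock.
rewrite -[id]/(opf (oid H)) -[X in otens T X]/(opf (oid K)) !otensE.
by [].
Qed.
Lemma flipE (H : Hil) (T : Op (htens H H) (htens H H)) : flip T = sw H H ** T ** sw H H.
Proof. by rewrite /flip swapE. Qed.

Lemma lcoefE (H K : Hil) (T : Op (htens H K) (htens H K)) x y : lcoef T x y = sl T x y.
Proof.
apply: xget_unique => [|G [bG hG]]; first by split; [exact: opP|move=> u v; exact: slE].
by rewrite -[G]/(opf (MkOp bG)); congr opf; apply: op_ext => v; apply: inner_ext => u; rewrite slE -hG.
Qed.
Lemma rcoefE (H K : Hil) (T : Op (htens H K) (htens H K)) u v : rcoef T u v = sr T u v.
Proof.
apply: xget_unique => [|G [bG hG]]; first by split; [exact: opP|move=> x y; exact: srE].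
by rewrite -[G]/(opf (MkOp bG)); congr opf; apply: op_ext => y; apply: inner_ext => x; rewrite srE -hG.
Qed.

Lemma unitary_op_unit (H K : Hil) (U : H -> K) : unitary_op U ->
  exists2 T : Op H K, U = T & unit_ T.
Proof.
move=> [bU h1 h2]; exists (MkOp bU) => //; move: h1 h2; rewrite -[U]/(opf (MkOp bU)) adjE => h1 h2.
by split; apply: op_ext => x; [exact: (congr1 (fun F => F x) h1)|exact: (congr1 (fun F => F x) h2)].
Qed.
Lemma unit_unitary_op (H K : Hil) (U : Op H K) : unit_ U -> unitary_op U.
Proof.
move=> [h1 h2]; split; rewrite ?adjE; first exact: opP.
  by apply/funext => x; exact: (congr1 (fun F : Op _ _ => F x) h1).
by apply/funext => x; exact: (congr1 (fun F : Op _ _ => F x) h2).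
Qed.

Section Pack.
Variables H K : Hil.
(** The value 0 on unbounded functions is a placeholder; [pkE] removes it wherever boundedness is
    known. *)
Definition pk (f : H -> K) : Op H K :=
  match pselect (bounded_op f) with left h => MkOp h | right _ => 0 end.
Lemma pkE f : bounded_op f -> pk f = f :> (H -> K).
Proof. by rewrite /pk; case: pselect. Qed.
Lemma pkK (T : Op H K) : pk T = T.
Proof. by apply: op_ext => x; rewrite pkE//; exact: opP. Qed.
Lemma opf_inj (S T : Op H K) : opf S = opf T -> S = T.
Proof. by move=> h; apply: op_ext => x; rewrite h. Qed.
Definition pset (A : set (H -> K)) : Op H K -> Prop := fun T => A T.

Lemma lspan_pset (S : set (H -> K)) f : (forall s, S s -> bounded_op s) ->
  lspan S f -> exists2 t, sp (pset S) t & f = t.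
Proof.
move=> hS /lspan_sp; elim=> [|c s w Ss _ [t ht ->]]; first by exists 0; [exact: sp0|].
exists (c *: MkOp (hS s Ss) + t); last by [].
by apply: spS.
Qed.
Lemma sp_lspan_pset (S : set (H -> K)) t : sp (pset S) t -> lspan S t.
Proof.
move=> h; apply: sp_lspan; elim: h => [|c s w Ss _ IH]; first exact: sp0.
by rewrite -[opf _]/(c *: (opf s : H -> K) + (opf w)); exact: spS.
Qed.

Lemma op_cspanE (S : set (H -> K)) (T : Op H K) : (forall s, S s -> bounded_op s) ->
  op_cspan S T <-> cs (@bnd R H K) (pset S) T.
Proof.
move=> hS; split=> [[_ h] e e0|h].
  have [_ /(lspan_pset hS)[t ht ->] hb_] := h e e0; exists t => //.
  by move=> x; rewrite suboE; exact: hb_.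
split=> [|e e0]; first exact: opP.
have [t ht hb_] := h e e0; exists (opf t); first exact: sp_lspan_pset.
by move=> x; have := hb_ x; rewrite suboE.
Qed.
Lemma op_cspanP (S : set (H -> K)) f : (forall s, S s -> bounded_op s) ->
  op_cspan S f -> exists2 T : Op H K, f = T & cs (@bnd R H K) (pset S) T.
Proof. by move=> hS h; have b := h.1; exists (MkOp b) => //; apply/op_cspanE. Qed.
End Pack.

Lemma pset_CA (H : Hil) (A : set (H -> H)) : cstar_algebra A -> CA (pset A).
Proof.
move=> cA; split.
- split; rewrite /pset.
  + have : op_cspan A 0; last by move=> /(cstar_closed cA).
    apply: (iffRL (@op_cspanE H H A 0 (cstar_bounded cA))).
    exact: csub0 (cs_csub (bnd_axioms H H) _).
  + move=> c v w Av Aw; apply: (cstar_closed cA).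
    apply: (iffRL (@op_cspanE H H A (c *: v + w) (cstar_bounded cA))).
    by apply: (csubL (cs_csub (bnd_axioms H H) _)); exact: (cs_in (bnd_axioms H H)).
  + move=> v h; apply: (cstar_closed cA).
    apply: (iffRL (@op_cspanE H H A v (cstar_bounded cA))).
    by move=> e /h [w Aw hw]; exists w => //; exact: sp_in.
- by move=> a b ha hb_; exact: (cstar_mul cA ha hb_).
- by move=> a ha; rewrite /pset -adjE; exact: cstar_adj.
Qed.

Lemma cstar_nd (H : Hil) (A : set (H -> H)) : cstar_algebra A ->
  hdense (fun y => exists a x, pset A a /\ y = a x).
Proof.
move=> cA; apply: dense_sub (closure_dense (cstar_nondegenerate cA)) _ => _ [a Aa [x _ <-]].
by exists (pk a), x; rewrite /pset !pkE//; exact: cstar_bounded Aa.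
Qed.

Lemma atensE (H K : Hil) (A : set (H -> H)) (B : set (K -> K)) T :
  (forall a, A a -> bounded_op a) -> (forall b, B b -> bounded_op b) ->
  atens A B (opf T) <-> at_ (pset A) (pset B) T.
Proof.
move=> hA hB; rewrite /atens op_cspanE; last first.
  move=> _ [a Aa [b Bb <-]].
  by rewrite -(pkE (hA a Aa)) -(pkE (hB b Bb)) otensE; exact: opP.
split; apply: (cs_min (cs_csub (bnd_axioms _ _) _)) => t ht; apply: (cs_in (bnd_axioms _ _)).
  case: ht => a Aa [b Bb]; rewrite -(pkE (hA a Aa)) -(pkE (hB b Bb)) otensE => /opf_inj <-.
  by exists (pk a), (pk b); split=> //; rewrite /pset pkE//; [exact: hA|exact: hB].
case: ht => a [b [Aa Bb ->]]; rewrite /pset -otensE.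
by exists a => //; exists b.
Qed.

Lemma atensP (H K : Hil) (A : set (H -> H)) (B : set (K -> K)) f : atens A B f ->
  exists T : Op _ _, f = T.
Proof. by move=> [b _]; exists (MkOp b). Qed.

Lemma pset_atens (H K : Hil) (A : set (H -> H)) (B : set (K -> K)) :
  (forall a, A a -> bounded_op a) -> (forall b, B b -> bounded_op b) ->
  pset (atens A B) = at_ (pset A) (pset B).
Proof. by move=> hA hB; apply/funext => T; apply/propext/atensE. Qed.

Lemma CA_prod (H : Hil) (A : Op H H -> Prop) a : CA A -> A a ->
  cs (@bnd R H H) (fun t => exists a b, [/\ A a, A b & t = a ** b]) a.
Proof.
move=> cA Aa e e0.
have [|u [Au _ _ hu]] := approx_unit (F := [:: a]) cA _ e0.
  by move=> b; rewrite inE => /eqP ->.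
exists (u ** a); first by apply: sp_in; exists u, a.
by have [] := hu a (mem_head _ _).
Qed.

Lemma mor_id (H : Hil) (A : set (H -> H)) : cstar_algebra A -> morphism A A id.
Proof.
move=> cA; have hA := cstar_bounded cA.
split=> //.
- by move=> a Aa; split=> [|b Ab]; [exact: hA|split; exact: (cstar_mul cA)].
have hp : forall s, [set a \o b | a in A & b in A] s -> bounded_op s.
  by move=> _ [a Aa [b Ab <-]]; apply: hA; exact: (cstar_mul cA).
apply/seteqP; split=> f.
  move=> /(op_cspanP hp)[T -> hT]; apply: (cstar_closed cA).
  apply: (iffRL (@op_cspanE H H A T hA)).
  move: hT; apply: (cs_min (cs_csub (bnd_axioms _ _) _)) => t [a Aa [b Ab e]].
  by apply: (cs_in (bnd_axioms _ _)); rewrite /pset -e; exact: (cstar_mul cA).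
move=> Af; rewrite -(pkE (hA f Af)); apply/(op_cspanE _ hp).
have : pset A (pk f) by rewrite /pset pkE//; exact: hA.
move=> /(CA_prod (pset_CA cA)).
apply: (cs_min (cs_csub (bnd_axioms _ _) _)) => _ [a [b [Aa Ab ->]]].
by apply: (cs_in (bnd_axioms _ _)); exists a => //; exists b.
Qed.

Section Morphisms.
Variables (H K : Hil) (A : set (H -> H)) (B : set (K -> K)) (phi : (H -> H) -> (K -> K)).
Hypotheses (cA : cstar_algebra A) (cB : cstar_algebra B) (mphi : morphism A B phi).
Definition ph (f : (H -> H) -> (K -> K)) : Op H H -> Op K K := fun a => pk (f a).
Lemma phE a : pset A a -> ph phi a = phi a :> (K -> K).
Proof. by move=> Aa; rewrite /ph pkE//; exact: (mor_mult mphi Aa).1. Qed.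

Lemma ph_hom : hom (pset A) (ph phi).
Proof.
split.
- move=> c a b Aa Ab; apply: opf_inj.
  rewrite -[RHS]/(c *: (opf (ph phi a) : K -> K) + opf (ph phi b)) !phE//.
    exact: (mor_lin mphi).
  exact: (csubL (ca_csub (pset_CA cA))).
- move=> a b Aa Ab; apply: opf_inj.
  rewrite -[RHS]/(opf (ph phi a) \o opf (ph phi b)) !phE//.
    exact: (mor_mul mphi).
  exact: (ca_mul (pset_CA cA)).
- move=> a Aa; apply: opf_inj; rewrite phE; last exact: (ca_adj (pset_CA cA)).
  by rewrite -!adjE phE//; exact: (mor_adj mphi).
Qed.

Lemma ph_mult a b : pset A a -> pset B b -> pset B (ph phi a ** b) /\ pset B (b ** ph phi a).
Proof.
move=> Aa Bb; have [_ h] := mor_mult mphi Aa; have [h1 h2] := h b Bb.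
by rewrite /pset -[opf (_ ** b)]/(opf (ph phi a) \o opf b) -[opf (b ** _)]/(opf b \o opf (ph phi a)) phE.
Qed.

Lemma ph_span b : pset B b ->
  cs (@bnd R K K) (fun t => exists a b, [/\ pset A a, pset B b & t = ph phi a ** b]) b.
Proof.
rewrite /pset -{1}(mor_nondegenerate mphi) => /op_cspanP[|T /opf_inj -> ].
  move=> _ [a Aa [c Bc <-]]; apply: (cstar_bounded cB).
  by have [_ /(_ c Bc)[]] := mor_mult mphi Aa.
apply: (cs_min (cs_csub (bnd_axioms _ _) _)) => t [a Aa [c Bc e]]; apply: (cs_in (bnd_axioms _ _)).
have ha := cstar_bounded cA Aa; have hc := cstar_bounded cB Bc.
exists (pk a), (pk c); split; rewrite /pset ?pkE//.
apply: opf_inj; rewrite -[RHS]/(opf (ph phi (pk a)) \o opf (pk c)) phE /pset ?pkE//.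
Qed.

Lemma ph_nd : nd (pset A) (ph phi).
Proof.
apply: dense_cs (cstar_nd cB) _ => _ [b [x [Bb ->]]].
have [c c0 hc] := op_bnd (oid K).
apply: (@cs_map R (Op K K) K _ _ (hb_axioms K) (fun t => t x) `|x| _ _ _ _ _ _ b (ph_span Bb)) => //.
- by move=> v d d0 hv; rewrite /hb mulrC; exact: hv.
by move=> _ [a [b' [Aa Bb' ->]]]; apply: (cs_in (hb_axioms K)); exists a, (b' x).
Qed.
End Morphisms.

Lemma atens_cstar (H K : Hil) (A : set (H -> H)) (B : set (K -> K)) :
  cstar_algebra A -> cstar_algebra B -> cstar_algebra (atens A B).
Proof.
move=> cA cB; have hA := cstar_bounded cA; have hB := cstar_bounded cB.
have pE := pset_atens hA hB.
have cAB := at_CA (pset_CA cA) (pset_CA cB).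
have hAB f : atens A B f -> bounded_op f by case.
split; first exact: hAB.
- move=> f /(op_cspanP hAB)[T -> hT]; rewrite -[atens A B T]/(pset (atens A B) T) pE.
  by move: hT; apply: (cs_min (ca_csub cAB)) => t; rewrite pE.
- move=> a b h1 h2; have [S eS] := atensP h1; have [T eT] := atensP h2.
  rewrite eS eT -[opf S \o opf T]/(opf (S ** T)) -[atens A B _]/(pset (atens A B) (S ** T)) pE.
  by apply: (ca_mul cAB); rewrite -pE /pset -?eS -?eT.
- move=> a h1; have [S eS] := atensP h1; rewrite eS adjE -[atens A B _]/(pset (atens A B) (ad S)) pE.
  by apply: (ca_adj cAB); rewrite -pE /pset -eS.
have dd : hdense (fun y => exists a x, at_ (pset A) (pset B) a /\ y = a x).
  (* Nondegeneracy is that of id (x) id, which is the identity on the tensor product. *)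
  pose T := thom (pset_CA cA) (pset_CA cB) (ph_hom cA (mor_id cA)) (ph_hom cB (mor_id cB)).
  have n0 : nd (at_ (pset A) (pset B)) T.
    exact: thom_nd (ph_nd cA cA (mor_id cA)) (ph_nd cB cB (mor_id cB)).
  have TE t : at_ (pset A) (pset B) t -> T t = t.
    apply: (hom_eq cAB (psi := id)); [exact: thom_hom|by []|].
    move=> _ [a [b [Aa Bb ->]]].
    by split; [exact: at_in|rewrite /T thomE// /ph !pkK].
  apply: (dense_sub n0) => y [a [x [ha ->]]]; exists a, x; rewrite TE//.
apply/seteqP; split=> // v _ U /nbhs_ballP[e /= e0 eU].
have [w hw vw] := dd v (e / 2) (divr_gt0 e0 (ltr0Sn _ 1)).
exists w; split.
  apply: sp_lspan; elim: hw => [|c s t [a [x [ha ->]]] _ IH]; first exact: sp0.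
  by apply: spS => //; exists a; [rewrite -pE in ha|exists x].
apply: eU; rewrite -ball_normE /=; apply: le_lt_trans vw _.
by rewrite ltr_pdivrMr// ltr_pMr// ltr1n.
Qed.
End Boundary.

(** * Tensor products of morphisms on multipliers *)

Section MorApp.
Variable R : realType.
Notation C := (Cplx R).
Notation Hil := (hilbertType R).
Notation csub_at := (cs_csub (bnd_axioms _ _)).
Notation at_in_ := (cs_in (bnd_axioms _ _)).

Lemma hom_preim2 (H K L : Hil) (A : Op H H -> Prop) (f : Op H H -> Op K K) (g : Op H H -> Op L L) P :
  CA A -> hom A f -> hom A g -> csub (bpair (@bnd R _ _) (@bnd R _ _)) P ->
  csub (@bnd R _ _) (fun a => A a /\ P (f a, g a)).
Proof.
move=> cA hf hg hP; split.
- by split; [exact: CA0|rewrite (hom0 cA hf) (hom0 cA hg); exact: (csub0 hP)].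
- move=> c v w [v1 v2] [w1 w2]; split; first exact: (csubL (ca_csub cA)).
  by rewrite (hom_lin hf)// (hom_lin hg)//; exact: (csubL hP c v2 w2).
- move=> v h.
  have Av : A v by apply: (csubC (ca_csub cA)) => e /h[w [Aw _] b]; exists w.
  split => //; apply: (csubC hP) => e e0; have [w [Aw Pw] b] := h e e0.
  exists (f w, g w) => //; split.
    rewrite -[X in bnd X]/(f v - f w) -(homB cA hf)//; apply: (hom_contr cA hf) => //.
      exact: CAB.
    exact: ltW.
  rewrite -[X in bnd X]/(g v - g w) -(homB cA hg)//; apply: (hom_contr cA hg) => //.
    exact: CAB.
  exact: ltW.
Qed.

Lemma csub_ker (H K L : Hil) (A : Op H H -> Prop) (f : Op H H -> Op K L) M : CA A ->
  (forall (c : C) a b, A a -> A b -> f (c *: a + b) = c *: f a + f b) -> 0 <= M ->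
  (forall a b, A a -> 0 <= b -> bnd a b -> bnd (f a) (M * b)) ->
  csub (@bnd R _ _) (fun a => A a /\ f a = 0).
Proof.
move=> cA fL M0 fb.
have f0 : f 0 = 0.
  have := fL 1 0 0 (CA0 cA) (CA0 cA); rewrite !scale1r addr0 => h.
  by apply: (addrI (f 0)); rewrite addr0 -h.
split.
- by split=> //; exact: CA0.
- move=> c v w [v1 v2] [w1 w2]; split; first exact: (csubL (ca_csub cA)).
  by rewrite fL// v2 w2 scaler0 addr0.
- move=> v h.
  have Av : A v by apply: (csubC (ca_csub cA)) => e /h[w [Aw _] b]; exists w.
  split=> //; apply: (bnd_eps0 M0) => e e0; have [w [Aw fw] b] := h e e0.
  have -> : f v = f (v - w).
    have := fL (-1) w v Aw Av; rewrite fw scaler0 add0r => <-.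
    by rewrite scaleN1r addrC.
  by apply: fb => //; [exact: CAB|exact: ltW].
Qed.

Lemma hom_id (H : Hil) (A : Op H H -> Prop) : hom A id.
Proof. by []. Qed.

Lemma il_ext (H K L : Hil) (S T : Op (htens H K) L) :
  (forall x, S ** il K x = T ** il K x) -> S = T.
Proof. by move=> h; apply: tens_ext => x y; rewrite -!ilE -!ocompE h. Qed.
Lemma ir_ext (H K L : Hil) (S T : Op (htens H K) L) :
  (forall y, S ** ir H y = T ** ir H y) -> S = T.
Proof. by move=> h; apply: tens_ext => x y; rewrite -!irE -!ocompE h. Qed.
Lemma sw_il (H K : Hil) (x : H) : sw H K ** il K x = ir K x.
Proof. by apply: op_ext => y; rewrite !ocompE ilE irE swE. Qed.
Lemma sw_ir (H K : Hil) (y : K) : sw H K ** ir H y = il H y.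
Proof. by apply: op_ext => x; rewrite !ocompE ilE irE swE. Qed.
Lemma sw_sw (H K : Hil) : sw H K ** sw K H = oid _.
Proof. by apply: tens_ext => x y; rewrite !ocompE !swE. Qed.

Section AppRel.
Variables (H1 H2 K1 K2 : Hil) (A1 : Op H1 H1 -> Prop) (A2 : Op H2 H2 -> Prop).
Variables (phi : Op H1 H1 -> Op K1 K1) (psi : Op H2 H2 -> Op K2 K2).
Hypotheses (c1 : CA A1) (c2 : CA A2) (hphi : hom A1 phi) (hpsi : hom A2 psi).

(* X is a left multiplier and (phi (x) psi)(X) = Z. *)
Definition app X Z := forall t, at_ A1 A2 t ->
  at_ A1 A2 (X ** t) /\ Z ** thom c1 c2 hphi hpsi t = thom c1 c2 hphi hpsi (X ** t).

Lemma app_ad X Z : unit_ X -> unit_ Z -> app X Z ->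
  (forall t, at_ A1 A2 t -> at_ A1 A2 (ad X ** t)) -> app (ad X) (ad Z).
Proof.
move=> uX uZ h hX t ht; split; first exact: hX.
have [_ e] := h _ (hX t ht).
by rewrite -(unitK (thom c1 c2 hphi hpsi (ad X ** t)) uZ) e unitVK.
Qed.

Let cat := at_CA c1 c2.

Lemma mg_pairR s x : at_ A1 A2 s ->
  mg A2 psi (thom c1 c2 hphi (@hom_id _ A2) s ** il _ x, thom c1 c2 hphi hpsi s ** il _ x).
Proof.
move=> hs; suff [] : at_ A1 A2 s /\ mg A2 psi
  (thom c1 c2 hphi (@hom_id _ A2) s ** il _ x, thom c1 c2 hphi hpsi s ** il _ x) by [].
move: s hs; apply: cs_min => [|_ [a [b [Aa Ab ->]]]].
  apply: (hom_preim2 cat (thom_hom _ _ _ _) (thom_hom _ _ _ _)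
    (P := fun p => mg A2 psi (p.1 ** il _ x, p.2 ** il _ x))).
  by apply: cpair_r; exact: mg_csub.
split; first exact: at_in.
rewrite (thomE c1 c2 hphi (@hom_id _ A2) Aa Ab) (thomE c1 c2 hphi hpsi Aa Ab) !ot_il.
exact: mg_in.
Qed.

Lemma mg_pairL s y : at_ A1 A2 s ->
  mg A1 phi (sw _ _ ** (thom c1 c2 (@hom_id _ A1) hpsi s ** ir _ y),
             sw _ _ ** (thom c1 c2 hphi hpsi s ** ir _ y)).
Proof.
move=> hs; suff [] : at_ A1 A2 s /\ mg A1 phi
  (sw _ _ ** (thom c1 c2 (@hom_id _ A1) hpsi s ** ir _ y),
             sw _ _ ** (thom c1 c2 hphi hpsi s ** ir _ y)) by [].
move: s hs; apply: cs_min => [|_ [a [b [Aa Ab ->]]]].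
  apply: (hom_preim2 (f := thom c1 c2 (@hom_id _ A1) hpsi) (g := thom c1 c2 hphi hpsi) cat
    (thom_hom _ _ _ _) (thom_hom _ _ _ _) (P := fun p => mg A1 phi (sw H1 K2 ** (p.1 ** ir _ y), sw K1 K2 ** (p.2 ** ir _ y)))).
  have h1 := cpair_l (sw H1 K2) (sw K1 K2) (mg_csub K2 A1 phi).
  exact: (cpair_r (ir H1 y) (ir K1 y) h1).
split; first exact: at_in.
rewrite (thomE c1 c2 (@hom_id _ A1) hpsi Aa Ab) (thomE c1 c2 hphi hpsi Aa Ab).
by rewrite !ot_ir !ocompA !sw_ir; exact: mg_in.
Qed.
End AppRel.

Section AppRel2.
Variables (H1 H2 K1 K2 : Hil) (A1 : Op H1 H1 -> Prop) (A2 : Op H2 H2 -> Prop).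
Variables (phi : Op H1 H1 -> Op K1 K1) (psi : Op H2 H2 -> Op K2 K2).
Hypotheses (c1 : CA A1) (c2 : CA A2) (hphi : hom A1 phi) (hpsi : hom A2 psi).
Notation id1 := (@hom_id _ A1).
Notation id2 := (@hom_id _ A2).

Lemma thom_id s : at_ A1 A2 s -> thom c1 c2 id1 id2 s = s.
Proof.
apply: (hom_eq (at_CA c1 c2) (psi := id) (thom_hom _ _ _ _) (@hom_id _ _)).
by move=> _ [a [b [Aa Ab ->]]]; split; [exact: at_in|rewrite thomE].
Qed.

(** It suffices to test on vectors [phi a x]; there both operators are read off from [X ** ot a b],
    an element of the tensor product, to which [mg_pairR] applies. *)
Lemma relR_of_app X Y Z : nd A1 phi -> app c1 c2 hphi id2 X Y -> app c1 c2 hphi hpsi X Z ->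
  rel A2 psi Y Z.
Proof.
move=> n1 hY hZ; apply: (rel_dense n1) => _ b [a [x [Aa ->]]] Ab.
have [hs eY] := hY _ (at_in Aa Ab); have [_ eZ] := hZ _ (at_in Aa Ab).
rewrite -!ot_il !ocompA.
rewrite -(thomE c1 c2 hphi id2 Aa Ab) eY -(thomE c1 c2 hphi hpsi Aa Ab) eZ.
exact: mg_pairR.
Qed.

Lemma relL_of_app X Y Z : nd A2 psi -> app c1 c2 id1 hpsi X Y -> app c1 c2 hphi hpsi X Z ->
  rel A1 phi (sw _ _ ** Y ** sw _ _) (sw _ _ ** Z ** sw _ _).
Proof.
move=> n2 hY hZ; apply: (rel_dense n2) => _ a [b [y [Ab ->]]] Aa.
have [hs eY] := hY _ (at_in Aa Ab); have [_ eZ] := hZ _ (at_in Aa Ab).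
rewrite -!(ocompA _ (sw _ _)) !(ocompA (sw _ _) (il _ _)) !sw_il -!ot_ir.
rewrite -!(ocompA (sw _ _)) !(ocompA _ _ (ir _ _)).
rewrite -(thomE c1 c2 id1 hpsi Aa Ab) eY -(thomE c1 c2 hphi hpsi Aa Ab) eZ.
rewrite -!(ocompA (sw _ _)).
exact: mg_pairL.
Qed.

(** The legs are treated one after the other, the first one as a second leg after a flip. On
    [ot a b] the module relations determine the action of Y and then of Z; linearity and boundedness
    extend this to all t. *)
Lemma app_of_rel X Y Z : (forall t, at_ A1 A2 t -> at_ A1 A2 (X ** t)) ->
  rel A2 psi X Y -> rel A1 phi (sw _ _ ** Y ** sw _ _) (sw _ _ ** Z ** sw _ _) ->
  app c1 c2 hphi hpsi X Z.
Proof.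
move=> hX rY rZ t ht; split; first exact: hX.
have key a b : A1 a -> A2 b -> Z ** thom c1 c2 hphi hpsi (ot a b) = thom c1 c2 hphi hpsi (X ** ot a b).
  move=> Aa Ab; have hs := hX _ (at_in Aa Ab); set s := X ** ot a b in hs *.
  have e1 : Y ** ot a (psi b) = thom c1 c2 id1 hpsi s.
    apply: il_ext => x; have m1 := mg_pairR c1 c2 id1 hpsi x hs.
    have := rY _ (mg_in psi (a x) Ab).
    rewrite -[X in mg _ _ X]/(X ** (il _ (a x) ** b), Y ** (il _ (a x) ** psi b)) -!ot_il !ocompA.
    move=> m2; apply: (mg_fun c2 hpsi m2).
    have e0 : thom c1 c2 id1 id2 s = s by exact: thom_id.
    by rewrite e0 in m1.
  rewrite (thomE c1 c2 hphi hpsi Aa Ab); apply: ir_ext => y.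
  have m1 := mg_pairL c1 c2 hphi hpsi y hs.
  have := rZ _ (mg_in phi (psi b y) Aa).
  rewrite -[X in mg _ _ X]/(_ ** _ ** _ ** (il _ (psi b y) ** a), _ ** _ ** _ ** (il _ (psi b y) ** phi a)).
  rewrite -!(ocompA _ (sw _ _)) !(ocompA (sw _ _) (il _ _)) !sw_il -!ot_ir.
  rewrite -!(ocompA (sw _ _)) !(ocompA _ _ (ir _ _)) e1 -!(ocompA (sw _ _)) => m2.
  by apply: (unit_injl (sw_unit _ _)); exact: (mg_fun c1 hphi m2 m1).
suff [] : at_ A1 A2 t /\ Z ** thom c1 c2 hphi hpsi t - thom c1 c2 hphi hpsi (X ** t) = 0.
  by move=> _ /eqP; rewrite subr_eq0 => /eqP.
have hT := thom_hom c1 c2 hphi hpsi; have cA := at_CA c1 c2.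
have [bX bX0 hbX] := op_bnd X; have [bZ bZ0 hbZ] := op_bnd Z.
move: t ht; apply: cs_min.
  apply: (csub_ker (M := bZ + bX) cA).
  - move=> c u v hu hv; rewrite (hom_lin hT)// !ocompDr !ocompZr (hom_lin hT); [|exact: hX|exact: hX].
    abel.
  - by rewrite addr_ge0.
  move=> u b hu b0 hb_; rewrite mulrDl; apply: (bdB (bnd_axioms _ _)).
    by apply: bnd_comp => //; exact: (hom_contr cA hT hu b0 hb_).
  apply: (hom_contr cA hT (hX _ hu)); first by rewrite mulr_ge0.
  exact: bnd_comp.
move=> _ [a [b [Aa Ab ->]]]; split; first exact: at_in.
by rewrite key// subrr.
Qed.
End AppRel2.

Section Tensor.
Variables (H1 H2 K1 K2 : Hil) (A1 : set (H1 -> H1)) (A2 : set (H2 -> H2)).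
Variables (B1 : set (K1 -> K1)) (B2 : set (K2 -> K2)).
Variables (phi : (H1 -> H1) -> (K1 -> K1)) (psi : (H2 -> H2) -> (K2 -> K2)).
Hypotheses (cA1 : cstar_algebra A1) (cA2 : cstar_algebra A2).
Hypotheses (cB1 : cstar_algebra B1) (cB2 : cstar_algebra B2).
Hypotheses (mphi : morphism A1 B1 phi) (mpsi : morphism A2 B2 psi).
Let Phi := thom (pset_CA cA1) (pset_CA cA2) (ph_hom cA1 mphi) (ph_hom cA2 mpsi).
Let hPhi : hom (at_ (pset A1) (pset A2)) Phi. Proof. exact: thom_hom. Qed.
Let PhiE a b : pset A1 a -> pset A2 b -> Phi (ot a b) = ot (ph phi a) (ph psi b).
Proof. exact: thomE. Qed.
Let cA := at_CA (pset_CA cA1) (pset_CA cA2).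
Let cB := at_CA (pset_CA cB1) (pset_CA cB2).
Let nPhi : nd (at_ (pset A1) (pset A2)) Phi.
Proof. exact: thom_nd (ph_nd cA1 cB1 mphi) (ph_nd cA2 cB2 mpsi). Qed.
Let eA := pset_atens (cstar_bounded cA1) (cstar_bounded cA2).
Let eB := pset_atens (cstar_bounded cB1) (cstar_bounded cB2).

Lemma thom_mult t s : at_ (pset A1) (pset A2) t -> at_ (pset B1) (pset B2) s ->
  at_ (pset B1) (pset B2) (Phi t ** s) /\ at_ (pset B1) (pset B2) (s ** Phi t).
Proof.
move=> ht hs.
suff : at_ (pset A1) (pset A2) t /\ forall s, at_ (pset B1) (pset B2) s ->
    at_ (pset B1) (pset B2) (Phi t ** s) /\ at_ (pset B1) (pset B2) (s ** Phi t).
  by move=> [_]; apply.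
move: t ht; apply: cs_min => [|_ [a [b [Aa Ab ->]]]].
  apply: (hom_preim cA hPhi (P := fun T => forall s, at_ (pset B1) (pset B2) s ->
    at_ (pset B1) (pset B2) (T ** s) /\ at_ (pset B1) (pset B2) (s ** T))).
  apply: csub_forall => u _; apply: csub_and.
    by apply: csub_compr; exact: csub_at.
  by apply: csub_compl; exact: csub_at.
split=> [|{hs}s' hs]; first exact: at_in.
rewrite (PhiE Aa Ab); move: s' hs; apply: cs_min => [|_ [c [d [Bc Bd ->]]]].
  apply: csub_and; first by apply: csub_compl; exact: csub_at.
  by apply: csub_compr; exact: csub_at.
have [h1 h2] := ph_mult mphi Aa Bc; have [h3 h4] := ph_mult mpsi Ab Bd.
by rewrite !ot_comp; split; apply: at_in.
Qed.

Lemma thom_span s : at_ (pset B1) (pset B2) s ->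
  cs (@bnd R _ _) (fun u => exists t s, [/\ at_ (pset A1) (pset A2) t, at_ (pset B1) (pset B2) s & u = Phi t ** s]) s.
Proof.
apply: (cs_min (csub_at _)) => _ [c [d [Bc Bd ->]]].
have [n n0 hn] := op_bnd c; have [m m0 hm] := op_bnd d.
apply: (@cs_map _ _ _ _ _ (bnd_axioms _ _) (fun c => ot c d) m _ _ _ _ _ _ c (ph_span cA1 cB1 mphi Bc)) => //.
- by move=> k v w; exact: otLl.
- by move=> v b b0 hv; rewrite mulrC; exact: bnd_ot.
move=> _ [a [b [Aa Bb ->]]].
have [q q0 hq] := op_bnd (ph phi a ** b).
apply: (@cs_map _ _ _ _ _ (bnd_axioms _ _) (fun d => ot (ph phi a ** b) d) q _ _ _ _ _ _ d (ph_span cA2 cB2 mpsi Bd)) => //.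
- by move=> k v w; exact: otLr.
- by move=> v k k0 hv; exact: bnd_ot.
move=> _ [a' [b' [Aa' Bb' ->]]]; apply: at_in_.
exists (ot a a'), (ot b b'); split; [exact: at_in|exact: at_in|].
by rewrite (PhiE Aa Aa') ot_comp.
Qed.

Let psetA f : atens A1 A2 f -> exists2 T, f = opf T & at_ (pset A1) (pset A2) T.
Proof. by move=> h; have [T e] := atensP h; exists T => //; rewrite -eA /pset -e. Qed.
Let psetB f : atens B1 B2 f -> exists2 T, f = opf T & at_ (pset B1) (pset B2) T.
Proof. by move=> h; have [T e] := atensP h; exists T => //; rewrite -eB /pset -e. Qed.
Let toB T : at_ (pset B1) (pset B2) T -> atens B1 B2 T.
Proof. by rewrite -eB. Qed.
Let toA T : at_ (pset A1) (pset A2) T -> atens A1 A2 T.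
Proof. by rewrite -eA. Qed.

Let mor_thom : morphism (atens A1 A2) (atens B1 B2) (fun f => Phi (pk f)).
Proof.
have cAf := atens_cstar cA1 cA2; have cBf := atens_cstar cB1 cB2.
split.
- move=> f /psetA[T -> hT]; rewrite pkK; split=> [|g /psetB[S -> hS]]; first exact: opP.
  have [h1 h2] := thom_mult hT hS.
  by split; [exact: (toB h1)|exact: (toB h2)].
- move=> c f g /psetA[T -> hT] /psetA[S -> hS].
  rewrite -[c *: opf T + opf S]/(opf (c *: T + S)) !pkK (hom_lin hPhi)//.
- move=> f g /psetA[T -> hT] /psetA[S -> hS].
  by rewrite -[opf T \o opf S]/(opf (T ** S)) !pkK (hom_mul hPhi).
- by move=> f /psetA[T -> hT]; rewrite !adjE !pkK (hom_adj hPhi)// adjE.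
have hb_ : forall s, [set opf (Phi (pk a)) \o b | a in atens A1 A2 & b in atens B1 B2] s -> bounded_op s.
  by move=> _ [f /psetA[T -> hT] [g /psetB[S -> hS] <-]]; exact: (opP (Phi (pk T) ** S)).
apply/seteqP; split=> f.
  move=> /(op_cspanP hb_)[T -> hT]; apply: toB; move: hT.
  apply: (cs_min (csub_at _)) => t [g /psetA[S -> hS] [h /psetB[U -> hU] e]].
  have -> : t = Phi S ** U by apply: opf_inj; rewrite -e pkK.
  exact: (thom_mult hS hU).1.
move=> /psetB[T -> hT]; apply/op_cspanE => //.
move: (thom_span hT); apply: (cs_min (csub_at _)) => _ [t [s [ht hs ->]]]; apply: at_in_.
by exists (opf t); [exact: toA|exists (opf s); [exact: toB|rewrite pkK]].
Qed.

(** The choice in [mor_tens] succeeds because [thom] is a witness; any other witness agrees with it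
    on elementary tensors, hence on the whole tensor product. *)
Lemma mor_tensE T : at_ (pset A1) (pset A2) T -> mor_tens A1 A2 B1 B2 phi psi T = Phi T.
Proof.
rewrite /mor_tens; set S := [set P | _].
have : S (xget (fun=> 0) S).
  apply: xgetPex; exists (fun f => opf (Phi (pk f))); split; first exact: mor_thom.
  move=> a b Aa Ab; have ha := cstar_bounded cA1 Aa; have hb_ := cstar_bounded cA2 Ab.
  rewrite -(pkE ha) -(pkE hb_) otensE pkK PhiE /pset ?pkE//.
  rewrite -otensE -[ph phi _]/(pk _) -[ph psi _]/(pk _) !pkE//.
    by have [] := mor_mult mpsi Ab.
  by have [] := mor_mult mphi Aa.
move: (xget _ _) => F [mF hF] hT.
have cAf := atens_cstar cA1 cA2.
have hpF := ph_hom cAf mF.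
rewrite eA in hpF.
have E : ph F T = Phi T.
  apply: (hom_eq cA hpF hPhi _ hT) => _ [a [b [Aa Ab ->]]]; split; first exact: at_in.
  apply: opf_inj; rewrite (phE mF); last by rewrite eA; exact: at_in.
  rewrite -otensE (hF _ _ Aa Ab) (PhiE Aa Ab).
  by rewrite -otensE (phE mphi Aa) (phE mpsi Ab).
by rewrite -E (phE mF) // eA.
Qed.

Notation app := (app (pset_CA cA1) (pset_CA cA2) (ph_hom cA1 mphi) (ph_hom cA2 mpsi)).

Lemma app_mor_app X Z : app X Z -> mor_app A1 A2 B1 B2 phi psi X = Z.
Proof.
move=> h; apply: xget_unique.
  split=> [|f /psetA[T -> hT]]; first exact: opP.
  have [h1 h2] := h T hT.
  by rewrite -[opf X \o opf T]/(opf (X ** T)) !mor_tensE//; exact: (congr1 (@opf _ _ _) h2).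
move=> F [bF hF]; rewrite -[F]/(opf (MkOp bF)); congr opf.
apply: (nd_eq nPhi) => t ht; apply: opf_inj; have [h1 ->] := h t ht.
by rewrite -(mor_tensE h1) -[RHS](hF t (toA ht)) (mor_tensE ht).
Qed.

Lemma mor_app_ex X : (forall t, at_ (pset A1) (pset A2) t -> at_ (pset A1) (pset A2) (X ** t)) ->
  exists2 Z, mor_app A1 A2 B1 B2 phi psi X = opf Z & app X Z.
Proof.
move=> hX; have [Z _ hZ] := ext_ex cA hPhi nPhi hX.
have h : app X Z by move=> t ht; split; [exact: hX|exact: hZ].
by exists Z => //; exact: app_mor_app.
Qed.
End Tensor.
End MorApp.

(** * Solving the leg equations *)

Section LegAlgebra.
Variable R : realType.
Notation C := (Cplx R).
Notation Hil := (hilbertType R).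

(** In [Y_ex] the letters are [w = W_23], [a = X_12], [b = X_13], [v0 = V_24] and [v1 = V_34]. The
    right side is the operator T on legs 124, the left side is T on legs 134 conjugated by w. *)
Lemma triv_mid (K : Hil) (w a b v0 v1 : Op K K) : unit_ w -> unit_ a -> unit_ v1 ->
  a ** b ** w = w ** a -> w ** v0 ** v1 = v1 ** w -> a ** v1 = v1 ** a ->
  ad w ** (ad b ** v1 ** b ** ad v1) ** w = ad a ** v0 ** a ** ad v0.
Proof.
move=> uw ua_ uv1 h1 h2 h3.
have eb : b = ad a ** w ** a ** ad w.
  by apply: (unit_injr uw); rewrite unitrVK// -!ocompA -h1 -ocompA unitK.
have h4 : a ** v1 ** ad a = v1 by rewrite h3 unitrK.
have h5 : ad w ** v1 ** w = v0 ** v1 by rewrite -ocompA -h2 -ocompA unitK.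
have h6 : ad w ** ad v1 ** w = ad v1 ** ad v0.
  by have := congr1 (@ad R K K) h5; rewrite !adM adK ocompA.
rewrite eb !adM !adK.
have -> : ad w ** (w ** (ad a ** (ad w ** a)) ** v1 ** (ad a ** w ** a ** ad w) ** ad v1) ** w =
  (ad w ** w) ** ad a ** (ad w ** (a ** v1 ** ad a) ** w) ** a ** (ad w ** ad v1 ** w).
  by rewrite !ocompA.
rewrite (proj1 uw) o1comp h4 h5 h6 -!ocompA; congr (_ ** (_ ** _)).
by rewrite !ocompA -h3 unitrK.
Qed.

(** In [Z_ex] the letters are [w = W_12], [y0 = Y_14], [y1 = Y_24], [v0 = V_13] and [v1 = V_23]. The
    right side is the operator D on legs 134, the left side is D on legs 234 conjugated by w. *)
Lemma triv_first (K : Hil) (w y0 y1 v0 v1 : Op K K) : unit_ w -> unit_ y0 -> unit_ v1 ->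
  y1 ** y0 ** w = w ** y0 -> w ** v0 ** v1 = v1 ** w -> v1 ** y0 = y0 ** v1 ->
  ad w ** (v1 ** y1 ** ad v1 ** ad y1) ** w = v0 ** y0 ** ad v0 ** ad y0.
Proof.
move=> uw uy0 uv1 h1 h2 h3.
have ey : y1 = w ** y0 ** ad w ** ad y0.
  by apply: (unit_injr uy0); rewrite unitrVK//; apply: (unit_injr uw); rewrite unitrVK.
have h4 : ad y0 ** ad v1 ** y0 = ad v1.
  by rewrite -adM h3 adM -ocompA (proj1 uy0) ocomp1.
have h5 : ad w ** v1 ** w = v0 ** v1 by rewrite -ocompA -h2 -ocompA unitK.
have h6 : ad w ** ad v1 ** w = ad v1 ** ad v0.
  by have := congr1 (@ad R K K) h5; rewrite !adM adK ocompA.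
rewrite ey !adM !adK.
have -> : ad w ** (v1 ** (w ** y0 ** ad w ** ad y0) ** ad v1 ** (y0 ** (w ** (ad y0 ** ad w)))) ** w =
  (ad w ** v1 ** w) ** y0 ** (ad w ** (ad y0 ** ad v1 ** y0) ** w) ** ad y0 ** (ad w ** w).
  by rewrite !ocompA.
rewrite h4 h5 h6 (proj1 uw) ocomp1 !ocompA; congr (_ ** _ ** _).
by rewrite -(ocompA v0) h3 !ocompA unitrK.
Qed.

Lemma l23_inj (H K L : Hil) (e : H) (S T : Op (htens K L) (htens K L)) : inner e e = 1 ->
  l23 H S = l23 H T -> S = T.
Proof.
move=> ee h; apply: tens_ext => y z; apply: vec_ext => y' z'.
have := congr1 (fun F : Op _ _ => inner (tens (tens e y') z') (F (tens (tens e y) z))) h.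
by rewrite /= !l23c ee !mul1r.
Qed.
Lemma l13_inj (H K L : Hil) (e : K) (S T : Op (htens H L) (htens H L)) : inner e e = 1 ->
  l13 K S = l13 K T -> S = T.
Proof.
move=> ee h; apply: tens_ext => y z; apply: vec_ext => y' z'.
have := congr1 (fun F : Op _ _ => inner (tens (tens y' e) z') (F (tens (tens y e) z))) h.
by rewrite /= !l13c ee !mulr1.
Qed.

Lemma sandE (K L : Hil) (S : Op K K) (j j' : Op L K) u v :
  inner u ((ad j ** S ** j') v) = inner (j u) (S (j' v)).
Proof. by rewrite !ocompE adEr. Qed.

Section Trivial.
Variable H : Hil.
Variable W : Op (htens H H) (htens H H).
Hypothesis comm : forall d, W ** ot d (oid H) = ot (oid H) d ** W -> exists c : C, d = c *: oid H.
Variable e : H.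
Hypothesis ee : inner e e = 1.
Hypothesis uW : unit_ W.

(** Slicing T over its outer legs gives operators d on the middle one, and the hypothesis becomes
    [W^* (1 (x) d) W = d (x) 1]. So every d is scalar, T does not act on the middle leg, and
    compression by e exhibits Z. *)
Lemma mid_leg (K : Hil) (T : Op (htens (htens H H) K) (htens (htens H H) K)) :
  ad (L23 H K W) ** e134 H T ** L23 H K W = e124 H T -> exists Z, T = l13 H Z.
Proof.
move=> hT; exists (ad (ins2 H K e) ** T ** ins2 H K e).
pose k x w := ir (htens H H) w ** il H x : Op H (htens (htens H H) K).
pose j x w := ir _ w ** ins1 H H x : Op (htens H H) (htens (htens (htens H H) H) K).
have jE x w y z : j x w (tens y z) = tens (tens (tens x y) z) w by rewrite /j ocompE ins1E.
have kE x w y : k x w y = tens (tens x y) w by [].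
have Lj x w : L23 H K W ** j x w = j x w ** W.
  by rewrite /L23 /e123 /l12 -lock /j !ocompA ot_ir -!ocompA l23_ins1.
have d_scal x x' w w' : exists c : C, ad (k x w) ** T ** k x' w' = c *: oid H.
  apply: comm; apply: (unit_injl (unit_ad uW)); rewrite unitK//.
  have e1 : ad (j x w) ** e134 H T ** j x' w' = ot (oid H) (ad (k x w) ** T ** k x' w').
    apply: tens_ext => y' z'; apply: vec_ext => y z.
    by rewrite otE inner_tens (sandE (e134 H T)) (sandE T) !jE e134c mulrC !kE.
  have e2 : ad (j x w) ** e124 H T ** j x' w' = ot (ad (k x w) ** T ** k x' w') (oid H).
    apply: tens_ext => y' z'; apply: vec_ext => y z.
    by rewrite otE inner_tens (sandE (e124 H T)) (sandE T) !jE e124c !kE.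
  rewrite -e1 -e2 -hT.
  have -> : ad (j x w) ** (ad (L23 H K W) ** e134 H T ** L23 H K W) ** j x' w' =
    ad (L23 H K W ** j x w) ** e134 H T ** (L23 H K W ** j x' w') by rewrite adM !ocompA.
  by rewrite !Lj adM !ocompA.
apply: op3_ext => x x' y y' w w'.
have [c hc] := d_scal x x' w w'.
have hcE z z' : inner (tens (tens x z) w) (T (tens (tens x' z') w')) = c * inner z z'.
  have := congr1 (fun F : Op H H => inner z (F z')) hc.
  by rewrite sandE !kE scaleoE innerZ.
by rewrite l13c !ocompE adEr !ins2E !hcE ee mulr1.
Qed.

(** The argument of [mid_leg], with slices over the last two legs. *)
Lemma first_leg (Ka Kb : Hil) (D : Op (htens (htens H Ka) Kb) (htens (htens H Ka) Kb)) :
  ad (L12 Ka Kb W) ** e234 H D ** L12 Ka Kb W = e134 H D -> exists Z, D = l23 H Z.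
Proof.
move=> hT; exists (ad (ins1 Ka Kb e) ** D ** ins1 Ka Kb e).
pose k z w := ir (htens H Ka) w ** ir H z : Op H (htens (htens H Ka) Kb).
pose j z w := ir _ w ** ir _ z : Op (htens H H) (htens (htens (htens H H) Ka) Kb).
have jE z w x y : j z w (tens x y) = tens (tens (tens x y) z) w by [].
have kE z w x : k z w x = tens (tens x z) w by [].
have Lj z w : L12 Ka Kb W ** j z w = j z w ** W.
  by rewrite /L12 /e123 /l12 -!lock /j !ocompA ot_ir -!ocompA ot_ir.
have d_scal z z' w w' : exists c : C, ad (k z w) ** D ** k z' w' = c *: oid H.
  apply: comm; apply: (unit_injl (unit_ad uW)); rewrite unitK//.
  have e1 : ad (j z w) ** e234 H D ** j z' w' = ot (oid H) (ad (k z w) ** D ** k z' w').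
    apply: tens_ext => x' y'; apply: vec_ext => x y.
    by rewrite otE inner_tens (sandE (e234 H D)) (sandE D) !jE e234c mulrC !kE.
  have e2 : ad (j z w) ** e134 H D ** j z' w' = ot (ad (k z w) ** D ** k z' w') (oid H).
    apply: tens_ext => x' y'; apply: vec_ext => x y.
    by rewrite otE inner_tens (sandE (e134 H D)) (sandE D) !jE e134c !kE.
  rewrite -e1 -e2 -hT.
  have -> : ad (j z w) ** (ad (L12 Ka Kb W) ** e234 H D ** L12 Ka Kb W) ** j z' w' =
    ad (L12 Ka Kb W ** j z w) ** e234 H D ** (L12 Ka Kb W ** j z' w') by rewrite adM !ocompA.
  by rewrite !Lj adM !ocompA.
apply: op3_ext => x x' z z' w w'.
have [c hc] := d_scal z z' w w'.
have hcE y y' : inner (tens (tens y z) w) (D (tens (tens y' z') w')) = c * inner y y'.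
  have := congr1 (fun F : Op H H => inner y (F y')) hc.
  by rewrite sandE !kE scaleoE innerZ.
by rewrite l23c !ocompE adEr !ins1E !hcE ee mulr1 mulrC.
Qed.
End Trivial.

(** * Word identities behind the leg equations *)

Section Words.
Variable K : Hil.
Implicit Types a b c d x y v w f xu : Op K K.
Lemma wl2 a b c d x : a ** b = c ** d -> x ** a ** b = x ** c ** d.
Proof. by move=> h; rewrite -!ocompA h. Qed.
Lemma wl3 a b c d d' x : a ** b ** c = d ** d' -> x ** a ** b ** c = x ** d ** d'.
Proof. by move=> h; rewrite -(ocompA x d) -h !ocompA. Qed.

Lemma wl3' a b c d d' d'' x : a ** b ** c = d ** d' ** d'' ->
  x ** a ** b ** c = x ** d ** d' ** d''.
Proof. by move=> h; rewrite -!ocompA (ocompA a) h !ocompA. Qed.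

(** Both sides are multiplied by [x2 x1] on the left and by v on the right, and the given relations
    then move the letters across. In [Y_corep] these factors are [X_23 X_13] and [V_34], on an
    auxiliary third leg. The next two lemmas use the same device. *)
Lemma word_c x1 x2 y1 y2 v w : unit_ x1 -> unit_ x2 -> unit_ v ->
  x1 ** y1 ** v = v ** x1 -> x2 ** y2 ** v = v ** x2 -> x2 ** x1 ** w = w ** x1 ->
  x1 ** y2 = y2 ** x1 -> w ** v = v ** w -> y2 ** y1 ** w = w ** y1.
Proof.
move=> u1 u2 uv h1 h2 h3 h4 h5; apply: (unit_injr uv); apply: (unit_injl (unit_comp u2 u1)).
by rewrite !ocompA (wl2 _ h4) (wl2 _ h5) (wl3 _ h1) h2 (wl3 _ h3) -h5 h3 (wl3 _ h1).
Qed.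

Lemma word_ry x y v34 v14 w12 w13 : unit_ x -> unit_ w13 -> unit_ v34 ->
  x ** w13 ** w12 = w12 ** w13 ** x -> x ** y ** v34 = v34 ** x ->
  w13 ** v14 ** v34 = v34 ** w13 -> w12 ** v34 = v34 ** w12 -> w13 ** y = y ** w13 ->
  v14 ** x = x ** v14 -> y ** v14 ** w12 = w12 ** v14 ** y.
Proof.
move=> ux uw uv h1 h2 h3 h4 h5 h6.
apply: (unit_injr uv); apply: (unit_injl (unit_comp ux uw)).
rewrite !ocompA (wl2 _ h5) (wl2 _ h4) (wl3 _ h3) h2 (wl3' _ h1) h1.
by rewrite -(wl2 _ h6) (wl3 _ h2) (wl3 _ h3) h4.
Qed.

Lemma word_rx xu y w12 v13 v14 v23 : unit_ w12 -> unit_ y -> unit_ v23 ->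
  y ** v14 ** w12 = w12 ** v14 ** y -> xu ** y ** v23 = v23 ** y -> w12 ** v13 ** v23 = v23 ** w12 ->
  v23 ** v14 = v14 ** v23 -> xu ** w12 = w12 ** xu -> y ** v13 = v13 ** y ->
  xu ** v14 ** v13 = v13 ** v14 ** xu.
Proof.
move=> uw uy uv h1 h2 h3 h4 h5 h6; apply: (unit_injl uw); apply: (unit_injr (unit_comp uy uv)).
rewrite !ocompA -h5 -(wl2 _ h6) -(wl3' _ h1) (wl3 _ h3) -(wl2 _ h4) h2.
by rewrite (wl3' _ h1) -h3 (wl2 _ h4) (wl3 _ h2).
Qed.

Lemma word_amp x y3 y4 v3 v4 : x ** y3 ** v3 = v3 ** x -> x ** y4 ** v4 = v4 ** x ->
  y4 ** v3 = v3 ** y4 -> x ** (y3 ** y4) ** (v3 ** v4) = v3 ** v4 ** x.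
Proof. by move=> h1 h2 h3; rewrite !ocompA (wl2 _ h3) h1 (wl3 _ h2). Qed.

Lemma word_amp2 x3 x4 y3 y4 v : x3 ** y3 ** v = v ** y3 -> x4 ** y4 ** v = v ** y4 ->
  x4 ** y3 = y3 ** x4 -> x3 ** x4 ** (y3 ** y4) ** v = v ** (y3 ** y4).
Proof. by move=> h1 h2 h3; rewrite !ocompA (wl2 _ h3) (wl3 _ h2) h1. Qed.

Lemma word_amp3 f3 f4 y v3 v4 : f3 ** y ** v3 = v3 ** y -> f4 ** y ** v4 = v4 ** y ->
  v3 ** f4 = f4 ** v3 -> f4 ** f3 ** y ** (v3 ** v4) = v3 ** v4 ** y.
Proof. by move=> h1 h2 h3; rewrite !ocompA (wl3 _ h1) -h3 (wl3 _ h2). Qed.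
End Words.

Section Construction.
Variables (H Hu : Hil) (e : H).
Hypothesis ee : inner e e = 1.
Variables (W X : Op (htens H H) (htens H H)) (V : Op (htens H Hu) (htens H Hu)).
Hypotheses (uW : unit_ W) (uX : unit_ X) (uV : unit_ V).
Hypothesis comm : forall d, W ** ot d (oid H) = ot (oid H) d ** W -> exists c : C, d = c *: oid H.
Hypothesis eqV : l12 Hu W ** l13 H V ** l23 H V = l23 H V ** l12 Hu W.
Hypothesis eqX1 : l12 H X ** l13 H X ** l23 H W = l23 H W ** l12 H X.
Hypothesis eqX2 : l23 H X ** l13 H X ** l12 H W = l12 H W ** l13 H X.
Hypothesis eqR : l23 H X ** l13 H W ** l12 H W = l12 H W ** l13 H W ** l23 H X.

Lemma l13_unit_inv (K L : Hil) (f : K) (T : Op (htens H L) (htens H L)) :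
  inner f f = 1 -> unit_ (l13 K T) -> unit_ T.
Proof.
move=> ff [h1 h2]; have sh := @sh_l13 R H K L.
by split; apply: (l13_inj ff); rewrite (shM sh) (shA sh) (sh1 sh).
Qed.
Lemma l23_unit_inv (K L : Hil) (T : Op (htens K L) (htens K L)) : unit_ (l23 H T) -> unit_ T.
Proof.
move=> [h1 h2]; have sh := @sh_l23 R H K L.
by split; apply: (l23_inj ee); rewrite (shM sh) (shA sh) (sh1 sh).
Qed.

(** T is the value that the equation forces on [l13 H Y]; what has to be shown is that T is trivial
    on its middle leg. *)
Lemma Y_ex : exists2 Y, unit_ Y & l12 Hu X ** l13 H Y ** l23 H V = l23 H V ** l12 Hu X.
Proof.
have u12 : unit_ (l12 Hu X) by apply: sh_unit uX; exact: sh_l12.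
have u23 : unit_ (l23 H V) by apply: sh_unit uV; exact: sh_l23.
pose T := ad (l12 Hu X) ** l23 H V ** l12 Hu X ** ad (l23 H V).
have uT : unit_ T.
  by apply: unit_comp; [apply: unit_comp => //; apply: unit_comp => //|]; exact: unit_ad.
have [|Y hY] := @mid_leg H W comm e ee uW Hu T.
  rewrite /T !(shM (sh_e134 _ _ _ _), shA (sh_e134 _ _ _ _)) e134_12 -/(L34 _ _ _).
  rewrite !(shM (sh_e124 _ _ _ _), shA (sh_e124 _ _ _ _)) e124_12 -/(L24 _ _ _).
  apply: triv_mid.
  - by apply: sh_unit uW; exact: sh_L23.
  - by apply: sh_unit uX; exact: sh_L12.
  - by apply: sh_unit uV; exact: sh_L34.
  - by rewrite /L12 /L13 /L23 -!(shM (sh_e123 _ _ _ _)) eqX1.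
  - by rewrite -e234_12 -e234_13 -e234_23 -!(shM (sh_e234 _ _ _ _)) eqV.
  - exact: L12_34.
exists Y; first by apply: (l13_unit_inv ee); rewrite -hY.
by rewrite -hY /T !ocompA (proj2 u12) o1comp unitrVK.
Qed.

(** Y0 is a parameter because two cases occur: [Y0 = Y] yields the lift, and [Y0 = X] its image
    under the reducing map on the second leg. *)
Lemma Z_ex (K : Hil) (Y0 : Op (htens H K) (htens H K)) : unit_ Y0 ->
  l23 H Y0 ** l13 H Y0 ** l12 K W = l12 K W ** l13 H Y0 ->
  exists2 Z, unit_ Z & l23 H Z ** l13 Hu Y0 ** l12 K V = l12 K V ** l13 Hu Y0.
Proof.
move=> uY hY.
have u12 : unit_ (l12 K V) by apply: sh_unit uV; exact: sh_l12.
have u13 : unit_ (l13 Hu Y0) by apply: sh_unit uY; exact: sh_l13.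
pose D := l12 K V ** l13 Hu Y0 ** ad (l12 K V) ** ad (l13 Hu Y0).
have uD : unit_ D.
  by apply: unit_comp; [apply: unit_comp; [exact: unit_comp|]|]; exact: unit_ad.
have [|Z hZ] := @first_leg H W comm e ee uW Hu K D.
  rewrite /D !(shM (sh_e234 _ _ _ _), shA (sh_e234 _ _ _ _)) e234_12 e234_13.
  rewrite !(shM (sh_e134 _ _ _ _), shA (sh_e134 _ _ _ _)) e134_12 e134_13.
  apply: triv_first.
  - by apply: sh_unit uW; exact: sh_L12.
  - by apply: sh_unit uY; exact: sh_L14.
  - by apply: sh_unit uV; exact: sh_L23.
  - by rewrite -e124_12 /L24 /L14 -!(shM (sh_e124 _ _ _ _)) hY.
  - by rewrite /L12 /L13 /L23 -!(shM (sh_e123 _ _ _ _)) eqV.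
  - by rewrite L14_23.
exists Z; first by apply: l23_unit_inv; rewrite -hZ.
by rewrite -hZ /D unitrVK// unitrVK.
Qed.

Variable Y : Op (htens H Hu) (htens H Hu).
Hypothesis uY : unit_ Y.
Hypothesis eqY : l12 Hu X ** l13 H Y ** l23 H V = l23 H V ** l12 Hu X.

Lemma e124_inj (K1 K2 K4 : Hil) (S T : Op (htens (htens K1 K2) K4) (htens (htens K1 K2) K4)) :
  e124 H S = e124 H T -> S = T.
Proof.
move=> h; apply: op3_ext => x x' y y' z z'.
have := congr1 (fun F : Op _ _ => inner (tens (tens (tens x y) e) z) (F (tens (tens (tens x' y') e) z'))) h.
by rewrite /= !e124c ee !mulr1.
Qed.
Lemma e134_inj (K1 K3 K4 : Hil) (S T : Op (htens (htens K1 K3) K4) (htens (htens K1 K3) K4)) :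
  e134 H S = e134 H T -> S = T.
Proof.
move=> h; apply: op3_ext => x x' y y' z z'.
have := congr1 (fun F : Op _ _ => inner (tens (tens (tens x e) y) z) (F (tens (tens (tens x' e) y') z'))) h.
by rewrite [X in X = _ -> _]e134c [X in _ = X -> _]e134c ee !mulr1.
Qed.

Lemma Y_corep : l23 H Y ** l13 H Y ** l12 Hu W = l12 Hu W ** l13 H Y.
Proof.
apply: e124_inj; rewrite !(shM (sh_e124 _ _ _ _)) e124_12.
apply: (@word_c _ (L13 H Hu X) (L23 H Hu X) _ _ (L34 H H V)).
- by apply: sh_unit uX; exact: sh_L13.
- by apply: sh_unit uX; exact: sh_L23.
- by apply: sh_unit uV; exact: sh_L34.
- by rewrite -e134_12 -[e124 _ _]/(L14 _ _ _) -e134_13 /L34 -!(shM (sh_e134 _ _ _ _)) eqY.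
- by rewrite -e234_12 -[e124 _ _]/(L24 _ _ _) -e234_13 -e234_23 -!(shM (sh_e234 _ _ _ _)) eqY.
- by rewrite /L12 /L13 /L23 -!(shM (sh_e123 _ _ _ _)) eqX2.
- exact: L13_24.
- exact: L12_34.
Qed.

Lemma Y_R : l23 H Y ** l13 H V ** l12 Hu W = l12 Hu W ** l13 H V ** l23 H Y.
Proof.
apply: e124_inj; rewrite !(shM (sh_e124 _ _ _ _)) e124_12.
apply: (@word_ry _ (L23 H Hu X) _ (L34 H H V) _ _ (L13 H Hu W)).
- by apply: sh_unit uX; exact: sh_L23.
- by apply: sh_unit uW; exact: sh_L13.
- by apply: sh_unit uV; exact: sh_L34.
- by rewrite /L12 /L13 /L23 -!(shM (sh_e123 _ _ _ _)) eqR.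
- by rewrite -e234_12 -[e124 _ _]/(L24 _ _ _) -e234_13 -e234_23 -!(shM (sh_e234 _ _ _ _)) eqY.
- by rewrite -e134_12 -[e124 _ _]/(L14 _ _ _) -e134_13 /L34 -!(shM (sh_e134 _ _ _ _)) eqV.
- exact: L12_34.
- exact: L13_24.
- exact: L14_23.
Qed.

Variable Z : Op (htens Hu Hu) (htens Hu Hu).
Hypothesis uZ : unit_ Z.
Hypothesis eqZ : l23 H Z ** l13 Hu Y ** l12 Hu V = l12 Hu V ** l13 Hu Y.

Lemma Z_R : l23 H Z ** l13 Hu V ** l12 Hu V = l12 Hu V ** l13 Hu V ** l23 H Z.
Proof.
apply: e134_inj; rewrite !(shM (sh_e134 _ _ _ _)) e134_12 e134_13 -[e134 _ _]/(L34 _ _ _).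
apply: (@word_rx _ _ (L24 H Hu Y) (L12 Hu Hu W) _ _ (L23 H Hu V)).
- by apply: sh_unit uW; exact: sh_L12.
- by apply: sh_unit uY; exact: sh_L24.
- by apply: sh_unit uV; exact: sh_L23.
- by rewrite -e124_12 /L24 /L14 -!(shM (sh_e124 _ _ _ _)) Y_R.
- by rewrite -e234_12 -e234_13 -e234_23 -!(shM (sh_e234 _ _ _ _)) eqZ.
- by rewrite /L12 /L13 /L23 -!(shM (sh_e123 _ _ _ _)) eqV.
- by rewrite L14_23.
- by rewrite L12_34.
- by rewrite L13_24.
Qed.
End Construction.

Section Permutations.
Variables H K L : Hil.
Definition c23 (T : Op (htens (htens H L) K) (htens (htens H L) K)) :
    Op (htens (htens H K) L) (htens (htens H K) L) :=
  ad (s23 H K L) ** T ** s23 H K L.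
Lemma sh_c23 : starhom c23. Proof. exact: sh_conj (s23_unit _ _ _). Qed.
Let c23c T x x' y y' z z' : inner (tens (tens x y) z) (c23 T (tens (tens x' y') z')) =
  inner (tens (tens x z) y) (T (tens (tens x' z') y')).
Proof. by rewrite /c23 !ocompE adEr !s23E. Qed.
Lemma c23_12 T : c23 (l12 K T) = l13 K T.
Proof. by apply: op3_ext => x x' y y' z z'; rewrite c23c l12c l13c. Qed.
Lemma c23_13 T : c23 (l13 L T) = l12 L T.
Proof. by apply: op3_ext => x x' y y' z z'; rewrite c23c l12c l13c. Qed.
Lemma swc (T : Op (htens L K) (htens L K)) y y' z z' :
  inner (tens y z) ((sw L K ** T ** sw K L) (tens y' z')) = inner (tens z y) (T (tens z' y')).
Proof. by rewrite !ocompE swE inner_sw swE. Qed.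
Lemma c23_23 T : c23 (l23 H T) = l23 H (sw L K ** T ** sw K L).
Proof. by apply: op3_ext => x x' y y' z z'; rewrite c23c !l23c swc. Qed.
End Permutations.

Section FourLegs.
Variables H1 H2 H3 H4 : Hil.
(** A comultiplication in the last leg produces operators on the pair of legs 3 and 4; this
    regrouping makes them operators on four separate legs. *)
Definition q4 (T : Op (htens (htens H1 H2) (htens H3 H4)) (htens (htens H1 H2) (htens H3 H4))) :=
  ad (as_ (htens H1 H2) H3 H4) ** T ** as_ (htens H1 H2) H3 H4.
Lemma sh_q4 : starhom q4. Proof. exact: sh_conj (as_unit _ _ _). Qed.
Lemma q4_inj S T : q4 S = q4 T -> S = T.
Proof.
move=> h; apply: (unit_injl (unit_ad (as_unit (htens H1 H2) H3 H4))).
exact: (unit_injr (as_unit (htens H1 H2) H3 H4) h).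
Qed.
Let q4c T x x' y y' z z' w w' :
  inner (tens (tens (tens x y) z) w) (q4 T (tens (tens (tens x' y') z') w')) =
  inner (tens (tens x y) (tens z w)) (T (tens (tens x' y') (tens z' w'))).
Proof. by rewrite /q4 !ocompE adEr !asE. Qed.
Lemma amp1c (E L M : Hil) (T : Op (htens E L) (htens E L)) x x' y y' z z' :
  inner (tens x (tens y z)) (amp1 M T (tens x' (tens y' z'))) = inner (tens x y) (T (tens x' y')) * inner z z'.
Proof.
rewrite /amp1 -lock !ocompE uaE otE oidE.
by rewrite -[as_ _ _ _]ad_ua adEr uaE inner_tens.
Qed.
Lemma amp2c (E L M : Hil) (T : Op (htens E M) (htens E M)) x x' y y' z z' :
  inner (tens x (tens y z)) (amp2 L T (tens x' (tens y' z'))) = inner (tens x z) (T (tens x' z')) * inner y y'.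
Proof.
rewrite /amp2 -lock !ocompE otE swE oidE.
by rewrite -[ot (oid E) (sw M L)]adK adEr ad_ot ad1 ad_sw otE swE amp1c.
Qed.
Lemma q4_12 T : q4 (l12 (htens H3 H4) T) = L12 H3 H4 T.
Proof.
by apply: op4_ext => x x' y y' z z' w w'; rewrite q4c l12c /L12 e123c l12c inner_tens mulrA.
Qed.
Lemma q4_23_amp1 T : q4 (l23 H1 (amp1 H4 T)) = L23 H1 H4 T.
Proof.
by apply: op4_ext => x x' y y' z z' w w'; rewrite q4c l23c amp1c /L23 e123c l23c mulrA.
Qed.
Lemma q4_23_amp2 T : q4 (l23 H1 (amp2 H3 T)) = L24 H1 H3 T.
Proof.
by apply: op4_ext => x x' y y' z z' w w'; rewrite q4c l23c amp2c /L24 e124c l23c mulrA.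
Qed.
Lemma q4_13_amp1 T : q4 (l13 H2 (amp1 H4 T)) = L13 H2 H4 T.
Proof.
apply: op4_ext => x x' y y' z z' w w'; rewrite q4c l13c amp1c /L13 e123c l13c.
by rewrite mulrAC.
Qed.
Lemma q4_13_amp2 T : q4 (l13 H2 (amp2 H3 T)) = L14 H2 H3 T.
Proof.
apply: op4_ext => x x' y y' z z' w w'; rewrite q4c l13c amp2c /L14 e124c l13c.
by rewrite mulrAC.
Qed.
End FourLegs.
End LegAlgebra.

(** * Transport along morphisms *)

Section StarRel.
Variable R : realType.
Notation Hil := (hilbertType R).
Notation Bd E L := (Op (htens E L) (htens E L)).

(** Solving a leg equation for one factor brings in the inverses of the others, so the relation is
    kept for adjoints as well. *)
Definition srel (E L K : Hil) (A : Op L L -> Prop) (phi : Op L L -> Op K K) (T : Bd E L) (T' : Bd E K) :=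
  rel A phi T T' /\ rel A phi (ad T) (ad T').

Section Basic.
Variables (L K : Hil) (A : Op L L -> Prop) (phi : Op L L -> Op K K).
Hypotheses (cA : CA A) (hphi : hom A phi).

Lemma srel_ad (E : Hil) (T : Bd E L) (T' : Bd E K) : srel A phi T T' -> srel A phi (ad T) (ad T').
Proof. by move=> [h1 h2]; split; rewrite ?adK. Qed.
Lemma srel_comp (E : Hil) (S T : Bd E L) (S' T' : Bd E K) :
  srel A phi S S' -> srel A phi T T' -> srel A phi (S ** T) (S' ** T').
Proof. by move=> [h1 h2] [h3 h4]; split; rewrite ?adM; exact: rel_comp. Qed.
Lemma srel_l12 (E1 E2 : Hil) (T : Bd E1 E2) : srel A phi (l12 L T) (l12 K T).
Proof. by split; rewrite -?(shA (sh_l12 _ _ _)); exact: rel_l12. Qed.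
Lemma srel_l13 (E1 E2 : Hil) (T : Bd E1 L) (T' : Bd E1 K) : srel A phi T T' ->
  srel A phi (l13 E2 T) (l13 E2 T').
Proof. by move=> [h1 h2]; split; rewrite -?(shA (sh_l13 _ _ _)); exact: rel_l13. Qed.
Lemma srel_l23 (E1 E2 : Hil) (T : Bd E2 L) (T' : Bd E2 K) : srel A phi T T' ->
  srel A phi (l23 E1 T) (l23 E1 T').
Proof. by move=> [h1 h2]; split; rewrite -?(shA (sh_l23 _ _ _)); exact: rel_l23. Qed.
Lemma srel_l13_inv (E1 E2 : Hil) (e : E2) (T : Bd E1 L) (T' : Bd E1 K) : inner e e = 1 ->
  srel A phi (l13 E2 T) (l13 E2 T') -> srel A phi T T'.
Proof.
by move=> ee [h1 h2]; split; apply: (rel_l13_inv ee); rewrite ?(shA (sh_l13 _ _ _)).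
Qed.
Lemma srel_l23_inv (E1 E2 : Hil) (e : E1) (T : Bd E2 L) (T' : Bd E2 K) : inner e e = 1 ->
  srel A phi (l23 E1 T) (l23 E1 T') -> srel A phi T T'.
Proof.
by move=> ee [h1 h2]; split; apply: (rel_l23_inv ee); rewrite ?(shA (sh_l23 _ _ _)).
Qed.
End Basic.

Section Amp.
Variables (E L1 L2 K1 K2 : Hil) (A1 : Op L1 L1 -> Prop) (A2 : Op L2 L2 -> Prop).
Variables (phi : Op L1 L1 -> Op K1 K1) (psi : Op L2 L2 -> Op K2 K2).
Hypotheses (c1 : CA A1) (c2 : CA A2) (hphi : hom A1 phi) (hpsi : hom A2 psi).
Lemma srel_amp1 (T : Bd E L1) (T' : Bd E K1) : srel A1 phi T T' ->
  srel (at_ A1 A2) (thom c1 c2 hphi hpsi) (amp1 L2 T) (amp1 K2 T').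
Proof. by move=> [h1 h2]; split; rewrite -?(shA (sh_amp1 _ _ _)); exact: rel_amp1. Qed.
Lemma srel_amp2 (T : Bd E L2) (T' : Bd E K2) : srel A2 psi T T' ->
  srel (at_ A1 A2) (thom c1 c2 hphi hpsi) (amp2 L1 T) (amp2 K1 T').
Proof. by move=> [h1 h2]; split; rewrite -?(shA (sh_amp2 _ _ _)); exact: rel_amp2. Qed.
End Amp.

Section Transport.
Variables (H Hu K : Hil) (e : H) (A : Op Hu Hu -> Prop) (phi : Op Hu Hu -> Op K K).
Hypothesis ee : inner e e = 1.
Hypotheses (cA : CA A) (hphi : hom A phi).

(** The equation expresses Y through X and V. Applying id (x) phi to each factor gives the same
    expression in X and V', which is Y'. The next two lemmas follow the same pattern. *)
Lemma srel_Y (X : Bd H H) (V Y : Bd H Hu) (V' Y' : Bd H K) : unit_ X -> unit_ V -> unit_ V' ->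
  l12 Hu X ** l13 H Y ** l23 H V = l23 H V ** l12 Hu X ->
  l12 K X ** l13 H Y' ** l23 H V' = l23 H V' ** l12 K X ->
  srel A phi V V' -> srel A phi Y Y'.
Proof.
move=> uX uV uV' h h' hV; apply: (srel_l13_inv (e := e) ee).
have E (L : Hil) (V0 Y0 : Bd H L) : unit_ V0 ->
    l12 L X ** l13 H Y0 ** l23 H V0 = l23 H V0 ** l12 L X ->
    l13 H Y0 = ad (l12 L X) ** l23 H V0 ** l12 L X ** ad (l23 H V0).
  move=> uV0 h0.
  have u12 : unit_ (l12 L X) by apply: sh_unit uX; exact: sh_l12.
  have u23 : unit_ (l23 H V0) by apply: sh_unit uV0; exact: sh_l23.
  by rewrite -(ocompA (ad (l12 L X))) -h0 -!ocompA unitK// (proj2 u23) ocomp1.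
rewrite (E _ _ _ uV h) (E _ _ _ uV' h').
have s12 : srel A phi (l12 Hu X) (l12 K X) by exact: srel_l12.
have s23_ := srel_l23 H hV.
exact: (srel_comp (srel_comp (srel_comp (srel_ad s12) s23_) s12) (srel_ad s23_)).
Qed.

Lemma srel_Z (M : Hil) (V : Bd H M) (Y : Bd H Hu) (Y' : Bd H K) (Z : Bd M Hu) (Z' : Bd M K) :
  unit_ V -> unit_ Y -> unit_ Y' ->
  l23 H Z ** l13 M Y ** l12 Hu V = l12 Hu V ** l13 M Y ->
  l23 H Z' ** l13 M Y' ** l12 K V = l12 K V ** l13 M Y' ->
  srel A phi Y Y' -> srel A phi Z Z'.
Proof.
move=> uV uY uY' h h' hY; apply: (srel_l23_inv (e := e) ee).
have E (L : Hil) (Y0 : Bd H L) (Z0 : Bd M L) : unit_ Y0 ->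
    l23 H Z0 ** l13 M Y0 ** l12 L V = l12 L V ** l13 M Y0 ->
    l23 H Z0 = l12 L V ** l13 M Y0 ** ad (l12 L V) ** ad (l13 M Y0).
  move=> uY0 h0.
  have u12 : unit_ (l12 L V) by apply: sh_unit uV; exact: sh_l12.
  have u13 : unit_ (l13 M Y0) by apply: sh_unit uY0; exact: sh_l13.
  by rewrite -h0 unitrK// unitrK.
rewrite (E _ _ _ uY h) (E _ _ _ uY' h').
have s12 : srel A phi (l12 Hu V) (l12 K V) by exact: srel_l12.
have s13 := srel_l13 M hY.
apply: srel_comp (srel_ad s13); apply: srel_comp (srel_ad _); first exact: srel_comp.
exact: s12.
Qed.

Lemma srel_F (M : Hil) (Y : Bd H M) (V : Bd H Hu) (V' : Bd H K) (F : Bd M Hu) (F' : Bd M K) :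
  unit_ Y -> unit_ V -> unit_ V' ->
  l23 H F ** l12 Hu Y ** l13 M V = l13 M V ** l12 Hu Y ->
  l23 H F' ** l12 K Y ** l13 M V' = l13 M V' ** l12 K Y ->
  srel A phi V V' -> srel A phi F F'.
Proof.
move=> uY uV uV' h h' hV; apply: (srel_l23_inv (e := e) ee).
have E (L : Hil) (V0 : Bd H L) (F0 : Bd M L) : unit_ V0 ->
    l23 H F0 ** l12 L Y ** l13 M V0 = l13 M V0 ** l12 L Y ->
    l23 H F0 = l13 M V0 ** l12 L Y ** ad (l13 M V0) ** ad (l12 L Y).
  move=> uV0 h0.
  have u12 : unit_ (l12 L Y) by apply: sh_unit uY; exact: sh_l12.
  have u13 : unit_ (l13 M V0) by apply: sh_unit uV0; exact: sh_l13.
  by rewrite -h0 unitrK// unitrK.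
rewrite (E _ _ _ uV h) (E _ _ _ uV' h').
have s12 : srel A phi (l12 Hu Y) (l12 K Y) by exact: srel_l12.
have s13 := srel_l13 M hV.
apply: srel_comp (srel_ad s12); apply: srel_comp (srel_ad s13).
by apply: srel_comp s12.
Qed.
End Transport.

Lemma amp1E (E L M : Hil) (T : Bd E L) : amp1 M T = as_ E L M ** l12 M T ** ua E L M.
Proof. by rewrite /amp1 /l12 -!lock. Qed.
Lemma as_coef (E L M : Hil) T x x' y y' z z' :
  inner (tens x (tens y z)) ((as_ E L M ** T ** ua E L M) (tens x' (tens y' z'))) =
  inner (tens (tens x y) z) (T (tens (tens x' y') z')).
Proof. by rewrite !ocompE uaE -[as_ _ _ _]ad_ua adEr uaE. Qed.
Lemma op3_ext' (E L M : Hil) (S T : Bd E (htens L M)) :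
  (forall x x' y y' z z', inner (tens x (tens y z)) (S (tens x' (tens y' z'))) =
    inner (tens x (tens y z)) (T (tens x' (tens y' z')))) -> S = T.
Proof.
move=> h; apply: tens_ext2' => x' y' z'; apply: (unit_adI (as_unit E L M)).
apply: vec_ext2 => x y z; rewrite !adEr !asE; exact: h.
Qed.
Lemma amp2E (E L M : Hil) (T : Bd E M) : amp2 L T = as_ E L M ** l13 L T ** ua E L M.
Proof. by apply: op3_ext' => x x' y y' z z'; rewrite as_coef amp2c l13c. Qed.
Lemma ot1E (E L M : Hil) (T : Bd L M) : ot (oid E) T = as_ E L M ** l23 E T ** ua E L M.
Proof. by apply: op3_ext' => x x' y y' z z'; rewrite as_coef l23c otE inner_tens. Qed.

(** By the leg equation 1 (x) Z is a product of [V_12], [Y_13] and their adjoints, each of which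
    preserves the module over A (x) B; slicing with e gives the claim for Z. The relation for the
    morphism id expresses that an operator is a left multiplier of the module. *)
Lemma at_mult (H L M : Hil) (e : H) (A : Op L L -> Prop) (B : Op M M -> Prop)
  (V : Bd H L) (Y : Bd H M) (Z : Bd L M) : inner e e = 1 -> CA A -> CA B ->
  unit_ V -> unit_ Y -> l23 H Z ** l13 L Y ** l12 M V = l12 M V ** l13 L Y ->
  srel A id V V -> srel B id Y Y ->
  forall t, at_ A B t -> at_ A B (Z ** t) /\ at_ A B (ad Z ** t).
Proof.
move=> ee cA cB uV uY h hV hY t ht.
have uV1 : unit_ (amp1 M V) by apply: sh_unit uV; exact: sh_amp1.
have uY2 : unit_ (amp2 L Y) by apply: sh_unit uY; exact: sh_amp2.
have eZ : ot (oid H) Z = amp1 M V ** amp2 L Y ** ad (amp1 M V) ** ad (amp2 L Y).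
  have : ot (oid H) Z ** amp2 L Y ** amp1 M V = amp1 M V ** amp2 L Y.
    have sj := sh_conj (ua_unit H L M).
    by rewrite ot1E amp2E amp1E -ad_ua -!(shM sj) h.
  by move=> <-; rewrite unitrK// unitrK.
have s1 := srel_amp1 cA cB (@hom_id _ _ A) (@hom_id _ _ B) hV.
have s2 := srel_amp2 cA cB (@hom_id _ _ A) (@hom_id _ _ B) hY.
have [r1 r2] : srel (at_ A B) (thom cA cB (@hom_id _ _ A) (@hom_id _ _ B)) (ot (oid H) Z) (ot (oid H) Z).
  rewrite eZ; apply: srel_comp (srel_ad s2); apply: srel_comp (srel_ad s1).
  exact: srel_comp.
have key p : mg (at_ A B) (thom cA cB (@hom_id _ _ A) (@hom_id _ _ B)) p ->
    at_ A B (ad (il _ e) ** p.1).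
  move: p; apply: cs_min => [|_ [x [a [Aa ->]]]].
    have bpx := bpair_axioms (bnd_axioms (htens L M) (htens H (htens L M))) (bnd_axioms (htens L M) (htens H (htens L M))).
    have [k k0 hk] := op_bnd (ad (il (htens L M) e)).
    apply: (csub_preim (bnd_axioms _ _) (f := fun p : Op (htens L M) (htens H (htens L M)) * Op (htens L M) (htens H (htens L M)) => ad (il _ e) ** p.1) (M := k)).
    - by move=> c v w; rewrite -[(_ + _).1]/(c *: v.1 + w.1) ocompDr ocompZr.
    - exact: k0.
    - by move=> v b b0 [h1 _]; exact: bnd_comp.
    exact: cs_csub (bnd_axioms _ _) _.
  rewrite ocompA.
  have -> : ad (il (htens L M) e) ** il _ x = inner e x *: oid _.
    by apply: op_ext => y; rewrite ocompE ilE ad_ilE.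
  by rewrite ocompZl o1comp; apply: (csubZ _ (ca_csub (at_CA cA cB))).
have il1 (S : Bd L M) : ad (il _ e) ** (ot (oid H) S ** (il _ e ** t)) = S ** t.
  rewrite (ocompA (ot _ _)) ot_il oidE !ocompA.
  have -> : ad (il (htens L M) e) ** il _ e = oid _.
    by apply: op_ext => y; rewrite ocompE ilE ad_ilE ee scale1r.
  by rewrite o1comp.
split; rewrite -il1; first exact: (key _ (r1 _ (mg_in _ e ht))).
rewrite -[oid H]ad1 -ad_ot; exact: (key _ (r2 _ (mg_in _ e ht))).
Qed.
End StarRel.

(** * Morphisms determined by a corepresentation *)

Section SliceRel.
Variable R : realType.
Notation C := (Cplx R).
Notation Hil := (hilbertType R).
Notation Bd E L := (Op (htens E L) (htens E L)).

Section RelSlice.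
Variables (E L K : Hil) (A : Op L L -> Prop) (phi : Op L L -> Op K K).
Hypotheses (cA : CA A) (hphi : hom A phi).

Lemma csub_graph : csub (bpair (@bnd R L L) (@bnd R K K)) (fun q => A q.1 /\ q.2 = phi q.1).
Proof.
split.
- by split; [exact: CA0|rewrite (hom0 cA hphi)].
- move=> c v w [v1 v2] [w1 w2].
  rewrite -[(_ + _).1]/(c *: v.1 + w.1) -[(_ + _).2]/(c *: v.2 + w.2).
  by split; [exact: (csubL (ca_csub cA))|rewrite (hom_lin hphi)// v2 w2].
- move=> v h.
  have Av : A v.1 by apply: (csubC (ca_csub cA)) => e /h[w [Aw _] [b _]]; exists w.1.
  split => //; apply: bnd_eps_eq => e e0; have e2 : 0 < e / 2 by rewrite divr_gt0.
  have [w [Aw ew] [b1 b2]] := h _ e2.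
  rewrite -(subrK w.2 v.2) -addrA (_ : e = e / 2 + e / 2); last by field.
  apply: (bdD (bnd_axioms _ _)); first exact: b2.
  rewrite ew -(homB cA hphi)//; apply: (hom_contr cA hphi _ (ltW e2)); first exact: CAB.
  exact: (bd_sub (bnd_axioms _ _) b1).
Qed.

Lemma mg_slice x p : @mg R E L K A phi p -> A (ad (il L x) ** p.1) /\ ad (il K x) ** p.2 = phi (ad (il L x) ** p.1).
Proof.
move: p; apply: cs_min => [|_ [y [a [Aa ->]]]].
  exact: (cpair_l (ad (il L x)) (ad (il K x)) csub_graph).
have ilil (M : Hil) (b : Op M M) : ad (il M x) ** (il M y ** b) = inner x y *: b.
  by apply: op_ext => z; rewrite !ocompE ilE ad_ilE.
by rewrite /= !ilil (homZ cA hphi)//; split=> //; exact: CAZ.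
Qed.

Lemma rel_slice (T : Bd E L) (T' : Bd E K) x z a : rel A phi T T' -> A a ->
  A (sl T x z ** a) /\ sl T' x z ** phi a = phi (sl T x z ** a).
Proof.
move=> h Aa; have := mg_slice x (h _ (mg_in phi z Aa)).
by rewrite /= /sl !ocompA.
Qed.

Lemma rel_sliceE (T : Bd E L) (T' : Bd E K) x z : nd A phi -> rel A phi T T' -> A (sl T x z) ->
  phi (sl T x z) = sl T' x z.
Proof.
move=> n h hA; apply: (nd_eq n) => a Aa; have [_ ->] := rel_slice x z h Aa.
by rewrite (hom_mul hphi).
Qed.
End RelSlice.

Lemma rel_slices_eq (E L K : Hil) (A : Op L L -> Prop) (phi psi : Op L L -> Op K K) (T : Bd E L) (T' : Bd E K) :
  CA A -> hom A phi -> hom A psi -> nd A phi -> nd A psi -> rel A phi T T' -> rel A psi T T' ->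
  (forall x z, A (sl T x z)) ->
  forall a, cs (@bnd R L L) (fun a => exists x z, a = sl T x z) a -> phi a = psi a.
Proof.
move=> cA h1 h2 n1 n2 r1 r2 hA; apply: (hom_eq cA h1 h2) => _ [x [z ->]]; split=> //.
by rewrite (rel_sliceE cA h1 n1 r1)// (rel_sliceE cA h2 n2 r2).
Qed.

Lemma slices_total (H K : Hil) (e : H) (U : Bd H K) : inner e e = 1 -> unit_ U ->
  htotal (fun y => exists x z k, y = sl U x z k).
Proof.
move=> ee uU v hv.
have h0 : tens e v = 0.
  rewrite -[tens e v]oidE -(proj2 uU) ocompE.
  have -> : ad U (tens e v) = 0; last by rewrite op0.
  apply: (dense_total (@dense_tens _ _ _)) => _ [z [y ->]].
  rewrite adEr innerC -slE innerC.
  have -> : inner (sl U e z y) v = 0; last by rewrite !conjC0.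
  by apply: hv; exists e, z, y.
by rewrite -[v]scale1r -ee -ad_ilE h0 op0.
Qed.

Section General.
Variables (H Hu K : Hil) (e : H) (A : Op Hu Hu -> Prop).
Variables (th1 th2 : Op Hu Hu -> Op K K) (V : Bd H Hu) (U : Bd H K).
Hypotheses (ee : inner e e = 1) (cA : CA A) (uU : unit_ U).
Hypotheses (h1 : hom A th1) (h2 : hom A th2) (n1 : nd A th1) (n2 : nd A th2).
Hypotheses (r1 : rel A th1 V U) (r2 : rel A th2 V U).
Hypothesis absorb : forall a x z, A a ->
  cs (@bnd R Hu Hu) (fun t => exists x z, t = sl V x z) (a ** sl V x z).

(* Two morphisms that agree on V agree: on the span of the slices of V
   both are determined, and a ** sl V x z lies in this span. *)
Lemma morphism_ext a : A a -> th1 a = th2 a.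
Proof.
move=> Aa.
pose G := fun q : Op Hu Hu * Op K K => exists x z, q = (sl V x z, sl U x z).
pose P (th : Op Hu Hu -> Op K K) (q : Op Hu Hu * Op K K) := forall b, A b -> A (q.1 ** b) /\ q.2 ** th b = th (q.1 ** b).
have PC (th : Op Hu Hu -> Op K K) : hom A th -> csub (bpair (@bnd R _ _) (@bnd R _ _)) (P th).
  move=> hth; apply: csub_forall => b _.
  exact: (cpair_r b (th b) (csub_graph cA hth)).
have PG (th : Op Hu Hu -> Op K K) : hom A th -> rel A th V U -> forall q, G q -> P th q.
  by move=> hth rth _ [x [z ->]] b Ab; exact: rel_slice.
have spP (th : Op Hu Hu -> Op K K) q : hom A th -> rel A th V U -> sp G q -> P th q.
  move=> hth rth; apply: sp_min; [exact: csub0 (PC _ hth)|exact: csubL (PC _ hth)|exact: PG].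
(* Seen through th1, the assignment [sl V x z |-> sl U x z] is contractive on the span of the
   slices. It extends to the closed span, which contains [a ** sl V x z]. *)
have contr q : sp G q -> forall b, 0 <= b -> bnd q.1 b -> bnd q.2 (1 * b).
  move=> hq b b0 hb_; rewrite mul1r.
  apply: (nd_bnd cA h1 n1 b0) => a' Aa' ba'.
  have [Aq ->] := spP _ _ h1 r1 hq a' Aa'.
  by apply: (hom_contr cA h1) => //; rewrite -[b]mulr1; exact: bnd_comp.
have key x z : th1 a ** sl U x z = th2 a ** sl U x z.
  have [|T hT] := @graph_total _ _ _ (@bnd R Hu Hu) (@bnd R K K) (bnd_axioms _ _) (bnd_axioms _ _)
    (@op_complete _ _ _) G 1 ler01 contr (a ** sl V x z).
    apply: (cs_min (cs_csub (bnd_axioms _ _) _) _ (absorb x z Aa)) => _ [x' [z' ->]].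
    by apply: (cs_in (bnd_axioms _ _)); exists (sl U x' z'), x', z'.
  have TE (th : Op Hu Hu -> Op K K) : hom A th -> nd A th -> rel A th V U -> T = th a ** sl U x z.
    move=> hth nth rth; apply: (nd_eq nth) => b Ab.
    have hP : P th (a ** sl V x z, T) by apply: cs_min hT; [exact: PC|exact: PG].
    have [_ ->] := hP b Ab.
    have [As es] := rel_slice cA hth x z rth Ab.
    by rewrite /= -(ocompA a) (hom_mul hth Aa As) -es ocompA.
  by rewrite -(TE _ h1 n1 r1) -(TE _ h2 n2 r2).
apply: (op_ext_total (slices_total ee uU)) => _ [x [z [k ->]]].
exact: (congr1 (fun F : Op _ _ => F k) (key x z)).
Qed.
End General.

Lemma phase (a b : C) : exists u : C, `|u| <= 1 /\ `|a| + `|b| <= `|a + u * b|.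
Proof.
have [->|b0] := eqVneq b 0; first by exists 0; rewrite normr0 mulr0 !addr0.
have [->|a0] := eqVneq a 0; first by exists 1; rewrite normr1 mul1r normr0 !add0r.
have na : 0 < `|a| by rewrite normr_gt0.
have nb : 0 < `|b| by rewrite normr_gt0.
exists ((a / `|a|) * (b^* / `|b|)); split.
  by rewrite !normrM !normfV !normr_id norm_conjC !divff ?gt_eqF// mulr1.
have -> : a + a / `|a| * (b^* / `|b|) * b = a * (1 + `|b| / `|a|).
  have e : b^* / `|b| * b = `|b|.
    by rewrite mulrAC [b^* * b]mulrC -normCK expr2 mulfK// gt_eqF.
  by rewrite -mulrA e; field; rewrite gt_eqF.
rewrite normrM [X in _ * X]ger0_norm ?addr_ge0 ?divr_ge0//.
by rewrite mulrDr mulr1 mulrCA divff ?mulr1// gt_eqF.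
Qed.

(** * Bounded functionals are small off an approximate unit *)

Section Functional.
Variables (H : Hil) (A : Op H H -> Prop) (w : Op H H -> C) (M : C).
Hypotheses (cA : CA A).
Hypothesis wL : forall (c : C) a b, A a -> A b -> w (c *: a + b) = c * w a + w b.
Hypothesis M0 : 0 <= M.
Hypothesis wB : forall a b, A a -> bnd a b -> `|w a| <= M * b.

Let w0 : w 0 = 0.
Proof.
have := wL 1 (CA0 cA) (CA0 cA); rewrite scale1r mul1r addr0 => h.
by apply: (addrI (w 0)); rewrite addr0 -h.
Qed.

(** If every c in the unit ball could be improved by d, repeated improvement would exceed the bound
    M. *)
Lemma near_max d : 0 < d -> exists c, [/\ A c, bnd c 1 &
  forall b, A b -> bnd b 1 -> `|w b| <= `|w c| + d].
Proof.
move=> d0; apply: contrapT => hn.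
have step n : exists c, [/\ A c, bnd c 1 & n%:R * d <= `|w c|].
  elim: n => [|n [c [Ac bc hc]]].
    exists 0; split; [exact: CA0| |by rewrite mul0r].
    exact: (bd0 (bnd_axioms _ _)).
  apply: contrapT => hn'; apply: hn; exists c; split=> // b Ab bb.
  rewrite real_leNgt//; last by rewrite realD// gtr0_real.
  apply/negP => lt; apply: hn'; exists b; split=> //.
  rewrite -natr1 mulrDl mul1r; apply: le_trans (ltW lt).
  by rewrite lerD2r.
have M1 : 0 < M + 1 by rewrite ltr_wpDl.
have [n hn'] := rate_small (divr_gt0 d0 M1).
have [c [Ac bc hc]] := step n.+1.
have := le_trans hc (wB Ac bc); rewrite mulr1.
apply/negP; rewrite -real_ltNge ?ger0_real//; last by rewrite mulr_ge0 ?ler0n// ltW.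
apply: (@lt_le_trans _ _ (M + 1)); first by rewrite ltrDl.
have n0 : 0 < n.+1%:R :> C by rewrite ltr0n.
by move: hn'; rewrite /rate ler_pdivlMr// ler_pdivrMl.
Qed.

(** Let c nearly maximize [|w|] and let e be nearly a unit for c. The element
    [q = u l (b - b e) + c e] has norm at most [1 + l^2 / 2] by the Pythagorean property of e, while
    a suitable phase u gives [|w q| >= |w (c e)| + l |w (b - b e)|]. Near-maximality of c leaves
    room only for a term [l |w (b - b e)|] of order [l^2]. *)
Lemma tail_small eps : 0 < eps -> exists e, [/\ A e, bnd e 1 &
  forall b, A b -> bnd b 1 -> `|w (b - b ** e)| <= eps].
Proof.
(* k bounds the coefficient of [l^2] in [fin]; the choice of l ensures both [l <= 1] and
   [l k <= eps]. *)
move=> e0; pose k := 3 * M + 3.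
have k0 : 0 < k by rewrite ltr_wpDl// mulr_ge0.
have ke : 0 < k + eps by rewrite addr_gt0.
pose l := eps / (k + eps).
have l0 : 0 < l by rewrite divr_gt0.
have l1 : l <= 1 by rewrite ler_pdivrMr// mul1r lerDr ltW.
have lk : l * k <= eps.
  by rewrite /l mulrAC ler_pdivrMr// ler_wpM2l ?(ltW e0)// lerDl ltW.
clearbody l; have l20 : 0 < l ^+ 2 by rewrite exprn_gt0.
have [c [Ac bc hc]] := near_max l20.
have [|e [Ae ade he hce]] := approx_unit (F := [:: c]) cA _ l20.
  by move=> b; rewrite inE => /eqP ->.
exists e; split=> //; first exact: bnd_proj he.
move=> b Ab bb.
have Abe : A (b - b ** e) by apply: CAB => //; exact: (ca_mul cA).
have Ace : A (c ** e) by exact: (ca_mul cA).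
set al := w (c ** e); set be := w (b - b ** e).
have [u [u1 hu]] := phase al (l * be).
pose q := u * l *: (b - b ** e) + c ** e.
have Aq : A q by exact: (csubL (ca_csub cA)).
have bq : bnd q (1 + l ^+ 2 / 2).
  move=> x; set p1 := `|e x|; set p2 := `|x - e x|.
  have -> : q x = c (e x) + (u * l) *: b (x - e x).
    by rewrite /q addoE scaleoE suboE !ocompE opB addrC.
  have s1 : `|c (e x) + (u * l) *: b (x - e x)| <= p1 + l * p2.
    apply: le_trans (ler_normD _ _) _; apply: lerD; first by rewrite -[p1]mul1r.
    rewrite normrZ normrM (ger0_norm (ltW l0)) -mulrA.
    have := bb (x - e x); rewrite mul1r => h.
    rewrite -[l * p2]mul1r; apply: ler_pM => //; first by rewrite mulr_ge0// ltW.
    by rewrite ler_wpM2l// ltW.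
  apply: le_trans s1 _.
  have l20' := ltW l20; have p10 : 0 <= p1 by exact: normr_ge0.
  have p20 : 0 <= p2 by exact: normr_ge0.
  have q0 : 0 <= 1 + l ^+ 2 / 2 by rewrite addr_ge0// divr_ge0.
  rewrite -(@ler_pXn2r _ 2) ?nnegrE//; [|by apply: addr_ge0 => //; apply: mulr_ge0 => //; exact: ltW|exact: mulr_ge0].
  apply: le_trans (_ : (1 + l ^+ 2) * (p1 ^+ 2 + p2 ^+ 2) <= _).
    rewrite -subr_ge0 (_ : _ - _ = (l * p1 - p2) ^+ 2); last by ring.
    have lr : l * p1 - p2 \is Num.real.
      apply: realB; last exact/ger0_real/normr_ge0.
      by apply: realM; [exact: gtr0_real|exact/ger0_real/normr_ge0].
    by rewrite real_exprn_even_ge0.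
  have p0 : 0 <= p1 ^+ 2 + p2 ^+ 2 by apply: addr_ge0; apply: exprn_ge0; exact: normr_ge0.
  rewrite [leRHS]exprMn; apply: (ler_pM _ p0 _ (he x)); first by rewrite addr_ge0.
  rewrite -subr_ge0 (_ : _ - _ = (l ^+ 2 / 2) ^+ 2); last by field.
  by rewrite exprn_ge0// divr_ge0.
have wq : w q = al + u * (l * be) by rewrite /q wL// addrC mulrA.
have bound : `|w q| <= (`|w c| + l ^+ 2) * (1 + l ^+ 2 / 2).
  have t0 : 0 < 1 + l ^+ 2 / 2 by rewrite addr_gt0// divr_gt0.
  set t := 1 + _ in t0 bq *; have wt : w (t^-1 *: q) = t^-1 * w q.
    by rewrite -[_ *: q]addr0 (wL _ Aq (CA0 cA)) w0 addr0.
  have := hc (t^-1 *: q) (CAZ cA _ Aq) _.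
  rewrite wt normrM normfV (gtr0_norm t0) ler_pdivrMl// [t * _]mulrC; apply.
  move=> x; rewrite scaleoE normrZ normfV (gtr0_norm t0) ler_pdivrMl// mul1r.
  exact: bq.
have ale : `|w c| - M * l ^+ 2 <= `|al|.
  rewrite lerBlDr; have -> : w c = al + w (c - c ** e).
    have -> : c - c ** e = (-1) *: (c ** e) + c by rewrite scaleN1r addrC.
    by rewrite (wL _ Ace Ac) mulN1r addNKr.
  apply: le_trans (ler_normD _ _) _; rewrite lerD2l; apply: wB; first exact: CAB.
  by have [] := hce c (mem_head _ _).
have wc : `|w c| <= M by rewrite -[M]mulr1; exact: wB.
have fin : l * `|be| <= l * (l * k).
  have h1 : `|al| + l * `|be| <= (`|w c| + l ^+ 2) * (1 + l ^+ 2 / 2).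
    by move: hu; rewrite normrM (gtr0_norm l0) -wq => hu; exact: le_trans hu bound.
  have h2 : l * `|be| <= (`|w c| + l ^+ 2) * (1 + l ^+ 2 / 2) - (`|w c| - M * l ^+ 2).
    by rewrite lerBrDl; apply: le_trans h1; rewrite lerD2r.
  apply: le_trans h2 _; rewrite -subr_ge0.
  have -> : l * (l * k) - ((`|w c| + l ^+ 2) * (1 + l ^+ 2 / 2) - (`|w c| - M * l ^+ 2)) =
     l ^+ 2 / 2 * (M - `|w c|) + l ^+ 2 * (3 / 2 * M) + l ^+ 2 * (1 - l ^+ 2) / 2 + l ^+ 2 * (3 / 2).
    by rewrite /k; field.
  have L0 : 0 <= l ^+ 2 by exact: ltW.
  have L1 : l ^+ 2 <= 1 by apply: exprn_ile1 => //; exact: ltW.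
  have mc : 0 <= M - `|w c| by rewrite subr_ge0.
  have L2 : 0 <= 1 - l ^+ 2 by rewrite subr_ge0.
  have [h1' h2' h3'] : [/\ 0 <= 2 :> C, 0 <= 3 :> C & 0 <= 3 / 2 :> C] by rewrite divr_ge0.
  apply: addr_ge0; first apply: addr_ge0; first apply: addr_ge0.
  - by apply: mulr_ge0 => //; exact: divr_ge0.
  - by apply: mulr_ge0 => //; exact: mulr_ge0.
  - by apply: divr_ge0 => //; exact: mulr_ge0.
  - exact: mulr_ge0.
by move: fin; rewrite ler_pM2l// => fin; exact: le_trans fin lk.
Qed.
End Functional.
End SliceRel.

(** * Slices of V by functionals of the dual absorb vector slices *)

Section Absorption.
Variable R : realType.
Notation C := (Cplx R).
Notation Hil := (hilbertType R).
Notation Bd E L := (Op (htens E L) (htens E L)).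

Lemma ir_ind (H K L M : Hil) (D : K -> Prop) (S : Op (htens H K) M) (T : Op L H)
    (P : Op L M -> Prop) z :
  csub (@bnd R L M) P -> hdense D -> (forall y, D y -> P (S ** ir H y ** T)) -> P (S ** ir H z ** T).
Proof.
move=> cP dD h.
have [s s0 hs] := op_bnd S; have [t t0 ht] := op_bnd T.
have cQ : csub (@hb R K) (fun y => P (S ** ir H y ** T)).
  apply: (csub_preim (bv := @hb R K) (bw := @bnd R L M) (bnd_axioms L M)
    (f := fun y => S ** ir H y ** T) (M := s * t) _ _ _ cP).
  - by move=> c v w; rewrite irL ocompDr ocompZr ocompDl ocompZl.
  - exact: mulr_ge0.
  - move=> v b b0 hv; rewrite mulrAC; apply: bnd_comp ht; first exact: mulr_ge0.
    apply: bnd_comp => // y; apply: le_trans (@bnd_ir R H K v y) _.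
    by rewrite ler_wpM2r.
exact: (cs_min cQ h (dD z)).
Qed.

Section Multipliers.
Variables (H K : Hil) (A : Op H H -> Prop) (B : Op K K -> Prop).
Hypotheses (cA : CA A) (nB : hdense (fun y => exists b x, B b /\ y = b x)).
Variable T : Bd H K.
Hypothesis LM : forall t, at_ A B t -> at_ A B (T ** t).

(** A column of a multiplier, cut off by a in A, is a limit of finite sums of columns with entries
    in A: z is replaced by a vector [b y], and [T ** ot a b] lies in A (x) B. *)
Lemma ir_mod z a : A a ->
  cs (@bnd R H (htens H K)) (fun t => exists y a, A a /\ t = ir H y ** a) (T ** ir H z ** a).
Proof.
move=> Aa; apply: ir_ind nB _; first exact: cs_csub (bnd_axioms _ _) _.
move=> _ [b [y [Bb ->]]]; rewrite -ocompA -ot_ir ocompA.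
apply: (cs_min (csub_compr (ir H y) (cs_csub (bnd_axioms _ _) _)) _ (LM (at_in Aa Bb))).
move=> _ [a' [b' [Aa' _ ->]]]; apply: (cs_in (bnd_axioms _ _)).
by exists (b' y), a'; rewrite ot_ir.
Qed.

Lemma sr_mod u v a : A a -> A (sr T u v ** a).
Proof.
move=> Aa; rewrite /sr; apply: ir_ind (ca_csub cA) nB _ => _ [b [y [Bb ->]]].
rewrite -ocompA -ot_ir ocompA -[_ ** T ** _]ocompA.
apply: (cs_min (csub_compl (ad (ir H u)) (csub_compr (ir H y) (ca_csub cA))) _ (LM (at_in Aa Bb))).
move=> _ [a' [b' [Aa' _ ->]]]; rewrite -ocompA ot_ir ocompA.
have -> : ad (ir H u) ** ir H (b' y) = inner u (b' y) *: oid H.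
  by apply: op_ext => x; rewrite ocompE irE ad_irE.
by rewrite ocompZl o1comp; exact: CAZ.
Qed.
End Multipliers.

Section Absorb.
Variables (H Hu : Hil) (A : Op H H -> Prop) (B0 : Op H H -> Prop) (B : Op Hu Hu -> Prop).
Variables (W : Bd H H) (V : Bd H Hu).
Hypotheses (cA : CA A) (uW : unit_ W) (uV : unit_ V).
Hypotheses (nB0 : hdense (fun y => exists b x, B0 b /\ y = b x)).
Hypotheses (nB : hdense (fun y => exists b x, B b /\ y = b x)).
Hypothesis srW : forall u v, A (sr (ad W) u v).
Hypothesis LW : forall t, at_ A B0 t -> at_ A B0 (W ** t).
Hypothesis LV : forall t, at_ A B t -> at_ A B (V ** t).
Hypothesis LV' : forall t, at_ A B t -> at_ A B (ad V ** t).
Hypothesis eqV : l12 Hu W ** l13 H V ** l23 H V = l23 H V ** l12 Hu W.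

Definition mult m := forall a, A a -> A (m ** a) /\ A (a ** m).

Lemma sr_mult u v : mult (sr V u v).
Proof.
move=> a Aa; split; first exact: (sr_mod cA nB LV).
rewrite -[_ ** _]adK adM ad_sr; apply: (ca_adj cA).
by apply: (sr_mod cA nB LV'); exact: (ca_adj cA).
Qed.

Lemma mult_lin c m n : mult m -> mult n -> mult (c *: m + n).
Proof.
move=> hm hn a Aa; have [h1 h2] := hm a Aa; have [h3 h4] := hn a Aa.
by split; rewrite ?(ocompDl, ocompDr, ocompZl, ocompZr); apply: (csubL (ca_csub cA)).
Qed.

Lemma mult_in a : A a -> mult a.
Proof. by move=> Aa b Ab; split; exact: (ca_mul cA). Qed.

Lemma mult_comp m n : mult m -> mult n -> mult (m ** n).
Proof.
move=> hm hn a Aa; split.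
  by rewrite -ocompA; apply: (hm _ _).1; apply: (hn _ _).1.
by rewrite ocompA; apply: (hn _ _).2; apply: (hm _ _).2.
Qed.

Variables (w w' : Op H H -> C) (M : C).
Hypothesis wL : forall (c : C) a b, A a -> A b -> w (c *: a + b) = c * w a + w b.
Hypothesis M0 : 0 <= M.
Hypothesis wB : forall a b, A a -> bnd a b -> `|w a| <= M * b.
Hypothesis wE : forall a, A a -> w' a = w a.
Hypothesis wL' : forall (c : C) m n, mult m -> mult n -> w' (c *: m + n) = c * w' m + w' n.
Variables (M' : C) (n : nat) (d : 'I_n -> Op H H).
Hypothesis dA : forall i, A (d i).
Hypothesis wB' : forall m b, mult m -> (forall i, bnd (m ** d i) b /\ bnd (d i ** m) b) -> `|w' m| <= M' * b.

Let M0' : 0 <= M'.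
Proof.
have := @wB' 0 1 (mult_in (CA0 cA)); rewrite mulr1 => h.
apply: le_trans (h _) => // i; rewrite ocomp0 o0comp.
by split; exact: (bd0 (bnd_axioms _ _)).
Qed.

(** Strict continuity of w' replaces [m - m e] by [f (m - m e)], with f a contractive element of A
    that is nearly a unit for finitely many elements. This is [f m - f m e] with [f m] in A, where
    [tail_small] applies. *)
Lemma ext_small eps : 0 < eps -> exists e, [/\ A e, bnd e 1 &
  forall m k, 0 <= k -> mult m -> bnd m k -> `|w' (m - m ** e)| <= eps * k].
Proof.
move=> e0; have [e [Ae be he]] := tail_small cA wL M0 wB e0.
exists e; split=> // m k k0 hm bm.
have me : mult (m - m ** e).
  by rewrite addrC -scaleN1r; apply: mult_lin => //; exact: mult_comp hm (mult_in Ae).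
have bme : bnd (m - m ** e) (k + k).
  apply: (bdB (bnd_axioms _ _) bm); rewrite -[k]mulr1; exact: bnd_comp.
apply: (@le_eps _ _ _ (M' * (1 + (k + k)))) => //.
- exact: mulr_ge0 (ltW e0) k0.
- by apply: mulr_ge0 => //; rewrite !addr_ge0.
move=> dl dl0.
pose F := [seq (m - m ** e) ** d i | i : 'I_n] ++ [seq d i | i : 'I_n].
have [|f [Af _ pf hf]] := approx_unit (F := F) cA _ dl0.
  move=> a; rewrite mem_cat => /orP[]/mapP[i _ ->]; last exact: dA.
  exact: (me _ _).1.
have bf := bnd_proj pf.
have Afm : A (f ** (m - m ** e)) by exact: (me _ _).2.
have -> : w' (m - m ** e) = w' ((m - m ** e) - f ** (m - m ** e)) + w (f ** (m - m ** e)).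
  rewrite -[in LHS](subrK (f ** (m - m ** e)) (m - m ** e)) -{1}[_ - f ** _]scale1r.
  rewrite wL'; last exact: mult_in.
    by rewrite mul1r [w' (f ** _)]wE.
  rewrite addrC -scaleN1r; apply: mult_lin => //; exact: mult_in.
rewrite addrC; apply: le_trans (ler_normD _ _) _; apply: lerD.
  have [k00|k1] := eqVneq k 0.
    have -> : f ** (m - m ** e) = 0.
      apply: (bnd_eps0 (c := 1)) => // q q0.
      have bm0 : bnd (m - m ** e) 0 by move: bme; rewrite k00 addr0.
      apply: (bd_le (bnd_axioms _ _)) (_ : _ <= _) (bnd_comp ler01 bf bm0).
      by rewrite mulr0 mul1r ltW.
    have -> : w 0 = 0.
      have := wL 1 (CA0 cA) (CA0 cA); rewrite scale1r mul1r addr0 => h.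
      by apply: (addrI (w 0)); rewrite addr0 -h.
    by rewrite normr0 mulr_ge0// ltW.
  have k2 : 0 < k by rewrite lt_def k1.
  have bfm : bnd (f ** m) k by rewrite -[k]mul1r; exact: bnd_comp.
  have Am : A (f ** m) by exact: (hm _ _).2.
  have := he (k^-1 *: (f ** m)) (CAZ cA _ Am) _.
  have -> : k^-1 *: (f ** m) - k^-1 *: (f ** m) ** e = k^-1 *: (f ** (m - m ** e)) + 0.
    by rewrite addr0 ocompBr scalerBr ocompZl ocompA.
  rewrite (wL _ Afm (CA0 cA)).
  have -> : w 0 = 0.
    have := wL 1 (CA0 cA) (CA0 cA); rewrite scale1r mul1r addr0 => h.
    by apply: (addrI (w 0)); rewrite addr0 -h.
  rewrite addr0 normrM normfV (gtr0_norm k2) ler_pdivrMl// [k * eps]mulrC; apply.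
  by move=> y; rewrite scaleoE normrZ normfV (gtr0_norm k2) ler_pdivrMl// mul1r; exact: bfm.
rewrite -mulrA; apply: wB'.
  rewrite addrC -scaleN1r; apply: mult_lin => //; exact: mult_in.
move=> i; split.
  have [|h _] := hf ((m - m ** e) ** d i).
    by rewrite mem_cat; apply/orP; left; apply: map_f; exact: mem_enum.
  rewrite ocompBl -ocompA; apply: (bd_le (bnd_axioms _ _)) (_ : _ <= _) h.
  by rewrite mulrDl mul1r lerDl mulr_ge0 ?(ltW dl0)// addr_ge0.
have [|_ h] := hf (d i).
  by rewrite mem_cat; apply/orP; right; apply: map_f; exact: mem_enum.
rewrite ocompBr ocompA -ocompBl.
apply: (bd_le (bnd_axioms _ _)) (_ : _ <= _) (bnd_comp (ltW dl0) h bme).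
by rewrite mulrC ler_wpM2r ?(ltW dl0)// lerDr.
Qed.

(** A coefficient of [W_12^* V_23] that is linear in the column t. Because
    [W_12^* V_23 W_12 = V_13 V_23], it turns the column of W at z into a coefficient of V at a
    vector moved by a slice of V ([Gam_W]). *)
Definition Gam x u v (t : Op H (htens H H)) : Op H H :=
  ad (ir (htens H H) u ** ir H x) ** l12 Hu (ad W) ** l23 H V ** ir (htens H H) v ** t.

Lemma GamL x u v c t t' : Gam x u v (c *: t + t') = c *: Gam x u v t + Gam x u v t'.
Proof. by rewrite /Gam ocompDr ocompZr. Qed.

Lemma Gam_bnd x u v t k : 0 <= k -> bnd t k -> bnd (Gam x u v t) (`|x| * k * `|u| * `|v|).
Proof.
move=> k0 bt; have -> : `|x| * k * `|u| * `|v| = `|u| * `|x| * 1 * 1 * `|v| * k by rewrite !mulr1; ring.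
have ge := @normr_ge0.
have b1 : bnd (ad (ir (htens H H) u ** ir H x)) (`|u| * `|x|).
  apply: bnd_ad; first exact: mulr_ge0.
  by apply: bnd_comp; [exact: ge|exact: bnd_ir|exact: bnd_ir].
have b2 : bnd (l12 Hu (ad W)) 1 by apply: unit_bnd; apply: (sh_unit (sh_l12 _ _ _)); exact: unit_ad.
have b3 : bnd (l23 H V) 1 by apply: unit_bnd; exact: (sh_unit (sh_l23 _ _ _)).
have p : 0 <= `|u| * `|x| by exact: mulr_ge0.
have p1 : 0 <= `|u| * `|x| * 1 by rewrite mulr1.
have p2 : 0 <= `|u| * `|x| * 1 * 1 by rewrite !mulr1.
apply: bnd_comp bt; first by apply: mulr_ge0.
apply: (bnd_comp _ _ (@bnd_ir R (htens H H) Hu v)) => //.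
by apply: bnd_comp => //; exact: bnd_comp.
Qed.

Lemma Gam_W x u v z : Gam x u v (W ** ir H z) = sr V u (sl V x z v).
Proof.
have e1 : l12 Hu (ad W) ** l23 H V ** l12 Hu W = l13 H V ** l23 H V.
  rewrite -[l12 Hu (ad W) ** _ ** _]ocompA -eqV (shA (sh_l12 _ _ _)) -ocompA unitK//.
  exact: (sh_unit (sh_l12 _ _ _)).
have e2 : ir (htens H H) v ** (W ** ir H z) = l12 Hu W ** (ir (htens H H) v ** ir H z).
  by apply: op_ext => h; rewrite !ocompE !irE /l12 -lock otE.
rewrite /Gam -!ocompA e2.
rewrite [l23 H V ** _]ocompA [l12 Hu (ad W) ** _]ocompA [l12 Hu (ad W) ** _]ocompA e1.
have e3 h : ad (ir (htens H H) u ** ir H x) ** l13 H V ** (ua H H Hu ** il _ h) =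
    ad (ir H u) ** V ** (il Hu h ** ad (il Hu x)).
  apply: tens_ext => p q; apply: inner_ext => h'.
  rewrite !ocompE !adEr !ocompE !irE !ilE uaE l13c ad_ilE.
  by rewrite -[tens h (_ *: _)]/(il Hu h (_ *: _)) !opZ innerZ mulrC.
apply: op_ext => h; have := congr1 (fun F : Op _ _ => F (V (tens z v))) (e3 h).
rewrite /sr /sl !ocompE !ilE !irE => <-; congr (ad _ (l13 H V _)).
by rewrite /l23 -lock !ocompE asE otE oidE.
Qed.

Lemma Gam_gen x z a : A a -> exists g, forall u v,
  A (Gam x u v (ir H z ** a)) /\ w (Gam x u v (ir H z ** a)) = inner u (sl V g z v).
Proof.
move=> Aa.
have GE u v : Gam x u v (ir H z ** a) = sr (ad W) x (sr V u v z) ** a.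
  have -> : sr (ad W) x (sr V u v z) ** a = ad (ir H x) ** ad W ** (ir H (sr V u v z) ** a).
    by rewrite /sr !ocompA.
  apply: op_ext => h; rewrite /Gam adM !ocompE !irE.
  have -> : l23 H V (tens (tens (a h) z) v) = ua H H Hu (tens (a h) (V (tens z v))).
    by rewrite /l23 -lock !ocompE asE otE oidE.
  have key : ad (ir (htens H H) u) ** l12 Hu (ad W) ** (ua H H Hu ** il _ (a h)) =
      ad W ** il _ (a h) ** ad (ir H u).
    apply: tens_ext => p q; rewrite !ocompE ad_irE ilE uaE /l12 -lock otE oidE ad_irE.
    by rewrite !opZ ilE.
  have := congr1 (fun F : Op _ _ => F (V (tens z v))) key; rewrite !ocompE !ilE => ->; by rewrite ?irE.
have [k k0 ha] := op_bnd a.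
have Af g : A (sr (ad W) x g ** a) by exact: (ca_mul cA).
have srl (c : C) g g' : sr (ad W) x (c *: g + g') ** a = c *: (sr (ad W) x g ** a) + sr (ad W) x g' ** a.
  by rewrite /sr irL !(ocompDr, ocompZr, ocompDl, ocompZl).
have [|y|g hg] := @riesz R H (fun g => w (sr (ad W) x g ** a)) (M * (`|x| * k)).
- by move=> c g g'; rewrite srl wL.
- rewrite -mulrA; apply: wB => //.
  have -> : `|x| * k * `|y| = `|x| * 1 * `|y| * k by rewrite mulr1; ring.
  apply: bnd_comp ha; first by rewrite mulr1 mulr_ge0.
  apply: (bnd_comp _ _ (@bnd_ir R H H y)); first by rewrite mulr1.
  apply: bnd_comp; first exact: normr_ge0.
    by apply: bnd_ad; [exact: normr_ge0|exact: bnd_ir].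
  exact: unit_bnd (unit_ad uW).
exists g => u v; rewrite GE; split=> //.
by rewrite hg srE slE.
Qed.

(** The coefficients of [S ** sl V x z] are values of w' on the operators of [Gam_W]. Cutting off by
    e costs little ([ext_small]), the column of W cut off by e is approximated by finite sums of
    columns [ir H y ** a] ([ir_mod]), and on those [Gam_gen] returns slices of V. All errors are
    uniform in u and v. *)
Lemma absorb_slice (S : Op Hu Hu) x z : (forall u v, inner u (S v) = w' (sr V u v)) ->
  cs (@bnd R Hu Hu) (fun t => exists x z, t = sl V x z) (S ** sl V x z).
Proof.
move=> hS eps e0; have e2 : 0 < eps / 2 by rewrite divr_gt0.
(* The added 1 keeps the divisors positive when x, z or M vanishes. *)
pose c1 := `|x| * `|z| + 1; have c10 : 0 < c1 by rewrite ltr_wpDl// mulr_ge0.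
pose c2 := M * `|x| + 1; have c20 : 0 < c2 by rewrite ltr_wpDl// mulr_ge0.
have [e [Ae _ he]] := ext_small (divr_gt0 e2 c10).
have d0 : 0 < eps / 2 / c2 by rewrite divr_gt0.
have [t st bt] := ir_mod nB0 LW z Ae d0.
have [Q [sQ hQ]] : exists Q, sp (fun t => exists x z, t = sl V x z) Q /\
    forall u v, A (Gam x u v t) /\ w (Gam x u v t) = inner u (Q v).
  elim: st => [|c s s' [y [a [Aa ->]]] _ [Q [sQ hQ]]].
    exists 0; split=> [|u v]; first exact: sp0.
    have -> : Gam x u v 0 = 0 by rewrite /Gam ocomp0.
    split; first exact: CA0.
    have := wL 1 (CA0 cA) (CA0 cA); rewrite scale1r mul1r addr0 zerooE inner0 => h.
    by apply: (addrI (w 0)); rewrite addr0 -h.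
  have [g hg] := Gam_gen x y Aa.
  exists (c *: sl V g y + Q); split=> [|u v]; first by apply: spS => //; exists g, y.
  rewrite GamL; have [A1 w1] := hg u v; have [A2 w2] := hQ u v.
  split; first exact: (csubL (ca_csub cA)).
  by rewrite wL// w1 w2 addoE scaleoE innerD innerZ.
exists Q => //; apply: bnd_inner => [|u v]; first exact: ltW.
have [AG wG] := hQ u v.
pose m := sr V u (sl V x z v).
have mm : mult m by exact: sr_mult.
have bm : bnd m (`|x| * `|z| * `|u| * `|v|).
  rewrite /m -Gam_W.
  have -> : `|x| * `|z| * `|u| * `|v| = `|x| * (1 * `|z|) * `|u| * `|v| by rewrite mul1r.
  apply: Gam_bnd; first by rewrite mul1r.
  by apply: bnd_comp => //; [exact: unit_bnd|exact: bnd_ir].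
have me : m ** e = Gam x u v (W ** ir H z ** e) by rewrite /m -Gam_W /Gam !ocompA.
have Ame : A (m ** e) by exact: (mm e Ae).1.
have AD : A (Gam x u v (W ** ir H z ** e - t)).
  have -> : W ** ir H z ** e - t = (-1) *: t + W ** ir H z ** e by rewrite scaleN1r addrC.
  by rewrite GamL -me; apply: (csubL (ca_csub cA)).
have wD : w (m ** e) = w (Gam x u v (W ** ir H z ** e - t)) + inner u (Q v).
  rewrite -wG -[w (Gam x u v (_ - _))]mul1r -wL// scale1r; congr (w _).
  rewrite me -[Gam x u v (_ - _)]scale1r -GamL scale1r; congr (Gam x u v _).
  by rewrite subrK.
have wm : w' m = w' (m - m ** e) + w (m ** e).
  rewrite -wE// -[w' (m - _)]mul1r -wL'; last 2 first.
  - by rewrite addrC -scaleN1r; apply: mult_lin => //; exact: mult_in.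
  - exact: mult_in.
  by rewrite scale1r subrK.
have -> : inner u ((S ** sl V x z - Q) v) = w' (m - m ** e) + w (Gam x u v (W ** ir H z ** e - t)).
  rewrite suboE innerB ocompE hS -/m wm wD; ring.
apply: le_trans (ler_normD _ _) _.
have uv0 : 0 <= `|u| * `|v| by exact: mulr_ge0.
have -> : eps * `|u| * `|v| = eps / 2 * (`|u| * `|v|) + eps / 2 * (`|u| * `|v|) by field.
apply: lerD.
  apply: le_trans (he _ _ _ mm bm) _; first by rewrite !mulr_ge0.
  rewrite -!mulrA; apply: ler_wpM2l; first exact: ltW e0.
  apply: ler_wpM2l; first by rewrite invr_ge0.
  rewrite ler_pdivrMl// !mulrA -mulrA -[leRHS]mulrA; apply: ler_wpM2r => //.
  by rewrite /c1 lerDl.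
have d0' := ltW d0.
apply: le_trans (wB AD (Gam_bnd x u v d0' bt)) _.
have -> : M * (`|x| * (eps / 2 / c2) * `|u| * `|v|) = M * `|x| / c2 * (eps / 2 * (`|u| * `|v|)) by ring.
rewrite -[leRHS]mul1r; apply: ler_wpM2r; first by rewrite mulr_ge0// ltW.
by rewrite ler_pdivrMr// mul1r /c2 lerDl.
Qed.
End Absorb.
End Absorption.

(** * Quantum groups in terms of operators *)

Section QuantumGroupLegs.
Variable R : realType.
Notation C := (Cplx R).
Notation Hil := (hilbertType R).
Notation Bd E L := (Op (htens E L) (htens E L)).

Lemma inner_sum (H : Hil) (x : H) I (r : seq I) (F : I -> H) :
  inner x (\sum_(i <- r) F i) = \sum_(i <- r) inner x (F i).
Proof. by elim: r => [|i r IH]; rewrite ?big_nil ?inner0// !big_cons innerD IH. Qed.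

Lemma dense_closure (H : Hil) (S : set H) : hdense S -> closure (lspan S) = setT.
Proof.
move=> dd; apply/seteqP; split=> // v _ U /nbhs_ballP[e /= e0 eU].
have [w hw vw] := dd v (e / 2) (divr_gt0 e0 (ltr0Sn _ 1)).
exists w; split; first exact: sp_lspan.
apply: eU; rewrite -ball_normE /=; apply: le_lt_trans vw _.
by rewrite ltr_pdivrMr// ltr_pMr// ltr1n.
Qed.

Lemma CA_cstar (H : Hil) (A : set (H -> H)) : (forall a, A a -> bounded_op a) -> CA (pset A) ->
  hdense (fun y => exists a x, pset A a /\ y = a x) -> cstar_algebra A.
Proof.
move=> hA cA dA; split=> //.
- move=> f /(op_cspanP hA)[T -> ]; rewrite -[A T]/(pset A T).
  by apply: (cs_min (ca_csub cA)).
- move=> a b Aa Ab; rewrite -(pkE (hA a Aa)) -(pkE (hA b Ab)).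
  by apply: (ca_mul cA (a := pk a) (b := pk b)); rewrite /pset pkE//; exact: hA.
- move=> a Aa; rewrite -(pkE (hA a Aa)) adjE.
  by apply: (ca_adj cA (a := pk a)); rewrite /pset pkE//; exact: hA.
apply: dense_closure; apply: (dense_sub dA) => _ [a [x [Aa ->]]].
by exists a => //; exists x.
Qed.

Lemma series_tail (f : nat -> C) e : cvgn (series f) -> 0 < e ->
  exists N, forall m, (N <= m)%N -> `|\sum_(N <= n < m) f n| <= e.
Proof.
move=> cf e0; have e2 : 0 < e / 2 by rewrite divr_gt0.
have /cvgrPdist_le/(_ _ e2)[N _ hN] := cf.
exists N => m Nm; rewrite -(sub_series_geq f Nm).
rewrite (splitr e); apply: le_trans (ler_distD (limn (series f)) _ _) _.
by apply: lerD; [rewrite distrC|]; apply: hN => //=.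
Qed.

Lemma sub_series (f : nat -> C) N m : (N <= m)%N -> series f m = series f N + \sum_(N <= n < m) f n.
Proof. by move=> Nm; rewrite -(sub_series_geq f Nm) addrC subrK. Qed.

(** Cutting both sequences at N leaves a tail which [2 |x| |y| <= |x|^2 + |y|^2] bounds by the tails
    of two convergent series. *)
Lemma normal_approx (H : Hil) (w : (H -> H) -> C) e : normal_functional w -> 0 < e ->
  exists s : seq (H * H), forall (T : Op H H) b, 0 <= b -> bnd T b ->
    `|w T - \sum_(p <- s) inner p.1 (T p.2)| <= e * b.
Proof.
move=> [x [y [cx cy hw]]] e0; have e2 : 0 < e / 2 by rewrite divr_gt0.
have [N1 h1] := series_tail cx e0; have [N2 h2] := series_tail cy e0.
pose N := maxn N1 N2.
exists [seq (x n, y n) | n <- index_iota 0 N] => T b b0 bT.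
have -> : \sum_(p <- [seq (x n, y n) | n <- index_iota 0 N]) inner p.1 (T p.2) =
    series (fun n => inner (x n) (T (y n))) N by rewrite big_map.
apply: (@le_eps _ _ _ 1) => //; first by rewrite mulr_ge0// ltW.
move=> d d0; have /cvgrPdist_le/(_ _ d0)[N3 _ h3] := hw _ (opP T).
pose m := maxn N N3.
have Nm : (N <= m)%N by exact: leq_maxl.
have := h3 m (leq_maxr _ _); rewrite mul1r => h4.
apply: le_trans (ler_distD (series (fun n => inner (x n) (T (y n))) m) _ _) _.
rewrite addrC; apply: lerD => //.
rewrite (sub_series _ Nm) addrAC subrr add0r.
apply: le_trans (ler_norm_sum _ _ _) _.
apply: (@le_trans _ _ (\sum_(N <= n < m) (b / 2 * (`|x n| ^+ 2) + b / 2 * (`|y n| ^+ 2)))).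
  apply: ler_sum => n _; apply: le_trans (CS _ _) _.
  apply: (@le_trans _ _ (b * (`|x n| * `|y n|))).
    by rewrite mulrCA; apply: ler_wpM2l.
  rewrite -subr_ge0 (_ : _ - _ = b / 2 * (`|x n| - `|y n|) ^+ 2); last by field.
  rewrite mulr_ge0 ?divr_ge0// real_exprn_even_ge0// realB// ger0_real//.
rewrite big_split/= -!mulr_sumr.
have t (f : nat -> H) M : (M <= N)%N -> (forall m, (M <= m)%N -> `|\sum_(M <= n < m) `|f n| ^+ 2| <= e) ->
    \sum_(N <= n < m) `|f n| ^+ 2 <= e.
  move=> MN h; apply: le_trans (h m (leq_trans MN Nm)).
  rewrite ger0_norm; last by apply: sumr_ge0 => n _; exact: exprn_ge0.
  rewrite (big_cat_nat MN Nm)/= lerDr sumr_ge0// => n _; by rewrite exprn_ge0.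
have -> : e * b = b / 2 * e + b / 2 * e by field.
have b2 : 0 <= b / 2 by rewrite divr_ge0.
apply: lerD; apply: ler_wpM2l => //.
  by apply: t h1; exact: leq_maxl.
by apply: t h2; exact: leq_maxr.
Qed.

Lemma vector_normal (H : Hil) (x z : H) :
  normal_functional (fun T : H -> H => inner x (T z)).
Proof.
have cst (f : nat -> C) : (forall n, f n.+1 = 0) -> series f @ \oo --> f 0%N.
  move=> f0; apply/cvgrPdist_le => e e0; exists 1%N => //= -[//|n] _.
  rewrite /series/= big_nat_recl// big1 ?addr0 ?subrr ?normr0 ?ltW//.
exists (fun n => if n is 0 then x else 0), (fun n => if n is 0 then z else 0); split.
- apply/cvg_ex; exists (`|x| ^+ 2); apply: (cst (fun n => `|if n is 0 then x else 0| ^+ 2)) => n.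
  by rewrite normr0 expr0n.
- apply/cvg_ex; exists (`|z| ^+ 2); apply: (cst (fun n => `|if n is 0 then z else 0| ^+ 2)) => n.
  by rewrite normr0 expr0n.
move=> T bT.
apply: (cst (fun n => inner (if n is 0 then x else 0) (T (if n is 0 then z else 0)))) => n.
by rewrite inner0l.
Qed.

Section Legs.
Variables (H K : Hil) (W : Bd H K).

(** [lslice] is a choice whose default is 0; the default belongs to every closed span, so it does no
    harm there. *)
Lemma lslice_cases w : (exists2 S : Op K K, lslice w W = S & forall u v, inner u (S v) = w (sr W u v)) \/
  lslice w W = (0 : Op K K).
Proof.
rewrite /lslice; case: xgetP => [S _ [bS hS]|_]; last by right.
by left; exists (MkOp bS) => // u v; rewrite -rcoefE; exact: hS.
Qed.

Lemma rslice_cases w : (exists2 S : Op H H, rslice w W = S & forall x y, inner x (S y) = w (sl W x y)) \/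
  rslice w W = (0 : Op H H).
Proof.
rewrite /rslice; case: xgetP => [S _ [bS hS]|_]; last by right.
by left; exists (MkOp bS) => // u v; rewrite -lcoefE; exact: hS.
Qed.

Lemma lslice_bounded w : bounded_op (lslice w W).
Proof. by have [[S -> _]| ->] := lslice_cases w; exact: opP. Qed.
Lemma rslice_bounded w : bounded_op (rslice w W).
Proof. by have [[S -> _]| ->] := rslice_cases w; exact: opP. Qed.

Lemma lslice_vec x z : lslice (fun T => inner x (T z)) W = sl W x z.
Proof.
rewrite /lslice; case: xgetP => [S _ [bS hS]|h].
  apply/funext => v; apply: inner_ext => u.
  by rewrite hS rcoefE srE slE.
exfalso; apply: (h (sl W x z)); split; first exact: opP.
by move=> u v; rewrite rcoefE srE slE.
Qed.

Lemma rslice_vec u v : rslice (fun T => inner u (T v)) W = sr W u v.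
Proof.
rewrite /rslice; case: xgetP => [S _ [bS hS]|h].
  apply/funext => y; apply: inner_ext => x.
  by rewrite hS lcoefE srE slE.
exfalso; apply: (h (sr W u v)); split; first exact: opP.
by move=> x y; rewrite lcoefE srE slE.
Qed.

Lemma sr_bnd b u v : 0 <= b -> bnd W b -> bnd (sr W u v) (b * `|u| * `|v|).
Proof.
move=> b0 hW; rewrite /sr [b * _]mulrC; apply: bnd_comp; [exact: mulr_ge0| |exact: bnd_ir].
by apply: bnd_comp => //; apply: bnd_ad => //; exact: bnd_ir.
Qed.
End Legs.

Section Algebras.
Variables (H : Hil) (W : Bd H H).

(** Normal functionals are norm limits of finite sums of vector functionals, so they add nothing to
    the closed span of the vector slices. *)
Lemma right_legE T : right_leg W (opf T) <-> slices W T.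
Proof.
have [b b0 hW] := op_bnd W.
rewrite /right_leg op_cspanE; last by move=> _ [w _ <-]; exact: lslice_bounded.
split; apply: (cs_min (cs_csub (bnd_axioms _ _) _)) => t; last first.
  move=> [x [z ->]]; apply: (cs_in (bnd_axioms _ _)).
  exists (fun T => inner x (T z)); [exact: vector_normal|exact: lslice_vec].
rewrite /pset => -[w nw]; have [[S -> hS]| ->] := lslice_cases W w; last first.
  by move=> /opf_inj <-; exact: csub0 (cs_csub (bnd_axioms _ _) _).
move=> /opf_inj <- e e0; have b1 : 0 < b + 1 by rewrite ltr_wpDl.
have [s hs] := normal_approx nw (divr_gt0 e0 b1).
exists (\sum_(p <- s) sl W p.1 p.2).
  elim: s {hs} => [|p s IH]; first by rewrite big_nil; exact: sp0.
  by rewrite big_cons -[sl _ _ _]scale1r; apply: spS => //; exists p.1, p.2.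
apply: bnd_inner => [|u v]; first exact: ltW.
rewrite suboE innerB hS sumoE inner_sum.
have -> : \sum_(p <- s) inner u (sl W p.1 p.2 v) = \sum_(p <- s) inner p.1 (sr W u v p.2).
  by apply: eq_bigr => p _; rewrite srE slE.
have b2 : 0 <= b * `|u| * `|v| by rewrite !mulr_ge0.
apply: le_trans (hs _ _ b2 (sr_bnd u v b0 hW)) _.
rewrite -!mulrA; apply: ler_wpM2l; first exact: ltW.
by rewrite ler_pdivrMl// ler_wpM2r ?mulr_ge0// lerDl.
Qed.

Lemma left_legE T : left_leg W (opf T) <-> lslices W T.
Proof.
have [b b0 hW] := op_bnd W.
rewrite /left_leg op_cspanE; last by move=> _ [w _ <-]; exact: rslice_bounded.
split; apply: (cs_min (cs_csub (bnd_axioms _ _) _)) => t; last first.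
  move=> [x [z ->]]; apply: (cs_in (bnd_axioms _ _)).
  exists (fun T => inner x (T z)); [exact: vector_normal|exact: rslice_vec].
rewrite /pset => -[w nw]; have [[S -> hS]| ->] := rslice_cases W w; last first.
  by move=> /opf_inj <-; exact: csub0 (cs_csub (bnd_axioms _ _) _).
move=> /opf_inj <- e e0; have b1 : 0 < b + 1 by rewrite ltr_wpDl.
have [s hs] := normal_approx nw (divr_gt0 e0 b1).
exists (\sum_(p <- s) sr W p.1 p.2).
  elim: s {hs} => [|p s IH]; first by rewrite big_nil; exact: sp0.
  by rewrite big_cons -[sr _ _ _]scale1r; apply: spS => //; exists p.1, p.2.
apply: bnd_inner => [|u v]; first exact: ltW.
rewrite suboE innerB hS sumoE inner_sum.
have -> : \sum_(p <- s) inner u (sr W p.1 p.2 v) = \sum_(p <- s) inner p.1 (sl W u v p.2).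
  by apply: eq_bigr => p _; rewrite srE slE.
have b2 : 0 <= b * `|u| * `|v| by rewrite !mulr_ge0.
apply: le_trans (hs _ _ b2 (sl_bnd u v b0 hW)) _.
rewrite -!mulrA; apply: ler_wpM2l; first exact: ltW.
by rewrite ler_pdivrMl// ler_wpM2r ?mulr_ge0// lerDl.
Qed.
End Algebras.
End QuantumGroupLegs.

(** * From [mor_app] to the module relations *)

Section Translation.
Variable R : realType.
Notation Hil := (hilbertType R).
Notation Bd E L := (Op (htens E L) (htens E L)).

Lemma ph_id (H : Hil) : ph id = id :> (Op H H -> Op H H).
Proof. by apply/funext => a; exact: pkK. Qed.

Lemma app_eq (H1 H2 K1 K2 : Hil) (A1 : Op H1 H1 -> Prop) (A2 : Op H2 H2 -> Prop)
    (phi phi' : Op H1 H1 -> Op K1 K1) (psi psi' : Op H2 H2 -> Op K2 K2)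
    (c1 : CA A1) (c2 : CA A2) h h' k k' X Z : phi = phi' -> psi = psi' ->
  app c1 c2 (h : hom A1 phi) (k : hom A2 psi) X Z -> app c1 c2 (h' : hom A1 phi') (k' : hom A2 psi') X Z.
Proof.
move=> e1 e2; subst phi' psi'.
by rewrite (Prop_irrelevance h h') (Prop_irrelevance k k').
Qed.

Lemma nd_id (H : Hil) (A : set (H -> H)) : cstar_algebra A -> nd (pset A) id.
Proof. exact: cstar_nd. Qed.

(* the unitaries of M(A (x) B) *)
Definition um (H K : Hil) (A : set (H -> H)) (B : set (K -> K)) (X : Bd H K) :=
  unit_ X /\ forall t, at_ (pset A) (pset B) t ->
    at_ (pset A) (pset B) (X ** t) /\ at_ (pset A) (pset B) (ad X ** t).

Lemma UM_um (H K : Hil) (A : set (H -> H)) (B : set (K -> K)) X :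
  cstar_algebra A -> cstar_algebra B -> UM (atens A B) X -> exists2 T, X = opf T & um A B T.
Proof.
move=> cA cB [uX [_ mX]]; have [T eT uT] := unitary_op_unit uX; exists T; first exact: eT.
have pE := pset_atens (cstar_bounded cA) (cstar_bounded cB).
split=> [|t ht]; first exact: uT.
have ha : at_ (pset A) (pset B) (ad t) by exact: (ca_adj (at_CA (pset_CA cA) (pset_CA cB))).
rewrite -pE in ht ha.
split.
  by rewrite -pE; have [h _] := mX _ ht; rewrite eT in h.
rewrite -[_ ** _]adK adM adK; apply: (ca_adj (at_CA (pset_CA cA) (pset_CA cB))).
by rewrite -pE; have [_ h] := mX _ ha; rewrite eT in h.
Qed.

Lemma um_UM (H K : Hil) (A : set (H -> H)) (B : set (K -> K)) (T : Bd H K) :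
  cstar_algebra A -> cstar_algebra B -> um A B T -> UM (atens A B) (opf T).
Proof.
move=> cA cB [uT hT]; have pE := pset_atens (cstar_bounded cA) (cstar_bounded cB).
split; first exact: unit_unitary_op.
split=> [|a Aa]; first exact: opP.
have [S eS] := atensP Aa; subst a.
have hS : at_ (pset A) (pset B) S by rewrite -pE.
split.
  by rewrite -[_ \o _]/(opf (T ** S)) -[atens _ _ _]/(pset (atens A B) (T ** S)) pE; exact: (hT _ hS).1.
rewrite -[_ \o _]/(opf (S ** T)) -[atens _ _ _]/(pset (atens A B) (S ** T)) pE.
rewrite -[_ ** _]adK adM; apply: (ca_adj (at_CA (pset_CA cA) (pset_CA cB))).
by apply: (hT _ _).2; exact: (ca_adj (at_CA (pset_CA cA) (pset_CA cB))).
Qed.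

Section Apply.
Variables (H1 H2 K1 K2 : Hil) (A1 : set (H1 -> H1)) (A2 : set (H2 -> H2)).
Variables (B1 : set (K1 -> K1)) (B2 : set (K2 -> K2)).
Variables (phi : (H1 -> H1) -> (K1 -> K1)) (psi : (H2 -> H2) -> (K2 -> K2)).
Hypotheses (cA1 : cstar_algebra A1) (cA2 : cstar_algebra A2).
Hypotheses (cB1 : cstar_algebra B1) (cB2 : cstar_algebra B2).
Hypotheses (mphi : morphism A1 B1 phi) (mpsi : morphism A2 B2 psi).
Variable X : Bd H1 H2.
Hypothesis uX : um A1 A2 X.
Notation p1 := (pset_CA cA1).
Notation p2 := (pset_CA cA2).
Notation h1 := (ph_hom cA1 mphi).
Notation h2 := (ph_hom cA2 mpsi).
Notation i1 := (@hom_id _ _ (pset A1)).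
Notation i2 := (@hom_id _ _ (pset A2)).

Let LX t (ht : at_ (pset A1) (pset A2) t) := (uX.2 t ht).1.

Lemma app_idid : app p1 p2 i1 i2 X X.
Proof. by move=> t ht; split; [exact: LX|rewrite thom_id; [rewrite thom_id; [by []|exact: LX]|exact: ht]]. Qed.

Lemma um_id : rel (pset A2) id X X.
Proof. exact: relR_of_app (nd_id cA1) app_idid app_idid. Qed.

Lemma mor_appE Z : mor_app A1 A2 B1 B2 phi psi X = opf Z -> app p1 p2 h1 h2 X Z.
Proof.
move=> e; have [Z' e' h] := mor_app_ex cA1 cA2 cB1 cB2 mphi mpsi LX.
by have /opf_inj -> : opf Z = opf Z' by rewrite -e -e'.
Qed.

(** The products of images of A1 (x) A2 with elements of B1 (x) B2 span the latter, and on them Z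
    and its adjoint act through X and its adjoint. *)
Lemma mor_app_um Z : mor_app A1 A2 B1 B2 phi psi X = opf Z -> unit_ Z -> um B1 B2 Z.
Proof.
move=> /mor_appE aZ uZ; split=> [|s hs]; first exact: uZ.
have aZ' := app_ad uX.1 uZ aZ (fun t ht => (uX.2 t ht).2).
have csub_at := cs_csub (bnd_axioms (htens K1 K2) (htens K1 K2)).
split; move: (thom_span cA1 cA2 cB1 cB2 mphi mpsi hs).
  apply: (cs_min (csub_compl _ (csub_at _))) => _ [t [s' [ht hs' ->]]].
  have [Xt e] := aZ t ht.
  by rewrite ocompA e; exact: (thom_mult cA1 cA2 mphi mpsi Xt hs').1.
apply: (cs_min (csub_compl _ (csub_at _))) => _ [t [s' [ht hs' ->]]].
have [Xt e] := aZ' t ht.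
by rewrite ocompA e; exact: (thom_mult cA1 cA2 mphi mpsi Xt hs').1.
Qed.

(** The two morphisms may be applied in either order; the two witnesses are the half-applied
    images. *)
Lemma mor_app_split Z : mor_app A1 A2 B1 B2 phi psi X = opf Z ->
  (exists Q, rel (pset A2) (ph psi) X Q /\ rel (pset A1) (ph phi) (sw _ _ ** Q ** sw _ _) (sw _ _ ** Z ** sw _ _)) /\
  (exists Q, rel (pset A1) (ph phi) (sw _ _ ** X ** sw _ _) (sw _ _ ** Q ** sw _ _) /\ rel (pset A2) (ph psi) Q Z).
Proof.
move=> /mor_appE aZ; split.
  have [Q _ hQ] := mor_app_ex cA1 cA2 cA1 cB2 (mor_id cA1) mpsi LX.
  have hQ' : app p1 p2 i1 h2 X Q by apply: app_eq hQ; [exact: ph_id|].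
  exists Q; split; first exact: relR_of_app (nd_id cA1) app_idid hQ'.
  exact: relL_of_app (ph_nd cA2 cB2 mpsi) hQ' aZ.
have [Q _ hQ] := mor_app_ex cA1 cA2 cB1 cA2 mphi (mor_id cA2) LX.
have hQ' : app p1 p2 h1 i2 X Q by apply: app_eq hQ; [|exact: ph_id].
exists Q; split; first exact: relL_of_app (nd_id cA2) app_idid hQ'.
exact: relR_of_app (ph_nd cA1 cB1 mphi) hQ' aZ.
Qed.

Lemma mor_app_of Y Z : rel (pset A2) (ph psi) X Y ->
  rel (pset A1) (ph phi) (sw _ _ ** Y ** sw _ _) (sw _ _ ** Z ** sw _ _) ->
  mor_app A1 A2 B1 B2 phi psi X = opf Z.
Proof.
move=> r1 r2; apply: (app_mor_app (cA1 := cA1) (cA2 := cA2) cB1 cB2 (mphi := mphi) (mpsi := mpsi)).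
exact: app_of_rel LX r1 r2.
Qed.
End Apply.

Section ApplyRight.
Variables (H1 H2 K2 : Hil) (A1 : set (H1 -> H1)) (A2 : set (H2 -> H2)) (B2 : set (K2 -> K2)).
Variables (psi : (H2 -> H2) -> (K2 -> K2)).
Hypotheses (cA1 : cstar_algebra A1) (cA2 : cstar_algebra A2) (cB2 : cstar_algebra B2).
Hypothesis (mpsi : morphism A2 B2 psi).
Variable X : Bd H1 H2.
Hypothesis uX : um A1 A2 X.

Lemma mor_appR Z : mor_app A1 A2 A1 B2 id psi X = opf Z -> unit_ Z -> srel (pset A2) (ph psi) X Z.
Proof.
move=> /(mor_appE cA1 cA2 cA1 cB2 (mor_id cA1) mpsi uX) aZ uZ.
have uX' : um A1 A2 (ad X).
  by split=> [|t ht]; [exact: unit_ad uX.1|rewrite adK; have [] := uX.2 t ht].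
have aZ' := app_ad uX.1 uZ aZ (fun t ht => (uX.2 t ht).2).
pose i1 := @hom_id _ _ (pset A1).
have b : app (pset_CA cA1) (pset_CA cA2) i1 (ph_hom cA2 mpsi) X Z by apply: app_eq aZ; [exact: ph_id|].
have b' : app (pset_CA cA1) (pset_CA cA2) i1 (ph_hom cA2 mpsi) (ad X) (ad Z).
  by apply: app_eq aZ'; [exact: ph_id|].
by split; [exact: relR_of_app (nd_id cA1) (app_idid cA1 cA2 uX) b|
  exact: relR_of_app (nd_id cA1) (app_idid cA1 cA2 uX') b'].
Qed.

Lemma mor_appR_of Z : rel (pset A2) (ph psi) X Z -> mor_app A1 A2 A1 B2 id psi X = opf Z.
Proof.
move=> r; have LX t (ht : at_ (pset A1) (pset A2) t) := (uX.2 t ht).1.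
have [Q e hQ] := mor_app_ex cA1 cA2 cA1 cB2 (mor_id cA1) mpsi LX.
rewrite e; congr opf; apply: (rel_fun (pset_CA cA2) (ph_hom cA2 mpsi)) r; first exact: ph_nd mpsi.
have b : app (pset_CA cA1) (pset_CA cA2) (@hom_id _ _ (pset A1)) (ph_hom cA2 mpsi) X Q.
  by apply: app_eq hQ; [exact: ph_id|].
exact: relR_of_app (nd_id cA1) (app_idid cA1 cA2 uX) b.
Qed.
End ApplyRight.

Section ApplyLeft.
Variables (H1 H2 K1 : Hil) (A1 : set (H1 -> H1)) (A2 : set (H2 -> H2)) (B1 : set (K1 -> K1)).
Variables (phi : (H1 -> H1) -> (K1 -> K1)).
Hypotheses (cA1 : cstar_algebra A1) (cA2 : cstar_algebra A2) (cB1 : cstar_algebra B1).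
Hypothesis (mphi : morphism A1 B1 phi).
Variable X : Bd H1 H2.
Hypothesis uX : um A1 A2 X.

Lemma mor_appL Z : mor_app A1 A2 B1 A2 phi id X = opf Z ->
  rel (pset A1) (ph phi) (sw _ _ ** X ** sw _ _) (sw _ _ ** Z ** sw _ _).
Proof.
move=> /(mor_appE cA1 cA2 cB1 cA2 mphi (mor_id cA2) uX) aZ.
have b : app (pset_CA cA1) (pset_CA cA2) (ph_hom cA1 mphi) (@hom_id _ _ (pset A2)) X Z.
  by apply: app_eq aZ; [|exact: ph_id].
exact: relL_of_app (nd_id cA2) (app_idid cA1 cA2 uX) b.
Qed.

Lemma um_idL : rel (pset A1) id (sw _ _ ** X ** sw _ _) (sw _ _ ** X ** sw _ _).
Proof.
have b := app_idid cA1 cA2 uX; exact: (relL_of_app (nd_id cA2) b b).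
Qed.

Lemma mor_appL_of Z :
  rel (pset A1) (ph phi) (sw _ _ ** X ** sw _ _) (sw _ _ ** Z ** sw _ _) ->
  mor_app A1 A2 B1 A2 phi id X = opf Z.
Proof.
move=> r; apply: (mor_app_of cA1 cA2 cB1 cA2 mphi (mor_id cA2) uX _ r).
by rewrite ph_id; exact: (um_id cA1 cA2 uX).
Qed.
End ApplyLeft.
End Translation.

(** * Leg equations from morphisms implemented by a unitary *)

Section LegEquations.
Variable R : realType.
Notation Hil := (hilbertType R).
Notation Bd E L := (Op (htens E L) (htens E L)).

Section Permute.
Variables E L M : Hil.
(* [asu] and [swu] identify the operators on (E (x) L) (x) M with those on
   E (x) (L (x) M) and on M (x) (E (x) L). *)
Definition asu (T : Bd (htens E L) M) : Bd E (htens L M) := as_ E L M ** T ** ua E L M.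
Lemma sh_asu : starhom asu.
Proof. by have := sh_conj (ua_unit E L M); rewrite ad_ua. Qed.
Lemma asu_inj S T : asu S = asu T -> S = T.
Proof.
move=> h; apply: (unit_injl (as_unit E L M)).
exact: (unit_injr (ua_unit E L M) h).
Qed.
Lemma asu12 T : asu (l12 M T) = amp1 M T. Proof. by rewrite amp1E. Qed.
Lemma asu13 T : asu (l13 L T) = amp2 L T. Proof. by rewrite amp2E. Qed.
Lemma asu23 T : asu (l23 E T) = ot (oid E) T. Proof. by rewrite ot1E. Qed.

Definition swu (T : Bd (htens E L) M) : Bd M (htens E L) := sw (htens E L) M ** T ** sw M (htens E L).
Lemma sh_swu : starhom swu.
Proof. by have := sh_conj (sw_unit M (htens E L)); rewrite ad_sw. Qed.
Lemma swu_inj S T : swu S = swu T -> S = T.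
Proof.
move=> h; apply: (unit_injl (sw_unit (htens E L) M)).
exact: (unit_injr (sw_unit M (htens E L)) h).
Qed.
Lemma swu12 T : swu (l12 M T) = ot (oid M) T.
Proof. by apply: op3_ext' => x x' y y' z z'; rewrite swc l12c otE inner_tens mulrC. Qed.
Lemma swu13 T : swu (l13 L T) = amp1 L (sw E M ** T ** sw M E).
Proof. by apply: op3_ext' => x x' y y' z z'; rewrite [LHS]swc l13c amp1c swc. Qed.
Lemma swu23 T : swu (l23 E T) = amp2 E (sw L M ** T ** sw M L).
Proof. by apply: op3_ext' => x x' y y' z z'; rewrite [LHS]swc l23c amp2c swc mulrC. Qed.
End Permute.

Section ExchangeFirst.
Variables H K L : Hil.
Definition c12 (T : Bd (htens K H) L) : Bd (htens H K) L := ot (sw K H) (oid L) ** T ** ot (sw H K) (oid L).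
Lemma sh_c12 : starhom c12.
Proof.
have u : unit_ (ot (sw H K) (oid L)) by apply: ot_unit; [exact: sw_unit|exact: unit_id].
by have := sh_conj u; rewrite ad_ot ad_sw ad1.
Qed.
Let c12c T x x' y y' z z' : inner (tens (tens x y) z) (c12 T (tens (tens x' y') z')) =
  inner (tens (tens y x) z) (T (tens (tens y' x') z')).
Proof.
by rewrite /c12 !ocompE -[ot (sw K H) _]adK adEr ad_ot ad_sw ad1 !otE !swE.
Qed.
Lemma c12_12 T : c12 (l12 L T) = l12 L (sw K H ** T ** sw H K).
Proof. by apply: op3_ext => x x' y y' z z'; rewrite c12c !l12c swc. Qed.
Lemma c12_13 T : c12 (l13 H T) = l23 H T.
Proof. by apply: op3_ext => x x' y y' z z'; rewrite c12c l13c l23c mulrC. Qed.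
Lemma c12_23 T : c12 (l23 K T) = l13 K T.
Proof. by apply: op3_ext => x x' y y' z z'; rewrite c12c l13c l23c mulrC. Qed.
End ExchangeFirst.

Section HomConj.
Variables (L K M N : Hil) (A : Op L L -> Prop) (phi : Op L L -> Op K K).
Hypotheses (cA : CA A) (hphi : hom A phi) (nphi : nd A phi).

Lemma hom_amp : hom A (fun a => ot (phi a) (oid M)).
Proof.
split=> [c a b Aa Ab|a b Aa Ab|a Aa].
- by rewrite (hom_lin hphi)// otLl.
- by rewrite (hom_mul hphi)// ot_comp ocomp1.
- by rewrite (hom_adj hphi)// ad_ot ad1.
Qed.

Lemma nd_amp : nd A (fun a => ot (phi a) (oid M)).
Proof.
apply: dense_cs (@dense_tens _ K M) _ => _ [x [y ->]].
apply: (@cs_map _ _ _ _ _ (hb_axioms _) (ir K y) `|y| _ _ _ _ _ _ x (nphi x)).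
- by move=> c v w; exact: opL.
- exact: normr_ge0.
- move=> v b b0 hv; apply: le_trans (@bnd_ir _ K M y v) _; exact: ler_wpM2l.
move=> _ [a [x' [Aa ->]]]; apply: (cs_in (hb_axioms _)).
by exists a, (tens x' y); rewrite otE irE.
Qed.

Variable U : Op K N.
Hypothesis uU : unit_ U.
Lemma hom_conj : hom A (fun a => U ** phi a ** ad U).
Proof.
split=> [c a b Aa Ab|a b Aa Ab|a Aa].
- by rewrite (hom_lin hphi)// ocompDr ocompDl ocompZr ocompZl.
- by rewrite (hom_mul hphi)// !ocompA unitrVK.
- by rewrite (hom_adj hphi)// !adM adK ocompA.
Qed.

Lemma nd_conj : nd A (fun a => U ** phi a ** ad U).
Proof.
apply: (dense_map (T := U) nphi) => [_ [a [x [Aa ->]]]|].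
  exists a, (U x); split=> //; rewrite !ocompE.
  by rewrite -[ad U (U x)]ocompE (proj1 uU) oidE.
move=> y; apply: (cs_in (hb_axioms _)).
by exists (ad U y); rewrite -ocompE (proj2 uU) oidE.
Qed.
End HomConj.

Section Conjugate.
Variables (E L K M : Hil) (A : Op L L -> Prop) (phi : Op L L -> Op K K).
Hypotheses (cA : CA A) (hphi : hom A phi).
Variable U : Bd K M.
Hypothesis uU : unit_ U.
Let Ad a := U ** ot (phi a) (oid M) ** ad U.

Lemma rel_conjR (T : Bd E L) (T' : Bd E K) : rel A phi T T' ->
  rel A Ad T (asu (l23 E U ** l12 M T' ** l23 E (ad U))).
Proof.
move=> h; rewrite !(shM (sh_asu _ _ _)) !asu23 asu12.
exact: rel_conj uU (rel_amp (M := M) h).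
Qed.

Lemma rel_conjL (X : Bd L E) (X' : Bd K E) :
  rel A phi (sw L E ** X ** sw E L) (sw K E ** X' ** sw E K) ->
  rel A Ad (sw L E ** X ** sw E L) (swu (l12 E U ** l13 M X' ** l12 E (ad U))).
Proof.
move=> h; rewrite !(shM (sh_swu _ _ _)) !swu12 swu13.
exact: rel_conj uU (rel_amp (M := M) h).
Qed.

Variable theta : Op L L -> Op (htens K M) (htens K M).
Hypotheses (htheta : hom A theta) (ntheta : nd A theta).
Hypothesis thetaE : forall a, A a -> theta a = Ad a.

(** The image of T under [theta = U (phi (x) 1) U^*] is [U_23 T'_12 U_23^*]; by uniqueness of images
    it equals S. *)
Lemma eq_right (T : Bd E L) (T' : Bd E K) S : rel A phi T T' -> rel A theta T (asu S) ->
  l23 E U ** l12 M T' = S ** l23 E U.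
Proof.
move=> /rel_conjR r1 r2.
have r3 : rel A theta T (asu (l23 E U ** l12 M T' ** l23 E (ad U))).
  by apply: rel_congr r1 => a Aa; rewrite thetaE.
have /asu_inj -> := rel_fun cA htheta ntheta r2 r3.
by rewrite (shA (sh_l23 _ _ _)) unitrVK//; exact: (sh_unit (sh_l23 _ _ _)).
Qed.

Lemma eq_left (X : Bd L E) (X' : Bd K E) S :
  rel A phi (sw L E ** X ** sw E L) (sw K E ** X' ** sw E K) ->
  rel A theta (sw L E ** X ** sw E L) (swu S) ->
  l12 E U ** l13 M X' = S ** l12 E U.
Proof.
move=> /rel_conjL r1 r2.
have r3 : rel A theta (sw L E ** X ** sw E L) (swu (l12 E U ** l13 M X' ** l12 E (ad U))).
  by apply: rel_congr r1 => a Aa; rewrite thetaE.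
have /swu_inj -> := rel_fun cA htheta ntheta r2 r3.
by rewrite (shA (sh_l12 _ _ _)) unitrVK//; exact: (sh_unit (sh_l12 _ _ _)).
Qed.
End Conjugate.

Section Implement.
Variables (H : Hil) (W : Bd H H).
Hypotheses (uW : unit_ W) (pent : l23 H W ** l12 H W = l12 H W ** l13 H W ** l23 H W).
Variables (A Ah : Op H H -> Prop) (D Dh : Op H H -> Bd H H).
Hypotheses (cA : CA A) (cAh : CA Ah) (hD : hom A D) (hDh : hom Ah Dh).
Hypotheses (nA : nd A id) (nAh : nd Ah id) (nD : nd A D) (nDh : nd Ah Dh).
Hypotheses (AE : forall a, A a <-> slices W a) (AhE : forall a, Ah a <-> lslices W a).

(** Both sides are morphisms that send W to [W_12 W_13], the right one by the pentagon equation, and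
    the slices of W have closed span A. *)
Lemma comult_impl a : rel A id W W -> rel A D W (asu (l12 H W ** l13 H W)) -> A a ->
  D a = W ** ot a (oid H) ** ad W.
Proof.
move=> r1 r2 /AE; have hid := @hom_id _ _ A.
have h2 := hom_conj (hom_amp H hid) uW.
have n2 := nd_conj (nd_amp (M := H) nA) uW.
apply: (rel_slices_eq cA hD h2 nD n2 r2).
  have -> : l12 H W ** l13 H W = l23 H W ** l12 H W ** l23 H (ad W).
    by rewrite pent (shA (sh_l23 _ _ _)) unitrK//; exact: (sh_unit (sh_l23 _ _ _)).
  exact: (rel_conjR uW r1).
by move=> x z; apply/AE; apply: (cs_in (bnd_axioms _ _)); exists x, z.
Qed.

Lemma sl_sw u v : sl (sw H H ** W ** sw H H) u v = sr W u v.
Proof.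
apply: op_ext => y; apply: inner_ext => x.
by rewrite slE srE swc.
Qed.

Lemma dcomult_impl b : rel Ah id (sw H H ** W ** sw H H) (sw H H ** W ** sw H H) ->
  rel Ah Dh (sw H H ** W ** sw H H) (swu (l23 H W ** l13 H W)) -> Ah b ->
  Dh b = dual W ** ot b (oid H) ** ad (dual W).
Proof.
move=> r1 r2 /AhE hb_; have hid := @hom_id _ _ Ah.
have uU := dual_unit uW.
have h2 := hom_conj (hom_amp H hid) uU.
have n2 := nd_conj (nd_amp (M := H) nAh) uU.
apply: (rel_slices_eq cAh hDh h2 nDh n2 r2).
- have -> : l23 H W ** l13 H W = l12 H (dual W) ** l13 H W ** l12 H (ad (dual W)).
    have := congr1 (@c12 H H H) pent.
    rewrite !(shM (sh_c12 _ _ _)) !c12_12 c12_13 c12_23 => p.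
    have u12 : unit_ (l12 H (sw H H ** W ** sw H H)).
      apply: (sh_unit (sh_l12 _ _ _)); apply: unit_comp; last exact: sw_unit.
      by apply: unit_comp => //; exact: sw_unit.
    have -> : dual W = ad (sw H H ** W ** sw H H) by rewrite !adM !ad_sw ocompA.
    move: p u12; rewrite adK (shA (sh_l12 _ _ _)); move: (sw H H ** W ** sw H H) => S p u12.
    by rewrite -ocompA p -ocompA unitK.
  exact: (rel_conjL uU r1).
- move=> x z; rewrite sl_sw; apply/AhE; apply: (cs_in (bnd_axioms _ _)); by exists x, z.
move: hb_; apply: (cs_min (cs_csub (bnd_axioms _ _) _)) => _ [u [v ->]].
by apply: (cs_in (bnd_axioms _ _)); exists u, v; rewrite sl_sw.
Qed.
End Implement.
End LegEquations.

(** * The reduced and the universal quantum group *)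

Section QuantumGroup.
Variables (R : realType) (G : cqgroup R).
Notation C := (Cplx R).
Notation Hil := (hilbertType R).
Notation Bd E L := (Op (htens E L) (htens E L)).
Notation H := (cq_space G).
Notation A := (cq_alg G).
Notation Ah := (cq_dual G).

Definition cqw : Bd H H := pk (cq_W G).
Notation W := cqw.

Lemma cqwE : cq_W G = W.
Proof. by rewrite pkE//; have [] := cq_unitary G. Qed.

Lemma cqw_unit : unit_ W.
Proof. by have [T eT uT] := unitary_op_unit (cq_unitary G); rewrite /cqw eT pkK. Qed.

Lemma cqw_pent : l23 H W ** l12 H W = l12 H W ** l13 H W ** l23 H W.
Proof.
apply: opf_inj; have := cq_pentagon G.
by rewrite /pentagon cqwE !(leg12E, leg13E, leg23E) => h; exact: h.
Qed.

Lemma cqw_facts : [/\ CA (slices W), CA (lslices W),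
  hdense (fun y => exists a x, slices W a /\ y = a x),
  hdense (fun y => exists a x, lslices W a /\ y = a x) &
  forall d, W ** ot d (oid H) = ot (oid H) d ** W -> exists c : C, d = c *: oid H].
Proof.
have [Q [W' [[Qd Qa _] Qi uW' WQ WW']]] := cq_manageable G.
have [T eT uT] := unitary_op_unit uW'; subst W'.
rewrite cqwE in WQ WW'; have uW := cqw_unit; have p := cqw_pent.
split.
- exact: (rslices_CA Qd Qa Qi uT p WQ WW').
- exact: (lslices_CA Qd Qa Qi uT p WW').
- exact: slices_nd uW.
- exact: (lslices_nd Qd Qa Qi uW uT p WW').
- exact: (commutant_scalar Qd Qa Qi uW uT WQ WW').
Qed.

Lemma cq_algE a : pset A a <-> slices W a.
Proof. by rewrite /pset /cq_alg cqwE; exact: right_legE. Qed.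
Lemma cq_dualE a : pset Ah a <-> lslices W a.
Proof. by rewrite /pset /cq_dual cqwE; exact: left_legE. Qed.

Let psetA : pset A = slices W. Proof. by apply/funext => a; apply/propext/cq_algE. Qed.
Let psetAh : pset Ah = lslices W. Proof. by apply/funext => a; apply/propext/cq_dualE. Qed.

Lemma cq_cstar : cstar_algebra A.
Proof.
have [h1 h2 h3 h4 _] := cqw_facts.
by apply: CA_cstar; rewrite ?psetA// => a [].
Qed.
Lemma cq_dcstar : cstar_algebra Ah.
Proof.
have [h1 h2 h3 h4 _] := cqw_facts.
by apply: CA_cstar; rewrite ?psetAh// => a [].
Qed.
Notation cA := cq_cstar.
Notation cAh := cq_dcstar.
Notation cAA := (atens_cstar cA cA).
Notation cAhAh := (atens_cstar cAh cAh).

Section Reassociate.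
Variables (H1 H2 K L : Hil) (A1 : set (H1 -> H1)) (A2 : set (H2 -> H2)).
Variables (B2 : set (htens K L -> htens K L)) (psi : (H2 -> H2) -> (htens K L -> htens K L)).
Hypotheses (cA1 : cstar_algebra A1) (cA2 : cstar_algebra A2) (cB2 : cstar_algebra B2).
Hypothesis mpsi : morphism A2 B2 psi.

Lemma mor_app_reassoc (X : Bd H1 H2) (T : Bd (htens H1 K) L) : um A1 A2 X ->
  reassoc (mor_app A1 A2 A1 B2 id psi X) = T -> mor_app A1 A2 A1 B2 id psi X = asu T.
Proof.
move=> uX; have LX t (ht : at_ (pset A1) (pset A2) t) := (uX.2 t ht).1.
have [Z -> _] := mor_app_ex cA1 cA2 cA1 cB2 (mor_id cA1) mpsi LX.
rewrite reassocE => /opf_inj <-; rewrite /asu; congr opf.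
by rewrite -!ocompA (proj2 (as_unit _ _ _)) ocomp1 -[as_ _ _ _]ad_ua unitK//; exact: ua_unit.
Qed.

Lemma reassoc_asu (T : Bd (htens H1 K) L) : reassoc (asu T) = T.
Proof.
rewrite reassocE /asu; congr opf.
by rewrite -!ocompA (proj1 (as_unit _ _ _)) ocomp1 unitK//; exact: as_unit.
Qed.
End Reassociate.

Variable Gu : universal_cqg G.
Notation Hu := (u_space Gu).
Notation Au := (u_alg Gu).
Notation cAu := (u_cstar Gu).
Notation cAuAu := (atens_cstar cAu cAu).
Definition uv : Bd H Hu := pk (u_V Gu).
Notation V := uv.
Notation Du := (ph (u_comult Gu)).
Notation Lam := (ph (u_red Gu)).
Notation D := (ph (@cq_comult R G)).
Notation Dh := (ph (@cq_dcomult R G)).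

Lemma uvE : u_V Gu = V.
Proof. by rewrite pkE//; have [[[[]]]] := u_corep Gu. Qed.

Lemma uv_um : um Ah Au V.
Proof.
have [h _] := u_corep Gu; rewrite uvE in h.
by have [T /opf_inj -> ] := UM_um cAh cAu h.
Qed.
Notation uV := uv_um.1.

Let redE : mor_app Ah Au Ah A id (u_red Gu) V = opf W.
Proof. by have := u_redE Gu; rewrite uvE cqwE. Qed.

Lemma rel_Lam : srel (pset Au) Lam V W.
Proof. exact: (mor_appR cAh cAu cA (u_red_mor Gu) uv_um redE cqw_unit). Qed.

(** That W multiplies the tensor product of the dual with A is inherited from V, whose image under
    the reducing map is W. *)
Lemma cqw_um : um Ah A W.
Proof. exact: (mor_app_um cAh cAu cAh cA (mor_id cAh) (u_red_mor Gu) uv_um redE cqw_unit). Qed.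

Let u12 (E L M : Hil) (T : Bd E L) : unit_ T -> unit_ (l12 M T).
Proof. by move=> u; exact: (sh_unit (sh_l12 _ _ _)). Qed.
Let u13 (E L M : Hil) (T : Bd E M) : unit_ T -> unit_ (l13 L T).
Proof. by move=> u; exact: (sh_unit (sh_l13 _ _ _)). Qed.
Let u23 (E L M : Hil) (T : Bd L M) : unit_ T -> unit_ (l23 E T).
Proof. by move=> u; exact: (sh_unit (sh_l23 _ _ _)). Qed.
Let uasu (E L M : Hil) (T : Bd (htens E L) M) : unit_ T -> unit_ (asu T).
Proof. by move=> u; exact: (sh_unit (sh_asu _ _ _)). Qed.

Lemma rel_Du : srel (pset Au) Du V (asu (l12 Hu V ** l13 Hu V)).
Proof.
apply: (mor_appR cAh cAu cAuAu (u_comult_mor Gu) uv_um).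
  apply: (mor_app_reassoc cAh cAu cAuAu (u_comult_mor Gu) uv_um).
  by have := u_comultE Gu; rewrite uvE leg12E leg13E.
by apply/uasu/unit_comp; [exact: u12 uV|exact: u13 uV].
Qed.

Lemma rel_D : srel (pset A) D W (asu (l12 H W ** l13 H W)).
Proof.
apply: (mor_appR cAh cA cAA (cq_comult_mor G) cqw_um).
  apply: (mor_app_reassoc cAh cA cAA (cq_comult_mor G) cqw_um).
  by have := cq_comultE G; rewrite cqwE leg12E leg13E.
by apply/uasu/unit_comp; [exact: u12 cqw_unit|exact: u13 cqw_unit].
Qed.

Lemma rel_Dh_W : rel (pset Ah) Dh (sw _ _ ** W ** sw _ _) (swu (l23 H W ** l13 H W)).
Proof.
apply: (mor_appL cAh cA cAhAh (cq_dcomult_mor G) cqw_um).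
by have := cq_dcomultE G; rewrite cqwE leg23E leg13E.
Qed.

Lemma rel_Dh_V : rel (pset Ah) Dh (sw _ _ ** V ** sw _ _) (swu (l23 H V ** l13 H V)).
Proof.
apply: (mor_appL cAh cAu cAhAh (cq_dcomult_mor G) uv_um).
by have [_] := u_corep Gu; rewrite uvE leg23E leg13E.
Qed.

Let hD := ph_hom cA (cq_comult_mor G).
Let hDh := ph_hom cAh (cq_dcomult_mor G).
Let nD := ph_nd cA cAA (cq_comult_mor G).
Let nDh := ph_nd cAh cAhAh (cq_dcomult_mor G).

Lemma D_impl a : pset A a -> D a = W ** ot a (oid H) ** ad W.
Proof.
apply: (comult_impl cqw_unit cqw_pent (pset_CA cA) hD (nd_id cA) nD cq_algE _ rel_D.1).
exact: (um_id cAh cA cqw_um).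
Qed.

Lemma Dh_impl b : pset Ah b -> Dh b = dual W ** ot b (oid H) ** ad (dual W).
Proof.
apply: (dcomult_impl cqw_unit cqw_pent (pset_CA cAh) hDh (nd_id cAh) nDh cq_dualE _ rel_Dh_W).
exact: (um_idL cAh cA cqw_um).
Qed.

(** The corepresentation property of V, with the dual comultiplication implemented by [dual W],
    after an exchange of the first two legs. *)
Lemma uv_corep : l12 Hu W ** l13 H V ** l23 H V = l23 H V ** l12 Hu W.
Proof.
have := eq_left (pset_CA cAh) (dual_unit cqw_unit) hDh nDh Dh_impl (um_idL cAh cAu uv_um) rel_Dh_V.
move=> /(congr1 (@c12 R H H Hu)); rewrite !(shM (sh_c12 _ _ _)) c12_12 c12_13 c12_23.
have -> : sw H H ** dual W ** sw H H = ad W.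
  by rewrite /dual !ocompA sw_sw o1comp -ocompA sw_sw ocomp1.
rewrite (shA (sh_l12 _ _ _)) => h.
have uw := u12 Hu cqw_unit.
by rewrite -ocompA -[LHS](unitrVK _ uw) -[_ ** ad _]ocompA -h unitVK.
Qed.
End QuantumGroup.

Section CompositeHom.
Variable R : realType.
Notation Hil := (hilbertType R).
Variables (L K M : Hil) (A : Op L L -> Prop) (B : Op K K -> Prop).
Variables (phi : Op L L -> Op K K) (psi : Op K K -> Op M M).
Hypotheses (cA : CA A) (cB : CA B) (hphi : hom A phi) (hpsi : hom B psi) (npsi : nd B psi).
Hypothesis phiB : forall a b, A a -> B b -> B (phi a ** b).
Hypothesis spanB : forall b, B b ->
  cs (@bnd R K K) (fun t => exists a b, [/\ A a, B b & t = phi a ** b]) b.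

(** theta is psi, extended to multipliers by [ext_ex], after phi. Its nondegeneracy comes from that
    of psi and from [spanB]. *)
Lemma composite_ex : exists theta : Op L L -> Op M M, [/\ hom A theta, nd A theta &
  forall a b, A a -> B b -> theta a ** psi b = psi (phi a ** b)].
Proof.
have /choice[theta thE] : forall a, exists T, A a -> forall b, B b -> T ** psi b = psi (phi a ** b).
  move=> a; have [Aa|nA] := pselect (A a); last by exists 0.
  by have [T _ hT] := ext_ex cB hpsi npsi (fun b Bb => phiB Aa Bb); exists T.
exists theta; split; last by move=> a b Aa Bb; exact: thE.
- split=> [c a b Aa Ab|a b Aa Ab|a Aa].
  + apply: (nd_eq npsi) => t Bt.
    rewrite ocompDl ocompZl !thE//; last exact: (csubL (ca_csub cA)).
    rewrite (hom_lin hphi)// ocompDl ocompZl (hom_lin hpsi)//; exact: phiB.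
  + apply: (nd_eq npsi) => t Bt.
    rewrite thE//; last exact: (ca_mul cA).
    by rewrite (hom_mul hphi)// -!ocompA thE// thE//; exact: phiB.
  + have Aa' := ca_adj cA Aa.
    have key t s : B t -> B s -> ad (psi s) ** (theta (ad a) ** psi t) = ad (psi s) ** (ad (theta a) ** psi t).
      move=> Bt Bs; have Bas := phiB Aa Bs.
      rewrite (thE _ Aa' _ Bt) -(hom_adj hpsi Bs) -(hom_mul hpsi (ca_adj cB Bs) (phiB Aa' Bt)).
      rewrite (hom_adj hpsi Bs) [RHS]ocompA -[ad (psi s) ** ad _]adM (thE _ Aa _ Bs) -(hom_adj hpsi Bas).
      by rewrite -(hom_mul hpsi (ca_adj cB Bas) Bt) adM (hom_adj hphi Aa) ocompA.
    apply: (nd_eq npsi) => t Bt; rewrite -[LHS]adK -[RHS]adK; congr ad.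
    apply: (nd_eq npsi) => s Bs.
    by rewrite -[psi s]adK -!(adM (ad (psi s))) key.
apply: dense_cs npsi _ => _ [b [x [Bb ->]]].
pose D (y : M) := exists a x, A a /\ y = theta a x.
have cD : csub (@bnd R M M) (fun T => cs (@hb R M) D (T x)).
  apply: (csub_preim (hb_axioms M) (f := fun T : Op M M => T x) (M := `|x|)).
  - by move=> c S T; rewrite addoE scaleoE.
  - exact: normr_ge0.
  - by move=> T k k0 hT; rewrite /hb mulrC; exact: hT.
  exact: cs_csub (hb_axioms M) _.
suff [] : B b /\ cs (@hb R M) D (psi b x) by [].
apply: (cs_min (hom_preim cB hpsi cD) _ (spanB Bb)) => _ [a [b' [Aa Bb' ->]]].
split; first exact: phiB.
by rewrite -thE//; apply: (cs_in (hb_axioms M)); exists a, (psi b' x).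
Qed.
End CompositeHom.

Section Universal.
Variables (R : realType) (G : cqgroup R) (Gu : universal_cqg G).
Notation C := (Cplx R).
Notation H := (cq_space G).
Notation A := (cq_alg G).
Notation Ah := (cq_dual G).
Notation W := (cqw G).
Notation Hu := (u_space Gu).
Notation Au := (u_alg Gu).
Notation V := (uv Gu).
Notation cA := (cq_cstar G).
Notation cAh := (cq_dcstar G).
Notation cAu := (u_cstar Gu).
Notation Du := (ph (u_comult Gu)).
Notation Lam := (ph (u_red Gu)).
Notation uW := (cqw_unit G).
Notation uV := (uv_um Gu).1.
Notation pAu := (pset_CA cAu).

Lemma mult_multiplier m : mult (pset Ah) m -> multiplier Ah m.
Proof.
move=> hm; split=> [|a Aa]; first exact: opP.
have ha := cstar_bounded cAh Aa.
have [|h1 h2] := hm (pk a); first by rewrite /pset pkE.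
by move: h1 h2; rewrite /pset -[opf (m ** _)]/(opf m \o opf (pk a)) -[opf (_ ** m)]/(opf (pk a) \o opf m) pkE.
Qed.

(** By [u_span] elements of the universal algebra are limits of combinations of slices of V by
    functionals of the dual, and each of these absorbs vector slices by [absorb_slice]. *)
Lemma uv_absorb a x z : pset Au a ->
  cs (@bnd R Hu Hu) (fun t => exists x z, t = sl V x z) (a ** sl V x z).
Proof.
move=> Aa; have csp := cs_csub (bnd_axioms Hu Hu).
have := u_span Aa; rewrite op_cspanE; last first.
  by move=> _ [w [w' [_ _ ->]]]; rewrite uvE; exact: lslice_bounded.
apply: (cs_min (csub_compr (sl V x z) (csp _))) => t [w [w' [[wL [M wB]] [wE wL' [M' [n [d [dA wB']]]]]]]].
rewrite uvE; have [[S -> hS]| ->] := lslice_cases V w'; last first.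
  by move=> /opf_inj ->; rewrite o0comp; exact: csub0 (csp _).
move=> /opf_inj ->.
have LV t' (ht : at_ (pset Ah) (pset Au) t') := ((uv_um Gu).2 t' ht).1.
have LV' t' (ht : at_ (pset Ah) (pset Au) t') := ((uv_um Gu).2 t' ht).2.
have LW t' (ht : at_ (pset Ah) (pset A) t') := ((cqw_um Gu).2 t' ht).1.
have srW u v : pset Ah (sr (ad W) u v).
  rewrite -ad_sr; apply: (ca_adj (pset_CA cAh)); apply/cq_dualE.
  by apply: (cs_in (bnd_axioms _ _)); exists v, u.
have M0 : 0 <= M.
  have := @wB (0 : Op H H) 1 (CA0 (pset_CA cAh)); rewrite mulr1 => h.
  by apply: le_trans (h _) => // y; rewrite zerooE normr0 mul1r.
pose w1 (T : Op H H) := w (opf T); pose w2 (T : Op H H) := w' (opf T).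
have w1L (c : C) a1 a2 : pset Ah a1 -> pset Ah a2 -> w1 (c *: a1 + a2) = c * w1 a1 + w1 a2.
  by move=> h1 h2; exact: wL.
have w1B a1 b : pset Ah a1 -> bnd a1 b -> `|w1 a1| <= M * b by move=> h1; exact: wB.
have w2E a1 : pset Ah a1 -> w2 a1 = w1 a1 by move=> h1; exact: wE.
have w2L (c : C) m1 m2 : mult (pset Ah) m1 -> mult (pset Ah) m2 ->
    w2 (c *: m1 + m2) = c * w2 m1 + w2 m2.
  by move=> /mult_multiplier h1 /mult_multiplier h2; exact: wL'.
have dA' i : pset Ah (pk (d i)) by rewrite /pset pkE//; exact: (cstar_bounded cAh (dA i)).
have w2B m b : mult (pset Ah) m ->
    (forall i, bnd (m ** pk (d i)) b /\ bnd (pk (d i) ** m) b) -> `|w2 m| <= M' * b.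
  move=> /mult_multiplier hm hb_; apply: wB' => // i; have [b1 b2] := hb_ i.
  have e := pkE (cstar_bounded cAh (dA i)).
  by move: b1 b2; rewrite /bnd -[opf (m ** _)]/(opf m \o opf (pk (d i))) -[opf (_ ** m)]/(opf (pk (d i)) \o opf m) e.
exact: (absorb_slice (pset_CA cAh) uW uV (cstar_nd cA) (cstar_nd cAu) srW LW LV LV' (uv_corep Gu)
  w1L M0 w1B w2E w2L dA' w2B x z hS).
Qed.

Section Vector.
Variable e : H.
Hypothesis ee : inner e e = 1.

Let PsiLam := thom pAu pAu (ph_hom cAu (u_red_mor Gu)) (@hom_id _ _ (pset Au)).

(** The common value of both morphisms on V is [W_12 V_13 = V_23 W_12 V_23^*]. Since [Du a] is only
    a multiplier, the composite enters through its products with [PsiLam b]. *)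
Lemma Lam_Du a b : pset Au a -> at_ (pset Au) (pset Au) b ->
  V ** ot (Lam a) (oid Hu) ** ad V ** PsiLam b = PsiLam (Du a ** b).
Proof.
move=> Aa hb_.
have cAuAu := atens_cstar cAu cAu.
have pE : pset (atens Au Au) = at_ (pset Au) (pset Au) := pset_atens (cstar_bounded cAu) (cstar_bounded cAu).
have hDu := ph_hom cAu (u_comult_mor Gu).
have hLam := ph_hom cAu (u_red_mor Gu).
have nLam := ph_nd cAu cA (u_red_mor Gu).
have DuB c t : pset Au c -> at_ (pset Au) (pset Au) t -> at_ (pset Au) (pset Au) (Du c ** t).
  by rewrite -pE => hc ht; exact: (ph_mult (u_comult_mor Gu) hc ht).1.
have spanB t : at_ (pset Au) (pset Au) t -> cs (@bnd R _ _)
    (fun t => exists c b, [/\ pset Au c, at_ (pset Au) (pset Au) b & t = Du c ** b]) t.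
  by rewrite -pE => ht; exact: (ph_span cAu cAuAu (u_comult_mor Gu) ht).
have hPsi : hom (at_ (pset Au) (pset Au)) PsiLam := thom_hom _ _ _ _.
have nPsi : nd (at_ (pset Au) (pset Au)) PsiLam := thom_nd _ _ _ _ nLam (nd_id cAu).
have cAt := at_CA pAu pAu.
have [theta [hth nth thE]] := composite_ex pAu cAt hDu hPsi nPsi DuB spanB.
suff -> : V ** ot (Lam a) (oid Hu) ** ad V = theta a by exact: thE.
have r2 : rel (pset Au) theta V (asu (l12 Hu W ** l13 H V)).
  apply: (rel_theta pAu cAt hPsi hth nPsi DuB thE (rel_Du Gu).1).
  rewrite !(shM (sh_asu _ _ _)) !asu12 !asu13; apply: rel_comp.
    exact: rel_amp1 (rel_Lam Gu).1.
  exact: rel_amp2 (um_id cAh cAu (uv_um Gu)).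
have r1 : rel (pset Au) (fun a => V ** ot (Lam a) (oid Hu) ** ad V) V (asu (l12 Hu W ** l13 H V)).
  have -> : l12 Hu W ** l13 H V = l23 H V ** l12 Hu W ** l23 H (ad V).
    rewrite -(uv_corep Gu) (shA (sh_l23 _ _ _)) unitrK//; exact: (sh_unit (sh_l23 _ _ _) uV).
  exact: (rel_conjR uV (rel_Lam Gu).1).
have uU : unit_ (asu (l12 Hu W ** l13 H V)).
  apply: (sh_unit (sh_asu _ _ _)); apply: unit_comp.
    exact: (sh_unit (sh_l12 _ _ _) uW).
  exact: (sh_unit (sh_l13 _ _ _) uV).
have h1 := hom_conj (hom_amp Hu hLam) uV.
have n1 := nd_conj (nd_amp (M := Hu) nLam) uV.
exact: (morphism_ext ee pAu uU h1 hth n1 nth r1 r2 uv_absorb Aa).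
Qed.
End Vector.
End Universal.

(** * Lifting bicharacters *)

Section Comultiplied.
Variable R : realType.
Notation Hil := (hilbertType R).
Notation Bd E L := (Op (htens E L) (htens E L)).

Lemma sw_asu (E K : Hil) (S T : Bd E K) :
  ot (oid E) (sw K K) ** asu (l12 K S ** l13 K T) ** ot (oid E) (sw K K) = asu (l13 K S ** l12 K T).
Proof.
have u : unit_ (ot (oid E) (sw K K)) by apply: ot_unit; [exact: unit_id|exact: sw_unit].
have sj := sh_conj u; rewrite ad_ot ad1 ad_sw in sj.
have e1 U : ot (oid E) (sw K K) ** amp1 K U ** ot (oid E) (sw K K) = amp2 K U.
  by apply: op3_ext' => x x' y y' z z'; rewrite -[X in _ = X]/(inner _ (amp2 K U _)) [in RHS]/amp2 -lock.
have e2 U : ot (oid E) (sw K K) ** amp2 K U ** ot (oid E) (sw K K) = amp1 K U.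
  have w2 : ot (oid E) (sw K K) ** ot (oid E) (sw K K) = oid _ by rewrite ot_comp ocomp1 sw_sw ot_id.
  by rewrite -e1 -!ocompA w2 ocomp1 !ocompA w2 o1comp.
by rewrite !(shM (sh_asu _ _ _)) !asu12 !asu13 (shM sj) e1 e2.
Qed.

Section Words.
Variables (H Hu M : Hil).

(** If Y solves the equation with V, then [Y_12 Y_13] solves it with [V_12 V_13], the image of V
    under the comultiplication. By [srel_Y] this identifies the image of Y. *)
Lemma amp_Y (X : Bd H H) (V Y : Bd H Hu) :
  l12 Hu X ** l13 H Y ** l23 H V = l23 H V ** l12 Hu X ->
  l12 (htens Hu Hu) X ** l13 H (asu (l12 Hu Y ** l13 Hu Y)) ** l23 H (asu (l12 Hu V ** l13 Hu V)) =
  l23 H (asu (l12 Hu V ** l13 Hu V)) ** l12 (htens Hu Hu) X.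
Proof.
move=> h; apply: q4_inj.
rewrite !(shM (sh_asu _ _ _)) !asu12 !asu13 !(shM (sh_l13 _ _ _)) !(shM (sh_l23 _ _ _)).
rewrite !(shM (sh_q4 _ _ _ _)) q4_12 q4_13_amp1 q4_13_amp2 q4_23_amp1 q4_23_amp2.
apply: word_amp; last exact: L14_23.
  by rewrite /L12 /L13 /L23 -!(shM (sh_e123 _ _ _ _)) h.
by rewrite -e124_12 /L14 /L24 -!(shM (sh_e124 _ _ _ _)) h.
Qed.

Lemma amp_Z (V : Bd H M) (Y : Bd H Hu) (Z : Bd M Hu) :
  l23 H Z ** l13 M Y ** l12 Hu V = l12 Hu V ** l13 M Y ->
  l23 H (asu (l12 Hu Z ** l13 Hu Z)) ** l13 M (asu (l12 Hu Y ** l13 Hu Y)) ** l12 (htens Hu Hu) V =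
  l12 (htens Hu Hu) V ** l13 M (asu (l12 Hu Y ** l13 Hu Y)).
Proof.
move=> h; apply: q4_inj.
rewrite !(shM (sh_asu _ _ _)) !asu12 !asu13 !(shM (sh_l13 _ _ _)) !(shM (sh_l23 _ _ _)).
rewrite !(shM (sh_q4 _ _ _ _)) q4_12 q4_13_amp1 q4_13_amp2 q4_23_amp1 q4_23_amp2.
apply: word_amp2; last by rewrite L13_24.
  by rewrite /L12 /L13 /L23 -!(shM (sh_e123 _ _ _ _)) h.
by rewrite -e124_12 /L14 /L24 -!(shM (sh_e124 _ _ _ _)) h.
Qed.

(** The factors of F come in reversed order, to match [Z_23 Z_13] when F is the flip of Z. *)
Lemma amp_F (Y : Bd H M) (V : Bd H Hu) (F : Bd M Hu) :
  l23 H F ** l12 Hu Y ** l13 M V = l13 M V ** l12 Hu Y ->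
  l23 H (amp2 Hu F ** amp1 Hu F) ** l12 (htens Hu Hu) Y ** l13 M (asu (l12 Hu V ** l13 Hu V)) =
  l13 M (asu (l12 Hu V ** l13 Hu V)) ** l12 (htens Hu Hu) Y.
Proof.
move=> h; apply: q4_inj.
rewrite !(shM (sh_asu _ _ _)) !asu12 !asu13 !(shM (sh_l13 _ _ _)) !(shM (sh_l23 _ _ _)).
rewrite !(shM (sh_q4 _ _ _ _)) q4_12 q4_13_amp1 q4_13_amp2 q4_23_amp1 q4_23_amp2.
apply: word_amp3; last exact: L13_24.
  by rewrite /L12 /L13 /L23 -!(shM (sh_e123 _ _ _ _)) h.
by rewrite -e124_12 /L14 /L24 -!(shM (sh_e124 _ _ _ _)) h.
Qed.

Lemma swap_last (V : Bd H M) (Y : Bd H Hu) (Z : Bd M Hu) :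
  l23 H Z ** l13 M Y ** l12 Hu V = l12 Hu V ** l13 M Y ->
  l23 H (sw M Hu ** Z ** sw Hu M) ** l12 M Y ** l13 Hu V = l13 Hu V ** l12 M Y.
Proof.
move=> /(congr1 (@c23 R H Hu M)); rewrite !(shM (sh_c23 _ _ _)).
by rewrite c23_12 c23_13 c23_23.
Qed.
End Words.
End Comultiplied.

(** * Existence and uniqueness of the lift *)

Section Lift.
Variables (R : realType) (G : cqgroup R) (Gu : universal_cqg G).
Notation C := (Cplx R).
Notation Hil := (hilbertType R).
Notation Bd E L := (Op (htens E L) (htens E L)).
Notation H := (cq_space G).
Notation A := (cq_alg G).
Notation W := (cqw G).
Notation Hu := (u_space Gu).
Notation Au := (u_alg Gu).
Notation V := (uv Gu).
Notation cA := (cq_cstar G).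
Notation cAh := (cq_dcstar G).
Notation cAu := (u_cstar Gu).
Notation cAA := (atens_cstar cA cA).
Notation cAuAu := (atens_cstar cAu cAu).
Notation Du := (ph (u_comult Gu)).
Notation Lam := (ph (u_red Gu)).
Notation D := (ph (@cq_comult R G)).
Notation uW := (cqw_unit G).
Notation uV := (uv_um Gu).1.
Notation pA := (pset_CA cA).
Notation pAu := (pset_CA cAu).
Notation mLam := (u_red_mor Gu).
Notation mDu := (u_comult_mor Gu).
Notation mD := (cq_comult_mor G).

Variables (e : H) (X : Bd H H).
Hypothesis ee : inner e e = 1.
Hypothesis uX : um A A X.
Hypothesis XL : mor_app A A (atens A A) A (@cq_comult R G) id X = l23 H X ** l13 H X.
Hypothesis XR : reassoc (mor_app A A A (atens A A) id (@cq_comult R G) X) = l12 H X ** l13 H X.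
Hypothesis Xflip : forall a, pset A a -> X ** (sw H H ** D a ** sw H H) ** ad X = D a.

Let hD := ph_hom cA mD.
Let nD := ph_nd cA cAA mD.
Let hDu := ph_hom cAu mDu.
Let nDu := ph_nd cAu cAuAu mDu.
Let hLam := ph_hom cAu mLam.
Let nLam := ph_nd cAu cA mLam.

Let rel_X : rel (pset A) D X (asu (l12 H X ** l13 H X)).
Proof.
have uT : unit_ (asu (l12 H X ** l13 H X)).
  apply: (sh_unit (sh_asu _ _ _)); apply: unit_comp.
    exact: (sh_unit (sh_l12 _ _ _) uX.1).
  exact: (sh_unit (sh_l13 _ _ _) uX.1).
exact: (mor_appR cA cA cAA mD uX (mor_app_reassoc cA cA cAA mD uX XR) uT).1.
Qed.

(** The image of X under the comultiplication in its second leg is [X_12 X_13] by hypothesis, and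
    [W_23 X_12 W_23^*] because W implements the comultiplication. *)
Let eqX1 : l12 H X ** l13 H X ** l23 H W = l23 H W ** l12 H X.
Proof.
by rewrite (eq_right pA uW hD nD (@D_impl R G Gu) (um_id cA cA uX) rel_X).
Qed.

Let eqX2 : l23 H X ** l13 H X ** l12 H W = l12 H W ** l13 H X.
Proof.
by rewrite (eq_left pA uW hD nD (@D_impl R G Gu) (um_idL cA cA uX) (mor_appL cA cA cAA mD uX XL)).
Qed.

(** The flip of the last two legs turns [T_12 T_13] into [T_13 T_12], so invariance under the flip
    followed by conjugation with Z is a commutation rule for [Z_23]. *)
Let flip_asu (L K : Hil) (T : Bd L K) (Z : Bd K K) : unit_ Z ->
  asu (l12 K T ** l13 K T) = ot (oid L) (Z ** sw K K) ** asu (l12 K T ** l13 K T) ** ot (oid L) (ad (Z ** sw K K)) <->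
  l23 L Z ** l13 K T ** l12 K T = l12 K T ** l13 K T ** l23 L Z.
Proof.
move=> uZ.
have -> : ot (oid L) (Z ** sw K K) ** asu (l12 K T ** l13 K T) ** ot (oid L) (ad (Z ** sw K K)) =
    asu (l23 L Z ** l13 K T ** l12 K T ** ad (l23 L Z)).
  have -> : ot (oid L) (Z ** sw K K) = ot (oid L) Z ** ot (oid L) (sw K K) by rewrite ot_comp ocomp1.
  have -> : ot (oid L) (ad (Z ** sw K K)) = ot (oid L) (sw K K) ** ot (oid L) (ad Z).
    by rewrite ot_comp ocomp1 adM ad_sw.
  have sm := shM (sh_asu L K K).
  transitivity (asu (l23 L Z) ** asu (l13 K T ** l12 K T) ** asu (l23 L (ad Z))).
    by rewrite !asu23 -sw_asu !ocompA.
  by rewrite -!sm (shA (sh_l23 _ _ _)) !ocompA.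
have uz : unit_ (l23 L Z) by exact: (sh_unit (sh_l23 _ _ _) uZ).
split=> [/asu_inj h|h]; last by rewrite h unitrK.
by rewrite h unitrVK.
Qed.

(* Conjugation by X and the flip fixes Delta, hence (id (x) Delta)W = W_12 W_13. *)
Let eqR : l23 H X ** l13 H W ** l12 H W = l12 H W ** l13 H W ** l23 H X.
Proof.
apply/(flip_asu _ uX.1); apply: (rel_fun pA hD nD (rel_D Gu).1).
have uXs : unit_ (X ** sw H H) by apply: unit_comp; [exact: uX.1|exact: sw_unit].
apply: rel_congr (rel_conj uXs (rel_D Gu).1) => a Aa.
by rewrite -[RHS](Xflip Aa) adM ad_sw !ocompA.
Qed.

Let comm : forall d, W ** ot d (oid H) = ot (oid H) d ** W -> exists c : C, d = c *: oid H.
Proof. by have [] := cqw_facts G. Qed.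

Let srel_id : srel (pset Au) id V V.
Proof.
have [uV' hV] := uv_um Gu; split; first exact: (um_id cAh cAu (uv_um Gu)).
apply: (um_id cAh cAu); split=> [|t ht]; first exact: unit_ad.
by rewrite adK; have [] := hV t ht.
Qed.

Lemma lift_exists : exists Z : Bd Hu Hu, [/\ um Au Au Z,
  mor_app Au Au A A (u_red Gu) (u_red Gu) Z = X,
  mor_app Au Au (atens Au Au) Au (u_comult Gu) id Z = l23 Hu Z ** l13 Hu Z,
  reassoc (mor_app Au Au Au (atens Au Au) id (u_comult Gu) Z) = l12 Hu Z ** l13 Hu Z &
  forall a, pset Au a -> Z ** (sw Hu Hu ** Du a ** sw Hu Hu) ** ad Z = Du a].
Proof.
have eqV := uv_corep Gu.
have [Y uY eqY] := Y_ex ee uW uX.1 uV comm eqV eqX1.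
have Yc := Y_corep ee uX.1 uV eqX2 eqY.
have [Z uZ eqZ] := Z_ex ee uW uV comm eqV uY Yc.
(* Y2 solves the equation of Z with X in place of Y; [sZ] shows that it is the image of Z under
   Lambda in the second leg. *)
have [Y2 uY2 eqY2] := Z_ex ee uW uV comm eqV uX.1 eqX2.
have asu_unit (E L : Hil) (T : Bd E L) : unit_ T -> unit_ (asu (l12 L T ** l13 L T)).
  move=> u; apply: (sh_unit (sh_asu _ _ _)); apply: unit_comp.
    exact: (sh_unit (sh_l12 _ _ _) u).
  exact: (sh_unit (sh_l13 _ _ _) u).
(* Each relation from here on compares solutions of equations of one shape over two different last
   legs. *)
have sY : srel (pset Au) Lam Y X := srel_Y ee uX.1 uV uW eqY eqX1 (rel_Lam Gu).
have sYi : srel (pset Au) id Y Y := srel_Y ee uX.1 uV uV eqY eqY srel_id.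
have sYD := srel_Y ee uX.1 uV (asu_unit _ _ _ uV) eqY (amp_Y eqY) (rel_Du Gu).
have sZ : srel (pset Au) Lam Z Y2 := srel_Z ee uV uY uX.1 eqZ eqY2 sY.
have sZD := srel_Z ee uV uY (asu_unit _ _ _ uY) eqZ (amp_Z eqZ) sYD.
(* Flipping Z makes its first leg the last one, where morphisms can be applied. *)
have eqF := swap_last eqZ.
have sF : srel (pset Au) Lam (sw _ _ ** Y2 ** sw _ _) (sw _ _ ** X ** sw _ _) :=
  srel_F ee uX.1 uV uW (swap_last eqY2) (swap_last eqX2) (rel_Lam Gu).
have sFD := srel_F ee uY uV (asu_unit _ _ _ uV) eqF (amp_F eqF) (rel_Du Gu).
have umZ : um Au Au Z by split=> [|t ht]; [exact: uZ|exact: (at_mult ee pAu pAu uV uY eqZ srel_id sYi ht)].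
exists Z; split.
- exact: umZ.
- exact: (mor_app_of cAu cAu cA cA mLam mLam umZ sZ.1 sF.1).
- apply: (mor_appL_of cAu cAu cAuAu mDu umZ).
  by rewrite -[sw _ _ ** (_ ** _) ** _]/(swu (l23 Hu Z ** l13 Hu Z)) (shM (sh_swu _ _ _)) swu23 swu13; exact: sFD.1.
- have := mor_appR_of cAu cAu cAuAu mDu umZ sZD.1 => ->.
  exact: reassoc_asu.
move=> a Aa.
have uZs : unit_ (Z ** sw Hu Hu) by apply: unit_comp; [exact: uZ|exact: sw_unit].
have zR := Z_R ee uW uX.1 uV eqV eqR uY eqY eqZ.
have r1 := rel_conj uZs (rel_Du Gu).1.
(* By this identity, conjugation of [Du] by Z and the flip is a second morphism with the same value
   on V as [Du]. *)
have r2 := iffRL (flip_asu V uZ) zR.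
rewrite -r2 in r1.
have := morphism_ext ee pAu (asu_unit _ _ _ uV) (hom_conj hDu uZs) hDu (nd_conj nDu uZs) nDu r1 (rel_Du Gu).1
  (@uv_absorb R G Gu) Aa.
by move=> h; rewrite -[RHS]h adM ad_sw !ocompA.
Qed.

(** With P the image of Z under Lambda in the first leg, the identity for the first leg gives
    [V_12 P_13 = Z_23 P_13 V_12], and Lambda on the last leg turns this into the first equation for
    Q. The second equation comes directly from the identity for the second leg. *)
Lemma lift_determined (Z : Bd Hu Hu) : um Au Au Z ->
  mor_app Au Au A A (u_red Gu) (u_red Gu) Z = X ->
  mor_app Au Au (atens Au Au) Au (u_comult Gu) id Z = l23 Hu Z ** l13 Hu Z ->
  reassoc (mor_app Au Au Au (atens Au Au) id (u_comult Gu) Z) = l12 Hu Z ** l13 Hu Z ->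
  exists Q : Bd Hu H, l23 H Q ** l13 Hu X ** l12 H V = l12 H V ** l13 Hu X /\
    l12 Hu Q ** l13 H Z ** l23 Hu V = l23 Hu V ** l12 Hu Q.
Proof.
move=> umZ hX hL hR.
have [[Q [rQ rQ']] [P [rP rP']]] := mor_app_split cAu cAu cA cA mLam mLam umZ hX.
exists Q.
have uZ := umZ.1.
have cAt := at_CA pAu pAu.
pose Psi := thom pAu pAu hLam (@hom_id _ _ (pset Au)).
have hPsi : hom (at_ (pset Au) (pset Au)) Psi := thom_hom _ _ _ _.
have nPsi : nd (at_ (pset Au) (pset Au)) Psi := thom_nd _ _ _ _ nLam (nd_id cAu).
pose theta a := V ** ot (Lam a) (oid Hu) ** ad V.
have hth : hom (pset Au) theta := hom_conj (hom_amp Hu hLam) uV.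
have nth : nd (pset Au) theta := nd_conj (nd_amp (M := Hu) nLam) uV.
have pE : pset (atens Au Au) = at_ (pset Au) (pset Au) := pset_atens (cstar_bounded cAu) (cstar_bounded cAu).
have DuB c t : pset Au c -> at_ (pset Au) (pset Au) t -> at_ (pset Au) (pset Au) (Du c ** t).
  by rewrite -pE => hc ht; exact: (ph_mult mDu hc ht).1.
have thE a b : pset Au a -> at_ (pset Au) (pset Au) b -> theta a ** Psi b = Psi (Du a ** b).
  move=> Aa hb_; exact: (Lam_Du ee Aa hb_).
have iZ := um_id cAu cAu umZ; have iZL := um_idL cAu cAu umZ.
have uT : unit_ (asu (l12 Hu Z ** l13 Hu Z)).
  apply: (sh_unit (sh_asu _ _ _)); apply: unit_comp.
    exact: (sh_unit (sh_l12 _ _ _) uZ).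
  exact: (sh_unit (sh_l13 _ _ _) uZ).
have rR := (mor_appR cAu cAu cAuAu mDu umZ (mor_app_reassoc cAu cAu cAuAu mDu umZ hR) uT).1.
have rL := mor_appL cAu cAu cAuAu mDu umZ hL.
split.
  have r1 : rel (pset Au) theta (sw _ _ ** Z ** sw _ _) (swu (l23 H Z ** l13 Hu P)).
    apply: (rel_theta pAu cAt hPsi hth nPsi DuB thE rL).
    rewrite -[sw _ _ ** (_ ** _) ** _]/(swu (l23 Hu Z ** l13 Hu Z)).
    rewrite !(shM (sh_swu _ _ _)) !swu23 !swu13; apply: rel_comp.
      exact: rel_amp2 iZL.
    exact: rel_amp1 rP.
  have eB := eq_left pAu uV hth nth (fun a _ => erefl (theta a)) rP r1.
  have rA : rel (pset Au) Lam (l12 Hu V ** l13 Hu P) (l12 H V ** l13 Hu X).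
    by apply: rel_comp; [exact: rel_l12|exact: rel_l13 rP'].
  have rB : rel (pset Au) Lam (l12 Hu V ** l13 Hu P) (l23 H Q ** l13 Hu X ** l12 H V).
    rewrite eB; apply: rel_comp; last exact: rel_l12.
    by apply: rel_comp; [exact: rel_l23 rQ|exact: rel_l13 rP'].
  exact: (rel_fun pAu hLam nLam rB rA).
have r1 : rel (pset Au) theta Z (asu (l12 Hu Q ** l13 H Z)).
  apply: (rel_theta pAu cAt hPsi hth nPsi DuB thE rR).
  rewrite !(shM (sh_asu _ _ _)) !asu12 !asu13; apply: rel_comp.
    exact: rel_amp1 rQ.
  exact: rel_amp2 iZ.
by rewrite (eq_right pAu uV hth nth (fun a _ => erefl (theta a)) rQ r1).
Qed.

Lemma lift_unique (Z Z' : Bd Hu Hu) (Q Q' : Bd Hu H) :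
  l23 H Q ** l13 Hu X ** l12 H V = l12 H V ** l13 Hu X ->
  l12 Hu Q ** l13 H Z ** l23 Hu V = l23 Hu V ** l12 Hu Q ->
  l23 H Q' ** l13 Hu X ** l12 H V = l12 H V ** l13 Hu X ->
  l12 Hu Q' ** l13 H Z' ** l23 Hu V = l23 Hu V ** l12 Hu Q' -> Z = Z'.
Proof.
move=> h1 h2 h1' h2'.
have u12 : unit_ (l12 H V) by exact: (sh_unit (sh_l12 _ _ _) uV).
have u13 : unit_ (l13 Hu X) by exact: (sh_unit (sh_l13 _ _ _) uX.1).
have u23 : unit_ (l23 Hu V) by exact: (sh_unit (sh_l23 _ _ _) uV).
have eQ : Q = Q'.
  apply: (l23_inj ee); apply: (unit_injr u13); apply: (unit_injr u12).
  by rewrite h1 h1'.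
have uQ : unit_ (l12 Hu Q).
  apply: (sh_unit (sh_l12 _ _ _)); apply: (l23_unit_inv ee).
  have -> : l23 H Q = l12 H V ** l13 Hu X ** ad (l12 H V) ** ad (l13 Hu X).
    by rewrite -h1 unitrK// unitrK.
  by apply: unit_comp (unit_ad u13); apply: unit_comp (unit_ad u12); exact: unit_comp.
rewrite -eQ in h2'.
by apply: (l13_inj ee); apply: (unit_injl uQ); apply: (unit_injr u23); rewrite h2 h2'.
Qed.
End Lift.

(** * The zero quantum group *)

Section Trivial.
Variables (R : realType) (G : cqgroup R) (Gu : universal_cqg G).
Notation Hu := (u_space Gu).
Notation Au := (u_alg Gu).
Notation Ah := (cq_dual G).

Lemma tens_trivial (H K : hilbertType R) : (forall x : H, x = 0) -> forall u : htens H K, u = 0.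
Proof.
move=> H0 u; apply: (dense_total (@dense_tens _ H K)) => _ [x [y ->]].
by rewrite (H0 x) tens0l inner0l.
Qed.

(** If H = 0, the coefficients of V in the first leg vanish, and extended functionals, being linear,
    vanish on them; so all slices of V are 0. Then [u_span] makes the universal algebra trivial, and
    nondegeneracy its space. *)
Lemma u_space_trivial : (forall x : cq_space G, x = 0) -> forall y : Hu, y = 0.
Proof.
move=> H0.
have A0 a : pset Au a -> a = 0.
  move=> Aa; have := u_span Aa; rewrite op_cspanE; last first.
    by move=> _ [w [w' [_ _ ->]]]; rewrite uvE; exact: lslice_bounded.
  apply: (cs_min (csub_eq Hu Hu)) => t [w [w' [_ [_ wL _]]]]; rewrite uvE.
  have [[S -> hS]| ->] := lslice_cases (uv Gu) w'; last by move=> /opf_inj.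
  move=> /opf_inj ->; apply: op_ext => v; apply: inner_ext => u; rewrite hS zerooE inner0.
  have -> : sr (uv Gu) u v = 0 by apply: op_ext => x; rewrite (H0 x) !op0.
  have m0 : multiplier Ah (opf (0 : Op (cq_space G) (cq_space G))).
    apply: mult_multiplier => c _; rewrite ocomp0 o0comp.
    by have h := CA0 (pset_CA (cq_dcstar G)).
  have := wL 1 _ _ m0 m0; rewrite mul1r.
  have -> : 1 *: opf (0 : Op (cq_space G) (cq_space G)) + opf (0 : Op (cq_space G) (cq_space G)) =
      opf (0 : Op (cq_space G) (cq_space G)) by apply/funext => x; rewrite [RHS]H0 [LHS]H0.
  by move=> h; apply: (addrI (w' (opf (0 : Op (cq_space G) (cq_space G))))); rewrite addr0 -h.
move=> y; apply: (dense_total (cstar_nd (u_cstar Gu))) => _ [a [x [Aa ->]]].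
by rewrite (A0 a Aa) zerooE inner0l.
Qed.
End Trivial.

Theorem proposition2p5 (R : realType) (G : cqgroup R) (Gu : universal_cqg G)
    (X : htens (cq_space G) (cq_space G) -> htens (cq_space G) (cq_space G)) :
  let A := cq_alg G in
  let Au := u_alg Gu in
  let Hu := u_space Gu in
  let Delta := u_comult Gu in
  let Lambda := u_red Gu in
  let lift (Xu : htens Hu Hu -> htens Hu Hu) : Prop :=
    [/\ UM (atens Au Au) Xu,
        mor_app Au Au A A Lambda Lambda Xu = X,
        mor_app Au Au (atens Au Au) Au Delta id Xu = leg23 Hu Xu \o leg13 Hu Xu &
        reassoc (mor_app Au Au Au (atens Au Au) id Delta Xu) =
          leg12 Hu Xu \o leg13 Hu Xu] in
  Rmatrix A (cq_comult G) X ->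
  (exists! Xu, lift Xu) /\
  (forall Xu, lift Xu ->
    forall a, Au a -> Xu \o flip (Delta a) \o adj Xu = Delta a).
Proof.
move=> A Au Hu Delta Lambda lift [[UX XL XR] Xflip].
have cA := cq_cstar G; have cAu := u_cstar Gu.
have cAuAu := atens_cstar cAu cAu.
(* A nonzero vector provides the unit vector e that compresses legs; without one, all operators
   involved act on zero spaces and coincide. *)
have [[x x0]|H0] := pselect (exists x : cq_space G, x != 0); last first.
  have h0 (x : cq_space G) : x = 0.
    by apply/eqP; apply/negP => /negP x0; apply: H0; exists x.
  have hu0 := @u_space_trivial _ _ Gu h0.
  have tu0 (S : Type) (f g : S -> htens Hu Hu) : f = g.
    by apply/funext => s; rewrite [LHS](tens_trivial hu0) [RHS](tens_trivial hu0).
  have ttu0 (S : Type) (f g : S -> htens (htens Hu Hu) Hu) : f = g.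
    by apply/funext => s; rewrite [LHS](tens_trivial (tens_trivial hu0)) [RHS](tens_trivial (tens_trivial hu0)).
  have t0 (S : Type) (f g : S -> htens (cq_space G) (cq_space G)) : f = g.
    by apply/funext => s; rewrite [LHS](tens_trivial h0) [RHS](tens_trivial h0).
  split; last by move=> Xu _ a _; exact: tu0.
  exists (opf (oid (htens Hu Hu))); split; last by move=> Xu _; exact: tu0.
  split; [|exact: t0|exact: ttu0|exact: ttu0].
  apply: (um_UM cAu cAu); split=> [|t ht]; first exact: unit_id.
  by split; rewrite ?ad1 o1comp; exact: ht.
have [e ee] : exists e : cq_space G, inner e e = 1.
  exists (`|x|^-1 *: x); rewrite inner_norm normrZ normfV normr_id mulVf ?expr1n//.
  by rewrite normr_eq0.
have [T eT uT] := UM_um cA cA UX; subst X.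
have XLT : mor_app A A (atens A A) A (@cq_comult R G) id T = l23 (cq_space G) T ** l13 (cq_space G) T.
  by rewrite XL leg23E leg13E.
have XRT : reassoc (mor_app A A A (atens A A) id (@cq_comult R G) T) = l12 (cq_space G) T ** l13 (cq_space G) T.
  by rewrite XR leg12E leg13E.
have flipT a : pset A a -> T ** (sw _ _ ** ph (@cq_comult R G) a ** sw _ _) ** ad T = ph (@cq_comult R G) a.
  move=> Aa; apply: opf_inj; have eD := phE (cq_comult_mor G) Aa.
  have h := Xflip _ Aa; rewrite -eD flipE adjE in h.
  by rewrite -[RHS]h.
have [Z [uZ Z1 Z2 Z3 Z4]] := lift_exists Gu ee uT XLT XRT flipT.
have uniq Xu : lift Xu -> Xu = opf Z.
  move=> [UXu h1 h2 h3].
  have [S eS uS] := UM_um cAu cAu UXu; subst Xu.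
  rewrite leg23E leg13E in h2; rewrite leg12E leg13E in h3.
  have [Q [q1 q2]] := lift_determined ee uS h1 h2 h3.
  have [Q' [q1' q2']] := lift_determined ee uZ Z1 Z2 Z3.
  by rewrite (lift_unique ee uT q1 q2 q1' q2').
have liftZ : lift (opf Z).
  split; [exact: (um_UM cAu cAu uZ)|exact: Z1|by rewrite leg23E leg13E|by rewrite leg12E leg13E].
split; first by exists (opf Z); split=> [|Xu /uniq ->]; [exact: liftZ|by []].
move=> Xu /uniq -> a Aa.
have Aa' : pset Au (pk a) by rewrite /pset pkE//; exact: (cstar_bounded cAu Aa).
have := Z4 _ Aa' => /(congr1 (@opf _ _ _)).
have eD : Delta a = ph Delta (pk a).
  by rewrite (phE (u_comult_mor Gu) Aa') pkE//; exact: (cstar_bounded cAu Aa).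
by rewrite eD flipE adjE.
Qed.
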